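(* Let $Z=\mathrm{Hilb}_0\times\mathrm{Hilb}_n\cong\mathrm{Hilb}_n$, regarded as a component of the $A$-fixed locus $\mathcal M(n,2)^A$, and let $N_-\subset N_Z$ be the subbundle of the normal bundle of $Z$ in $\mathcal M(n,2)$ on which $A$ acts with character $u=u_1-u_2$. Then there is an isomorphism of $T$-equivariant vector bundles on $\mathrm{Hilb}_n$ $$N_-\;\cong\;\mathcal V\otimes u ,$$ where $\mathcal V$ is the tautological bundle on $\mathrm{Hilb}_n$ and $u$ denotes the trivial line bundle on which $A$ acts through the character $u$ (and $B$ acts trivially).
   Context: $\mathrm{Hilb}_n$ is the Hilbert scheme of $n$ points on $\mathbb C^2$ (ideals $\mathcal J\subset\mathbb C[x,y]$ of codimension $n$). The tautological bundle $\mathcal V$ on it has fibre $\mathbb C[x,y]/\mathcal J$ over $[\mathcal J]$. $\mathcal M(n,2)$ is the moduli space of torsion-free sheaves $\mathcal S$ on $\mathbb P^2$ of rank $2$ with $c_2=n$, together with a framing $\mathcal S|_{L_\infty}\cong\mathcal O_{L_\infty}^{\oplus 2}$ on the line $L_\infty=\mathbb P^2\setminus\mathbb C^2$. The torus $A=(\mathbb C^* )^2$ acts by changing the framing and $B=(\mathbb C^* )^2$ acts through scaling the coordinates of $\mathbb C^2$; put $T=A\times B$. The fixed locus is $\mathcal M(n,2)^A=\coprod_{n_1+n_2=n}\mathrm{Hilb}_{n_1}\times\mathrm{Hilb}_{n_2}$, where $(\mathcal I,\mathcal J)$ corresponds to $\mathcal S=\mathcal I\oplus\mathcal J$. At such a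 point the normal space to the fixed component is the sum of the two off-diagonal parts of the tangent space, $\mathrm{Ext}^1(\mathcal I,\mathcal J(-L_\infty))\oplus\mathrm{Ext}^1(\mathcal J,\mathcal I(-L_\infty))$. Convention: the characters $u_1,u_2$ of $A$ are normalized so that $A$ acts on the part $\mathrm{Ext}^1(\mathcal I,\mathcal J(-L_\infty))$ with character $u_1-u_2$ and on $\mathrm{Ext}^1(\mathcal J,\mathcal I(-L_\infty))$ with character $u_2-u_1$. *)

(* Defs.v *)
From HB Require Import structures.
From mathcomp Require Import all_boot all_order all_algebra finmap.
From mathcomp Require Import reals complex.

Set Implicit Arguments.
Unset Strict Implicit.
Unset Printing Implicit Defensive.
Import GRing.Theory.
Local Open Scope ring_scope.

(* Schemes over the algebraically closed field K are given by their functors of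
   points on finitely generated commutative K-algebras R.  A vector bundle E on
   X is given by its R-modules of sections E(x), x in X(R), with base change
   along K-algebra morphisms R -> R'.  A point of a moduli space is represented
   by a family over R, and equality of points is isomorphism of families. *)

Definition fin_gen_alg (K : closedFieldType) (R : comAlgType K) : Prop :=
  exists (l : nat) (gen : 'I_l -> R), forall P : R -> Prop,
    P 1 -> (forall i, P (gen i)) ->
    (forall (c : K) x y, P x -> P y -> P (c *: x + y)) ->
    (forall x y, P x -> P y -> P (x * y)) ->
    forall x, P x.

(* R[e_1, ..., e_k] / (e_i e_j)_{i,j}, with (r, v) standing for
   r + \sum_i v_i e_i; for k = 1 these are the dual numbers over R. *)
Definition dualnum (K : closedFieldType) (R : comAlgType K) (k : nat) : Type :=
  (R * 'rV[R]_k)%type.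

Section DualNumbers.
Variables (K : closedFieldType) (R : comAlgType K) (k : nat).
Local Notation D := (dualnum R k).

HB.instance Definition _ := GRing.Zmodule.on D.

Definition dual_one : D := (1, 0).
Definition dual_mul (x y : D) : D := (x.1 * y.1, x.1 *: y.2 + y.1 *: x.2).
Definition dual_scale (c : K) (x : D) : D := (c *: x.1, c%:A *: x.2).

Fact dual_mulA : associative dual_mul.
Proof.
move=> x y z; rewrite /dual_mul /= mulrA; congr pair.
rewrite !scalerDr !scalerA addrA; congr (_ + _ + _).
  by rewrite mulrC.
by rewrite mulrC.
Qed.
Fact dual_mulC : commutative dual_mul.
Proof. by move=> x y; rewrite /dual_mul mulrC addrC. Qed.
Fact dual_mul1 : left_id dual_one dual_mul.
Proof. by case=> a v; rewrite /dual_mul /= mul1r scale1r scaler0 addr0. Qed.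
Fact dual_mulDl : left_distributive dual_mul +%R.
Proof.
move=> x y z; rewrite /dual_mul /= mulrDl; congr pair => /=.
by rewrite scalerDl scalerDr addrACA.
Qed.
Fact dual_one_neq0 : dual_one != 0.
Proof. by apply/eqP => -[/eqP]; rewrite oner_eq0. Qed.

HB.instance Definition _ := GRing.Zmodule_isComNzRing.Build D
  dual_mulA dual_mulC dual_mul1 dual_mulDl dual_one_neq0.

Fact dual_scaleA (a b : K) (x : D) :
  dual_scale a (dual_scale b x) = dual_scale (a * b) x.
Proof. by rewrite /dual_scale /= !scalerA mulr_algl scalerA. Qed.
Fact dual_scale1 : left_id 1 dual_scale.
Proof. by case=> a v; rewrite /dual_scale /= !scale1r. Qed.
Fact dual_scaleDr : right_distributive dual_scale +%R.
Proof. by move=> c x y; rewrite /dual_scale /= !scalerDr. Qed.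
Fact dual_scaleDl (x : D) : {morph dual_scale^~ x : a b / a + b}.
Proof. by move=> a b; rewrite /dual_scale /= !scalerDl. Qed.

HB.instance Definition _ := GRing.Zmodule_isLmodule.Build K D
  dual_scaleA dual_scale1 dual_scaleDr dual_scaleDl.

Fact dual_scaleAl (c : K) (x y : D) : c *: (x * y) = (c *: x) * y.
Proof.
congr pair => /=; first by rewrite scalerAl.
by rewrite scalerDr !scalerA mulr_algl [c%:A * _]mulrC.
Qed.

HB.instance Definition _ := GRing.Lmodule_isLalgebra.Build K D dual_scaleAl.
HB.instance Definition _ := GRing.Lalgebra_isComAlgebra.Build K D.

Definition dual_aug (x : D) : R := x.1.
Fact dual_aug_linear : linear dual_aug. Proof. by []. Qed.
Fact dual_aug_monoid : monoid_morphism dual_aug. Proof. by []. Qed.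
HB.instance Definition _ := GRing.isLinear.Build K D R _ dual_aug dual_aug_linear.
HB.instance Definition _ := GRing.isMonoidMorphism.Build D R dual_aug
  dual_aug_monoid.

Definition dual_const (r : R) : D := (r, 0).
Fact dual_const_zmod : zmod_morphism dual_const.
Proof. by move=> x y; congr pair; rewrite subr0. Qed.
Fact dual_const_monoid : monoid_morphism dual_const.
Proof. by split=> // x y; congr pair; rewrite /= !scaler0 addr0. Qed.
HB.instance Definition _ := GRing.isZmodMorphism.Build R D dual_const
  dual_const_zmod.
HB.instance Definition _ := GRing.isMonoidMorphism.Build R D dual_const
  dual_const_monoid.

End DualNumbers.

Section DualMap.
Variables (K : closedFieldType) (R R' : comAlgType K) (k l : nat).
Variables (g : {lrmorphism R -> R'}) (A : 'M[R']_(k, l)).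

(* the morphism over g sending e_i to \sum_j A i j e_j *)
Definition dual_map (x : dualnum R k) : dualnum R' l :=
  (g x.1, map_mx g x.2 *m A).

Fact dual_map_linear : linear dual_map.
Proof.
move=> c x y; congr pair => /=; first by rewrite linearP.
by rewrite map_mxD mulmxDl map_mxZ scalemxAl /= linearZ /= rmorph1.
Qed.
Fact dual_map_monoid : monoid_morphism dual_map.
Proof.
split; first by congr pair => /=; rewrite ?rmorph1 // map_mx0 mul0mx.
move=> x y; congr pair => /=; first by rewrite rmorphM.
by rewrite map_mxD !map_mxZ mulmxDl !scalemxAl.
Qed.
HB.instance Definition _ := GRing.isLinear.Build K _ _ _ dual_map dual_map_linear.
HB.instance Definition _ := GRing.isMonoidMorphism.Build _ _ dual_map
  dual_map_monoid.
End DualMap.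

Record Gm (R : comNzRingType) := GmPoint {
  gm_val : R;
  gm_inv : R;
  gm_valK : gm_val * gm_inv = 1 }.

Definition gm1 (R : comNzRingType) : Gm R := GmPoint (mulr1 (1 : R)).

Fact gm_map_subproof (R R' : comNzRingType) (f : {rmorphism R -> R'}) (g : Gm R) :
  f (gm_val g) * f (gm_inv g) = 1.
Proof. by rewrite -rmorphM gm_valK rmorph1. Qed.
Definition gm_map (R R' : comNzRingType) (f : {rmorphism R -> R'}) (g : Gm R) :
  Gm R' := GmPoint (gm_map_subproof f g).

Definition gm_pow (R : comNzRingType) (g : Gm R) (z : int) : R :=
  match z with Posz j => gm_val g ^+ j | Negz j => gm_inv g ^+ j.+1 end.

Record torus (R : comNzRingType) := Torus {
  torusA : 'I_2 -> Gm R;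
  torusB : 'I_2 -> Gm R }.

Definition torus1 (R : comNzRingType) : torus R :=
  Torus (fun=> gm1 R) (fun=> gm1 R).
Definition torus_map (R R' : comNzRingType) (f : {rmorphism R -> R'})
    (t : torus R) : torus R' :=
  Torus (fun i => gm_map f (torusA t i)) (fun i => gm_map f (torusB t i)).
Definition projA (R : comNzRingType) (t : torus R) : torus R :=
  Torus (torusA t) (fun=> gm1 R).

Definition bweight (R : comNzRingType) (t : torus R) (m : int * int) : R :=
  gm_pow (torusB t ord0) m.1 * gm_pow (torusB t ord_max) m.2.

(* u = u_1 - u_2 *)
Definition char_u (R : comNzRingType) (t : torus R) : R :=
  gm_val (torusA t ord0) * gm_inv (torusA t ord_max).

(* P^2 has homogeneous coordinates x_0, x_1, x_2 with x = x_1/x_0, y = x_2/x_0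
   and L_oo = {x_0 = 0}.  The pair m = (p, q) stands for the Laurent monomial
   x^p y^q = x_0^(-p-q) x_1^p x_2^q, and expo m i is its exponent in x_i. *)
Definition expo (m : int * int) (i : 'I_3) : int :=
  [:: - (m.1 + m.2); m.1; m.2]`_i.

(* I stands for the open set U_I where the x_i with i in I are all invertible;
   its coordinate ring A_I is spanned by the monomials m with regular I m. *)
Definition chart := {I : {set 'I_3} | I != set0}.
Definition csub (I J : chart) : bool := sval I \subset sval J.
Definition regular (I : {set 'I_3}) (m : int * int) : bool :=
  [forall i, (i \notin I) ==> (0 <= expo m i)].
Definition chart_inf (I : chart) : bool := ord0 \notin sval I.

Notation laurent R := {fsfun (int * int)%type -> R with 0}.

Definition in_O (R : comNzRingType) (I : chart) (c : laurent R) : Prop :=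
  forall m, c m != 0 -> regular (sval I) m.

(* A quasi-coherent sheaf on P^2_R, as its sections on the U_I; an A_I-module
   is an R-module with an action of the monomials of A_I.  The values of mon
   and res outside the conditions below are irrelevant. *)
Record qcoh (R : comNzRingType) := Qcoh {
  sec : chart -> lmodType R;
  mon : forall I, int * int -> sec I -> sec I;
  res : forall I J, sec I -> sec J;
  mon_linear : forall I m, regular (sval I) m ->
    forall (r : R) s t, mon m (r *: s + t) = r *: mon m s + mon m t :> sec I;
  mon_0 : forall I (s : sec I), mon 0 s = s;
  mon_D : forall I m m' (s : sec I), regular (sval I) m -> regular (sval I) m' ->
    mon (m + m') s = mon m (mon m' s);
  res_linear : forall I J, csub I J ->
    forall (r : R) (s t : sec I), res J (r *: s + t) = r *: res J s + res J t;
  res_id : forall I (s : sec I), res I s = s;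
  res_comp : forall I J H, csub I J -> csub J H ->
    forall s : sec I, res H (res J s) = res H s;
  res_mon : forall I J, csub I J -> forall m, regular (sval I) m ->
    forall s : sec I, res J (mon m s) = mon m (res J s);
  (* sec J is the localization of sec I at the monomials of A_I that are
     invertible on U_J *)
  res_ker : forall I J, csub I J -> forall s : sec I, res J s = 0 ->
    exists m, [/\ regular (sval I) m, regular (sval J) (- m) & mon m s = 0];
  res_frac : forall I J, csub I J -> forall t : sec J,
    exists m (s : sec I),
      [/\ regular (sval I) m, regular (sval J) (- m) & mon m t = res J s] }.

Arguments mon {R} S {I} m s : rename.
Arguments res {R} S {I} J s : rename.

Section Sheaves.
Variable R : comNzRingType.
Implicit Types (S : qcoh R) (I J : chart).

Definition act S I (c : laurent R) (s : sec S I) : sec S I :=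
  \sum_(m <- finsupp c) c m *: mon S m s.

Definition fin_gen S : Prop := forall I,
  exists (l : nat) (gen : 'I_l -> sec S I), forall s : sec S I,
    exists c : 'I_l -> laurent R,
      (forall j, in_O I (c j)) /\ s = \sum_j act (c j) (gen j).

Definition indep S I (l : nat) (s : 'I_l -> sec S I) : Prop :=
  forall c : 'I_l -> laurent R, (forall j, in_O I (c j)) ->
    \sum_j act (c j) (s j) = 0 -> forall j m, c j m = 0.

(* equational criterion *)
Definition flat_module (M : lmodType R) : Prop :=
  forall (k : nat) (r : 'rV[R]_k) (x : 'I_k -> M), \sum_i r 0 i *: x i = 0 ->
    exists (l : nat) (a : 'M[R]_(k, l)) (z : 'I_l -> M),
      r *m a = 0 /\ forall i, x i = \sum_j a i j *: z j.

Definition flat S : Prop := forall I, flat_module (sec S I).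

(* S is the sheaf of those vectors of r Laurent polynomials that satisfy D I
   over U_I; io is the inclusion. *)
Definition is_subsheaf (r : nat) S (D : chart -> ('I_r -> laurent R) -> Prop)
    (io : forall I, sec S I -> 'I_r -> laurent R) : Prop :=
  [/\ forall I x s t k m, io I (x *: s + t) k m = x * io I s k m + io I t k m,
      forall I m, regular (sval I) m ->
        forall s k m', io I (mon S m s) k m' = io I s k (m' - m),
      forall I J, csub I J -> forall s, io J (res S J s) = io I s,
      forall I s t, io I s = io I t -> s = t &
      forall I c, D I c <-> exists s, io I s = c].

(* The line bundle O(a); a section h over U_I is identified with h / x_0^a. *)
Definition in_Oa (a : int) (I : chart) (c : 'I_1 -> laurent R) : Prop :=
  forall m, c ord0 m != 0 -> forall i, i \notin sval I ->
    0 <= expo m i + (if i == ord0 then a else 0).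
Definition is_O (a : int) S : Prop := exists io, is_subsheaf (S := S) (in_Oa a) io.

Definition sheaf_morph (S S' : qcoh R) (F : forall I, sec S I -> sec S' I) : Prop :=
  [/\ forall I (r : R) s t, F I (r *: s + t) = r *: F I s + F I t,
      forall I m, regular (sval I) m -> forall s, F I (mon S m s) = mon S' m (F I s) &
      forall I J, csub I J -> forall s, F J (res S J s) = res S' J (F I s)].

Definition short_exact (S1 S2 S3 : qcoh R) : Prop :=
  exists (F : forall I, sec S1 I -> sec S2 I) (G : forall I, sec S2 I -> sec S3 I),
    [/\ sheaf_morph F, sheaf_morph G,
        forall I s, F I s = 0 -> s = 0,
        forall I t, exists s, G I s = t &
        forall I s, G I s = 0 <-> exists s', F I s' = s].

(* s vanishes on L_oo; the ideal of L_oo in A_I is generated by a monomial *)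
Definition vanish_inf S I (s : sec S I) : Prop :=
  exists m s', [/\ regular (sval I) m, 0 < expo m ord0 & s = mon S m s'].

(* fr is an isomorphism O^2 -> S|_{L_oo}, given by the images e_0, e_1 of the
   standard basis; only the classes of the e_k in S|_{L_oo} matter. *)
Definition is_framing S (fr : forall I, 'I_2 -> sec S I) : Prop :=
  [/\ forall I J k, chart_inf J -> csub I J -> vanish_inf (res S J (fr I k) - fr J k),
      forall I, chart_inf I -> forall s, exists c : 'I_2 -> laurent R,
        (forall k, in_O I (c k)) /\ vanish_inf (s - \sum_k act (c k) (fr I k)) &
      forall I (c : 'I_2 -> laurent R), chart_inf I -> (forall k, in_O I (c k)) ->
        vanish_inf (\sum_k act (c k) (fr I k)) ->
        forall k m, expo m ord0 = 0 -> c k m = 0].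

End Sheaves.

(* F exhibits M' as M (x)_R R' along g. *)
Definition is_tensor (R R' : comNzRingType) (g : {rmorphism R -> R'})
    (M : lmodType R) (M' : lmodType R') (F : M -> M') : Prop :=
  forall (N : lmodType R') (h : M -> N),
    (forall (r : R) s t, h (r *: s + t) = g r *: h s + h t) ->
    exists h' : M' -> N,
      [/\ forall (r : R') s t, h' (r *: s + t) = r *: h' s + h' t,
          forall s, h' (F s) = h s &
          forall h'' : M' -> N,
            (forall (r : R') s t, h'' (r *: s + t) = r *: h'' s + h'' t) ->
            (forall s, h'' (F s) = h s) -> h'' =1 h'].

(* F exhibits S' as b_*(g^* S), where b = torusB t is the automorphism
   (x, y) |-> (b_1 x, b_2 y) of P^2.  As b preserves every U_I, the sheaf b_* S
   has the sections of S, with a function h acting as h o b. *)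
Definition is_pullback (R R' : comNzRingType) (g : {rmorphism R -> R'})
    (t : torus R') (S : qcoh R) (S' : qcoh R') (F : forall I, sec S I -> sec S' I)
    : Prop :=
  [/\ forall I (r : R) s s', F I (r *: s + s') = g r *: F I s + F I s',
      forall I m, regular (sval I) m ->
        forall s, F I (mon S m s) = bweight t (- m) *: mon S' m (F I s),
      forall I J, csub I J -> forall s, F J (res S J s) = res S' J (F I s) &
      forall I, is_tensor g (F I)].

Section OverField.
Variable K : closedFieldType.
Implicit Types S : qcoh K.

Definition torsion_free S : Prop := forall I (s : sec S I), s <> 0 ->
  forall c : laurent K, in_O I c -> act c s = 0 -> forall m, c m = 0.

Fact full_chart_subproof : [set: 'I_3] != set0.
Proof. by apply/set0Pn; exists ord0; rewrite inE. Qed.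
Definition torus_chart : chart := exist _ [set: 'I_3] full_chart_subproof.

Definition has_rank S (r : nat) : Prop :=
  (exists s : 'I_r -> sec S torus_chart, indep s) /\
  (forall s : 'I_r.+1 -> sec S torus_chart, ~ indep s).

(* Total Chern class of coherent sheaves on P^2, with values in Z[h]/(h^3)
   (represented by {poly int}): c(O(a)) = 1 + a h, and c is multiplicative on
   short exact sequences.  Line bundles generate the Grothendieck group of P^2,
   so this determines c on every coherent sheaf. *)
Inductive total_chern : qcoh K -> {poly int} -> Prop :=
| chern_O a S : is_O a S -> total_chern S (1 + a *: 'X)
| chern_mid S1 S2 S3 c1 c3 : short_exact S1 S2 S3 ->
    total_chern S1 c1 -> total_chern S3 c3 -> total_chern S2 (c1 * c3)
| chern_sub S1 S2 S3 c1 c2 c3 : short_exact S1 S2 S3 ->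
    total_chern S2 c2 -> total_chern S3 c3 ->
    take_poly 3 c2 = take_poly 3 (c1 * c3) -> total_chern S1 c1
| chern_quo S1 S2 S3 c1 c2 c3 : short_exact S1 S2 S3 ->
    total_chern S1 c1 -> total_chern S2 c2 ->
    take_poly 3 c2 = take_poly 3 (c1 * c3) -> total_chern S3 c3.

Definition has_c2 S (n : nat) : Prop :=
  exists c, total_chern S c /\ c`_2 = n%:Z.

End OverField.

Section Moduli.
Variable K : closedFieldType.
Implicit Types R : comAlgType K.

(* A point of M(n,2) over a finitely generated R: a coherent R-flat sheaf on
   P^2_R, framed along L_oo, whose restrictions to the closed points of Spec R
   are torsion-free of rank 2 with c_2 = n. *)
Record framed (n : nat) R := Framed {
  sheaf :> qcoh R;
  frame : forall I, 'I_2 -> sec sheaf I;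
  framed_fin_gen : fin_gen sheaf;
  framed_flat : flat sheaf;
  framed_fibre : forall (p : {lrmorphism R -> K^o}) (S0 : qcoh K) F,
    is_pullback (S := sheaf) (S' := S0) p (torus1 K) F ->
    [/\ torsion_free S0, has_rank S0 2 & has_c2 S0 n];
  framed_frame : is_framing frame }.

(* The point S' of M(n,2) is t . g^*S.  The group A acts by e_k |-> a_k e_k on
   the basis e of the framing, that is, by composing the framing S|_{L_oo} -> O^2
   with a^-1.  Under this normalization u_1 - u_2 is the character of A on the
   part Ext^1(I, J(-L_oo)) of the tangent space at the sum of I and J: for f in
   Hom(I, O/J) the deformation {(x, y) in O[e]^2 : x in I[e], y = e f(x) mod J[e]}
   is taken by a to the one attached to (a_1 / a_2) f. *)
Definition moves n R R' (g : {lrmorphism R -> R'}) (t : torus R')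
    (S : framed n R) (S' : framed n R') : Prop :=
  exists2 F, is_pullback (S := S) (S' := S') g t F &
    forall I k, chart_inf I ->
      vanish_inf (gm_val (torusA t k) *: F I (frame S I k) - frame S' I k).

Definition pulls n R R' (g : {lrmorphism R -> R'}) (S : framed n R)
  (S' : framed n R') : Prop := moves g (torus1 R') S S'.

End Moduli.

Section Hilbert.
Variable K : closedFieldType.
Implicit Types R : comAlgType K.

(* {poly {poly R}} is R[x,y], with x = 'X%:P and y = 'X. *)
Definition coefxy (R : comNzRingType) (P : {poly {poly R}}) (m : int * int) : R :=
  match m with (Posz p, Posz q) => P`_q`_p | _ => 0 end.

(* R[x,y]/J is locally free of rank n: over each set of the open cover of Spec R
   by the D(d j), the polynomials e j i form a basis. *)
Definition quotient_locally_free (R : comNzRingType) (J : {poly {poly R}} -> Prop)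
    (n : nat) : Prop :=
  exists (l : nat) (d w : 'I_l -> R) (e : 'I_l -> 'I_n -> {poly {poly R}}),
    \sum_j w j * d j = 1 /\ forall j,
      (forall P, exists (N : nat) (c : 'I_n -> R),
        J ((d j ^+ N)%:P%:P * P - \sum_i (c i)%:P%:P * e j i)) /\
      (forall c : 'I_n -> R, J (\sum_i (c i)%:P%:P * e j i) ->
        exists N : nat, forall i, d j ^+ N * c i = 0).

Record hilb (n : nat) R := Hilb {
  ideal :> {poly {poly R}} -> Prop;
  ideal0 : ideal 0;
  idealD : forall P Q, ideal P -> ideal Q -> ideal (P + Q);
  idealM : forall P Q, ideal Q -> ideal (P * Q);
  ideal_free : quotient_locally_free ideal n }.

Definition map_xy R R' (g : {lrmorphism R -> R'}) : {poly {poly R}} -> {poly {poly R'}} :=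
  map_poly (map_poly g).

(* J' = g^*J *)
Definition hilb_pulls n R R' (g : {lrmorphism R -> R'}) (J : hilb n R)
    (J' : hilb n R') : Prop :=
  forall Q, J' Q <-> exists (l : nat) (P : 'I_l -> {poly {poly R}})
      (c : 'I_l -> {poly {poly R'}}),
    (forall i, J (P i)) /\ Q = \sum_i c i * map_xy g (P i).

(* P o b^-1 for b = torusB t acting by (x, y) |-> (b_1 x, b_2 y) *)
Definition act_xy R (t : torus R) (P : {poly {poly R}}) : {poly {poly R}} :=
  map_poly (fun p : {poly R} => p \Po (gm_inv (torusB t ord0) *: 'X)) P
    \Po ((gm_inv (torusB t ord_max))%:P *: 'X).

(* J' = t . J; the group A acts trivially *)
Definition hilb_moves n R (t : torus R) (J J' : hilb n R) : Prop :=
  forall P, J P <-> J' (act_xy t P).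

Definition aff_chart : {set 'I_3} := [set ord0].

(* Sections over U_I of the ideal sheaf on P^2_R of the closure of {J = 0}, which
   is disjoint from L_oo: those c in A_I whose restriction to U_I \cap C^2 lies
   in the localization of J. *)
Definition in_ideal_sheaf n R (J : hilb n R) (I : chart) (c : laurent R) : Prop :=
  in_O I c /\ exists m P,
    [/\ regular aff_chart m, regular (ord0 |: sval I) (- m), J P &
        forall m', coefxy P m' = c (m' - m)].

(* S is the direct sum of the ideal sheaves of J1 and J2, with the framing given
   by their identification with O along L_oo. *)
Definition is_sum n1 n2 n R (J1 : hilb n1 R) (J2 : hilb n2 R) (S : framed n R)
    : Prop :=
  exists2 io : forall I, sec S I -> 'I_2 -> laurent R,
    is_subsheaf (fun I c => in_ideal_sheaf J1 I (c ord0) /\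
                            in_ideal_sheaf J2 I (c ord_max)) io &
    forall I k, chart_inf I -> forall k' m, expo m ord0 = 0 ->
      io I (frame S I k) k' m = ((k == k') && (m == 0))%:R.

(* S is the image of J under Hilb_n = Hilb_0 x Hilb_n = Z -> M(n,2). *)
Definition in_Z n R (J : hilb n R) (S : framed n R) : Prop :=
  exists J0 : hilb 0 R, is_sum J0 J S.

End Hilbert.

(* The structure of a T-equivariant vector bundle E on Hilb_n: for each R-point J
   a set of representatives of the sections of J^*E with their equality, addition
   and scaling, base change along g (relevant when J' = g^*J), and the action of
   t in T(R) (relevant when J' = t . J).  The operations are given by their graphs;
   eq_rel x y stands for x = y, add_rel x y z for x + y = z, scale_rel r x y for
   r x = y, etc. *)
Record eqbundle (K : closedFieldType) (n : nat) := EqBundle {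
  fib : forall R : comAlgType K, hilb n R -> Type;
  eq_rel : forall R (J : hilb n R), fib J -> fib J -> Prop;
  add_rel : forall R (J : hilb n R), fib J -> fib J -> fib J -> Prop;
  scale_rel : forall R (J : hilb n R), R -> fib J -> fib J -> Prop;
  pull_rel : forall (R R' : comAlgType K) (g : {lrmorphism R -> R'}) (J : hilb n R)
    (J' : hilb n R'), fib J -> fib J' -> Prop;
  act_rel : forall (R : comAlgType K) (t : torus R) (J J' : hilb n R), fib J -> fib J' -> Prop }.

Arguments fib {K n} E {R} J : rename.
Arguments eq_rel {K n} E {R J} x y : rename.
Arguments add_rel {K n} E {R J} x y z : rename.
Arguments scale_rel {K n} E {R J} r x y : rename.
Arguments pull_rel {K n} E {R R'} g {J J'} x x' : rename.
Arguments act_rel {K n} E {R} t {J J'} x x' : rename.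

Definition bundle_iso (K : closedFieldType) (n : nat) (E F : eqbundle K n) : Prop :=
  exists phi : forall R : comAlgType K, fin_gen_alg R ->
      forall J : hilb n R, fib E J -> fib F J,
  [/\ forall (R : comAlgType K) (hR : fin_gen_alg R) (J : hilb n R) (x y : fib E J),
        eq_rel E x y <-> eq_rel F (phi R hR J x) (phi R hR J y),
      forall (R : comAlgType K) (hR : fin_gen_alg R) (J : hilb n R) (y : fib F J),
        exists x, eq_rel F (phi R hR J x) y,
      forall (R : comAlgType K) (hR : fin_gen_alg R) (J : hilb n R),
        (forall x y z : fib E J, add_rel E x y z <->
          add_rel F (phi R hR J x) (phi R hR J y) (phi R hR J z)) /\
        (forall (r : R) (x y : fib E J), scale_rel E r x y <->
          scale_rel F r (phi R hR J x) (phi R hR J y)),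
      forall (R R' : comAlgType K) (hR : fin_gen_alg R)
          (hR' : fin_gen_alg R') (g : {lrmorphism R -> R'}) (J : hilb n R) (J' : hilb n R'),
        hilb_pulls g J J' -> forall (x : fib E J) (x' : fib E J'),
        pull_rel E g x x' <-> pull_rel F g (phi R hR J x) (phi R' hR' J' x') &
      forall (R : comAlgType K) (hR : fin_gen_alg R) (t : torus R) (J J' : hilb n R),
        hilb_moves t J J' -> forall (x : fib E J) (x' : fib E J'),
        act_rel E t x x' <-> act_rel F t (phi R hR J x) (phi R hR J' x')].

Section Bundles.
Variables (K : closedFieldType) (n : nat).
Implicit Types R : comAlgType K.

Definition tautological : eqbundle K n :=
  @EqBundle K n (fun R J => {poly {poly R}})
    (fun R J P Q => J (P - Q))
    (fun R J P Q S => J (P + Q - S))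
    (fun R J r P Q => J (r%:P%:P * P - Q))
    (fun R R' g J J' P P' => J' (map_xy g P - P'))
    (fun R t J J' P P' => J' (act_xy t P - P')).

Definition twist (E : eqbundle K n) (chi : forall R, torus R -> R) : eqbundle K n :=
  @EqBundle K n (fun R J => fib E J)
    (fun R J => eq_rel E (J := J)) (fun R J => add_rel E (J := J))
    (fun R J => scale_rel E (J := J))
    (fun R R' g J J' => pull_rel E g (J := J) (J' := J'))
    (fun R t J J' x x' =>
      exists2 y : fib E J', act_rel E t x y & scale_rel E (chi R t) y x').

(* The subbundle of E of those sections on which A acts with character chi, where
   A acts trivially on Hilb_n. *)
Definition has_weight (E : eqbundle K n) (chi : forall R, torus R -> R)
    R (J : hilb n R) (x : fib E J) : Prop :=
  forall R' (g : {lrmorphism R -> R'}) (t : torus R') (J' : hilb n R')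
      (x' y : fib E J'), fin_gen_alg R' -> hilb_pulls g J J' ->
    pull_rel E g x x' -> scale_rel E (chi R' t) x' y -> act_rel E (projA t) x' y.

Definition weight_subbundle (E : eqbundle K n) (chi : forall R, torus R -> R)
    : eqbundle K n :=
  @EqBundle K n (fun R J => {x : fib E J | has_weight chi x})
    (fun R J x y => eq_rel E (sval x) (sval y))
    (fun R J x y z => add_rel E (sval x) (sval y) (sval z))
    (fun R J r x y => scale_rel E r (sval x) (sval y))
    (fun R R' g J J' x x' => pull_rel E g (sval x) (sval x'))
    (fun R t J J' x x' => act_rel E t (sval x) (sval x')).

(* v is a tangent vector to M(n,2) at the image of J in Z. *)
Definition tangent R (J : hilb n R) (v : framed n (dualnum R 1)) : Prop :=
  exists2 S0 : framed n R, in_Z J S0 & pulls (@dual_aug K R 1) v S0.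

(* The tangent vectors along R[e_1,e_2] -> R[e] for (e_1, e_2) |-> (e, 0), (0, e)
   and (e, e) are v, w and s, that is, v + w = s. *)
Definition tangent_add R (v w s : framed n (dualnum R 1)) : Prop :=
  exists d : framed n (dualnum R 2),
    [/\ pulls (dual_map idfun (delta_mx ord0 0 : 'M[R]_(2, 1))) d v,
        pulls (dual_map idfun (delta_mx ord_max 0 : 'M[R]_(2, 1))) d w &
        pulls (dual_map idfun (const_mx 1 : 'M[R]_(2, 1))) d s].

(* v = w modulo the tangent space of Z at J *)
Definition normal_eq R (J : hilb n R) (v w : framed n (dualnum R 1)) : Prop :=
  exists (J1 : hilb n (dualnum R 1)) (z : framed n (dualnum R 1)),
    [/\ hilb_pulls (@dual_aug K R 1) J1 J, in_Z J1 z & tangent_add w z v].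

Definition normal_bundle : eqbundle K n :=
  @EqBundle K n (fun R J => {v : framed n (dualnum R 1) | tangent J v})
    (fun R J v w => normal_eq J (sval v) (sval w))
    (fun R J v w s => exists2 s', tangent_add (sval v) (sval w) s' &
      normal_eq J s' (sval s))
    (fun R J r v w => exists2 w', pulls (dual_map idfun (r%:M : 'M[R]_1)) (sval v) w' &
      normal_eq J w' (sval w))
    (fun R R' g J J' v v' => exists2 w, pulls (dual_map g (1%:M : 'M[R']_1)) (sval v) w &
      normal_eq J' w (sval v'))
    (fun R t J J' v v' => exists2 w,
      moves idfun (torus_map (@dual_const K R 1) t) (sval v) w &
      normal_eq J' w (sval v')).

Definition N_minus : eqbundle K n := weight_subbundle normal_bundle (@char_u).

End Bundles.

(* Main.v *)
(* For P in R[x,y] and a deformation J1 of J over R[e], the sheaf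
   {(a, b) in O[e]^2 : b - e P a in J1}, framed as a subsheaf of O[e]^2, is a tangent vector
   to M(n,2) at the sum of O and J; it depends only on P mod J and on J1.  The isomorphism
   sends a vector of weight u to the P of such a presentation.

   A tangent vector v has this form exactly when the inclusion q of its special fibre in O^2
   lifts to a framed map v -> O[e]^2.  The lift is unique because a map O (+) J -> O that
   vanishes at infinity is zero.  If two of the three tangent vectors in a relation
   v + w = s have such a lift, so has the third, and P is additive; this also gives the
   compatibility with scaling, base change and the torus.  Conversely, deformations
   of ideals over R[e] can be glued over R[e_1,e_2], so that the class of P mod J determines
   the vector modulo the tangent space of Z.

   The obstruction to the lift lies in the part of weight u^-1 of the normal space.  It is
   shown to vanish on vectors of weight u by testing the weight condition at one constant
   point of the torus with u = 2: the resulting relation between v rescaled by 2, v moved by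
   the torus and a vector along Z is inverted by hand, up to a Cech class in H^1(P^2, O) = 0. *)

Require Import Defs.
From HB Require Import structures.
From mathcomp Require Import all_boot all_order all_algebra finmap reals complex.
From mathcomp Require Import boolp zify ring.

Set Implicit Arguments.
Unset Strict Implicit.
Unset Printing Implicit Defensive.
Import Order.TTheory GRing.Theory Num.Theory.
Local Open Scope ring_scope.

(** The obstacle is that a tangent vector is an arbitrary framed flat sheaf over R[e] without any
    presentation, and that relations such as v + w = s, or even v = v in the normal bundle, assert
    that a framed sheaf over R[e_1,e_2] exists. Two sources of such sheaves are available:
    subsheaves of O^2 cut out by P and an ideal, for which flatness, base change and c_2 are checked
    by hand; and base changes of a given sheaf along e -> e_1 or along an automorphism of R[e],
    whose fibres at closed points are fibres of the given sheaf. Origin of u = 2: rescaling e by u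
    and the torus agree on vectors of weight u, while on weight u^-1 they differ by u - u^-1 = 3/2,
    which has to be invertible. Characteristic zero of the base enters here, and the constants 1/2
    and -2/3 = 1/(1/2 - 2) come from here. As 2 is a constant, the weight condition is tested over R
    itself rather than over R[t, 1/t]. *)

Notation o0 := (ord0 : 'I_3).
Notation k0 := (ord0 : 'I_2).
Notation k1 := (ord_max : 'I_2).

(** * Laurent polynomials *)

Notation ZZ := (int * int)%type.

(* The operations are locked: unification must never unfold them. *)
HB.lock Definition mkL (R : comNzRingType) (S : {fset ZZ}) (f : ZZ -> R) : laurent R :=
  [fsfun m in S => f m].
HB.lock Definition L0 (R : comNzRingType) : laurent R := mkL fset0 (fun=> 0).
HB.lock Definition Ladd (R : comNzRingType) (c d : laurent R) : laurent R :=
  mkL (finsupp c `|` finsupp d)%fset (fun m => c m + d m).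
HB.lock Definition Lopp (R : comNzRingType) (c : laurent R) : laurent R :=
  mkL (finsupp c) (fun m => - c m).
HB.lock Definition Lscale (R : comNzRingType) (r : R) (c : laurent R) : laurent R :=
  mkL (finsupp c) (fun m => r * c m).
HB.lock Definition mono (R : comNzRingType) (m : ZZ) : laurent R := mkL [fset m]%fset (fun=> 1).
HB.lock Definition Lmul (R : comNzRingType) (c d : laurent R) : laurent R :=
  let shift m := \big[@Ladd R/@L0 R]_(m' <- finsupp d) Lscale (d m') (mono R (m + m')) in
  \big[@Ladd R/@L0 R]_(m <- finsupp c) Lscale (c m) (shift m).

Section LaurentModule.
Variable R : comNzRingType.
Implicit Types (c d : laurent R) (m : ZZ).

Lemma mkLE S (f : ZZ -> R) m : mkL S f m = if m \in S then f m else 0.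
Proof. by rewrite mkL.unlock; exact: fsfun_fun. Qed.

Lemma laurP c d : (forall m, c m = d m) -> c = d.
Proof. by move=> e; apply/fsfunP. Qed.

Local Notation L0 := (L0 R).
Fact L0E m : L0 m = 0. Proof. by rewrite L0.unlock mkLE. Qed.
Fact LaddE c d m : Ladd c d m = c m + d m.
Proof. by rewrite Ladd.unlock mkLE inE; do 2![case: finsuppP => ?]; rewrite /= ?addr0. Qed.
Fact LoppE c m : Lopp c m = - c m.
Proof. by rewrite Lopp.unlock mkLE; case: finsuppP; rewrite ?oppr0. Qed.
Fact LscaleE r c m : Lscale r c m = r * c m.
Proof. by rewrite Lscale.unlock mkLE; case: finsuppP; rewrite ?mulr0. Qed.

Fact LaddA : associative (@Ladd R).
Proof. by move=> x y z; apply: laurP => m; rewrite !LaddE addrA. Qed.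
Fact LaddC : commutative (@Ladd R).
Proof. by move=> x y; apply: laurP => m; rewrite !LaddE addrC. Qed.
Fact Ladd0 : left_id L0 (@Ladd R).
Proof. by move=> x; apply: laurP => m; rewrite LaddE L0E add0r. Qed.
Fact LaddN : left_inverse L0 (@Lopp R) (@Ladd R).
Proof. by move=> x; apply: laurP => m; rewrite LaddE LoppE L0E addNr. Qed.

HB.instance Definition _ := GRing.isZmodule.Build (laurent R) LaddA LaddC Ladd0 LaddN.

Fact LscaleA (a b : R) c : Lscale a (Lscale b c) = Lscale (a * b) c.
Proof. by apply: laurP => m; rewrite !LscaleE mulrA. Qed.
Fact Lscale1 : left_id 1 (@Lscale R).
Proof. by move=> c; apply: laurP => m; rewrite LscaleE mul1r. Qed.
Fact LscaleDr : right_distributive (@Lscale R) +%R.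
Proof. by move=> r c d; apply: laurP => m; rewrite [RHS]LaddE !LscaleE LaddE mulrDr. Qed.
Fact LscaleDl c : {morph (@Lscale R)^~ c : a b / a + b}.
Proof. by move=> a b; apply: laurP => m; rewrite [RHS]LaddE !LscaleE mulrDl. Qed.

HB.instance Definition _ := GRing.Zmodule_isLmodule.Build R (laurent R)
  LscaleA Lscale1 LscaleDr LscaleDl.

Lemma lcoef0 m : (0 : laurent R) m = 0. Proof. exact: L0E. Qed.
Lemma lcoefD c d m : (c + d) m = c m + d m. Proof. exact: LaddE. Qed.
Lemma lcoefN c m : (- c) m = - c m. Proof. exact: LoppE. Qed.
Lemma lcoefB c d m : (c - d) m = c m - d m. Proof. by rewrite lcoefD lcoefN. Qed.
Lemma lcoefZ r c m : (r *: c) m = r * c m. Proof. exact: LscaleE. Qed.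
Lemma lcoef_sum (I : Type) (s : seq I) (P : pred I) (F : I -> laurent R) m :
  (\sum_(i <- s | P i) F i) m = \sum_(i <- s | P i) F i m.
Proof. by elim/big_rec2: _ => [|i y x _ <-]; rewrite ?lcoef0 ?lcoefD. Qed.

Local Notation mono := (mono R).
Lemma monoE m m' : mono m m' = (m' == m)%:R.
Proof. by rewrite mono.unlock mkLE inE; case: eqP. Qed.

Lemma laur_sum (S : {fset ZZ}) c : (finsupp c `<=` S)%fset ->
  c = \sum_(m <- S) c m *: mono m.
Proof.
move=> cS; apply: laurP => m; rewrite lcoef_sum.
under eq_bigr do rewrite lcoefZ monoE.
case: (boolP (m \in S)) => mS.
  rewrite (bigD1_seq m) //= ?fset_uniq // eqxx mulr1 big1 ?addr0 // => i.
  by rewrite eq_sym => /negPf->; rewrite mulr0.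
rewrite big1_seq => [|i /= iS].
  by apply/eqP; case: finsuppP => // /(fsubsetP cS) mS'; rewrite mS' in mS.
by case: eqP => [e|]; rewrite ?mulr0 //; rewrite e iS in mS.
Qed.

Lemma laur_expand c : c = \sum_(m <- finsupp c) c m *: mono m.
Proof. exact: laur_sum. Qed.

Definition Lext (M : lmodType R) (f : ZZ -> M) c : M := \sum_(m <- finsupp c) c m *: f m.

Section Lext.
Variables (M : lmodType R) (f : ZZ -> M).
Lemma LextE (S : {fset ZZ}) c : (finsupp c `<=` S)%fset ->
  Lext f c = \sum_(m <- S) c m *: f m.
Proof.
move=> cS; apply: big_fset_incl => // m _.
by move/fsfun_dflt => ->; rewrite scale0r.
Qed.
Fact Lext_linear : linear (Lext f).
Proof.
move=> r /= c d; set S := (finsupp (c : laurent R) `|` finsupp (d : laurent R) `|` finsupp (r *: c + d : laurent R)%R)%fset.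
rewrite !(@LextE S) ?fsubsetUr //.
- by rewrite scaler_sumr -big_split /=; apply: eq_bigr => i _;
     rewrite lcoefD lcoefZ scalerDl scalerA.
- by rewrite /S fsetUC fsetUA fsubsetUr.
- by rewrite /S -fsetUA fsubsetUl.
Qed.
HB.instance Definition _ := GRing.isLinear.Build R (laurent R) M _ (Lext f) Lext_linear.
Lemma Lext_mono m : Lext f (mono m) = f m.
Proof.
rewrite (@LextE [fset m]%fset) ?big_seq_fset1 ?monoE ?eqxx ?scale1r //.
by apply/fsubsetP => x; rewrite mem_finsupp monoE !inE; have [//|/=] := eqVneq x m; rewrite eqxx.
Qed.
End Lext.

(** Monomials form a basis, so the ring axioms for [Lmul] reduce to identities between exponents. *)
Lemma lin_ext (M : lmodType R) (f g : laurent R -> M) : linear f -> linear g ->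
  (forall m, f (mono m) = g (mono m)) -> f =1 g.
Proof.
move=> lf lg e c.
pose f' : {linear laurent R -> M} := HB.pack f (GRing.isLinear.Build _ _ _ _ f lf).
pose g' : {linear laurent R -> M} := HB.pack g (GRing.isLinear.Build _ _ _ _ g lg).
rewrite (laur_expand c) -[f _]/(f' _) -[g _]/(g' _) !linear_sum.
by apply: eq_bigr => m _; rewrite !linearZ /= e.
Qed.

Definition Lshift m : laurent R -> laurent R := Lext (fun m' => mono (m + m')).
HB.instance Definition _ m := GRing.Linear.on (Lshift m).
Lemma Lshift_mono m m' : Lshift m (mono m') = mono (m + m').
Proof. exact: Lext_mono. Qed.
Lemma LshiftE m c m' : Lshift m c m' = c (m' - m).
Proof.
rewrite /Lshift /Lext lcoef_sum.
under eq_bigr do rewrite lcoefZ monoE.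
rewrite {3}(laur_expand c) lcoef_sum; apply: eq_bigr => i _.
by rewrite lcoefZ monoE subr_eq addrC.
Qed.

Fact LmulE c d : Lmul c d = Lext (fun m => Lshift m d) c.
Proof. by rewrite Lmul.unlock. Qed.

Fact Lmul_mono m m' : Lmul (mono m) (mono m') = mono (m + m').
Proof. by rewrite LmulE Lext_mono Lshift_mono. Qed.
Fact Lmul_l d : linear ((@Lmul R)^~ d).
Proof. by move=> r c c'; rewrite !LmulE linearP. Qed.
Fact Lmul_r c : linear (Lmul c : laurent R -> laurent R).
Proof.
move=> r d d'; rewrite !LmulE /Lext scaler_sumr -big_split; apply: eq_bigr => m _.
by rewrite /= linearP scalerDr !scalerA mulrC.
Qed.
Fact LmulC : commutative (@Lmul R).
Proof.
move=> c d; move: c; apply: lin_ext; [exact: Lmul_l|exact: Lmul_r|move=> m].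
move: d; apply: lin_ext; [exact: Lmul_r|exact: Lmul_l|move=> m'].
by rewrite !Lmul_mono addrC.
Qed.
Fact LmulA : associative (@Lmul R).
Proof.
move=> a b c; move: a; apply: lin_ext => [|r x y|m].
- exact: Lmul_l.
- by rewrite Lmul_l Lmul_l.
move: b; apply: lin_ext => [r x y|r x y|m'].
- by rewrite Lmul_l Lmul_r.
- by rewrite Lmul_r Lmul_l.
move: c; apply: lin_ext => [r x y|r x y|m2].
- by rewrite Lmul_r Lmul_r.
- by rewrite Lmul_r.
by rewrite !Lmul_mono addrA.
Qed.
Fact Lmul1 : left_id (mono 0) (@Lmul R).
Proof.
apply: lin_ext => [r x y|//|m]; first by rewrite Lmul_r.
by rewrite Lmul_mono add0r.
Qed.
Fact LmulDl : left_distributive (@Lmul R) +%R.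
Proof. by move=> x y z; have := Lmul_l z 1 x y; rewrite !scale1r. Qed.
Fact L1_neq0 : mono 0 != 0.
Proof.
by apply/eqP => /(congr1 (fun c : laurent R => c 0)) /eqP; rewrite monoE lcoef0 eqxx oner_eq0.
Qed.
HB.instance Definition _ := GRing.Zmodule_isComNzRing.Build (laurent R)
  LmulA LmulC Lmul1 LmulDl L1_neq0.
Fact LscaleAl (r : R) c d : r *: (c * d) = (r *: c) * d.
Proof. by have := Lmul_l d r c 0; rewrite /= [Lmul 0 d](mul0r d) !addr0. Qed.
HB.instance Definition _ := GRing.Lmodule_isLalgebra.Build R (laurent R) LscaleAl.
Fact LscaleAr (r : R) c d : r *: (c * d) = c * (r *: d).
Proof. by rewrite mulrC scalerAl mulrC. Qed.
HB.instance Definition _ := GRing.Lalgebra_isAlgebra.Build R (laurent R) LscaleAr.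
HB.instance Definition _ := GRing.Lalgebra_isComAlgebra.Build R (laurent R).

Lemma monoD m m' : mono (m + m') = mono m * mono m'.
Proof. by rewrite -Lmul_mono. Qed.
Lemma mono0 : mono 0 = 1. Proof. by []. Qed.
Lemma monoK m : mono (- m) * mono m = 1.
Proof. by rewrite -monoD addNr. Qed.
Lemma monoVK m : mono m * mono (- m) = 1.
Proof. by rewrite -monoD addrN. Qed.
Lemma lcoef_mono m c m' : (mono m * c) m' = c (m' - m).
Proof. by rewrite -LshiftE -[_ * _]/(Lmul _ _) LmulE Lext_mono. Qed.
Lemma mulL_sum c d : c * d = \sum_(m <- finsupp c) c m *: (mono m * d).
Proof.
by rewrite {1}(laur_expand c) mulr_suml; apply: eq_bigr => m _; rewrite scalerAl.
Qed.
Lemma lcoefM c d m : (c * d) m = \sum_(i <- finsupp c) c i * d (m - i).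
Proof.
by rewrite mulL_sum lcoef_sum; apply: eq_bigr => i _; rewrite lcoefZ lcoef_mono.
Qed.
Lemma lcoef1 m : (1 : laurent R) m = (m == 0)%:R. Proof. exact: monoE. Qed.
Lemma mono_inj m c d : mono m * c = mono m * d -> c = d.
Proof. by move/(congr1 ( *%R (mono (- m)))); rewrite !mulrA monoK !mul1r. Qed.
Lemma monoX m k : mono m ^+ k = mono (m *+ k).
Proof. by elim: k => [|k IH]; rewrite ?mulr0n // exprS IH mulrS monoD. Qed.

Lemma lcoefM_neq0 c d m : (c * d) m != 0 -> exists m1 m2,
  [/\ m = m1 + m2, c m1 != 0 & d m2 != 0].
Proof.
rewrite lcoefM => h.
have /hasP[i ic /negP hi] : has (fun i => ~~ (c i * d (m - i) == 0)) (finsupp c).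
  by apply: contraNT h => /hasPn h; rewrite big1_seq // => i /= /h /negPn/eqP.
exists i, (m - i); rewrite [i + _]addrC subrK; split=> //; apply/eqP => e; apply: hi.
  by rewrite e mul0r.
by rewrite e mulr0.
Qed.

End LaurentModule.

Arguments mono {R} m.

HB.lock Definition Lmap (R R' : comNzRingType) (g : {rmorphism R -> R'}) (c : laurent R) :
  laurent R' := mkL (finsupp c) (fun m => g (c m)).

Section Lmap.
Variables (R R' : comNzRingType) (g : {rmorphism R -> R'}).
Local Notation Lmap := (@Lmap R R' g).

Lemma LmapE c m : Lmap c m = g (c m).
Proof. by rewrite Lmap.unlock mkLE; case: finsuppP; rewrite ?rmorph0. Qed.
Fact Lmap_zmod : zmod_morphism Lmap.
Proof. by move=> c d; apply: laurP => m; rewrite lcoefB !LmapE lcoefB rmorphB. Qed.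
HB.instance Definition _ := GRing.isZmodMorphism.Build _ _ Lmap Lmap_zmod.
Lemma LmapZ r c : Lmap (r *: c) = g r *: Lmap c.
Proof. by apply: laurP => m; rewrite lcoefZ !LmapE lcoefZ rmorphM. Qed.
Lemma Lmap_mono m : Lmap (mono m) = mono m.
Proof. by apply: laurP => m'; rewrite LmapE !monoE rmorph_nat. Qed.
Fact Lmap_monoid : monoid_morphism Lmap.
Proof.
split; first exact: Lmap_mono.
move=> c d; have -> : Lmap c = \sum_(m <- finsupp c) g (c m) *: mono m.
  by rewrite {1}(laur_expand c) raddf_sum; apply: eq_bigr => m _; rewrite /= LmapZ Lmap_mono.
rewrite mulL_sum raddf_sum mulr_suml; apply: eq_bigr => m _.
rewrite /= LmapZ -scalerAl; congr (_ *: _).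
by apply: laurP => m'; rewrite LmapE !lcoef_mono LmapE.
Qed.
HB.instance Definition _ := GRing.isMonoidMorphism.Build _ _ Lmap Lmap_monoid.
End Lmap.

(** * Polynomials in x and y as Laurent polynomials *)

Section PolyToLaurent.
Variable R : comNzRingType.
Notation A := {poly {poly R}}.
Implicit Types (P Q : A) (c : laurent R) (m : ZZ).

Definition cst : R -> laurent R := in_alg (laurent R).
HB.instance Definition _ := GRing.RMorphism.on cst.
Definition monX : laurent R := mono (1, 0).
Definition monY : laurent R := mono (0, 1).
Fact cst_comm (x : laurent R) : commr_rmorph cst x.
Proof. by move=> r; apply: mulrC. Qed.
Definition toLx : {poly R} -> laurent R := horner_morph (cst_comm monX).
HB.instance Definition _ := GRing.RMorphism.on toLx.
Fact toLx_comm (x : laurent R) : commr_rmorph toLx x.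
Proof. by move=> r; apply: mulrC. Qed.
Definition toL : A -> laurent R := horner_morph (toLx_comm monY).
HB.instance Definition _ := GRing.RMorphism.on toL.

Lemma toLxE p : toLx p = \sum_(i < size p) p`_i *: mono (i%:Z, 0).
Proof.
rewrite /toLx /horner_morph (@horner_coef_wide _ (size p)) ?size_poly //.
apply: eq_bigr => i _; rewrite coef_map /= mulr_algl; congr (_ *: _).
rewrite /monX monoX; congr mono; apply/eqP/andP; rewrite /= !raddfMn /=.
by split; rewrite ?mul0rn // pmulrn intz.
Qed.

Lemma toLE P m : toL P m = coefxy P m.
Proof.
rewrite /toL /horner_morph (@horner_coef_wide _ (size P)) ?size_poly //.
have E (i : nat) : ((map_poly toLx P)`_i * monY ^+ i) m =
    if m.2 == i%:Z then (if m.1 is Posz p then P`_i`_p else 0) else 0.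
  rewrite coef_map /= toLxE mulr_suml lcoef_sum.
  have E2 (j : 'I_(size P`_i)) : (P`_i`_j *: mono (j%:Z, 0) * monY ^+ i) m =
     P`_i`_j * ((m.1 == j%:Z) && (m.2 == i%:Z))%:R.
    rewrite -scalerAl lcoefZ /monY monoX -monoD monoE; congr (_ * _%:R).
    have -> : (j%:Z, 0) + (0, 1) *+ i = (j%:Z, i%:Z) :> ZZ.
      apply/eqP; rewrite -[_ == _]/((_ == _) && (_ == _)) /= !raddfMn /= mul0rn addr0 add0r.
      by rewrite pmulrn intz !eqxx.
    by case: m => ? ?; rewrite xpair_eqE.
  under eq_bigr do rewrite E2.
  case: eqP => _; last by rewrite big1 // => j _; rewrite andbF mulr0.
  case: m.1 => [p|p]; last by rewrite big1 // => j _; rewrite mulr0.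
  under eq_bigr do rewrite andbT.
  case: (ltnP p (size P`_i)) => hp.
    rewrite (bigD1 (Ordinal hp)) //= eqxx mulr1 big1 ?addr0 // => j.
    by rewrite -val_eqE /= -eqz_nat eq_sym => /negPf->; rewrite mulr0.
  rewrite [RHS]nth_default // big1 // => j _; rewrite eqz_nat.
  by case: eqP => [e|]; rewrite ?mulr0 //; move: hp; rewrite e leqNgt ltn_ord.
rewrite lcoef_sum; under eq_bigr do rewrite E.
case: m E => [m1 [q|q]] /= _; last first.
  by rewrite big1 //; case: m1.
case: (ltnP q (size P)) => hq.
  rewrite (bigD1 (Ordinal hq)) //= eqxx big1 ?addr0 // => j.
  by rewrite -val_eqE /= -eqz_nat eq_sym => /negPf->.
rewrite big1 => [|j _]; last first.
  by rewrite eqz_nat; case: eqP => // e; move: hq; rewrite e leqNgt ltn_ord.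
by case: m1 => // p; rewrite [P`_q]nth_default // coef0.
Qed.

Lemma toL_inj : injective toL.
Proof.
move=> P Q e; apply/polyP => q; apply/polyP => p.
by have := congr1 (fun c : laurent R => c (Posz p, Posz q)) e; rewrite !toLE.
Qed.

Definition nonneg m := (0 <= m.1) && (0 <= m.2).
Definition polyL c := forall m, c m != 0 -> nonneg m.

Lemma toL_polyL P : polyL (toL P).
Proof. by move=> [[p|p] [q|q]]; rewrite toLE /= ?eqxx. Qed.

Definition monA (p q : nat) : A := 'X^q * ('X^p)%:P.
Lemma toLC r : toL r%:P%:P = cst r.
Proof. by rewrite /toL horner_morphC /= /toLx horner_morphC. Qed.
Lemma toLX : toL ('X%:P) = monX.
Proof. by rewrite /toL horner_morphC /= /toLx horner_morphX. Qed.
Lemma toLY : toL 'X = monY.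
Proof. by rewrite /toL horner_morphX. Qed.
Lemma toLZ r P : toL (r%:P%:P * P) = r *: toL P.
Proof. by rewrite rmorphM /= toLC mulr_algl. Qed.
Lemma toL_mon p q : toL (monA p q) = mono (p%:Z, q%:Z).
Proof.
rewrite rmorphM rmorphXn /= toLY polyC_exp rmorphXn /= toLX /monX /monY !monoX -monoD.
congr mono; apply/eqP; rewrite -[_ == _]/((_ == _) && (_ == _)) /= !raddfMn /=.
by rewrite !mul0rn addr0 add0r !pmulrn !intz !eqxx.
Qed.

(** The absolute values only make the formula total: the result is meaningful when all exponents in
    [c] are nonnegative. *)
Definition fromL c : A :=
  \sum_(m <- finsupp c) (c m)%:P%:P * monA `|m.1|%N `|m.2|%N.
Lemma fromLK c : polyL c -> toL (fromL c) = c.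
Proof.
move=> hc; rewrite /fromL rmorph_sum /= {3}(laur_expand c) big_seq [RHS]big_seq.
apply: eq_bigr => m; rewrite mem_finsupp => /hc /andP[h1 h2].
by rewrite toLZ toL_mon !gez0_abs //; case: m {h1 h2}.
Qed.
Lemma toLK P : fromL (toL P) = P.
Proof. by apply: toL_inj; apply: fromLK; apply: toL_polyL. Qed.
End PolyToLaurent.

Lemma toL_map (R R' : comNzRingType) (g : {rmorphism R -> R'}) (P : {poly {poly R}}) :
  toL (map_poly (map_poly g) P) = Lmap g (toL P).
Proof.
apply: laurP => m; rewrite LmapE !toLE.
by case: m => [[p|p] [q|q]] /=; rewrite ?rmorph0 // !coef_map.
Qed.

(** * Charts and localized ideals *)

Definition o1 : 'I_3 := @Ordinal 3 1 isT.
Definition o2 : 'I_3 := @Ordinal 3 2 isT.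

Lemma ord3 (i : 'I_3) : [\/ i = o0, i = o1 | i = o2].
Proof.
by case: i => [[|[|[|]]] ?] //; [constructor 1|constructor 2|constructor 3]; apply: val_inj.
Qed.
Lemma nonempty3 (A : {set 'I_3}) : A != set0 -> [|| o0 \in A, o1 \in A | o2 \in A].
Proof. by case/set0Pn=> i; have [->|->|->] := ord3 i; move=> ->; rewrite ?orbT. Qed.

Lemma regularE (A : {set 'I_3}) (m : ZZ) : regular A m =
  [&& (o0 \in A) || (m.1 + m.2 <= 0), (o1 \in A) || (0 <= m.1) & (o2 \in A) || (0 <= m.2)].
Proof.
have e2 : ord_max = o2 by apply: val_inj.
apply/forallP/and3P => [h|[h0 h1 h2] i].
  have := h o0; have := h o1; have := h o2; rewrite /expo /= !implybE !negbK oppr_ge0.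
  by move=> -> -> ->.
rewrite implybE negbK; have [->|->|->] := ord3 i.
- by rewrite /expo /= oppr_ge0.
- by [].
- by [].
Qed.

Lemma regular0 A : regular A 0.
Proof. by rewrite regularE /= addr0 lexx !orbT. Qed.
Lemma regularD A m m' : regular A m -> regular A m' -> regular A (m + m').
Proof.
rewrite !regularE => /and3P[a b c] /and3P[a' b' c']; apply/and3P; split=> /=; lia.
Qed.
Lemma regularS (A B : {set 'I_3}) m : A \subset B -> regular A m -> regular B m.
Proof.
move=> /subsetP AB; rewrite !regularE => /and3P[a b c]; apply/and3P; split.
- by case/orP: a => [/AB ->|->]; rewrite ?orbT.
- by case/orP: b => [/AB ->|->]; rewrite ?orbT.
- by case/orP: c => [/AB ->|->]; rewrite ?orbT.
Qed.
Lemma regular_aff m : regular aff_chart m = nonneg m.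
Proof. by rewrite regularE /aff_chart !inE. Qed.

Section InO.
Variables (R : comNzRingType).
Implicit Types (c d : laurent R) (m : ZZ) (A B : {set 'I_3}).

(** This is [in_O] over a bare set of indices, so that sets such as [o0 |: A] can be used without a
    proof of nonemptiness. *)
Definition inOs A c := forall m, c m != 0 -> regular A m.

Lemma inOs0 A : inOs A 0. Proof. by move=> m; rewrite lcoef0 eqxx. Qed.
Lemma inOsD A c d : inOs A c -> inOs A d -> inOs A (c + d).
Proof.
move=> hc hd m; rewrite lcoefD; have [->|/hc //] := eqVneq (c m) 0.
by rewrite add0r; apply: hd.
Qed.
Lemma inOsZ A r c : inOs A c -> inOs A (r *: c).
Proof. by move=> hc m; rewrite lcoefZ => h; apply: hc; apply: contraNneq h => ->; rewrite mulr0. Qed.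
Lemma inOsN A c : inOs A c -> inOs A (- c).
Proof. by move=> h; rewrite -scaleN1r; apply: inOsZ. Qed.
Lemma inOsB A c d : inOs A c -> inOs A d -> inOs A (c - d).
Proof. by move=> h h'; apply: inOsD => //; apply: inOsN. Qed.
Lemma inOsM A c d : inOs A c -> inOs A d -> inOs A (c * d).
Proof. by move=> hc hd m /lcoefM_neq0[m1 [m2 [-> /hc h1 /hd h2]]]; apply: regularD. Qed.
Lemma inOs_mono A m : regular A m -> inOs A (mono m).
Proof. by move=> h m'; rewrite monoE; have [->//|_] := eqVneq m' m; rewrite eqxx. Qed.
Lemma inOs1 A : inOs A 1. Proof. exact/inOs_mono/regular0. Qed.
Lemma inOsX A c k : inOs A c -> inOs A (c ^+ k).
Proof. by move=> h; elim: k => [|k IH]; [apply: inOs1|rewrite exprS; apply: inOsM]. Qed.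
Lemma inOs_sum A (I : Type) (s : seq I) (P : pred I) (F : I -> laurent R) :
  (forall i, P i -> inOs A (F i)) -> inOs A (\sum_(i <- s | P i) F i).
Proof. by move=> h; elim/big_rec: _ => [|i x Pi]; [apply: inOs0|apply: inOsD; apply: h]. Qed.
Lemma inOsS A B c : A \subset B -> inOs A c -> inOs B c.
Proof. by move=> AB h m /h; apply: regularS. Qed.
Lemma inOs_aff c : inOs aff_chart c <-> polyL c.
Proof. by split=> h m /h; rewrite regular_aff. Qed.
Lemma inOs_toL A P : o0 \in A -> inOs A (toL P : laurent R).
Proof.
move=> hA; apply: (@inOsS aff_chart); first by rewrite sub1set.
by apply/inOs_aff; apply: toL_polyL.
Qed.

Lemma supp_bound c : exists K : nat, forall m, c m != 0 -> (`|m.1| <= K)%N && (`|m.2| <= K)%N.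
Proof.
exists (\max_(m <- finsupp c) maxn `|m.1| `|m.2|)%N => m.
rewrite -mem_finsupp => h; have := @leq_bigmax_seq _ (enum_fset (finsupp c)) xpredT (fun m : ZZ => maxn `|m.1| `|m.2|) m h isT.
by rewrite geq_max.
Qed.

(** The k-th power of the product of those affine coordinates that are invertible on U_A: regular on
    C^2, a unit on the part of U_A in C^2, and cofinal among such denominators. *)
Definition mu A (k : nat) : ZZ :=
  ((if o1 \in A then k else 0)%:Z, (if o2 \in A then k else 0)%:Z).

Lemma mu_nonneg A k : nonneg (mu A k).
Proof. by rewrite /nonneg /mu /=; case: (o1 \in A); case: (o2 \in A). Qed.
Lemma muN_reg A k : regular (o0 |: A) (- mu A k).
Proof. by rewrite regularE !inE /mu /=; case: (o1 \in A); case: (o2 \in A) => //=. Qed.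
Lemma mu_reg0 A k : regular (o0 |: A) (mu A k).
Proof. by rewrite regularE !inE /mu /=; case: (o1 \in A); case: (o2 \in A) => //=. Qed.
Lemma muD A k l : mu A (k + l) = mu A k + mu A l.
Proof. by rewrite /mu; case: (o1 \in A); case: (o2 \in A); rewrite ?PoszD. Qed.
Lemma mu0 A : mu A 0 = 0. Proof. by rewrite /mu; case: (o1 \in A); case: (o2 \in A). Qed.

Lemma polyL_up A c : inOs (o0 |: A) c ->
  exists k0, forall k, (k0 <= k)%N -> polyL (mono (mu A k) * c).
Proof.
move=> hc; have [K hK] := supp_bound c; exists K => k hk m; rewrite lcoef_mono => h.
have := hK _ h; have := hc _ h; rewrite regularE !inE /nonneg /mu /=.
by case: (o1 \in A); case: (o2 \in A) => /=; lia.
Qed.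

(** If o0 is not in A, then A contains o1 or o2, so division by [mu A k] lowers the total degree
    until the poles at infinity are gone. *)
Lemma inOs_down A c : A != set0 -> polyL c ->
  exists k0, forall k, (k0 <= k)%N -> inOs A (mono (- mu A k) * c).
Proof.
move=> A0 hc; have [K hK] := supp_bound c; exists (2 * K)%N => k hk m; rewrite lcoef_mono => h.
have := hK _ h; have := hc _ h; rewrite regularE /nonneg /mu /=.
have := nonempty3 A0.
by case: (o0 \in A); case: (o1 \in A); case: (o2 \in A) => //= _; lia.
Qed.

Lemma inOs_aff_up A c : inOs (o0 |: A) c ->
  exists k0, forall k, (k0 <= k)%N -> exists P, toL P = mono (mu A k) * c.
Proof.
move=> /polyL_up[k0 h]; exists k0 => k /h hk; exists (fromL (mono (mu A k) * c)).
exact: fromLK.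
Qed.

(* For a chart meeting infinity, the equation [x_0/x_i] of the line at infinity. *)
Definition zinf A : ZZ := if o1 \in A then (-1, 0) else (0, -1).
Lemma zinf_reg A : A != set0 -> o0 \notin A -> regular A (zinf A).
Proof.
move=> /nonempty3 + /negPf h0; rewrite regularE /zinf h0 /=.
by case: (o1 \in A); case: (o2 \in A).
Qed.
Lemma zinf_div A m : A != set0 -> o0 \notin A -> regular A m -> 0 < expo m ord0 ->
  regular A (m - zinf A).
Proof.
move=> A0 h0; have := zinf_reg A0 h0; rewrite !regularE (negPf h0) /expo /zinf /=.
by case: (o1 \in A); case: (o2 \in A) => //=; lia.
Qed.
Lemma zinf_expo A : expo (zinf A) ord0 = 1.
Proof. by rewrite /zinf; case: ifP. Qed.
Lemma zinfN_reg A : A != set0 -> o0 \notin A -> regular (o0 |: A) (- zinf A).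
Proof.
move=> A0 h0; have := zinf_reg A0 h0; rewrite !regularE !inE (negPf h0) /zinf /=.
by case: (o1 \in A); case: (o2 \in A) => //=; lia.
Qed.

Lemma expoD m m' i : expo (m + m') i = expo m i + expo m' i.
Proof. by case: i => [[|[|[|]]] ?] //=; rewrite /expo /=; lia. Qed.
Lemma expoN m i : expo (- m) i = - expo m i.
Proof. by case: i => [[|[|[|]]] ?] //=; rewrite /expo /=; lia. Qed.

Definition is_ideal (J : {poly {poly R}} -> Prop) :=
  [/\ J 0, (forall P Q, J P -> J Q -> J (P + Q)) & (forall P Q, J Q -> J (P * Q))].

End InO.

(** * Localizations of an ideal of R[x,y] *)

Section Jloc.
Variables (R : comNzRingType) (J : {poly {poly R}} -> Prop) (Ji : is_ideal J).
Implicit Types (c d : laurent R) (m : ZZ) (A B : {set 'I_3}).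

Lemma ideal_0 : J 0. Proof. by case: Ji. Qed.
Lemma ideal_D P Q : J P -> J Q -> J (P + Q). Proof. by case: Ji => _ h _; apply: h. Qed.
Lemma ideal_M P Q : J Q -> J (P * Q). Proof. by case: Ji => _ _; apply. Qed.
Lemma ideal_Mr P Q : J P -> J (P * Q). Proof. by rewrite mulrC; apply: ideal_M. Qed.
Lemma ideal_N P : J P -> J (- P). Proof. by rewrite -mulN1r; apply: ideal_M. Qed.
Lemma ideal_B P Q : J P -> J Q -> J (P - Q).
Proof. by move=> h /ideal_N; apply: ideal_D. Qed.
Lemma ideal_sum (I : Type) (s : seq I) (p : pred I) F :
  (forall i, p i -> J (F i)) -> J (\sum_(i <- s | p i) F i).
Proof. by move=> h; elim/big_rec: _ => [|i x pi]; [apply: ideal_0|apply: ideal_D; apply: h]. Qed.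
Lemma ideal_subK P Q : J (P - Q) -> J Q -> J P.
Proof. by move=> h /(ideal_D h); rewrite subrK. Qed.

(** The localization of [J] on the part of U_A in C^2; it imposes no regularity along L_oo. One
    cofinal family of denominators replaces the arbitrary monomials of [in_ideal_sheaf]. *)
Definition Jloc A c := exists k Q, J Q /\ toL Q = mono (mu A k) * c.

Lemma Jloc_gen A m Q c : nonneg m -> regular (o0 |: A) (- m) -> J Q -> toL Q = mono m * c ->
  exists k0, forall k, (k0 <= k)%N -> exists Q, J Q /\ toL Q = mono (mu A k) * c.
Proof.
move=> m0 mA JQ e; exists (maxn `|m.1| `|m.2|) => k hk.
have hn : nonneg (mu A k - m).
  move: m0 mA hk; rewrite /nonneg regularE !inE /mu /=.
  by case: (o1 \in A); case: (o2 \in A) => /=; lia.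
have hp : polyL (mono (mu A k - m) : laurent R).
  by move=> m'; rewrite monoE; have [->//|_] := eqVneq m' (mu A k - m); rewrite eqxx.
exists (fromL (mono (mu A k - m)) * Q); split; first exact: ideal_M.
by rewrite rmorphM /= fromLK // e mulrA -monoD subrK.
Qed.

Lemma Jloc_up A c : Jloc A c ->
  exists k0, forall k, (k0 <= k)%N -> exists Q, J Q /\ toL Q = mono (mu A k) * c.
Proof. by case=> k [Q [JQ e]]; apply: Jloc_gen JQ e; [apply: mu_nonneg|apply: muN_reg]. Qed.

Lemma Jloc_iff A c : Jloc A c <-> exists m Q,
  [/\ regular aff_chart m, regular (o0 |: A) (- m), J Q & toL Q = mono m * c].
Proof.
split=> [[k [Q [JQ e]]]|[m [Q [h1 h2 JQ e]]]].
  by exists (mu A k), Q; split=> //; rewrite ?regular_aff ?mu_nonneg ?muN_reg.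
rewrite regular_aff in h1; have [k h] := Jloc_gen h1 h2 JQ e.
by exists k; apply: h.
Qed.

Lemma Jloc_toL A P : J P -> Jloc A (toL P).
Proof. by move=> h; exists 0%N, P; rewrite mu0 mono0 mul1r. Qed.
Lemma Jloc0 A : Jloc A 0.
Proof. by exists 0%N, 0; rewrite mulr0 rmorph0; split=> //; apply: ideal_0. Qed.
Lemma JlocD A c d : Jloc A c -> Jloc A d -> Jloc A (c + d).
Proof.
move=> /Jloc_up[k h] /Jloc_up[k' h'].
have [Q [JQ e]] := h _ (leq_maxl k k'); have [Q' [JQ' e']] := h' _ (leq_maxr k k').
exists (maxn k k'), (Q + Q'); split; first exact: ideal_D.
by rewrite rmorphD /= e e' mulrDr.
Qed.
Lemma JlocM A c d : inOs (o0 |: A) c -> Jloc A d -> Jloc A (c * d).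
Proof.
move=> /inOs_aff_up[k hk] [k' [Q [JQ e]]]; have [P eP] := hk k (leqnn k).
exists (k + k')%N, (P * Q); split; first exact: ideal_M.
by rewrite rmorphM /= eP e muD monoD mulrACA.
Qed.
Lemma JlocZ A r c : Jloc A c -> Jloc A (r *: c).
Proof. by rewrite -mulr_algl => h; apply: JlocM => //; apply: inOsZ; apply: inOs1. Qed.
Lemma JlocN A c : Jloc A c -> Jloc A (- c).
Proof. by rewrite -scaleN1r; apply: JlocZ. Qed.
Lemma JlocB A c d : Jloc A c -> Jloc A d -> Jloc A (c - d).
Proof. by move=> h /JlocN; apply: JlocD. Qed.
Lemma JlocS A B c : A \subset B -> Jloc A c -> Jloc B c.
Proof.
move=> AB /Jloc_iff[m [Q [h1 h2 h3 h4]]]; apply/Jloc_iff; exists m, Q; split=> //.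
by apply: regularS h2; apply: setUS.
Qed.
Lemma Jloc_aff c : Jloc aff_chart c -> exists2 Q, J Q & toL Q = c.
Proof.
by case=> k [Q [JQ e]]; exists Q; rewrite // e /mu /aff_chart !inE /= mono0 mul1r.
Qed.
Lemma Jloc0U A c : Jloc (o0 |: A) c <-> Jloc A c.
Proof.
have e k : mu (o0 |: A) k = mu A k by rewrite /mu !inE.
by split=> -[k [Q h]]; exists k, Q; rewrite ?e // -e.
Qed.
End Jloc.

(** * Ideals with locally free quotient *)

(** One exponent is raised at a time: if b is the j-th term, then 1 = b^M + (1 - b)(1 + ... +
    b^(M-1)), and 1 - b is the sum of the other terms. *)
Lemma unity_powers (R : comNzRingType) (l : nat) (d w : 'I_l -> R) (M : nat) :
  \sum_j w j * d j = 1 -> exists v : 'I_l -> R, \sum_j v j * d j ^+ M = 1.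
Proof.
move=> wd.
suff H (s : seq 'I_l) : uniq s -> exists v, \sum_j v j * d j ^+ (if j \in s then M else 1) = 1.
  by have [v e] := H _ (enum_uniq 'I_l); exists v; rewrite -[RHS]e; apply: eq_bigr => j _; rewrite mem_enum.
elim: s => [|j s IH] => [_|/= /andP[js us]]; first by exists w.
have [v] := IH us; rewrite (bigD1 j) //= (negPf js) => e.
pose b := v j * d j ^+ 1; pose a := 1 - b; pose t := \sum_(i < M) 1 ^+ (M.-1 - i) * b ^+ i.
have eM : 1 = b ^+ M + a * t.
  by rewrite /a /t -subrXX expr1n addrC subrK.
exists (fun i => if i == j then v j ^+ M else v i * t).
rewrite (bigD1 j) //= inE eqxx /= [RHS]eM; congr (_ + _).
  by rewrite /b expr1 exprMn.
have -> : a = \sum_(i | i != j) v i * d i ^+ (if i \in s then M else 1).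
  by apply/eqP; rewrite /a subr_eq addrC -e.
rewrite mulr_suml; apply: eq_bigr => i /negPf ij.
by rewrite inE ij mulrAC.
Qed.

Section LocallyFree.
Variables (R : comNzRingType).
Notation A := {poly {poly R}}.
Implicit Types (P Q : A).

Definition cst2 : R -> A := polyC \o polyC.
HB.instance Definition _ := GRing.RMorphism.on cst2.
Fact evA_comm (xi : A) : commr_rmorph cst2 xi.
Proof. by move=> r; apply: mulrC. Qed.
Definition evA (xi : A) : {poly R} -> A := horner_morph (evA_comm xi).
HB.instance Definition _ xi := GRing.RMorphism.on (evA xi).

Lemma evAC xi r : evA xi r%:P = r%:P%:P. Proof. exact: horner_morphC. Qed.
Lemma evAXx xi : evA xi 'X = xi. Proof. exact: horner_morphX. Qed.
Lemma evA_sum xi (p : {poly R}) n : (size p <= n)%N -> evA xi p = \sum_(i < n) (p`_i)%:P%:P * xi ^+ i.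
Proof.
move=> h; rewrite /evA /horner_morph (@horner_coef_wide _ n); last first.
  by apply: leq_trans h; apply: size_poly.
by apply: eq_bigr => i _; rewrite coef_map.
Qed.
Lemma poly_ext (S : nzRingType) (u v : {rmorphism {poly R} -> S}) :
  (forall r, u r%:P = v r%:P) -> u 'X = v 'X -> u =1 v.
Proof.
move=> eC eX p; rewrite -[p]coefK poly_def !rmorph_sum; apply: eq_bigr => i _.
by rewrite -mul_polyC !rmorphM !rmorphXn /= eC eX.
Qed.
Lemma evA_X p : evA 'X%:P p = p%:P.
Proof. by apply: (@poly_ext _ (evA 'X%:P) polyC) => [r|] /=; rewrite ?evAC ?evAXx. Qed.
Lemma evA_Y p : evA 'X p = map_poly polyC p.
Proof.
apply: (@poly_ext _ (evA 'X) (map_poly polyC)) => [r|] /=; first by rewrite evAC map_polyC.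
by rewrite evAXx map_polyX.
Qed.

Lemma polyA_expand P : P = \sum_(m <- finsupp (toL P)) (toL P m)%:P%:P * monA R `|m.1|%N `|m.2|%N.
Proof. by rewrite -{1}(toLK P). Qed.

Variables (J : A -> Prop) (Ji : is_ideal J).

Definition local_basis (n : nat) (d : R) (b : 'I_n -> A) :=
  (forall P, exists (N : nat) (c : 'I_n -> R),
     J ((d ^+ N)%:P%:P * P - \sum_i (c i)%:P%:P * b i)) /\
  (forall c : 'I_n -> R, J (\sum_i (c i)%:P%:P * b i) ->
     exists N : nat, forall i, d ^+ N * c i = 0).

Lemma span_fin n d (b : 'I_n -> A) (T : finType) (P : T -> A) : local_basis d b ->
  exists N (C : T -> 'I_n -> R), forall t,
    J ((d ^+ N)%:P%:P * P t - \sum_i (C t i)%:P%:P * b i).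
Proof.
case=> sp _; have /choice[N h] := fun t => sp (P t).
have /choice[C hC] := h.
exists (\max_t N t)%N, (fun t i => d ^+ (\max_t N t - N t) * C t i) => t.
have ht : (N t <= \max_t N t)%N by apply: leq_bigmax.
have -> : (d ^+ (\max_t N t))%:P%:P * P t -
    \sum_i (d ^+ (\max_t N t - N t) * C t i)%:P%:P * b i =
    (d ^+ (\max_t N t - N t))%:P%:P * ((d ^+ N t)%:P%:P * P t - \sum_i (C t i)%:P%:P * b i).
  rewrite mulrBr mulrA -!polyCM -exprD subnK // mulr_sumr; congr (_ - _).
  by apply: eq_bigr => i _; rewrite mulrA -!polyCM.
exact: ideal_M.
Qed.

Lemma kill_fin n d (b : 'I_n -> A) (s : seq ('I_n -> R)) : local_basis d b ->
  (forall c, List.In c s -> J (\sum_i (c i)%:P%:P * b i)) ->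
  exists N, forall c, List.In c s -> forall i, d ^+ N * c i = 0.
Proof.
case=> _ ind; elim: s => [|c s IH] h; first by exists 0%N.
have [N1 h1] := IH (fun c hc => h c (or_intror hc)); have [N2 h2] := ind c (h c (or_introl erefl)).
exists (N1 + N2)%N => c' [<-|h'] i; rewrite exprD; first by rewrite -mulrA h2 mulr0.
by rewrite mulrAC h1 ?mul0r.
Qed.

(** Determinant trick over the open set D(d): d^N xi acts on the basis through a matrix whose
    characteristic polynomial kills every [b i], hence also d^N' for some N', which the basis
    spans. *)
Lemma integral_local n d (b : 'I_n -> A) xi : local_basis d b -> exists M (f : {poly R}),
  [/\ (size f <= n.+1)%N, f`_n = d ^+ M & J (evA xi f)].
Proof.
move=> lb; have [N [C hC]] := span_fin (fun i => xi * b i) lb.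
have [N' [c' hc']] := (proj1 lb) 1.
pose Cm : 'M[R]_n := \matrix_(k, i) C k i.
pose y := (d ^+ N)%:P%:P * xi.
pose Mx : 'M[A]_n := y%:M - map_mx cst2 Cm.
have detE : \det Mx = evA y (char_poly Cm).
  rewrite /char_poly -det_map_mx; congr (\det _); apply/matrixP => i j.
  rewrite !mxE rmorphB /= evAC; congr (_ - _).
  by case: eqP => _; rewrite ?mulr1n ?mulr0n ?evAXx ?rmorph0.
have Jdet i : J (\det Mx * b i).
  pose v : 'cV[A]_n := \col_i b i.
  have -> : \det Mx * b i = (\adj Mx *m (Mx *m v)) i 0.
    by rewrite mulmxA mul_adj_mx mul_scalar_mx !mxE.
  rewrite mxE; apply: ideal_sum => // k _; apply: ideal_M => //.
  have -> : (Mx *m v) k 0 = y * b k - \sum_i (C k i)%:P%:P * b i.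
    rewrite /Mx mulmxBl mul_scalar_mx !mxE; congr (_ - _).
    by apply: eq_bigr => j _; rewrite !mxE.
  by rewrite /y -mulrA; apply: hC.
have Jd : J (\det Mx * (d ^+ N')%:P%:P).
  have := ideal_M Ji (\det Mx) hc'; rewrite mulr1 mulrBr => h.
  apply: (ideal_subK Ji h); rewrite mulr_sumr; apply: ideal_sum => // i _.
  by rewrite mulrCA; apply: ideal_M.
(* The characteristic polynomial is monic of degree n in d^N xi, which gives the leading coefficient
   d^(N n) in xi; the factor d^N' comes from expressing 1 in the basis. *)
exists (N' + N * n)%N, (\poly_(k < n.+1) (d ^+ N' * ((char_poly Cm)`_k * d ^+ (N * k)))).
split; first exact: size_poly.
  have /monicP := char_poly_monic Cm; rewrite /lead_coef size_char_poly /= => e.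
  by rewrite coef_poly ltnSn e mul1r exprD.
rewrite (evA_sum _ (size_poly _ _)); suff -> : \sum_(i < n.+1)
  ((\poly_(k < n.+1) (d ^+ N' * ((char_poly Cm)`_k * d ^+ (N * k))))`_i)%:P%:P * xi ^+ i =
  \det Mx * (d ^+ N')%:P%:P by [].
rewrite detE (@evA_sum _ _ n.+1) ?size_char_poly // mulr_suml; apply: eq_bigr => i _.
rewrite coef_poly ltn_ord /y exprMn -!rmorphXn /= -exprM !polyCM; ring.
Qed.

Definition lf_ideal n := quotient_locally_free J n.

(** The local relations all have degree n and a power of [d j] as leading coefficient; a partition
    of unity for these powers combines them into one monic relation. *)
Lemma lf_integral n xi : lf_ideal n -> exists2 f : {poly R}, f \is monic & J (evA xi f).
Proof.
case=> l [d [w [b [wd lb]]]].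
have /choice[M h] := fun j => integral_local xi (lb j).
have /choice[f hf] := h.
have [v vd] := unity_powers (\max_j M j) wd.
pose g := \sum_j (v j * d j ^+ (\max_j M j - M j)) *: f j.
have gn : g`_n = 1.
  rewrite /g coef_sum -vd; apply: eq_bigr => j _.
  rewrite coefZ; have [_ -> _] := hf j; rewrite -mulrA -exprD subnK //; exact: leq_bigmax.
have gs : (size g <= n.+1)%N.
  apply: (leq_trans (size_sum _ _ _)); apply/bigmax_leqP => j _.
  by apply: (leq_trans (size_scale_leq _ _)); have [] := hf j.
exists g.
  rewrite monicE /lead_coef; suff -> : size g = n.+1 by rewrite gn.
  apply/eqP; rewrite eqn_leq gs ltnNge; apply: contraTN isT => /leq_sizeP/(_ _ (leqnn _)).
  by rewrite gn => /eqP; rewrite oner_eq0.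
rewrite rmorph_sum; apply: ideal_sum => // j _.
by rewrite -mul_polyC rmorphM; apply: ideal_M => //; have [] := hf j.
Qed.

Lemma eqJ_trans Q P S : J (P - Q) -> J (Q - S) -> J (P - S).
Proof. by move=> h h'; rewrite -(subrK Q P) -addrA; apply: ideal_D. Qed.
Lemma eqJ_M Q P S : J (P - S) -> J (Q * P - Q * S).
Proof. by rewrite -mulrBr; apply: ideal_M. Qed.
Lemma eqJ_sum (I : Type) (s : seq I) (p : pred I) (F G : I -> A) :
  (forall i, p i -> J (F i - G i)) -> J (\sum_(i <- s | p i) F i - \sum_(i <- s | p i) G i).
Proof. by move=> h; rewrite -sumrB; apply: ideal_sum. Qed.

(** Division with remainder by f in x and by g in y. The ideal is left general because the proof of
    finite generation applies this to the ideal generated by a given list. *)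
Lemma span_mon (f g : {poly R}) : f \is monic -> g \is monic ->
  J f%:P -> J (map_poly polyC g) -> exists D, forall p q, exists lam : 'I_D -> 'I_D -> R,
    J (monA R p q - \sum_i \sum_j (lam i j)%:P%:P * monA R i j).
Proof.
move=> mf mg Jf Jg; set D := maxn (size f) (size g); exists D => p q.
pose r := Pdiv.Ring.rmodp 'X^p f; pose s := Pdiv.Ring.rmodp 'X^q g.
have rE : r%:P = \sum_(i < D) (r`_i)%:P%:P * 'X%:P ^+ i.
  rewrite -evA_X; apply: evA_sum; apply: (@leq_trans (size f)); last exact: leq_maxl.
  by apply: ltnW; rewrite Pdiv.Ring.ltn_rmodp monic_neq0.
have sE : map_poly polyC s = \sum_(i < D) (s`_i)%:P%:P * 'X ^+ i.
  rewrite -evA_Y; apply: evA_sum; apply: (@leq_trans (size g)); last exact: leq_maxr.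
  by apply: ltnW; rewrite Pdiv.Ring.ltn_rmodp monic_neq0.
exists (fun i j => r`_i * s`_j).
have -> : \sum_(i < D) \sum_(j < D) (r`_i * s`_j)%:P%:P * monA R i j =
    map_poly polyC s * r%:P.
  rewrite rE sE mulr_suml exchange_big; apply: eq_bigr => j _; rewrite mulr_sumr.
  by apply: eq_bigr => i _; rewrite /monA !polyCM polyC_exp; ring.
have eX : 'X^p = Pdiv.Ring.rdivp 'X^p f * f + r by apply: Pdiv.RingMonic.rdivp_eq.
have eY : 'X^q = Pdiv.Ring.rdivp 'X^q g * g + s by apply: Pdiv.RingMonic.rdivp_eq.
have -> : monA R p q = map_poly polyC 'X^q * ('X^p)%:P by rewrite /monA map_polyXn.
rewrite eX eY !rmorphD !rmorphM /= mulrDl !mulrDr addrA addrK.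
by apply: ideal_D => //; [apply: ideal_D => //|]; rewrite ?mulrA; do ?[exact: ideal_M|
  apply: ideal_Mr => //; exact: ideal_M].
Qed.

Lemma lf_span_mon n : lf_ideal n -> exists D, forall p q, exists lam : 'I_D -> 'I_D -> R,
    J (monA R p q - \sum_i \sum_j (lam i j)%:P%:P * monA R i j).
Proof.
move=> lf; have [f mf Jf] := lf_integral 'X%:P lf; have [g mg Jg] := lf_integral 'X lf.
by rewrite evA_X in Jf; rewrite evA_Y in Jg; apply: span_mon mf mg Jf Jg.
Qed.

Definition Lfun (c : ZZ -> R) : laurent R -> R^o := Lext (c : ZZ -> R^o).
HB.instance Definition _ c := GRing.Linear.on (Lfun c).
Lemma LfunE c u : Lfun c u = \sum_(m <- finsupp u) u m * c m. Proof. by []. Qed.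
Lemma Lfun_scale x c u : Lfun (fun m => x * c m) u = x * Lfun c u.
Proof. by rewrite !LfunE mulr_sumr; apply: eq_bigr => m _; rewrite mulrCA. Qed.

(** Coordinates are chosen on monomials and extended linearly. Choosing them for each P separately
    would not give additive functions, since local coordinates are unique only up to torsion. *)
Lemma dual_lin (T : finType) (x : R) (c : T -> ZZ -> R) (b : T -> A) :
  (forall p q : nat, J (x%:P%:P * monA R p q - \sum_k (c k (p%:Z, q%:Z))%:P%:P * b k)) ->
  forall P, J (x%:P%:P * P - \sum_k (Lfun (c k) (toL P))%:P%:P * b k).
Proof.
move=> h P.
have -> : \sum_k (Lfun (c k) (toL P))%:P%:P * b k =
    \sum_(m <- finsupp (toL P)) (toL P m)%:P%:P * \sum_k (c k m)%:P%:P * b k.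
  under [RHS]eq_bigr do rewrite mulr_sumr.
  rewrite exchange_big; apply: eq_bigr => k _; rewrite LfunE /= !raddf_sum /= mulr_suml.
  by apply: eq_bigr => m _; rewrite mulrA -!polyCM.
rewrite {1}(polyA_expand P) mulr_sumr -sumrB big_seq; apply: ideal_sum => // m hm.
rewrite mulrCA -mulrBr; apply: ideal_M => //.
have /andP[] : nonneg m by apply: (@toL_polyL _ P); rewrite -mem_finsupp.
by case: m {hm} => [[p|p] [q|q]] //= _ _; apply: h.
Qed.

(** Linear coordinate functionals for the basis [b], up to the factor d^N. As coordinates are
    determined up to d-power torsion, enlarging N makes a finite list of elements of [J] go to 0
    exactly and makes the duality with [b] exact. *)
Lemma local_dual n d (b : 'I_n -> A) (s : seq A) : lf_ideal n -> local_basis d b ->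
  (forall P, P \in s -> J P) -> exists N (c : 'I_n -> ZZ -> R),
  [/\ forall P, J ((d ^+ N)%:P%:P * P - \sum_k (Lfun (c k) (toL P))%:P%:P * b k),
      forall P k, P \in s -> Lfun (c k) (toL P) = 0 &
      forall i k, Lfun (c k) (toL (b i)) = d ^+ N * (i == k)%:R].
Proof.
move=> lf lb Js; have [D hD] := lf_span_mon lf.
have [N [C hC]] := span_fin (fun t : 'I_D * 'I_D => monA R t.1 t.2) lb.
pose lam p q := sval (cid (hD p q)).
pose c k m := \sum_i \sum_j lam `|m.1|%N `|m.2|%N i j * C (i, j) k.
have hc P : J ((d ^+ N)%:P%:P * P - \sum_k (Lfun (c k) (toL P))%:P%:P * b k).
  apply: dual_lin => p q; rewrite /c !absz_nat /lam; case: cid => /= mu hmu.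
  apply: (eqJ_trans (eqJ_M (d ^+ N)%:P%:P hmu)).
  have -> : \sum_k (\sum_i \sum_j mu i j * C (i, j) k)%:P%:P * b k =
     \sum_i \sum_j (mu i j)%:P%:P * \sum_k (C (i, j) k)%:P%:P * b k.
    transitivity (\sum_k \sum_i \sum_j (mu i j)%:P%:P * ((C (i, j) k)%:P%:P * b k)).
      apply: eq_bigr => k _; rewrite !raddf_sum /= mulr_suml; apply: eq_bigr => i _.
      rewrite !raddf_sum /= mulr_suml; apply: eq_bigr => j _.
      by rewrite !polyCM mulrA.
    rewrite exchange_big; apply: eq_bigr => i _; rewrite exchange_big; apply: eq_bigr => j _.
    by rewrite mulr_sumr.
  rewrite mulr_sumr; apply: eqJ_sum => i _; rewrite mulr_sumr; apply: eqJ_sum => j _.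
  by rewrite mulrCA; apply: eqJ_M; apply: (hC (i, j)).
pose cs := [seq (fun k => Lfun (c k) (toL P) : R) | P <- s].
pose cb := [seq (fun k => Lfun (c k) (toL (b i)) - d ^+ N * (i == k)%:R) | i <- enum 'I_n].
have hs e : List.In e cs -> J (\sum_i (e i)%:P%:P * b i).
  rewrite /cs => {cs cb}; elim: s Js => //= P s IH Js [<-|]; last first.
    by apply: IH => Q Qs; apply: Js; rewrite inE Qs orbT.
  apply: (ideal_subK Ji (Q := (d ^+ N)%:P%:P * P)).
    by rewrite -opprB; apply: ideal_N.
  by apply: ideal_M => //; apply: Js; rewrite mem_head.
have hb e : List.In e cb -> J (\sum_i (e i)%:P%:P * b i).
  rewrite /cb; elim: (enum _) => //= i s' IH [<-|//].
  have := hc (b i); rewrite -opprB => /(ideal_N Ji); rewrite opprK.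
  congr J; under [RHS]eq_bigr do rewrite !polyCB mulrBl.
  rewrite sumrB; congr (_ - _); rewrite (bigD1 i) //= eqxx mulr1 big1 ?addr0 // => k.
  by rewrite eq_sym => /negPf->; rewrite mulr0 !polyC0 mul0r.
have [N1 h1] := kill_fin lb hs; have [N2 h2] := kill_fin lb hb.
pose M := (N1 + N2)%N; exists (M + N)%N, (fun k m => d ^+ M * c k m); split.
- move=> P; under eq_bigr do rewrite Lfun_scale !polyCM -mulrA.
  by rewrite -mulr_sumr exprD !polyCM -mulrA -mulrBr; apply: ideal_M.
- move=> P k Ps; rewrite Lfun_scale /M addnC exprD -mulrA.
  rewrite (h1 (fun k => Lfun (c k) (toL P) : R)) ?mulr0 //.
  by move: Ps {Js hs h1}; rewrite /cs => {cs}; elim: s => //= Q s IH; rewrite inE => /predU1P[->|/IH]; [left|right].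
- move=> i k; rewrite Lfun_scale exprD -mulrA; apply/eqP; rewrite -subr_eq0 -mulrBr; apply/eqP.
  rewrite /M exprD -mulrA (h2 (fun k => Lfun (c k) (toL (b i)) - d ^+ N * (i == k)%:R)) ?mulr0 //.
  rewrite /cb; elim: (enum 'I_n) (mem_enum 'I_n i) => //= i' s' IH; rewrite inE.
  by case/orP => [/eqP->|/IH]; [left|right].
Qed.
End LocallyFree.

Section LocallyFree2.
Variables (R : comNzRingType) (J : {poly {poly R}} -> Prop) (Ji : is_ideal J).
Variables (n : nat) (lf : lf_ideal J n).
Notation A := {poly {poly R}}.

(** R[x,y]/J is finitely generated and projective: this is a dual basis, patched from the local ones
    by a partition of unity. *)
Lemma global_dual : exists (T : finType) (b : T -> A), forall s : seq A,
  (forall P, P \in s -> J P) -> exists c : T -> ZZ -> R,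
  (forall P, J (P - \sum_k (Lfun (c k) (toL P))%:P%:P * b k)) /\
  (forall P k, P \in s -> Lfun (c k) (toL P) = 0).
Proof.
have [l [d [w [b [wd lb]]]]] := lf.
exists ('I_l * 'I_n)%type, (fun t => b t.1 t.2) => s Js.
have /choice[N h] := fun j => local_dual Ji lf (lb j) Js.
have /choice[c hc] := h.
have [v vd] := unity_powers (\max_j N j) wd; set M := (\max_j N j)%N in vd.
pose y j := v j * d j ^+ (M - N j).
exists (fun t m => y t.1 * c t.1 t.2 m); split; last first.
  by move=> P t Ps; rewrite Lfun_scale; have [_ -> // _] := hc t.1; rewrite mulr0.
move=> P.
rewrite -(pair_bigA _ (fun j k => (Lfun (fun m => y j * c j k m) (toL P))%:P%:P * b j k)) /=.
have {1}-> : P = \sum_j (y j)%:P%:P * ((d j ^+ N j)%:P%:P * P).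
  transitivity (\sum_j (v j * d j ^+ M)%:P%:P * P).
    by rewrite -mulr_suml -!rmorph_sum /= vd mul1r.
  apply: eq_bigr => j _; rewrite mulrA -!polyCM -mulrA -exprD subnK //; exact: leq_bigmax.
apply: (eqJ_sum Ji) => j _; under eq_bigr do rewrite Lfun_scale (polyCM (y j)) polyCM -mulrA.
by rewrite -mulr_sumr; apply: (eqJ_M Ji); have [] := hc j.
Qed.

Lemma Lfun_toL_sum (c : ZZ -> R) (I : Type) (s : seq I) (p : pred I) (F : I -> A) :
  Lfun c (toL (\sum_(i <- s | p i) F i)) = \sum_(i <- s | p i) Lfun c (toL (F i)).
Proof. by rewrite (raddf_sum (@toL R)) (raddf_sum (Lfun c)). Qed.
Lemma Lfun_toLZ (c : ZZ -> R) (r : R) (P : A) :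
  Lfun c (toL (r%:P%:P * P)) = r * Lfun c (toL P).
Proof. by rewrite toLZ; exact: (linearZ_LR (Lfun c)). Qed.

Lemma Lfun_mono (c : ZZ -> R) m : Lfun c (mono m) = c m.
Proof. exact: (Lext_mono (c : ZZ -> R^o)). Qed.

Definition gen_by (G : seq A) (P : A) := exists q : nat -> A, P = \sum_(i < size G) q i * G`_i.

Lemma gen_by_ideal G : is_ideal (gen_by G).
Proof.
split; first by exists (fun=> 0); rewrite big1 // => i _; rewrite mul0r.
  move=> P Q [q ->] [q' ->]; exists (fun i => q i + q' i).
  by rewrite -big_split; apply: eq_bigr => i _; rewrite mulrDl.
move=> P Q [q ->]; exists (fun i => P * q i).
by rewrite mulr_sumr; apply: eq_bigr => i _; rewrite mulrA.
Qed.
Lemma gen_by_mem G P : P \in G -> gen_by G P.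
Proof.
move=> PG; exists (fun i => (i == index P G)%:R).
have lt : (index P G < size G)%N by rewrite index_mem.
rewrite (bigD1 (Ordinal lt)) //= eqxx mul1r nth_index // big1 ?addr0 // => i.
by rewrite -val_eqE /= => /negPf->; rewrite mul0r.
Qed.

(** Generators are the monic f(x) and g(y) together with the defects [rho] of finitely many small
    monomials. Modulo f and g an element of [J] becomes some Q in [J] with small exponents; powers
    of [d j] kill the local coordinates of Q, so multiples of [rho j Q] are multiples of Q, and a
    partition of unity recovers Q. *)
Lemma lf_fin_gen : exists G : seq A, (forall P, P \in G -> J P) /\ (forall P, J P -> gen_by G P).
Proof.
have [f mf Jf] := lf_integral Ji 'X%:P lf; have [g mg Jg] := lf_integral Ji 'X lf.
rewrite evA_X in Jf; rewrite evA_Y in Jg.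
have [l [d [w [b [wd lb]]]]] := lf.
have Js P : P \in [::] -> J P by [].
have /choice[N h] := fun j => local_dual Ji lf (lb j) Js.
have /choice[c hc] := h.
pose rho j P := (d j ^+ N j)%:P%:P * P - \sum_k (Lfun (c j k) (toL P))%:P%:P * b j k.
have sp G : f%:P \in G -> map_poly polyC g \in G -> exists D, forall p q,
    exists lam : 'I_D -> 'I_D -> R,
    gen_by G (monA R p q - \sum_i \sum_j (lam i j)%:P%:P * monA R i j).
  by move=> h1 h2; apply: (span_mon (gen_by_ideal G) mf mg); apply: gen_by_mem.
pose G0 := [:: f%:P; map_poly polyC g].
have f0 : f%:P \in G0 by rewrite mem_head.
have g0 : map_poly polyC g \in G0 by rewrite !inE eqxx orbT.
have [D hD] := sp G0 f0 g0.
pose rs := map (fun t : 'I_l * ('I_D * 'I_D) => rho t.1 (monA R t.2.1 t.2.2)) (enum {: 'I_l * ('I_D * 'I_D)}).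
pose G := [:: f%:P, map_poly polyC g & rs].
have Gr j (i k : 'I_D) : gen_by G (rho j (monA R i k)).
  apply: gen_by_mem; rewrite !inE; apply/orP; right; apply/orP; right.
  by apply/mapP; exists (j, (i, k)); rewrite ?mem_enum.
have GJ P : P \in G -> J P.
  rewrite !inE => /orP[/eqP-> //|/orP[/eqP-> //|/mapP[[j [i k]] _ ->]]].
  by rewrite /rho /=; have [] := hc j.
have GiJ P : gen_by G P -> J P.
  case=> q ->; apply: ideal_sum => // i _; apply: ideal_M => //; apply: GJ.
  exact: mem_nth.
exists G; split=> // P JP.
have Gi := gen_by_ideal G.
have hD' p q : exists lam : 'I_D -> 'I_D -> R,
    gen_by G (monA R p q - \sum_i \sum_j (lam i j)%:P%:P * monA R i j).
  have [lam hl] := hD p q; exists lam.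
  have [q' ->] := hl; apply: ideal_sum => // i _; apply: ideal_M => //; apply: gen_by_mem.
  by case: i => [[|[|i]] hi] //=; rewrite !inE eqxx ?orbT.
pose lam p q := sval (cid (hD' p q)).
pose L i j := \sum_(m <- finsupp (toL P)) toL P m * lam `|m.1|%N `|m.2|%N i j.
pose Q := \sum_i \sum_j (L i j)%:P%:P * monA R i j.
have PQ : gen_by G (P - Q).
  have -> : Q = \sum_(m <- finsupp (toL P)) (toL P m)%:P%:P *
     \sum_i \sum_j (lam `|m.1|%N `|m.2|%N i j)%:P%:P * monA R i j.
    under [RHS]eq_bigr do rewrite mulr_sumr.
    rewrite exchange_big; apply: eq_bigr => i _.
    under [RHS]eq_bigr do rewrite mulr_sumr.
    rewrite exchange_big; apply: eq_bigr => j _.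
    rewrite /L !raddf_sum /= mulr_suml; apply: eq_bigr => m _.
    by rewrite mulrA !polyCM.
  rewrite {1}(polyA_expand P); apply: (eqJ_sum Gi) => m _; apply: (eqJ_M Gi).
  by rewrite /lam; case: cid.
apply: (ideal_subK Gi PQ).
have JQ : J Q by rewrite -[Q](subKr P); apply: ideal_B => //; apply: GiJ.
have GrQ j : gen_by G (rho j Q).
  have -> : rho j Q = \sum_i \sum_k (L i k)%:P%:P * rho j (monA R i k).
    rewrite /rho {1}/Q mulr_sumr.
    under [RHS]eq_bigr do rewrite (eq_bigr _ (fun _ _ => mulrBr _ _ _)) sumrB.
    rewrite sumrB; congr (_ - _).
      apply: eq_bigr => i _; rewrite mulr_sumr; apply: eq_bigr => k _.
      by rewrite mulrCA.
    under [RHS]eq_bigr => i _ do (under eq_bigr do rewrite mulr_sumr; rewrite exchange_big).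
    rewrite exchange_big; apply: eq_bigr => t _ /=.
    rewrite /Q Lfun_toL_sum !raddf_sum /= mulr_suml; apply: eq_bigr => i _.
    rewrite Lfun_toL_sum !raddf_sum /= mulr_suml; apply: eq_bigr => k _.
    by rewrite Lfun_toLZ !polyCM mulrA.
  by apply: ideal_sum => // i _; apply: ideal_sum => // k _; apply: ideal_M.
clearbody Q => {PQ}.
have /choice[N' hN'] : forall j, exists N', forall k, d j ^+ N' * Lfun (c j k) (toL Q) = 0.
  move=> j; apply: (proj2 (lb j)) => /=.
  apply: (ideal_subK Ji (Q := (d j ^+ N j)%:P%:P * Q)); last exact: ideal_M.
  by rewrite -opprB; apply: ideal_N => //; have [] := hc j.
have [v vd] := unity_powers (\max_j (N' j + N j)) wd; set M := (\max_j _)%N in vd.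
have -> : Q = \sum_j (v j * d j ^+ (M - (N' j + N j)) * d j ^+ N' j)%:P%:P * rho j Q.
  transitivity (\sum_j (v j * d j ^+ M)%:P%:P * Q).
    by rewrite -mulr_suml -!rmorph_sum /= vd mul1r.
  apply: eq_bigr => j _; rewrite /rho mulrBr (_ : _ * \sum_k _ = 0) ?subr0; last first.
    rewrite [LHS]mulr_sumr big1 // => k _.
    by rewrite mulrA -2!polyCM -(mulrA (_ * _) (_ ^+ _)) hN' mulr0 !polyC0 mul0r.
  rewrite mulrA -!polyCM -!mulrA -!exprD; congr (_%:P%:P * _); congr (_ * _ ^+ _).
  by rewrite subnK //; apply: (@leq_bigmax _ (fun j => (N' j + N j)%N)).
by apply: ideal_sum => // j _; apply: ideal_M.
Qed.

End LocallyFree2.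

(** * Base change of ideals *)

Section BaseChange.
Variables (R R' : comNzRingType) (g : {rmorphism R -> R'}).
Variables (J : {poly {poly R}} -> Prop) (Ji : is_ideal J).
Notation A := {poly {poly R}}.
Notation A' := {poly {poly R'}}.

Definition map2 : A -> A' := map_poly (map_poly g).
HB.instance Definition _ := GRing.RMorphism.on map2.

Definition Jmap (Q : A') : Prop := exists (l : nat) (P : 'I_l -> A) (c : 'I_l -> A'),
  (forall i, J (P i)) /\ Q = \sum_i c i * map2 (P i).

Lemma Jmap_in P : J P -> Jmap (map2 P).
Proof. by move=> h; exists 1%N, (fun=> P), (fun=> 1); rewrite big_ord1 mul1r. Qed.

Lemma Jmap_ideal : is_ideal Jmap.
Proof.
split.
- by exists 0%N, (fun=> 0), (fun=> 0); split=> [[]//|]; rewrite big_ord0.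
- move=> _ _ [l [P [c [h ->]]]] [l' [P' [c' [h' ->]]]].
  exists (l + l')%N, (fun i => match split i with inl j => P j | inr j => P' j end),
    (fun i => match split i with inl j => c j | inr j => c' j end); split.
    by move=> i; case: (split i).
  rewrite big_split_ord; congr (_ + _); apply: eq_bigr => i _.
    by rewrite (unsplitK (inl i)).
  by rewrite (unsplitK (inr i)).
- move=> Q _ [l [P [c [h ->]]]]; exists l, P, (fun i => Q * c i); split=> //.
  by rewrite mulr_sumr; apply: eq_bigr => i _; rewrite mulrA.
Qed.

Lemma map2_mon p q : map2 (monA R p q) = monA R' p q.
Proof. by rewrite rmorphM rmorphXn /= /map2 map_polyX map_polyC /= rmorphXn /= map_polyX. Qed.
Lemma map2C r : map2 r%:P%:P = (g r)%:P%:P.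
Proof. by rewrite /map2 map_polyC /= map_polyC. Qed.

Lemma Jmap_span Q : Jmap Q -> exists s : seq (R' * A),
  (forall t, t \in s -> J t.2) /\ Q = \sum_(t <- s) t.1%:P%:P * map2 t.2.
Proof.
case=> l [P [c [hP ->]]].
elim/big_ind: _ => [|x y [s [hs ->]] [s' [hs' ->]]|i _].
- by exists [::]; rewrite big_nil.
- exists (s ++ s'); rewrite big_cat; split=> // t.
  by rewrite mem_cat => /orP[/hs|/hs'].
exists [seq (toL (c i) m, monA R `|m.1| `|m.2| * P i) | m <- finsupp (toL (c i))]; split.
  by move=> t /mapP[m _ ->]; apply: ideal_M.
rewrite big_map {1}(polyA_expand (c i)) mulr_suml; apply: eq_bigr => m _.
by rewrite /= rmorphM /= map2_mon -mulrA.
Qed.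

Lemma Lfun_map (c : ZZ -> R) (u : laurent R) : Lfun (fun m => g (c m)) (Lmap g u) = g (Lfun c u).
Proof.
rewrite {1}(laur_expand u) raddf_sum /= (raddf_sum (Lfun _)) LfunE rmorph_sum; apply: eq_bigr => m _.
by rewrite /= LmapZ Lmap_mono (linearZ_LR (Lfun _)) rmorphM; congr (_ * _); apply: Lext_mono.
Qed.

Lemma Lfun_Jmap (c : ZZ -> R) (s : seq (R' * A)) :
  (forall t, t \in s -> Lfun c (toL t.2) = 0) ->
  Lfun (fun m => g (c m)) (toL (\sum_(t <- s) t.1%:P%:P * map2 t.2)) = 0.
Proof.
move=> h; rewrite Lfun_toL_sum big_seq big1 // => t ts.
by rewrite Lfun_toLZ toL_map Lfun_map h // rmorph0 mulr0.
Qed.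

(** Independence: a relation over R' lies in the span of the images of finitely many elements of
    [J]. Dual functionals that kill these elements, base changed to R', read off the coefficients of
    the relation. *)
Lemma local_basis_map n d (b : 'I_n -> A) : lf_ideal J n -> local_basis J d b ->
  local_basis Jmap (g d) (fun i => map2 (b i)).
Proof.
move=> lf lb; split.
  move=> P; have [N [c [hc _ _]]] := local_dual (s := [::]) Ji lf lb (fun _ h => False_ind _ (elimF idP (erefl false) h)).
  exists N, (fun k => Lfun (fun m => g (c k m)) (toL P)).
  rewrite -rmorphXn; apply: (dual_lin Jmap_ideal) => p q.
  have := Jmap_in (hc (monA R p q)).
  rewrite rmorphB rmorphM /= map2C map2_mon rmorph_sum /=; congr (Jmap (_ - _)).
  apply: eq_bigr => k _; rewrite rmorphM /= map2C; congr ((g _)%:P%:P * _).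
  by rewrite toL_mon Lfun_mono.
move=> e /Jmap_span[s [hs eQ]].
have hs' P : P \in [seq t.2 | t <- s] -> J P by case/mapP => t /hs ? ->.
have [N [c [_ hc0 hcb]]] := local_dual Ji lf lb hs'.
exists N => k; have := Lfun_Jmap (c := c k) (s := s) _.
rewrite -eQ Lfun_toL_sum (bigD1 k) //= Lfun_toLZ toL_map Lfun_map hcb eqxx mulr1.
rewrite big1 => [|i /negPf ik]; last first.
  by rewrite Lfun_toLZ toL_map Lfun_map hcb ik mulr0 rmorph0 mulr0.
rewrite addr0 -rmorphXn mulrC => -> // t ts; apply: hc0; exact: map_f.
Qed.

Lemma lf_map n : lf_ideal J n -> lf_ideal Jmap n.
Proof.
move=> lf; have [l [d [w [b [wd lb]]]]] := lf.
exists l, (g \o d), (g \o w), (fun j i => map2 (b j i)); split.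
  by rewrite -(rmorph1 g) -wd rmorph_sum; apply: eq_bigr => j _; rewrite rmorphM.
by move=> j; apply: (local_basis_map lf (lb j)).
Qed.
End BaseChange.

#[global] Opaque Lfun toL toLx fromL map2.

Section ToLMorph.
Variable R : comNzRingType.
Implicit Types P Q : {poly {poly R}}.
Lemma toLB P Q : toL (P - Q) = toL P - toL Q. Proof. exact: raddfB. Qed.
Lemma toLD P Q : toL (P + Q) = toL P + toL Q. Proof. exact: rmorphD. Qed.
Lemma toLM P Q : toL (P * Q) = toL P * toL Q. Proof. exact: rmorphM. Qed.
Lemma toL0 : toL (0 : {poly {poly R}}) = 0. Proof. exact: rmorph0. Qed.
Lemma toL1 : toL (1 : {poly {poly R}}) = 1. Proof. exact: rmorph1. Qed.
End ToLMorph.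

(** * Subsheaves of a free sheaf *)

Definition sub_closed (R : comNzRingType) (V : lmodType R) (D : V -> Prop) :=
  D 0 /\ forall (r : R) x y, D x -> D y -> D (r *: x + y).

Definition submod (R : comNzRingType) (V : lmodType R) (D : V -> Prop)
  (h : sub_closed D) : Type := {x : V | D x}.

Section Submod.
Variables (R : comNzRingType) (V : lmodType R) (D : V -> Prop) (h : sub_closed D).
Local Notation W := (submod h).
Implicit Types (s t : W).

HB.instance Definition _ := gen_eqMixin W.
HB.instance Definition _ := gen_choiceMixin W.

Lemma submodP s t : sval s = sval t -> s = t.
Proof.
by case: s t => [x px] [y py] /= e; rewrite e in px *; congr exist; apply: Prop_irrelevance.
Qed.
Fact submod_add s t : D (sval s + sval t).
Proof. by rewrite -[sval s]scale1r; apply: (proj2 h); [case: s|case: t]. Qed.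
Fact submod_opp s : D (- sval s).
Proof. by rewrite -[- _]addr0 -scaleN1r; apply: (proj2 h); [case: s|case: h]. Qed.
Fact submod_scale (r : R) s : D (r *: sval s).
Proof. by rewrite -[_ *: _]addr0; apply: (proj2 h); [case: s|case: h]. Qed.
Definition sm0 : W := exist D 0 (proj1 h).
Definition smD s t : W := exist D _ (submod_add s t).
Definition smN s : W := exist D _ (submod_opp s).
Definition smZ r s : W := exist D _ (submod_scale r s).
Fact smA : associative smD. Proof. by move=> x y z; apply: submodP; rewrite /= addrA. Qed.
Fact smC : commutative smD. Proof. by move=> x y; apply: submodP; rewrite /= addrC. Qed.
Fact sm0D : left_id sm0 smD. Proof. by move=> x; apply: submodP; rewrite /= add0r. Qed.
Fact smND : left_inverse sm0 smN smD. Proof. by move=> x; apply: submodP; rewrite /= addNr. Qed.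
HB.instance Definition _ := GRing.isZmodule.Build W smA smC sm0D smND.
Fact smZA a b s : smZ a (smZ b s) = smZ (a * b) s.
Proof. by apply: submodP; rewrite /= scalerA. Qed.
Fact smZ1 : left_id 1 smZ. Proof. by move=> x; apply: submodP; rewrite /= scale1r. Qed.
Fact smZDr : right_distributive smZ +%R.
Proof. by move=> r x y; apply: submodP; rewrite /= scalerDr. Qed.
Fact smZDl s : {morph smZ^~ s : a b / a + b}.
Proof. by move=> a b; apply: submodP; rewrite /= scalerDl. Qed.
HB.instance Definition _ := GRing.Zmodule_isLmodule.Build R W smZA smZ1 smZDr smZDl.

(** Sending vectors outside [D] to 0 keeps the sheaf operations total, also for monomials that are
    not regular on the chart. *)
Definition tosub (x : V) : W := if pselect (D x) is left p then exist D x p else 0.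
Lemma tosubK x : D x -> sval (tosub x) = x.
Proof. by rewrite /tosub; case: pselect. Qed.
End Submod.

Section Subsheaf.
Variables (R : comNzRingType) (r : nat) (D : chart -> ('I_r -> laurent R) -> Prop).

Record sheaf_cond : Prop := {
  sc0 : forall I, D I (fun=> 0);
  scL : forall I (x : R) s t, D I s -> D I t -> D I (fun k => x *: s k + t k);
  scM : forall I m s, regular (sval I) m -> D I s -> D I (fun k => mono m * s k);
  scR : forall I J s, csub I J -> D I s -> D J s;
  scF : forall I J t, csub I J -> D J t -> exists m,
    [/\ regular (sval I) m, regular (sval J) (- m) & D I (fun k => mono m * t k)] }.

Hypothesis h : sheaf_cond.

Notation V := {ffun 'I_r -> laurent R}.
Definition ssD I (x : V) := D I x.
Fact ssD_closed I : sub_closed (ssD I).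
Proof.
split; rewrite /ssD.
  rewrite (_ : (0 : V) = (fun=> 0) :> (_ -> _)); first exact: (sc0 h).
  by apply: funext => k; rewrite ffunE.
move=> x s t hs ht; rewrite (_ : (x *: s + t : V) = (fun k => x *: s k + t k) :> (_ -> _)).
  exact: (scL h).
by apply: funext => k; rewrite !ffunE.
Qed.
Definition ssec I : lmodType R := submod (ssD_closed I).
Definition smk I (c : 'I_r -> laurent R) : ssec I := tosub (ssD_closed I) [ffun k => c k].
Definition sio I (s : ssec I) : 'I_r -> laurent R := sval s.
Lemma smkK I c : D I c -> sio (smk I c) = c.
Proof.
move=> hc; have e : ([ffun k => c k] : V) = c :> (_ -> _) by apply: funext => k; rewrite ffunE.
by rewrite /sio /smk tosubK // /ssD e.
Qed.
Lemma sioP I (s : ssec I) : D I (sio s). Proof. by case: s. Qed.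
Lemma sio_inj I (s t : ssec I) : sio s = sio t -> s = t.
Proof. by move=> e; apply: submodP; apply/ffunP => k; rewrite -!/(sio _ k) e. Qed.
Definition smon I (m : ZZ) (s : ssec I) : ssec I := smk I (fun k => mono m * sio s k).
Definition sres I J (s : ssec I) : ssec J := smk J (sio s).

Lemma sio_lin I x (s t : ssec I) : sio (x *: s + t) = (fun k => x *: sio s k + sio t k).
Proof. by apply: funext => k; rewrite /sio /= !ffunE. Qed.
Lemma sio_mon I m (s : ssec I) : regular (sval I) m ->
  sio (smon m s) = (fun k => mono m * sio s k).
Proof. by move=> hm; rewrite smkK //; apply: (scM h) => //; apply: sioP. Qed.
Lemma sio_res I J (s : ssec I) : csub I J -> sio (sres J s) = sio s.
Proof. by move=> hI; rewrite smkK //; apply: (scR h) hI _; apply: sioP. Qed.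
Lemma sio0 I : sio (0 : ssec I) = fun=> 0.
Proof. by apply: funext => k; rewrite /sio /= ffunE. Qed.

Definition subsheaf : qcoh R.
Proof.
refine (@Qcoh R ssec smon sres _ _ _ _ _ _ _ _ _).
- move=> I m hm x s t; apply: sio_inj; rewrite sio_mon // !sio_lin !sio_mon //.
  by apply: funext => k; rewrite mulrDr scalerAr.
- move=> I s; apply: sio_inj; rewrite sio_mon; last exact: regular0.
  by apply: funext => k; rewrite mono0 mul1r.
- move=> I m m' s hm hm'; apply: sio_inj; rewrite !sio_mon //; last exact: regularD.
  by apply: funext => k; rewrite monoD mulrA.
- by move=> I J hI x s t; apply: sio_inj; rewrite sio_lin !sio_res // sio_lin.
- by move=> I s; apply: sio_inj; rewrite sio_res // /csub.
- move=> I J H IJ JH s; apply: sio_inj; rewrite !sio_res //.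
  exact: subset_trans IJ JH.
- move=> I J hI m hm s; have hm' : regular (sval J) m by apply: regularS hm.
  by apply: sio_inj; rewrite sio_res // !sio_mon // sio_res.
(* Restriction is injective here, so the trivial monomial already works. *)
- move=> I J hI s e; exists 0; split; [exact: regular0|rewrite oppr0; exact: regular0|].
  apply: sio_inj; have := congr1 (@sio J) e; rewrite sio_res // !sio0 sio_mon; last exact: regular0.
  by move=> e'; apply: funext => k; rewrite (congr1 (fun f => f k) e') mulr0.
- move=> I J hI t; have [m [h1 h2 h3]] := scF h hI (sioP t).
  exists m, (smk I (fun k => mono m * sio t k)); split=> //.
  apply: sio_inj; rewrite sio_mon ?sio_res ?smkK //.
  exact: regularS h1.
Defined.

Lemma subsheaf_is : is_subsheaf (S := subsheaf) D sio.
Proof.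
split.
- by move=> I x s t k m; rewrite [sio _]sio_lin lcoefD lcoefZ.
- by move=> I m hm s k m'; rewrite [sio _]sio_mon // lcoef_mono.
- by move=> I J hI s; rewrite [sio _]sio_res.
- by move=> I s t; apply: sio_inj.
- by move=> I c; split=> [hc|[s <-]]; [exists (smk I c); rewrite smkK|apply: sioP].
Qed.
End Subsheaf.

Section SubsheafTheory.
Variables (R : comNzRingType) (r : nat) (S : qcoh R) (D : chart -> ('I_r -> laurent R) -> Prop).
Variables (io : forall I, sec S I -> 'I_r -> laurent R) (H : is_subsheaf D io).
Implicit Types (I J : chart).

Lemma io_lin I x (s t : sec S I) k : io (x *: s + t) k = x *: io s k + io t k.
Proof. by case: H => h _ _ _ _; apply: laurP => m; rewrite h lcoefD lcoefZ. Qed.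
Lemma io_mon I m (s : sec S I) k : regular (sval I) m -> io (mon S m s) k = mono m * io s k.
Proof. by case: H => _ h _ _ _ hm; apply: laurP => m'; rewrite h // lcoef_mono. Qed.
Lemma io_res I J (s : sec S I) : csub I J -> io (res S J s) = io s.
Proof. by case: H => _ _ h _ _ hm; apply: h. Qed.
Lemma io_inj I (s t : sec S I) : (forall k, io s k = io t k) -> s = t.
Proof. by case: H => _ _ _ h _ e; apply: h; apply: funext. Qed.
Lemma io_D I (s : sec S I) : D I (io s).
Proof. by case: H => _ _ _ _ h; apply/h; exists s. Qed.
Lemma io_ex I c : D I c -> exists s : sec S I, io s = c.
Proof. by case: H => _ _ _ _ h /h. Qed.
Lemma io_0 I k : io (0 : sec S I) k = 0.
Proof.
have := io_lin 1 (0 : sec S I) 0 k; rewrite scaler0 addr0 scale1r => /eqP.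
by rewrite -{1}[io 0 k]addr0 (inj_eq (addrI _)) eq_sym => /eqP.
Qed.
Lemma io_add I (s t : sec S I) k : io (s + t) k = io s k + io t k.
Proof. by rewrite -[s]scale1r io_lin !scale1r. Qed.
Lemma io_scale I x (s : sec S I) k : io (x *: s) k = x *: io s k.
Proof. by rewrite -[x *: s]addr0 io_lin io_0 addr0. Qed.
Lemma io_sub I (s t : sec S I) k : io (s - t) k = io s k - io t k.
Proof. by rewrite -scaleN1r io_add io_scale scaleN1r. Qed.
Lemma io_sum I (T : Type) (l : seq T) (p : pred T) (F : T -> sec S I) k :
  io (\sum_(i <- l | p i) F i) k = \sum_(i <- l | p i) io (F i) k.
Proof. by elim/big_rec2: _ => [|i y x _ <-]; rewrite ?io_0 ?io_add. Qed.
Lemma io_act I c (s : sec S I) k : in_O I c -> io (act c s) k = c * io s k.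
Proof.
move=> hc; rewrite mulL_sum io_sum big_seq [RHS]big_seq; apply: eq_bigr => m.
by rewrite mem_finsupp => /hc hm; rewrite io_scale io_mon.
Qed.
End SubsheafTheory.

(** * Explicit deformations *)

(** Clearing denominators works for all large exponents; in this form several bounds are met by a
    single exponent. *)
Definition evt (p : nat -> Prop) := exists n0, forall k, (n0 <= k)%N -> p k.
Lemma evt_and p q : evt p -> evt q -> evt (fun k => p k /\ q k).
Proof.
move=> [a ha] [b hb]; exists (maxn a b) => k; rewrite geq_max => /andP[h1 h2].
by split; [apply: ha|apply: hb].
Qed.
Lemma evt_ex p : evt p -> exists k, p k.
Proof. by case=> n h; exists n; apply: h. Qed.
Lemma evt_seq (T : eqType) (s : seq T) (p : T -> nat -> Prop) :
  (forall t, t \in s -> evt (p t)) -> evt (fun k => forall t, t \in s -> p t k).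
Proof.
elim: s => [|t s IH] h; first by exists 0%N.
have [a ha] := evt_and (h t (mem_head _ _)) (IH (fun u us => h u (mem_behead (us : u \in behead (t :: s))))).
exists a => k /ha[h1 h2] u; rewrite inE => /predU1P[->//|]; exact: h2.
Qed.
Lemma evt_fin (T : finType) (p : T -> nat -> Prop) :
  (forall t, evt (p t)) -> evt (fun k => forall t, p t k).
Proof.
move=> h; have [a ha] := @evt_seq _ (enum T) p (fun t _ => h t).
by exists a => k /ha hk t; apply: hk; rewrite mem_enum.
Qed.

Lemma ord2 (k : 'I_2) : k = k0 \/ k = k1.
Proof. by case: k => [[|[|]] ?] //; [left|right]; apply: val_inj. Qed.
Lemma sum2 (V : nmodType) (F : 'I_2 -> V) : \sum_k F k = F k0 + F k1.
Proof. by rewrite big_ord_recl big_ord1; congr (_ + F _); apply: val_inj. Qed.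

(* The monomial [\prod_(i in B :\: A) (x_i / x_j)^k] for one [j] in A. *)
Definition frm (A B : {set 'I_3}) (k : nat) : ZZ :=
  let b i := (i \in B) && (i \notin A) in
  let s := (b o0 + b o1 + b o2)%N in
  (if b o1 then k%:Z else if (o0 \notin A) && (o1 \in A) then - (k * s)%:Z else 0,
   if b o2 then k%:Z else if (o0 \notin A) && (o1 \notin A) then - (k * s)%:Z else 0).

Section Frm.
Variables (A B : {set 'I_3}) (A0 : A != set0) (AB : A \subset B).
Lemma frm_regA k : regular A (frm A B k).
Proof.
have := nonempty3 A0; have /subsetP h := AB; have := h o0; have := h o1; have := h o2.
rewrite regularE /frm /=.
case: (o0 \in A); case: (o1 \in A); case: (o2 \in A); case: (o0 \in B); case: (o1 \in B);
 case: (o2 \in B) => //= ha hb hc hd; try (by have := ha isT); try (by have := hb isT);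
 try (by have := hc isT); lia.
Qed.
Lemma frm_regB k : regular B (- frm A B k).
Proof.
have := nonempty3 A0; have /subsetP h := AB; have := h o0; have := h o1; have := h o2.
rewrite regularE /frm /=.
case: (o0 \in A); case: (o1 \in A); case: (o2 \in A); case: (o0 \in B); case: (o1 \in B);
 case: (o2 \in B) => //= ha hb hc hd; try (by have := ha isT); try (by have := hb isT);
 try (by have := hc isT); lia.
Qed.
Lemma frm_up (R : comNzRingType) (c : laurent R) :
  inOs B c -> evt (fun k => inOs A (mono (frm A B k) * c)).
Proof.
move=> hc; have [K hK] := supp_bound c; exists (2 * K)%N => k hk m; rewrite lcoef_mono => hm.
have := hK _ hm; have {hm} := hc _ hm.
have := nonempty3 A0; have /subsetP h := AB; have := h o0; have := h o1; have := h o2.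
rewrite !regularE /frm /=.
case: (o0 \in A); case: (o1 \in A); case: (o2 \in A); case: (o0 \in B); case: (o1 \in B);
 case: (o2 \in B) => //= ha hb hc' hd; try (by have := ha isT); try (by have := hb isT);
 try (by have := hc' isT); lia.
Qed.
Lemma frm_J (R : comNzRingType) (J : {poly {poly R}} -> Prop) (c : laurent R) : is_ideal J ->
  Jloc J B c -> evt (fun k => Jloc J A (mono (frm A B k) * c)).
Proof.
move=> Ji [l [Q [JQ e]]]; exists l => k hk.
(* The exponent in the denominator of [frm A B k] is k times the number of elements of B outside A,
   so at most 3 k. *)
set k' := (l + 3 * k)%N.
have hn : nonneg (mu A k' - mu B l + frm A B k).
  have := nonempty3 A0; have /subsetP h := AB; have := h o0; have := h o1; have := h o2.
  rewrite /k' /nonneg /mu /frm /=.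
  case: (o0 \in A); case: (o1 \in A); case: (o2 \in A); case: (o0 \in B); case: (o1 \in B);
   case: (o2 \in B) => //= ha hb hc' hd; try (by have := ha isT); try (by have := hb isT);
   try (by have := hc' isT); lia.
have hp : polyL (mono (mu A k' - mu B l + frm A B k) : laurent R).
  by move=> m'; rewrite monoE; have [->|] := eqVneq m' (mu A k' - mu B l + frm A B k); rewrite ?eqxx.
exists k', (fromL (mono (mu A k' - mu B l + frm A B k)) * Q); split; first exact: ideal_M.
by rewrite rmorphM /= fromLK // e !mulrA -!monoD; congr (mono _ * _); rewrite addrAC subrK.
Qed.
End Frm.

Section Explicit.
Variables (R : comNzRingType) (P : {poly {poly R}}) (J : {poly {poly R}} -> Prop).
Hypothesis Ji : is_ideal J.
Implicit Types (I : chart).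

(* The extension of O by the ideal sheaf of J inside O^2 whose class is P mod J. *)
Definition Dexp I (c : 'I_2 -> laurent R) : Prop :=
  [/\ in_O I (c k0), in_O I (c k1) & Jloc J (sval I) (c k1 - toL P * c k0)].

Lemma chart_neq0 I : sval I != set0. Proof. by case: I. Qed.

Lemma Dexp_inO I c k : Dexp I c -> in_O I (c k).
Proof. by case=> h h' _; case: (ord2 k) => ->. Qed.

Lemma Dexp_cond : sheaf_cond Dexp.
Proof.
split.
- by move=> I; split; try exact: inOs0; rewrite mulr0 subr0; apply: Jloc0.
- move=> I x s t [a b c] [a' b' c']; split; try by apply: inOsD => //; apply: inOsZ.
  rewrite mulrDr opprD addrACA -scalerAr -scalerBr; apply: JlocD; [exact: Ji|exact: JlocZ|exact: c'].
- move=> I m s hm [a b c]; split; try by apply: inOsM => //; apply: inOs_mono.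
  rewrite mulrCA -mulrBr; apply: JlocM => //; apply: inOs_mono.
  by apply: regularS hm; apply: subsetUr.
- move=> I J' s hI [a b c]; split; [exact: inOsS hI a|exact: inOsS hI b|exact: JlocS hI c].
- move=> I J' t hI [a b c].
  have I0 := chart_neq0 I.
  have [k [ha [hb hc]]] := evt_ex (evt_and (frm_up I0 hI a) (evt_and (frm_up I0 hI b) (frm_J I0 hI Ji c))).
  exists (frm (sval I) (sval J') k); split; [exact: frm_regA|exact: frm_regB|].
  by split; [exact: ha|exact: hb|rewrite mulrCA -mulrBr].
Qed.

Lemma Dexp_O I c u : in_O I u -> Dexp I c -> Dexp I (fun k => u * c k).
Proof.
move=> hu [a b h]; split; try exact: inOsM.
by rewrite mulrCA -mulrBr; apply: JlocM => //; apply: inOsS hu; apply: subsetUr.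
Qed.
End Explicit.

Lemma Dexp_eqP (R : comNzRingType) (P P' : {poly {poly R}}) J I c : is_ideal J -> J (P - P') ->
  Dexp P J I c -> Dexp P' J I c.
Proof.
move=> Ji h [a b hc]; split; [exact: a|exact: b|].
have -> : c k1 - toL P' * c k0 = (c k1 - toL P * c k0) + c k0 * toL (P - P').
  by rewrite toLB; move: (c k0) (c k1) (toL P) (toL P') => x y u v; ring.
apply: JlocD; [exact: Ji|exact: hc|apply: JlocM; [exact: Ji| |exact: Jloc_toL]].
by apply: inOsS a; apply: subsetUr.
Qed.

(** * Functions and ideals near the line at infinity *)

Section AtInf.
Variable R : comNzRingType.
Implicit Types (c d : laurent R) (A : {set 'I_3}).

(* For c regular along L_oo: c vanishes on L_oo. *)
Definition atinf0 c := forall m, expo m ord0 = 0 -> c m = 0.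

Lemma atinf0_z A c : A != set0 -> o0 \notin A -> inOs A c -> atinf0 c ->
  exists2 d, inOs A d & c = mono (zinf A) * d.
Proof.
move=> A0 h0 hc ha; exists (mono (- zinf A) * c); last by rewrite mulrA monoVK mul1r.
move=> m; rewrite lcoef_mono opprK => h.
rewrite -[m](addrK (zinf A)); have hr := hc _ h; apply: zinf_div => //.
rewrite lt_def; apply/andP; split; first by apply: contraNneq h => /ha ->.
have /forallP/(_ ord0) := hr; rewrite h0 //=.
Qed.
Lemma z_atinf0 A m d : o0 \notin A -> 0 < expo m ord0 -> inOs A d -> atinf0 (mono m * d).
Proof.
move=> h0 hm hd m' e; rewrite lcoef_mono; apply/eqP; apply: contraTT isT => /hd.
by move/forallP/(_ ord0); rewrite h0 /= expoD expoN e add0r oppr_ge0 leNgt hm.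
Qed.
Lemma atinf0M A c d : A != set0 -> o0 \notin A -> inOs A c -> inOs A d -> atinf0 d -> atinf0 (c * d).
Proof.
move=> A0 h0 hc hd /(atinf0_z A0 h0 hd)[d' hd' ->]; rewrite mulrCA.
by apply: z_atinf0 h0 _ (inOsM hc hd'); rewrite zinf_expo.
Qed.

(** The coordinate xi = 1/z satisfies a monic relation f(xi) in [J]. Multiplied by z^N it becomes 1
    plus a multiple of z, so near L_oo the ideal contains a function that is 1 on L_oo. *)
Lemma near_inf (J : {poly {poly R}} -> Prop) n A : is_ideal J -> lf_ideal J n ->
  A != set0 -> o0 \notin A ->
  exists2 w, inOs A w & Jloc J A (1 + mono (zinf A) * w).
Proof.
move=> Ji lf A0 h0; set z := zinf A.
have [xi exi] : exists xi : {poly {poly R}}, toL xi = mono (- z).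
  rewrite /z /zinf; case: ifP => _; [exists 'X%:P; rewrite toLX|exists 'X; rewrite toLY];
  by congr mono; apply/eqP; rewrite -[_ == _]/((_ == _) && (_ == _)) /= oppr0.
have [f mf Jf] := lf_integral Ji xi lf.
pose N := (size f).-1.
have sf : size f = N.+1 by rewrite prednK // lt0n size_poly_eq0 monic_neq0.
exists (\sum_(i < N) f`_i *: mono (z *+ (N.-1 - i))).
  by apply: inOs_sum => i _; apply: inOsZ; rewrite -monoX; apply/inOsX/inOs_mono/zinf_reg.
have -> : 1 + mono z * (\sum_(i < N) f`_i *: mono (z *+ (N.-1 - i))) = mono (z *+ N) * toL (evA xi f).
  rewrite (@evA_sum _ _ _ N.+1) ?sf // (rmorph_sum (@toL R)) /= [RHS]mulr_sumr [RHS]big_ord_recr /= addrC; congr (_ + _); last first.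
    rewrite mulr_sumr; apply: eq_bigr => i _.
    rewrite toLZ rmorphXn /= exi monoX -!scalerAr -!monoD; congr (_ *: mono _).
    rewrite mulNrn -mulrS -[X in z *+ X - _](subnK (ltnW (ltn_ord i))) mulrnDr addrK; congr (_ *+ _).
    by case: N i {sf} => [[]//|N i] /=; rewrite subSn // -ltnS.
  rewrite toLZ rmorphXn /= exi monoX -scalerAr -monoD mulNrn subrr mono0.
  by have /monicP := mf; rewrite /lead_coef sf /= => ->; rewrite scale1r.
apply: JlocM => //; last exact: Jloc_toL.
rewrite -monoX; apply/inOsX/inOs_mono; apply: (regularS (subsetUr _ _)); exact: zinf_reg.
Qed.

(* The closed set {J = 0} does not meet L_oo, so P can be replaced modulo J by a
   function u that vanishes on L_oo. *)
Lemma near_lift (J : {poly {poly R}} -> Prop) n A (P : {poly {poly R}}) :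
  is_ideal J -> lf_ideal J n -> A != set0 -> o0 \notin A ->
  exists u, [/\ inOs A u, atinf0 u & Jloc J A (toL P - u)].
Proof.
move=> Ji lf A0 h0; have [w hw Jw] := near_inf Ji lf A0 h0; set z := zinf A in Jw *.
have z0 : inOs (o0 |: A) (mono z : laurent R).
  by apply: inOs_mono; apply: regularS (subsetUr _ _) _; apply: zinf_reg.
have hw0 : inOs (o0 |: A) w by apply: inOsS hw; apply: subsetUr.
have [k hk] : evt (fun k => inOs A (mono (z *+ k) * toL P)).
  have [K hK] := supp_bound (toL P); exists (2 * K)%N => k hk m; rewrite lcoef_mono => h.
  have := hK _ h; have := toL_polyL h; have := nonempty3 A0; move: h0.
  rewrite regularE /nonneg /z /zinf; case: (o0 \in A) => // _.
  by case: (o1 \in A); case: (o2 \in A) => //= _;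
    rewrite !raddfMn /= ?mul0rn ?mulNrn -?pmulrn ?natz; lia.
have {}hk := hk k (leqnn k).
(* With t = -z w the function 1 - t lies in the ideal, so P is congruent to t^(k+1) P. Here k of the
   factors z absorb the pole of P at infinity and the last one makes the product vanish there. *)
exists ((- w) ^+ k.+1 * (mono z * (mono (z *+ k) * toL P))).
have h1 : inOs A (mono z * (mono (z *+ k) * toL P)).
  by apply: inOsM => //; apply: inOs_mono; apply: zinf_reg.
have h2 : inOs A ((- w) ^+ k.+1) by apply: inOsX; apply: inOsN.
split; first exact: inOsM.
- apply: (@atinf0M A) => //; apply: z_atinf0 h0 _ hk; by rewrite zinf_expo.
- pose t := mono z * - w.
  have et : 1 + mono z * w = 1 - t by rewrite /t mulrN opprK.
  have e : 1 - t ^+ k.+1 = (1 - t) * (\sum_(i < k.+1) 1 ^+ (k.+1.-1 - i) * t ^+ i).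
    by rewrite -subrXX expr1n.
  have -> : toL P - (- w) ^+ k.+1 * (mono z * (mono (z *+ k) * toL P)) =
     (toL P * \sum_(i < k.+1) 1 ^+ (k.+1.-1 - i) * t ^+ i) * (1 + mono z * w).
    rewrite et -mulrA [in RHS](mulrC _ (1 - t)) -e mulrBr mulr1; congr (_ - _).
    rewrite /t exprMn monoX mulrS monoD.
    by move: ((- w) ^+ k.+1) (mono z) (mono (z *+ k)) (toL P) => x y u v; ring.
  apply: JlocM; [exact: Ji| |exact: Jw]; apply: inOsM; first by apply: inOs_toL; rewrite !inE.
  apply: inOs_sum => i _; apply: inOsM; apply: inOsX; first exact: inOs1.
  by apply: inOsM => //; apply: inOsN.
Qed.
End AtInf.

Definition mk2 (T : Type) (a b : T) (k : 'I_2) : T := if k == k0 then a else b.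
Lemma mk2_eta (T : Type) (c : 'I_2 -> T) : mk2 (c k0) (c k1) = c.
Proof. by apply: funext => k; rewrite /mk2; case: (ord2 k) => ->. Qed.

(** * Finite generation and framing of the explicit sheaves *)

Section Gens.
Variables (R : comNzRingType).
Implicit Types (A : {set 'I_3}).

Lemma z_up A (c : laurent R) : A != set0 -> o0 \notin A -> inOs (o0 |: A) c ->
  evt (fun k => inOs A (mono (zinf A *+ k) * c)).
Proof.
move=> A0 h0 hc; have [K hK] := supp_bound c; exists (2 * K)%N => k hk m; rewrite lcoef_mono => h.
have := hK _ h; have := hc _ h; have := nonempty3 A0; move: h0.
rewrite !regularE !inE /zinf; case: (o0 \in A) => // _.
by case: (o1 \in A); case: (o2 \in A) => //= _;
  rewrite !raddfMn /= ?mul0rn ?mulNrn -?pmulrn ?natz; lia.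
Qed.

Lemma inOs0U A (c : laurent R) : inOs A c -> inOs (o0 |: A) c.
Proof. by apply: inOsS; apply: subsetUr. Qed.

(** On a chart that reaches L_oo the generators are those of [J], divided by a monomial to become
    regular, and 1 - t with t = -z w. Then e = (1 - t) T e + t^k' e, and for large k' the factor
    z^k' clears the poles in the expansion of the last term. *)
Lemma Jloc_fin_gen (J : {poly {poly R}} -> Prop) n A : is_ideal J -> lf_ideal J n -> A != set0 ->
  exists (r : nat) (y : 'I_r -> laurent R), (forall i, inOs A (y i) /\ Jloc J A (y i)) /\
  forall e, inOs A e -> Jloc J A e -> exists d : 'I_r -> laurent R,
    (forall i, inOs A (d i)) /\ e = \sum_i d i * y i.
Proof.
move=> Ji lf A0; have [G [GJ Jg]] := lf_fin_gen Ji lf.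
have GiJ (i : 'I_(size G)) : J G`_i by apply: GJ; apply: mem_nth.
case/boolP: (o0 \in A) => h0.
  exists (size G), (fun i => toL G`_i); split.
    by move=> i; split; [apply: inOs_toL|apply: Jloc_toL].
  move=> e _ [k [Q [/Jg[q ->] eQ]]]; exists (fun i => mono (- mu A k) * toL (q i)); split.
    move=> i; apply: inOsM; last exact: inOs_toL.
    by apply: inOs_mono; have := muN_reg A k; rewrite setUC (setUidPl _) ?sub1set.
  rewrite -[e]mul1r -(monoK R (mu A k)) -mulrA -eQ (raddf_sum (@toL R)) mulr_sumr.
  by apply: eq_bigr => i _; rewrite /= toLM mulrA.
have [w hw Jw] := near_inf Ji lf A0 h0; set z := zinf A in Jw *.
have zO : inOs A (mono z : laurent R) by apply: inOs_mono; apply: zinf_reg.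
have [D hD] := evt_ex (evt_fin (fun i : 'I_(size G) => inOs_down A0 (toL_polyL (P := G`_i)))).
exists (size G).+1, (fun i => if unlift ord0 i is Some j then mono (- mu A D) * toL G`_j
  else 1 + mono z * w); split.
  move=> i; case: unliftP => [j _|_].
    split; first exact: hD.
    by apply: JlocM => //; [apply/inOs_mono/muN_reg|apply: Jloc_toL].
  by split=> //; apply: inOsD; [apply: inOs1|apply: inOsM].
move=> e he [k [Q [/Jg[q ->] eQ]]].
have [k' hk'] := evt_ex (evt_fin (fun i : 'I_(size G) => z_up A0 h0
  (inOsM (inOsM (inOs_mono (muN_reg A k)) (inOs_mono (mu_reg0 A D)))
   (@inOs_toL R (o0 |: A) (q i) (setU11 _ _))))).
pose t := mono z * - w; pose T := \sum_(i < k') 1 ^+ (k'.-1 - i) * t ^+ i.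
have tE : (1 + mono z * w) * T = 1 - t ^+ k'.
  by rewrite -[in RHS](expr1n _ k') subrXX /T /t mulrN opprK.
have tO : inOs A t by apply: inOsM => //; apply: inOsN.
have TO : inOs A T by apply: inOs_sum => i _; apply: inOsM; apply: inOsX => //; apply: inOs1.
exists (fun i => if unlift ord0 i is Some j then
  (- w) ^+ k' * (mono (z *+ k') * (mono (- mu A k) * mono (mu A D) * toL (q j))) else T * e); split.
  move=> i; case: unliftP => [j _|_]; last exact: inOsM.
  by apply: inOsM; [apply: inOsX; apply: inOsN|apply: hk'].
rewrite big_ord_recl unlift_none.
under eq_bigr do rewrite liftK.
have -> : \sum_(i < size G) (- w) ^+ k' * (mono (z *+ k') * (mono (- mu A k) * mono (mu A D) * toL (q i))) *
    (mono (- mu A D) * toL G`_i) = t ^+ k' * e.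
  rewrite -[e]mul1r -(monoK R (mu A k)) -(mulrA (mono _)) -eQ (raddf_sum (@toL R)) !mulr_sumr.
  apply: eq_bigr => i _; rewrite /= toLM /t exprMn monoX -[RHS]mulr1 -(monoVK R (mu A D)).
  move: ((- w) ^+ k') (mono (z *+ k')) (mono (- mu A k)) (mono (mu A D)) (toL (q i))
    (mono (- mu A D)) (toL G`_i) => x1 x2 x3 x4 x5 x6 x7; ring.
have -> : T * e * (1 + mono z * w) = e - t ^+ k' * e.
  by rewrite mulrAC [T * _]mulrC tE mulrBl mul1r.
by rewrite subrK.
Qed.

Section ExplicitGens.
Variables (P : {poly {poly R}}) (J : {poly {poly R}} -> Prop) (n : nat).
Hypotheses (Ji : is_ideal J) (lf : lf_ideal J n).

Lemma Dexp0 I c : in_O I c -> Jloc J (sval I) c -> Dexp P J I (mk2 0 c).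
Proof.
move=> hc Jc; split; rewrite /mk2 /=; [exact: inOs0|exact: hc|].
by rewrite mulr0 subr0.
Qed.

(** The first component maps the explicit sheaf to O; the section (1, u) splits this map on each
    chart, and with u zero on L_oo it can serve as the first framing vector. *)
Lemma Dexp_lift I : exists u, Dexp P J I (mk2 1 u) /\ (chart_inf I -> atinf0 u).
Proof.
case/boolP: (o0 \in sval I) => h0.
  exists (toL P); split; last by rewrite /chart_inf h0.
  split; rewrite /mk2 /=; [exact: inOs1|exact: inOs_toL|].
  by rewrite mulr1 subrr; apply: Jloc0.
have [u [uO u0 Ju]] := near_lift P Ji lf (chart_neq0 I) h0.
exists u; split=> //; split; rewrite /mk2 /=; [exact: inOs1|exact: uO|].
by rewrite mulr1 -opprB; apply: JlocN.
Qed.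

Lemma Dexp_fin_gen I : exists (r : nat) (y : 'I_r -> 'I_2 -> laurent R),
  (forall i, Dexp P J I (y i)) /\
  forall c, Dexp P J I c -> exists d : 'I_r -> laurent R,
    (forall i, in_O I (d i)) /\ forall k, c k = \sum_i d i * y i k.
Proof.
have [u [hu _]] := Dexp_lift I.
have [r [y [hy yg]]] := Jloc_fin_gen Ji lf (chart_neq0 I).
exists r.+1, (fun i => if unlift ord0 i is Some j then mk2 0 (y j) else mk2 1 u); split.
  by move=> i; case: unliftP => [j _|_] //; have [h1 h2] := hy j; apply: Dexp0.
move=> c [ha hb hc].
have [_ uO Ju] := hu; rewrite /mk2 /= mulr1 in uO Ju.
have [||d [dO e]] := yg (c k1 - c k0 * u).
- by apply: inOsB => //; apply: inOsM.
- have -> : c k1 - c k0 * u = (c k1 - toL P * c k0) - c k0 * (u - toL P).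
    by move: (c k0) (c k1) (toL P) => x1 x2 x3; ring.
  by apply: JlocB => //; apply: JlocM => //; apply: inOs0U.
exists (fun i => if unlift ord0 i is Some j then d j else c k0); split.
  by move=> i; case: unliftP => [j _|_]; [exact: dO|exact: ha].
move=> k; rewrite big_ord_recl unlift_none.
under eq_bigr do rewrite liftK.
case: (ord2 k) => ->; rewrite /mk2 /=.
  by rewrite mulr1 big1 ?addr0 // => i _; rewrite mulr0.
by rewrite -e addrC subrK.
Qed.

Variables (S : qcoh R) (io : forall I, sec S I -> 'I_2 -> laurent R).
Hypothesis H : is_subsheaf (Dexp P J) io.

Lemma emb_fin_gen : fin_gen S.
Proof.
move=> I; have [r [y [hy yg]]] := Dexp_fin_gen I.
have /choice[g hg] := fun i => io_ex H (hy i).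
exists r, g => s; have [d [dO e]] := yg _ (io_D H s).
exists d; split=> //; apply: (io_inj H) => k; rewrite e (io_sum H).
by apply: eq_bigr => i _; rewrite (io_act H) // hg.
Qed.

Lemma vanish_z I (s : sec S I) : chart_inf I -> vanish_inf s ->
  exists s' : sec S I, s = mon S (zinf (sval I)) s'.
Proof.
move=> hI [m [s' [h1 h2 ->]]]; exists (mon S (m - zinf (sval I)) s').
rewrite -mon_D; first by rewrite addrC subrK.
  by apply: zinf_reg => //; apply: chart_neq0.
by apply: zinf_div => //; apply: chart_neq0.
Qed.

(** The equation z of L_oo is a unit on C^2, and the condition involving [J] lives only there; so
    dividing both components by z stays inside the sheaf. *)
Lemma emb_vanish I (s : sec S I) : chart_inf I -> vanish_inf s <-> forall k, atinf0 (io s k).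
Proof.
move=> hI; split=> [[m [s' [h1 h2 ->]]] k|h].
  rewrite (io_mon H) //; apply: z_atinf0 hI h2 _; apply: (Dexp_inO (io_D H s')).
have I0 := chart_neq0 I.
have [ha hb hc] := io_D H s.
have [a aO ea] := atinf0_z I0 hI ha (h k0).
have [b bO eb] := atinf0_z I0 hI hb (h k1).
have hd : Dexp P J I (mk2 a b).
  split; rewrite /mk2 /=; [exact: aO|exact: bO|].
  have -> : b - toL P * a = mono (- zinf (sval I)) * (io s k1 - toL P * io s k0).
    rewrite ea eb -[b - _]mul1r -(monoK R (zinf (sval I))).
    by move: (mono _) (mono _) (toL P) => x1 x2 x3; ring.
  by apply: JlocM => //; apply: inOs_mono; apply: zinfN_reg.
have [s' es'] := io_ex H hd.
exists (zinf (sval I)), s'; split; [exact: zinf_reg|by rewrite zinf_expo|].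
apply: (io_inj H) => k; rewrite (io_mon H) ?es'; last exact: zinf_reg.
by rewrite /mk2; case: (ord2 k) => -> /=.
Qed.

Definition std_frame (fr : forall I, 'I_2 -> sec S I) := forall I k, chart_inf I ->
  forall k' m, expo m ord0 = 0 -> io (fr I k) k' m = ((k == k') && (m == 0))%:R.

Lemma std_frame_ex : exists fr, std_frame fr.
Proof.
suff h (Ik : chart * 'I_2) : exists s : sec S Ik.1, chart_inf Ik.1 ->
    forall k' m, expo m ord0 = 0 -> io s k' m = ((Ik.2 == k') && (m == 0))%:R.
  exists (fun I k => sval (cid (h (I, k)))) => I k; exact: (svalP (cid (h (I, k)))).
case: Ik => I k /=; case/boolP: (chart_inf I) => hI; last by exists 0.
case: (ord2 k) => ->.
  have [u [hu /(_ hI) u0]] := Dexp_lift I; have [s es] := io_ex H hu.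
  exists s => _ k' m hm; rewrite es /mk2; case: (ord2 k') => -> /=; first by rewrite lcoef1.
  by rewrite u0.
(* The second framing vector is (0, 1 + z w), which lies in the ideal and has the value 1 on
   L_oo. *)
have [w hw Jw] := near_inf Ji lf (chart_neq0 I) hI.
have hf : in_O I (1 + mono (zinf (sval I)) * w).
  apply: inOsD; [exact: inOs1|apply: inOsM => //; apply: inOs_mono].
  by apply: zinf_reg => //; apply: chart_neq0.
have [s es] := io_ex H (Dexp0 hf Jw).
exists s => _ k' m hm; rewrite es /mk2; case: (ord2 k') => -> /=; first by rewrite lcoef0.
rewrite lcoefD lcoef1 (z_atinf0 hI _ hw) ?addr0 // zinf_expo //.
Qed.

Lemma std_coef fr I k k' c m : std_frame fr -> chart_inf I -> in_O I c -> expo m ord0 = 0 ->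
  (c * io (fr I k) k') m = (k == k')%:R * c m.
Proof.
move=> sf hI hc hm.
have hO : in_O I (io (fr I k) k') := Dexp_inO (io_D H (fr I k)).
have h0 : atinf0 (io (fr I k) k' - (k == k')%:R%:A).
  move=> m' hm'; rewrite lcoefB sf // lcoefZ lcoef1 -natrM mulnb subrr //.
rewrite -[io _ _](subrK (k == k')%:R%:A) mulrDr lcoefD.
rewrite (atinf0M (chart_neq0 I) hI hc _ h0) // ?add0r.
  by rewrite -scalerAr mulr1 lcoefZ.
by apply: inOsB => //; apply: inOsZ; apply: inOs1.
Qed.

Lemma emb_framing fr : std_frame fr -> is_framing fr.
Proof.
move=> sf; split.
- move=> I J' k hJ hI; apply/emb_vanish => // k' m hm.
  have hI' : chart_inf I by apply: contra hJ; apply: (subsetP hI).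
  by rewrite (io_sub H) (io_res H) // lcoefB !sf // subrr.
- move=> I hI s; exists (io s); split; first by move=> k; apply: (Dexp_inO (io_D H s)).
  apply/emb_vanish => // k' m hm.
  rewrite (io_sub H) (io_sum H) sum2 lcoefB lcoefD !(io_act H); try exact: (Dexp_inO (io_D H s)).
  rewrite !std_coef //; try exact: (Dexp_inO (io_D H s)).
  by case: (ord2 k') => ->; rewrite /= mul1r mul0r ?addr0 ?add0r subrr.
- move=> I c hI hc /emb_vanish h k m hm; have := h hI k m hm.
  rewrite (io_sum H) sum2 !(io_act H) // lcoefD !std_coef //.
  by case: (ord2 k) => ->; rewrite /= mul1r mul0r ?addr0 ?add0r.
Qed.
End ExplicitGens.
End Gens.

(** This is used for maps out of a tensor product: values are prescribed on combinations of
    generators, and well-definedness is only checked for combinations that are 0. *)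
Lemma graph_fun (R : nzRingType) (M N : lmodType R) (G : M -> N -> Prop) :
  (forall (r : R) s t y x, G s y -> G t x -> G (r *: s + t) (r *: y + x)) ->
  (forall s, exists y, G s y) -> (forall y, G 0 y -> y = 0) ->
  exists f : M -> N, [/\ forall (r : R) s t, f (r *: s + t) = r *: f s + f t,
    forall s, G s (f s) & forall s y, G s y -> y = f s].
Proof.
move=> Gl Gt G0; have /choice[f hf] := Gt.
have Gu s y : G s y -> y = f s.
  move=> h; apply/eqP; rewrite -subr_eq0; apply/eqP; apply: G0.
  by have := Gl (-1) _ _ _ _ (hf s) h; rewrite !scaleN1r addNr addrC.
exists f; split=> // r s t; apply/esym/Gu; exact: Gl.
Qed.

Lemma linear_laur (R : comNzRingType) (M : lmodType R) (f : laurent R -> M) (F : {fset ZZ}) u :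
  linear f -> (finsupp u `<=` F)%fset -> f u = \sum_(m <- F) u m *: f (mono m).
Proof.
move=> lf /laur_sum e.
pose f' : {linear laurent R -> M} := HB.pack f (GRing.isLinear.Build _ _ _ _ f lf).
rewrite {1}e -[f _]/(f' _) linear_sum; apply: eq_bigr => m _.
by rewrite linearZ.
Qed.

Lemma fset_cover (R : comNzRingType) (s : seq (laurent R)) : exists F : {fset ZZ},
  (forall c, c \in s -> (finsupp c `<=` F)%fset) /\
  forall m, m \in F -> exists2 c, c \in s & c m != 0.
Proof.
elim: s => [|c s [F [h1 h2]]]; first by exists fset0; split=> [//|m]; rewrite inE.
exists (finsupp c `|` F)%fset; split.
  move=> d; rewrite inE => /predU1P[->|/h1 h]; first exact: fsubsetUl.
  by apply: fsubset_trans h (fsubsetUr _ _).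
move=> m; rewrite inE => /orP[|/h2[d ds dm]].
  by rewrite mem_finsupp => h; exists c; rewrite ?mem_head.
by exists d; rewrite // inE ds orbT.
Qed.

(** * Purity of the explicit sheaves in O^2 *)

Section Pure.
Variables (R R' : comNzRingType) (g : {rmorphism R -> R'}).
Variables (P : {poly {poly R}}) (J : {poly {poly R}} -> Prop) (n : nat).
Hypotheses (Ji : is_ideal J) (lf : lf_ideal J n).
Notation P' := (map2 g P).
Notation J' := (Jmap g J).

(* Local retractions onto the sheaf, compatible with base change: this is the
   purity that gives flatness and the injectivity of base change. *)
Lemma pure I (p : nat) (s : 'I_p -> 'I_2 -> laurent R') :
  (forall i, Dexp P' J' I (s i)) -> exists (F : {fset ZZ}) (z : 'I_2 -> ZZ -> 'I_2 -> laurent R),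
  (forall k m, Dexp P J I (z k m)) /\
  forall i j, s i j = \sum_k \sum_(m <- F) s i k m *: Lmap g (z k m j).
Proof.
move=> hs; set A := sval I.
have J'i : is_ideal J' := Jmap_ideal g J.
have [T [b hb]] := global_dual Ji lf.
have [F [F1 F2]] := fset_cover ([seq s i k0 | i <- enum 'I_p] ++ [seq s i k1 | i <- enum 'I_p]).
have Fs i k : (finsupp (s i k) `<=` F)%fset.
  apply: F1; rewrite mem_cat; apply/orP; case: (ord2 k) => ->; [left|right];
  by apply/mapP; exists i; rewrite ?mem_enum.
have FA m : m \in F -> regular A m.
  case/F2 => c; rewrite mem_cat => /orP[]/mapP[i _ ->]; exact: (Dexp_inO (hs i)).
have FA0 m : m \in F -> inOs (o0 |: A) (mono m : laurent R).
  by move=> h; apply: inOs0U; apply: inOs_mono; apply: FA.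
have E1 : evt (fun k => forall i, exists Q, J' Q /\
    toL Q = mono (mu A k) * (s i k1 - toL P' * s i k0)).
  by apply: evt_fin => i; have [_ _ h] := hs i; exact: (Jloc_up J'i h).
have E2 := evt_fin (fun t => inOs_down (chart_neq0 I) (toL_polyL (P := b t))).
have E3 := evt_seq (fun m (h : m \in enum_fset F) => polyL_up (FA0 m h)).
have E4 := evt_seq (fun m (h : m \in enum_fset F) =>
  polyL_up (inOsM (@inOs_toL R (o0 |: A) P (setU11 _ _)) (FA0 m h))).
have [K [/choice[Q hQ] [hK2 [hK3 hK4]]]] := evt_ex (evt_and E1 (evt_and E2 (evt_and E3 E4))).
rewrite -/A in hQ hK2 hK3 hK4.
have /choice[l hl] := fun i => Jmap_span Ji (proj1 (hQ i)).
(* The functionals only need to kill the finitely many elements of [J] that occur in the given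
   sections. *)
have [|c [c1 c2]] := hb (flatten [seq [seq t.2 | t <- l i] | i <- enum 'I_p]).
  by move=> x /flatten_mapP[i _ /mapP[t ht ->]]; have [h _] := hl i; apply: h.
pose Phi0 (u : laurent R) := \sum_t (Lfun (c t) u : R) *: (toL (b t) : laurent R).
pose Phi (u : laurent R') := \sum_t (Lfun (fun m => g (c t m)) u : R') *: Lmap g (toL (b t)).
have PhiE u : Lmap g (Phi0 u) = Phi (Lmap g u).
  rewrite /Phi0 (raddf_sum (Lmap g)); apply: eq_bigr => t _.
  by rewrite /= LmapZ Lfun_map.
have Phil : linear Phi.
  move=> r x y; rewrite /Phi scaler_sumr -big_split; apply: eq_bigr => t _.
  by rewrite (linearP (Lfun _)) scalerDl scalerA.
have PhiQ i : Phi (toL (Q i)) = 0.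
  rewrite /Phi big1 // => t _; have [h1 h2] := hl i; rewrite h2 Lfun_Jmap ?scale0r // => u ul.
  by apply: c2; apply/flatten_mapP; exists i; rewrite ?mem_enum //; apply: map_f.
have Jaux u : polyL u -> Jloc J A (mono (- mu A K) * (u - Phi0 u)).
  move=> hu; apply: JlocM => //; first exact/inOs_mono/muN_reg.
  have -> : u - Phi0 u = toL (fromL u - \sum_t (Lfun (c t) (toL (fromL u)) : R)%:P%:P * b t).
    rewrite toLB fromLK // (raddf_sum (@toL R)); congr (_ - _).
    by apply: eq_bigr => t _; rewrite /= toLZ.
  exact: Jloc_toL.
have Oaux u : inOs A (mono (- mu A K) * Phi0 u).
  rewrite mulr_sumr; apply: inOs_sum => t _; rewrite -scalerAr; apply: inOsZ; exact: hK2.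
(* Images of the monomial vectors under (a, b) -> (a, b - Phi(b - P a)), where Phi is conjugated by
   the denominator [mu A K]. They lie in the sheaf because u - Phi u is in the ideal, and the [s i]
   are fixed because Phi kills their J-parts. *)
pose z k m : 'I_2 -> laurent R := if m \in F then
  (if k == k0 then mk2 (mono m) (mono (- mu A K) * Phi0 (mono (mu A K) * (toL P * mono m)))
   else mk2 0 (mono m - mono (- mu A K) * Phi0 (mono (mu A K) * mono m))) else mk2 0 0.
exists F, z; split.
  move=> k m; rewrite /z; case: ifP => [mF|_]; last first.
    by apply: Dexp0 => //; [apply: inOs0|apply: Jloc0].
  case: eqP => _.
    split; rewrite /mk2 /=; [exact/inOs_mono/FA|exact: Oaux|].
    have -> : mono (- mu A K) * Phi0 (mono (mu A K) * (toL P * mono m)) - toL P * mono m =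
      - (mono (- mu A K) * (mono (mu A K) * (toL P * mono m) - Phi0 (mono (mu A K) * (toL P * mono m)))).
      by rewrite mulrBr (mulrA (mono (- mu A K))) monoK mul1r opprB.
    by apply: JlocN => //; apply: Jaux; apply: hK4.
  apply: Dexp0; first by apply: inOsB; [exact/inOs_mono/FA|exact: Oaux].
  have -> : mono m - mono (- mu A K) * Phi0 (mono (mu A K) * mono m) =
      mono (- mu A K) * (mono (mu A K) * mono m - Phi0 (mono (mu A K) * mono m)).
    by rewrite mulrBr (mulrA (mono (- mu A K))) monoK mul1r.
  by apply: Jaux; apply: hK3.
move=> i j; rewrite sum2.
have big_F (f h : ZZ -> laurent R') : (forall m, m \in F -> f m = h m) ->
    \sum_(m <- F) f m = \sum_(m <- F) h m.
  by move=> e; rewrite big_seq [RHS]big_seq; apply: eq_bigr.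
case: (ord2 j) => ->.
  rewrite (big_F _ (fun m => s i k0 m *: mono m)); last first.
    by move=> m mF; rewrite /z mF /mk2 /= Lmap_mono.
  rewrite (big_F (fun m => s i k1 m *: _) (fun=> 0)); last first.
    by move=> m mF; rewrite /z mF /mk2 /= raddf0 scaler0.
  rewrite [X in _ + X]big1 // addr0; exact: laur_sum.
pose Psi w (u : laurent R') := mono (- mu A K) * Phi (mono (mu A K) * (w * u)).
have Psil w : linear (Psi w).
  move=> r x y; rewrite /Psi mulrDr -scalerAr mulrDr -scalerAr Phil.
  by rewrite mulrDr -scalerAr.
rewrite (big_F _ (fun m => s i k0 m *: Psi (toL P') (mono m))); last first.
  move=> m mF; rewrite /z mF /mk2 /= (rmorphM (Lmap g)) /= Lmap_mono PhiE.
  by rewrite !(rmorphM (Lmap g)) /= !Lmap_mono -toL_map.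
rewrite (big_F (fun m => s i k1 m *: _)
  (fun m => s i k1 m *: mono m - s i k1 m *: Psi 1 (mono m))); last first.
  move=> m mF; rewrite /z mF /mk2 /= (raddfB (Lmap g)) /= Lmap_mono (rmorphM (Lmap g)) /=.
  by rewrite Lmap_mono PhiE (rmorphM (Lmap g)) /= !Lmap_mono scalerBr /Psi mul1r.
rewrite sumrB -!(linear_laur (Psil _)) // -laur_sum // addrC -addrA addrC.
rewrite -[LHS]add0r; congr (_ + _).
have -> : - Psi 1 (s i k1) + Psi (toL P') (s i k0) = - (mono (- mu A K) * Phi (mono (mu A K) * (s i k1 - toL P' * s i k0))).
  rewrite /Psi mul1r mulrBr.
  have -> x y : Phi (x - y) = Phi x - Phi y.
    by rewrite -scaleN1r addrC Phil scaleN1r addrC.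
  by rewrite mulrBr opprB addrC.
have [_ <-] := hQ i; by rewrite PhiQ mulr0 oppr0.
Qed.
End Pure.

Section Identity.
Variable R : comNzRingType.
Lemma Lmap_id (u : laurent R) : Lmap idfun u = u.
Proof. by apply: laurP => m; rewrite LmapE. Qed.
Lemma map2_id (P : {poly {poly R}}) : map2 idfun P = P.
Proof. by apply: toL_inj; rewrite toL_map Lmap_id. Qed.
Lemma Jmap_id J : is_ideal J -> Jmap (idfun : {rmorphism R -> R}) J = J.
Proof.
move=> Ji; apply: funext => Q; apply: propext; split=> [[l [P [c [h ->]]]]|h].
  by apply: ideal_sum => // i _; rewrite map2_id; apply: ideal_M.
by have := Jmap_in idfun h; rewrite map2_id.
Qed.
End Identity.

Section Semilinear.
Variables (R R' : nzRingType) (g : {rmorphism R -> R'}) (M : lmodType R) (N : lmodType R').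
Variables (h : M -> N) (hl : forall (r : R) s t, h (r *: s + t) = g r *: h s + h t).
Lemma semilinD s t : h (s + t) = h s + h t.
Proof. by rewrite -[s in LHS]scale1r hl rmorph1 scale1r. Qed.
Lemma semilin0 : h 0 = 0.
Proof.
have := semilinD 0 0; rewrite addr0 => /eqP.
by rewrite -{1}[h 0]addr0 (inj_eq (addrI _)) eq_sym => /eqP.
Qed.
Lemma semilinZ r s : h (r *: s) = g r *: h s.
Proof. by rewrite -[r *: s]addr0 hl semilin0 addr0. Qed.
Lemma semilinB s t : h (s - t) = h s - h t.
Proof. by rewrite -scaleN1r semilinD semilinZ rmorphN1 scaleN1r. Qed.
Lemma semilin_sum (T : Type) (l : seq T) (p : pred T) (f : T -> M) :
  h (\sum_(i <- l | p i) f i) = \sum_(i <- l | p i) h (f i).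
Proof. by elim/big_rec2: _ => [|i y x _ <-]; rewrite ?semilin0 ?semilinD. Qed.
End Semilinear.

Lemma pure_id (R : comNzRingType) (P : {poly {poly R}}) J n I p (s : 'I_p -> 'I_2 -> laurent R) :
  is_ideal J -> lf_ideal J n -> (forall i, Dexp P J I (s i)) ->
  exists (F : {fset ZZ}) (z : 'I_2 -> ZZ -> 'I_2 -> laurent R),
  (forall k m, Dexp P J I (z k m)) /\
  forall i j, s i j = \sum_k \sum_(m <- F) s i k m *: z k m j.
Proof.
move=> Ji lf h; have [|F [z [h1 h2]]] := @pure _ _ idfun P J n Ji lf I p s.
  by move=> i; rewrite map2_id Jmap_id.
exists F, z; split=> // i j; rewrite {1}h2; apply: eq_bigr => k _; apply: eq_bigr => m _.
by rewrite Lmap_id.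
Qed.

(** * Flatness and base change of the explicit sheaves *)

Section Tensor.
Variables (R : comNzRingType) (P : {poly {poly R}}) (J : {poly {poly R}} -> Prop) (n : nat).
Hypotheses (Ji : is_ideal J) (lf : lf_ideal J n).
Variables (S : qcoh R) (io : forall I, sec S I -> 'I_2 -> laurent R).
Hypothesis H : is_subsheaf (Dexp P J) io.

Lemma pure_sec I p (x : 'I_p -> sec S I) : exists (F : {fset ZZ}) (z : 'I_2 -> ZZ -> sec S I),
  forall i, x i = \sum_k \sum_(m <- F) io (x i) k m *: z k m.
Proof.
have [F [z [h1 h2]]] := pure_id Ji lf (fun i => io_D H (x i)).
have /choice[y hy] := fun t : 'I_2 * ZZ => io_ex H (h1 t.1 t.2).
exists F, (fun k m => y (k, m)) => i; apply: (io_inj H) => j.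
rewrite (io_sum H) h2; apply: eq_bigr => k _; rewrite (io_sum H); apply: eq_bigr => m _.
by rewrite (io_scale H) hy.
Qed.

(** Purity expresses sections through their own Laurent coefficients, and a linear relation between
    sections is one between coefficients; these form the matrix of the equational criterion. *)
Lemma emb_flat : flat S.
Proof.
move=> I k r x e; have [F [z hz]] := pure_sec x.
pose L := [seq (j, m) | j <- enum 'I_2, m <- F].
exists (size L), (\matrix_(i, j) io (x i) (nth (k0, 0) L j).1 (nth (k0, 0) L j).2),
  (fun j => z (nth (k0, 0) L j).1 (nth (k0, 0) L j).2); split.
  apply/matrixP => a j; rewrite (ord1 a) !mxE.
  have := congr1 (fun s => io s (nth (k0, 0) L j).1 (nth (k0, 0) L j).2) e.
  rewrite (io_0 H) lcoef0 (io_sum H) lcoef_sum => e'; rewrite -[RHS]e'.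
  by apply: eq_bigr => i _; rewrite mxE (io_scale H) lcoefZ.
move=> i; rewrite {1}hz; transitivity (\sum_(t <- L) io (x i) t.1 t.2 *: z t.1 t.2).
  by rewrite big_allpairs big_enum.
rewrite (big_nth (k0, 0)) big_mkord; apply: eq_bigr => j _; by rewrite mxE.
Qed.

Variables (R' : comNzRingType) (g : {rmorphism R -> R'}).
Variables (P' : {poly {poly R'}}) (J' : {poly {poly R'}} -> Prop).
Hypotheses (J'E : forall Q, J' Q <-> Jmap g J Q) (P'E : J' (P' - map2 g P)).
Variables (S' : qcoh R') (io' : forall I, sec S' I -> 'I_2 -> laurent R').
Hypothesis H' : is_subsheaf (Dexp P' J') io'.

Lemma bc_J' : J' = Jmap g J.
Proof. by apply: funext => Q; apply: propext. Qed.
Lemma bc_ideal : is_ideal J'. Proof. by rewrite bc_J'; apply: Jmap_ideal. Qed.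

Lemma Dexp_bc I c : Dexp P' J' I c <-> Dexp (map2 g P) (Jmap g J) I c.
Proof.
have Ji' := bc_ideal; rewrite -bc_J'; split; apply: Dexp_eqP => //.
by rewrite -opprB; apply: ideal_N.
Qed.

Lemma Jloc_map A c : Jloc J A c -> Jloc (Jmap g J) A (Lmap g c).
Proof.
case=> k [Q [JQ e]]; exists k, (map2 g Q); split; first exact: Jmap_in.
by rewrite toL_map e (rmorphM (Lmap g)) /= Lmap_mono.
Qed.
Lemma inOs_map A c : inOs A c -> inOs A (Lmap g c).
Proof. by move=> h m; rewrite LmapE => e; apply: h; apply: contraNneq e => ->; rewrite rmorph0. Qed.

Lemma Dexp_map I c : Dexp P J I c -> Dexp P' J' I (fun k => Lmap g (c k)).
Proof.
case=> a b hc; apply/Dexp_bc; split; try exact: inOs_map.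
by have := Jloc_map hc; rewrite (raddfB (Lmap g)) /= (rmorphM (Lmap g)) /= -toL_map.
Qed.

(** Purity over [g] writes every section of S' as a combination of images, on which an extension of
    h is forced. It is well defined: purity over R rewrites a combination so that its coefficients
    are the Laurent coefficients of its image in S', which are 0 if the image is 0. *)
Lemma pull_explicit : exists F, is_pullback (S := S) (S' := S') g (torus1 R') F /\
  forall I s k, io' (F I s) k = Lmap g (io s k).
Proof.
pose F I s := sval (cid (io_ex H' (Dexp_map (io_D H (s : sec S I))))).
have FE I s k : io' (F I s) k = Lmap g (io s k).
  by rewrite /F; case: cid => t /= ->.
have bw m : bweight (torus1 R') m = 1.
  by rewrite /bweight; case: m => [[a|a] [b|b]]; rewrite /= !expr1n mulr1.
have Fl I (r : R) s s' : F I (r *: s + s') = g r *: F I s + F I s'.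
  apply: (io_inj H') => k; rewrite FE (io_lin H) (raddfD (Lmap g)) /= LmapZ.
  by rewrite (io_lin H') !FE.
exists F; split=> //; split=> //.
- move=> I m hm s; rewrite bw scale1r; apply: (io_inj H') => k.
  by rewrite FE (io_mon H) // (io_mon H') // (rmorphM (Lmap g)) /= Lmap_mono FE.
- by move=> I K hI s; apply: (io_inj H') => k; rewrite FE (io_res H) // (io_res H') // FE.
move=> I N h hl.
have h0 := semilin0 hl; have hZ := semilinZ hl; have hsum := semilin_sum hl.
pose G (s' : sec S' I) (y : N) := exists l : seq (R' * sec S I),
  s' = \sum_(t <- l) t.1 *: F I t.2 /\ y = \sum_(t <- l) t.1 *: h t.2.
have [|||f [f1 f2 f3]] := @graph_fun R' (sec S' I) N G.
- move=> r _ _ _ _ [l [-> ->]] [l' [-> ->]].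
  exists ([seq (r * t.1, t.2) | t <- l] ++ l'); rewrite !big_cat !big_map !scaler_sumr.
  by split; congr (_ + _); apply: eq_bigr => t _; rewrite scalerA.
- move=> s'.
  have [|E [z [hz e]]] := @pure _ _ g P J n Ji lf I 1 (fun=> io' s').
    by move=> _; apply/Dexp_bc; apply: (io_D H').
  have /choice[y hy] := fun t : 'I_2 * ZZ => io_ex H (hz t.1 t.2).
  exists (\sum_(t <- [seq (io' s' j m, y (j, m)) | j <- enum 'I_2, m <- E]) t.1 *: h t.2).
  eexists; split; last reflexivity.
  apply: (io_inj H') => j; rewrite (e ord0) (io_sum H') big_allpairs_dep big_enum.
  apply: eq_bigr => k _; apply: eq_bigr => m _.
  by rewrite (io_scale H') FE hy.
- move=> y [l [e ->]].
  have [E [z hz]] := pure_sec (fun i : 'I_(size l) => (nth (0, 0) l i).2).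
  rewrite (big_nth (0, 0)) big_mkord.
  transitivity (\sum_k \sum_(m <- E)
      (\sum_(i < size l) (nth (0, 0) l i).1 * g (io (nth (0, 0) l i).2 k m)) *: h (z k m)).
    rewrite (eq_bigr (fun i : 'I_(size l) => \sum_k \sum_(m <- E)
       ((nth (0, 0) l i).1 * g (io (nth (0, 0) l i).2 k m)) *: h (z k m))).
      rewrite exchange_big; apply: eq_bigr => k _; rewrite exchange_big; apply: eq_bigr => m _.
      by rewrite scaler_suml.
    move=> i _; rewrite {1}hz hsum scaler_sumr; apply: eq_bigr => k _.
    rewrite hsum scaler_sumr; apply: eq_bigr => m _; by rewrite hZ scalerA.
  rewrite big1 // => k _; rewrite big1 // => m _.
  suff -> : \sum_(i < size l) (nth (0, 0) l i).1 * g (io (nth (0, 0) l i).2 k m) = 0 by rewrite scale0r.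
  have := congr1 (fun s => io' s k m) e; rewrite (io_0 H') lcoef0 => e'; rewrite [RHS]e'.
  rewrite (big_nth (0, 0)) big_mkord (io_sum H') lcoef_sum; apply: eq_bigr => i _.
  by rewrite (io_scale H') lcoefZ FE LmapE.
exists f; split=> // [s|h'' l'' e].
  by apply/esym/f3; exists [:: (1, s)]; rewrite !big_cons !big_nil !addr0 !scale1r.
move=> s'; apply: f3.
have [l [-> ef]] := f2 s'; exists l; split=> //.
have h0' := semilin0 (g := idfun) l''.
elim: l {ef} => [|t l IH]; first by rewrite !big_nil.
by rewrite !big_cons l'' IH e.
Qed.
End Tensor.

(** * Chern classes of ideal sheaves *)

Section Twist.
Variable R : comNzRingType.
Implicit Types (a : int) (A B : {set 'I_3}).

Definition inOa a A (c : laurent R) := forall m, c m != 0 -> forall i, i \notin A ->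
    0 <= expo m i + (if i == ord0 then a else 0).

Lemma inOaP a A c : inOa a A c <-> forall m, c m != 0 ->
  [&& (o0 \in A) || (m.1 + m.2 <= a), (o1 \in A) || (0 <= m.1) & (o2 \in A) || (0 <= m.2)].
Proof.
split=> h m hm.
  have := h m hm o0; have := h m hm o1; have := h m hm o2; rewrite /expo /=.
  by case: (o0 \in A); case: (o1 \in A); case: (o2 \in A) => //= h2 h1 h0;
    rewrite ?andbT; do ?[apply/andP; split]; try (by have := h0 isT; lia);
    try (by have := h1 isT; lia); try (by have := h2 isT; lia).
have := h m hm => /and3P[h0 h1 h2] i; have [->|->|->] := ord3 i => iA.
- by move: h0; rewrite (negPf iA) /expo /=; lia.
- by move: h1; rewrite (negPf iA) /expo /=; lia.
- by move: h2; rewrite (negPf iA) /expo /=; lia.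
Qed.

Lemma inOa0 A c : inOa 0 A c <-> inOs A c.
Proof. by rewrite inOaP; split=> h m /h; rewrite regularE. Qed.

(** Local conditions on one function. The denominators in [gF] are the fixed monomials [frm] for all
    large k, so that conditions can be intersected and imposed componentwise. *)
Record good (E : chart -> laurent R -> Prop) : Prop := {
  g0 : forall I, E I 0;
  gD : forall I s t, E I s -> E I t -> E I (s + t);
  gZ : forall I (x : R) s, E I s -> E I (x *: s);
  gM : forall I m s, regular (sval I) m -> E I s -> E I (mono m * s);
  gR : forall I J s, csub I J -> E I s -> E J s;
  gF : forall I J t, csub I J -> E J t -> evt (fun k => E I (mono (frm (sval I) (sval J) k) * t)) }.

Lemma good_inOa a : good (fun I => inOa a (sval I)).
Proof.
split.
- by move=> I m; rewrite lcoef0 eqxx.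
- move=> I s t hs ht m; rewrite lcoefD; have [->|/hs //] := eqVneq (s m) 0.
  by rewrite add0r; apply: ht.
- by move=> I x s hs m; rewrite lcoefZ => h; apply: hs; apply: contraNneq h => ->; rewrite mulr0.
- move=> I m s hm /inOaP hs; apply/inOaP => m'; rewrite lcoef_mono => /hs; move: hm.
  rewrite regularE; case: (o0 \in _); case: (o1 \in _); case: (o2 \in _) => //=; lia.
- move=> I J s /subsetP hI hs m hm i hi; apply: hs => //; apply: contra hi; exact: hI.
move=> I J c AB /inOaP hc; have [K hK] := supp_bound c; exists (2 * (K + `|a|))%N => k hk.
apply/inOaP => m; rewrite lcoef_mono => hm.
have := hK _ hm; have {hm} := hc _ hm.
have := nonempty3 (chart_neq0 I); have /subsetP h := AB.
have := h o0; have := h o1; have := h o2; rewrite /frm /=.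
case: (o0 \in sval I); case: (o1 \in sval I); case: (o2 \in sval I);
 case: (o0 \in sval J); case: (o1 \in sval J); case: (o2 \in sval J) => //= ha hb hc' hd;
 try (by have := ha isT); try (by have := hb isT); try (by have := hc' isT); lia.
Qed.

Lemma good_Jloc J (P : {poly {poly R}}) : is_ideal J -> good (fun I c => Jloc J (sval I) (toL P * c)).
Proof.
move=> Ji; split.
- by move=> I; rewrite mulr0; apply: Jloc0.
- by move=> I s t; rewrite mulrDr; apply: JlocD.
- by move=> I x s; rewrite -scalerAr; apply: JlocZ.
- move=> I m s hm; rewrite mulrCA; apply: JlocM => //; apply: inOs0U; exact: inOs_mono.
- by move=> I K s; apply: JlocS.
- move=> I K t hI /(frm_J (chart_neq0 I) hI Ji)[k hk]; exists k => k' /hk.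
  by rewrite mulrCA.
Qed.

Lemma good_and E E' : good E -> good E' -> good (fun I c => E I c /\ E' I c).
Proof.
move=> h h'; split.
- by move=> I; split; apply: g0.
- by move=> I s t [a b] [a' b']; split; apply: gD.
- by move=> I x s [a b]; split; apply: gZ.
- by move=> I m s hm [a b]; split; apply: gM.
- by move=> I J s hI [a b]; split; [apply: (gR h) a|apply: (gR h') b].
- by move=> I J t hI [a b]; apply: evt_and; [apply: (gF h)|apply: (gF h')].
Qed.

Definition prodD r (E : 'I_r -> chart -> laurent R -> Prop) I (c : 'I_r -> laurent R) :=
  forall k, E k I (c k).
Lemma good_cond r (E : 'I_r -> chart -> laurent R -> Prop) :
  (forall k, good (E k)) -> sheaf_cond (prodD E).
Proof.
move=> h; split.
- by move=> I k; apply: (g0 (h k)).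
- by move=> I x s t hs ht k; apply: (gD (h k)) => //; apply: (gZ (h k)).
- by move=> I m s hm hs k; apply: (gM (h k)).
- by move=> I J s hI hs k; apply: (gR (h k)) hI _.
- move=> I J t hI ht; have [k hk] := evt_ex (evt_fin (fun k => gF (h k) hI (ht k))).
  exists (frm (sval I) (sval J) k); split=> //; [exact: frm_regA (chart_neq0 I) hI k|].
  exact: frm_regB (chart_neq0 I) hI k.
Qed.
End Twist.

Section Exact.
Variable R : comNzRingType.
Definition Llin r r' (T : ('I_r -> laurent R) -> 'I_r' -> laurent R) :=
  (forall (x : R) s t, T (fun k => x *: s k + t k) = (fun k => x *: T s k + T t k)) /\
  (forall m s, T (fun k => mono m * s k) = fun k => mono m * T s k).

Lemma morph_of r r' (S S' : qcoh R) D D' io io' (T : ('I_r -> laurent R) -> 'I_r' -> laurent R) :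
  is_subsheaf (S := S) D io -> is_subsheaf (S := S') D' io' -> Llin T ->
  (forall I c, D I c -> D' I (T c)) ->
  exists F : forall I, sec S I -> sec S' I, sheaf_morph F /\ forall I s, io' I (F I s) = T (io I s).
Proof.
move=> H H' [Tl Tm] h.
pose F I s := sval (cid (io_ex H' (h I _ (io_D H (s : sec S I))))).
have FE I s : io' I (F I s) = T (io I s) by rewrite /F; case: cid.
exists F; split=> //; split.
- move=> I x s t; apply: (io_inj H') => k; rewrite FE (io_lin H') !FE.
  rewrite -[RHS]/((fun k => x *: T (io I s) k + T (io I t) k) k) -Tl; congr (T _ k).
  by apply: funext => j; rewrite (io_lin H).
- move=> I m hm s; apply: (io_inj H') => k; rewrite FE (io_mon H') // FE.
  rewrite -[RHS]/((fun k => mono m * T (io I s) k) k) -Tm; congr (T _ k).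
  by apply: funext => j; rewrite (io_mon H).
- by move=> I J hI s; apply: (io_inj H') => k; rewrite FE !(io_res H, io_res H') // FE.
Qed.

Lemma short_exact_of r1 r2 r3 (S1 S2 S3 : qcoh R) D1 D2 D3 io1 io2 io3
  (T : ('I_r1 -> laurent R) -> 'I_r2 -> laurent R) (U : ('I_r2 -> laurent R) -> 'I_r3 -> laurent R) :
  is_subsheaf (S := S1) D1 io1 -> is_subsheaf (S := S2) D2 io2 -> is_subsheaf (S := S3) D3 io3 ->
  Llin T -> Llin U ->
  (forall I c, D1 I c -> D2 I (T c)) -> (forall I c, D2 I c -> D3 I (U c)) ->
  (forall I c, D1 I c -> (forall k, T c k = 0) -> forall k, c k = 0) ->
  (forall I c, D3 I c -> exists2 d, D2 I d & U d = c) ->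
  (forall I c, D1 I c -> forall k, U (T c) k = 0) ->
  (forall I d, D2 I d -> (forall k, U d k = 0) -> exists2 c, D1 I c & T c = d) ->
  short_exact S1 S2 S3.
Proof.
move=> H1 H2 H3 Tl Ul h12 h23 inj sur c0 ex.
have [F [Fm FE]] := morph_of H1 H2 Tl h12; have [G [Gm GE]] := morph_of H2 H3 Ul h23.
exists F, G; split=> //.
- move=> I s e; apply: (io_inj H1) => k; rewrite (io_0 H1); apply: (inj I) => [|j].
    exact: (io_D H1).
  by rewrite -FE e (io_0 H2).
- move=> I t; have [d hd e] := sur I _ (io_D H3 t); have [s es] := io_ex H2 hd.
  by exists s; apply: (io_inj H3) => k; rewrite GE es e.
- move=> I s; split=> [e|[s' <-]].
    have [|c hc ec] := ex I (io2 I s) (io_D H2 s).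
      by move=> k; rewrite -GE e (io_0 H3).
    have [s' es] := io_ex H1 hc; exists s'; apply: (io_inj H2) => k; by rewrite FE es ec.
  by apply: (io_inj H3) => k; rewrite GE FE (io_0 H3); apply: (c0 I); apply: (io_D H1).
Qed.
End Exact.

Lemma lf_zero (R : comNzRingType) (J : {poly {poly R}} -> Prop) : is_ideal J -> lf_ideal J 0 ->
  forall P, J P.
Proof.
move=> Ji [l [d [w [e [wd h]]]]] P.
have /choice[N hN] : forall j, exists N, J ((d j ^+ N)%:P%:P * P).
  by move=> j; have [N [c]] := proj1 (h j) P; rewrite big_ord0 subr0; exists N.
have [v vd] := unity_powers (\max_j N j) wd.
have -> : P = \sum_j (v j * d j ^+ (\max_j N j))%:P%:P * P.
  by rewrite -mulr_suml -!rmorph_sum /= vd mul1r.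
apply: ideal_sum => // j _.
rewrite -(subnK (@leq_bigmax _ N j)) exprD mulrA !polyCM -mulrA.
exact: ideal_M.
Qed.

Lemma is_subsheaf_eq (R : comNzRingType) r (S : qcoh R) D D' (io : forall I, sec S I -> 'I_r -> laurent R) :
  (forall I c, D I c <-> D' I c) -> is_subsheaf D io -> is_subsheaf D' io.
Proof.
move=> e [h1 h2 h3 h4 h5]; split=> // I c.
by rewrite -e.
Qed.

Section Field.
Variable K : closedFieldType.
Notation A := {poly {poly K}}.
Notation L := (laurent K).

Lemma clear_denoms (c : L) : evt (fun k => exists P, toL P = mono (mu setT k) * c).
Proof.
have h : inOs (o0 |: setT) c by move=> m _; rewrite regularE !inE.
by have [k hk] := polyL_up h; exists k => j /hk hj; exists (fromL (mono (mu setT j) * c)); rewrite fromLK.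
Qed.

Lemma mono_eq0 (m : ZZ) (c : L) : mono m * c = 0 -> c = 0.
Proof. by move=> e; apply: (@mono_inj K m); rewrite mulr0. Qed.

Lemma laur_domain (c d : L) : c * d = 0 -> c = 0 \/ d = 0.
Proof.
move=> e; have [k [[P eP] [Q eQ]]] := evt_ex (evt_and (clear_denoms c) (clear_denoms d)).
have : P * Q = 0.
  apply: (@toL_inj K); rewrite toLM toL0 eP eQ mulrACA e mulr0 //.
move/eqP; rewrite mulf_eq0 => /orP[]/eqP e0; [left|right];
  by apply: (@mono_eq0 (mu setT k)); rewrite -?eP -?eQ e0 toL0.
Qed.

Definition xa (a : K) : A := 'X%:P - a%:P%:P.
Definition yb (b : K) : A := 'X - b%:P%:P.
Lemma toL_xa a : toL (xa a) = mono (1, 0) - a%:A.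
Proof. by rewrite toLB toLX toLC. Qed.
Lemma toL_yb b : toL (yb b) = mono (0, 1) - b%:A.
Proof. by rewrite toLB toLY toLC. Qed.
Lemma toL_neq0 (P : A) : P != 0 -> toL P <> 0.
Proof. by move=> h e; case/eqP: h; apply: (@toL_inj K); rewrite e toL0. Qed.
Lemma yb_neq0 b : yb b != 0. Proof. by rewrite /yb (@polyXsubC_eq0 {poly K}). Qed.

Lemma eval_split (P : A) a b : exists P0 P1,
  P = (P.[b%:P].[a])%:P%:P + xa a * P0 + yb b * P1.
Proof.
have /factor_theorem[Q eQ] : root (P - P.[b%:P]%:P) b%:P by rewrite /root !hornerE subrr.
set p := P.[b%:P] in eQ *.
have /factor_theorem[q eq] : root (p - p.[a]%:P) a by rewrite /root !hornerE subrr.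
have e1 : P = p%:P + Q * ('X - b%:P%:P) by rewrite -eQ addrC subrK.
have e2 : p = p.[a]%:P + q * ('X - a%:P) by rewrite -eq addrC subrK.
exists q%:P, Q; rewrite {1}e1 {1}e2 polyCD polyCM polyCB /xa /yb.
by rewrite [q%:P * _]mulrC [Q * _]mulrC.
Qed.

(** At a monomial of [w] of highest total degree within [V] nothing cancels in the product, because
    v has positive degree. This turns bounds on the exponents of (x - b) w into bounds for w. *)
Lemma top_coef (w : L) (v : ZZ) (b : K) (V : ZZ -> bool) : 0 < v.1 + v.2 ->
  (forall m, V m -> V (m + v)) -> (exists2 m, w m != 0 & V m) ->
  exists m, [/\ V m, w m != 0 & ((mono v - b%:A) * w) (m + v) = w m].
Proof.
move=> hv Vv [m0 m0w m0V].
pose f (m : ZZ) := m.1 + m.2.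
suff [m [mV mw hm]] : exists m, [/\ V m, w m != 0 & forall m', V m' -> w m' != 0 -> f m' <= f m].
  exists m; split=> //; rewrite mulrBl lcoefB lcoef_mono addrK -scalerAl mul1r lcoefZ.
  suff -> : w (m + v) = 0 by rewrite mulr0 subr0.
  apply/eqP; apply: contraTT isT => h; have := hm _ (Vv _ mV) h; rewrite /f /=; lia.
have : has V (finsupp w) by apply/hasP; exists m0; rewrite // mem_finsupp.
have E m : (m \in enum_fset (finsupp w)) = (w m != 0) by rewrite -mem_finsupp.
rewrite -[has _ _]/(has V (enum_fset (finsupp w))).
suff H (s : seq ZZ) : has V s -> exists m, [/\ V m, m \in s & forall m', V m' -> m' \in s -> f m' <= f m].
  case/H=> m [h1 h2 h3]; exists m; split; rewrite -?E // => m' h4.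
  by rewrite -E; apply: h3.
elim: s => //= m s IH; case/boolP: (has V s) => [/IH[m' [h1 h2 h3]] _|/hasPn hs].
  case/boolP: (V m && (f m' < f m)) => [/andP[Vm hm]|hn].
    exists m; split=> //; first exact: mem_head.
    move=> m2 V2; rewrite inE => /predU1P[->//|/(h3 _ V2) h]; lia.
  exists m'; split=> //; first by rewrite inE h2 orbT.
  move=> m2 V2; rewrite inE => /predU1P[e|/(h3 _ V2) //].
  by move: hn; rewrite -e V2 /= -leNgt.
rewrite orbF => Vm; exists m; split=> //; first exact: mem_head.
by move=> m2 V2; rewrite inE => /predU1P[->//|/hs]; rewrite V2.
Qed.

(** Exactness in the middle of the Koszul complex of (x - a, y - b), with control of poles: w is
    found by setting y = b, and [top_coef] on each forbidden region of exponents places it in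
    O(e). *)
Lemma koszul_ker B a b e (c0 c1 : L) : inOa (e + 1) B c0 -> inOa (e + 1) B c1 ->
  toL (xa a) * c0 + toL (yb b) * c1 = 0 ->
  exists2 w, inOa e B w & c0 = toL (yb b) * w /\ c1 = - (toL (xa a) * w).
Proof.
move=> h0 h1 E.
have [k [[P0 e0] [P1 e1]]] := evt_ex (evt_and (clear_denoms c0) (clear_denoms c1)).
have EP : xa a * P0 + yb b * P1 = 0.
  apply: (@toL_inj K); rewrite toLD !toLM e0 e1 toL0.
  by rewrite mulrCA [X in _ + X]mulrCA -mulrDr E mulr0.
have /factor_theorem[Q eQ] : root P0 b%:P.
  have := congr1 (fun P : A => P.[b%:P]) EP; rewrite /xa /yb !hornerE subrr mul0r addr0 => /eqP.
  by rewrite mulf_eq0 polyXsubC_eq0.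
pose w := mono (- mu setT k) * toL Q.
have c0E : c0 = toL (yb b) * w.
  rewrite /w mulrCA -toLM mulrC [yb b * Q]mulrC -eQ e0 mulrC mulrA monoK mul1r //.
have c1E : c1 = - (toL (xa a) * w).
  apply/eqP; rewrite -subr_eq0 opprK; apply/eqP.
  have [] // := @laur_domain (toL (yb b)) (c1 + toL (xa a) * w); last first.
    by move=> e2; case: (toL_neq0 (yb_neq0 b) e2).
  by rewrite mulrDr -E c0E [X in _ + X]mulrCA addrC.
exists w => //; apply/inOaP => m wm.
have no (v : ZZ) (b' : K) (V : ZZ -> bool) : 0 < v.1 + v.2 -> (forall m, V m -> V (m + v)) -> V m ->
   exists m, [/\ V m, w m != 0 & ((mono v - b'%:A) * w) (m + v) = w m].
  by move=> hv Vv Vm; apply: top_coef => //; exists m.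
apply/and3P; split; [case/boolP: (o0 \in B) => //= hB|case/boolP: (o1 \in B) => //= hB|
  case/boolP: (o2 \in B) => //= hB]; rewrite leNgt; apply/negP => hV.
- have [||m2 [V2 w2 E2]] := no (0, 1) b (fun m => e < m.1 + m.2) _ _ hV; first by [].
    by move=> m' /=; lia.
  have := proj1 (inOaP _ _ _) h0 (m2 + (0, 1)); rewrite c0E toL_yb E2 => /(_ w2) /and3P[].
  by rewrite (negPf hB) /=; lia.
- have [||m2 [V2 w2 E2]] := no (0, 1) b (fun m => m.1 < 0) _ _ hV; first by [].
    by move=> m' /=; lia.
  have := proj1 (inOaP _ _ _) h0 (m2 + (0, 1)); rewrite c0E toL_yb E2 => /(_ w2) /and3P[_].
  by rewrite (negPf hB) /=; lia.
- have [||m2 [V2 w2 E2]] := no (1, 0) a (fun m => m.2 < 0) _ _ hV; first by [].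
    by move=> m' /=; lia.
  have := proj1 (inOaP _ _ _) h1 (m2 + (1, 0)).
  rewrite c1E lcoefN oppr_eq0 toL_xa E2 => /(_ w2) /and3P[_ _].
  by rewrite (negPf hB) /=; lia.
Qed.
End Field.

Section Chern.
Variable K : closedFieldType.
Notation A := {poly {poly K}}.
Notation L := (laurent K).
Implicit Types (B : {set 'I_3}) (J : A -> Prop).

Lemma inOa_aff a B (c : L) : o0 \in B -> inOs B c -> inOa a B c.
Proof.
move=> hB hc; apply/inOaP => m /hc; by rewrite regularE hB.
Qed.
Lemma inOa_0U a B (c : L) : inOa a B c -> inOs (o0 |: B) c.
Proof.
move=> /inOaP hc m /hc /and3P[_ h1 h2]; rewrite regularE !inE /=; apply/andP; split; exact.
Qed.
Lemma inOaM a B (u c : L) : inOs B u -> inOa a B c -> inOa a B (u * c).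
Proof.
move=> hu /inOaP hc; apply/inOaP => m /lcoefM_neq0[m1 [m2 [-> /hu + /hc]]].
rewrite regularE; case: (o0 \in B); case: (o1 \in B); case: (o2 \in B) => //=; lia.
Qed.
Lemma inOa_z a B (c : L) : B != set0 -> o0 \notin B -> inOa a B c -> inOa (a - 1) B (mono (zinf B) * c).
Proof.
move=> /nonempty3 B0 hB /inOaP hc; apply/inOaP => m; rewrite lcoef_mono => /hc; move: B0 hB.
rewrite /zinf; case: (o0 \in B); case: (o1 \in B); case: (o2 \in B) => //=; lia.
Qed.
Lemma z_up_a a B (c : L) : B != set0 -> o0 \notin B -> inOs (o0 |: B) c ->
  evt (fun k => inOa a B (mono (zinf B *+ k) * c)).
Proof.
move=> B0 h0 hc; have [N hN] := supp_bound c; exists (2 * N + `|a|)%N => k hk.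
apply/inOaP => m; rewrite lcoef_mono => h.
have := hN _ h; have := hc _ h; have := nonempty3 B0; move: h0.
rewrite !regularE !inE /zinf; case: (o0 \in B) => // _.
by case: (o1 \in B); case: (o2 \in B) => //= _;
  rewrite !raddfMn /= ?mul0rn ?mulNrn -?pmulrn ?natz; lia.
Qed.

Definition EO (a : int) (I : chart) (c : L) := inOa a (sval I) c.
(** The colon ideal (J : s) inside O(a). For s = 1 and a = 0 it is the ideal sheaf of [J]; for a
    socle element s it is the twisted ideal of a point. *)
Definition EP J (s : A) (a : int) (I : chart) (c : L) :=
  inOa a (sval I) c /\ Jloc J (sval I) (toL s * c).
Lemma good_EO a : good (EO a). Proof. exact: good_inOa. Qed.
Lemma good_EP J s a : is_ideal J -> good (EP J s a).
Proof. by move=> Ji; apply: good_and; [apply: good_inOa|apply: good_Jloc]. Qed.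

Definition E1 (E : chart -> L -> Prop) (k : 'I_1) := E.
Definition E2 (E E' : chart -> L -> Prop) (k : 'I_2) := if k == k0 then E else E'.
Lemma good_E1 E : good E -> forall k, good (E1 E k). Proof. by []. Qed.
Lemma good_E2 E E' : good E -> good E' -> forall k, good (E2 E E' k).
Proof. by move=> h h' k; rewrite /E2; case: eqP. Qed.
Lemma prodD2 E E' I c d : E I c -> E' I d -> prodD (E2 E E') I (mk2 c d).
Proof. by move=> h h' k; rewrite /E2 /mk2; case: eqP. Qed.

Lemma is_O_EO a S (io : forall I, sec S I -> 'I_1 -> L) :
  is_subsheaf (prodD (E1 (EO a))) io -> is_O a S.
Proof.
move=> H; exists io; apply: is_subsheaf_eq H => I c; split=> [h|h k]; first exact: (h ord0).
by rewrite (ord1 k).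
Qed.

Definition shO a : qcoh K := subsheaf (good_cond (good_E1 (good_EO a))).
Lemma chern_shO a : total_chern (shO a) (1 + a *: 'X).
Proof. by apply: chern_O; apply: is_O_EO (subsheaf_is _). Qed.

Lemma Llin_scal r r' (T : ('I_r -> L) -> 'I_r' -> L) (M : 'I_r' -> 'I_r -> L) :
  (forall s k, T s k = \sum_j M k j * s j) -> Llin T.
Proof.
move=> h; split=> [x s t|m s]; apply: funext => k; rewrite !h.
  rewrite scaler_sumr -big_split; apply: eq_bigr => j _.
  by rewrite /= mulrDr scalerAr.
by rewrite mulr_sumr; apply: eq_bigr => j _; rewrite mulrCA.
Qed.

Lemma chern_sum2 a : exists2 S : qcoh K,
  exists io : forall I, sec S I -> 'I_2 -> L, is_subsheaf (prodD (E2 (EO a) (EO a))) io &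
  total_chern S ((1 + a *: 'X) * (1 + a *: 'X)).
Proof.
pose h := good_cond (good_E2 (good_EO a) (good_EO a)).
exists (subsheaf h); first by exists (@sio _ _ _ h); apply: subsheaf_is.
apply: (chern_mid (S1 := shO a) (S3 := shO a)); try exact: chern_shO.
apply: (short_exact_of (T := fun c => mk2 (c ord0) 0) (U := fun c _ => c k1)
  (subsheaf_is _) (subsheaf_is _) (subsheaf_is _)).
- apply: (@Llin_scal _ _ _ (fun k _ => (k == k0)%:R)) => s k.
  by rewrite big_ord1 /mk2; case: eqP => _; rewrite ?mul1r ?mul0r.
- apply: (@Llin_scal _ _ _ (fun _ k => (k == k1)%:R)) => s k.
  by rewrite sum2 /= mul1r mul0r add0r.
- by move=> I c hc; apply: prodD2; [apply: hc|apply: (g0 (good_EO a))].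
- by move=> I c hc k; apply: (hc k1).
- by move=> I c _ e k; have := e k0; rewrite (ord1 k).
- move=> I c hc; exists (mk2 0 (c ord0)).
    by apply: prodD2; [apply: (g0 (good_EO a))|apply: hc].
  by apply: funext => k; rewrite (ord1 k).
- by [].
- move=> I d hd e; exists (fun _ => d k0); first by move=> k; apply: (hd k0).
  by rewrite -[RHS]mk2_eta; congr mk2; rewrite (e ord0).
Qed.

Section Socle.
Variables (J J' : A -> Prop) (s : A) (a b : K) (d : nat).
Hypotheses (Ji : is_ideal J) (Ji' : is_ideal J') (sJ : ~ J s) (sa : J (xa a * s)) (sb : J (yb b * s)).
Hypothesis J'E : forall Q, J' Q <-> exists x : K, J (Q - x%:P%:P * s).
Hypothesis sd : forall B (c : L), inOa (- d%:Z) B c -> inOs B (toL s * c).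

(** Modulo [J] the product Q s equals Q(a, b) s. As s is not in [J], membership forces Q(a, b) = 0,
    so Q lies in the ideal of the point (a, b). *)
Lemma Mp_split B (c : L) : inOs (o0 |: B) c -> Jloc J B (toL s * c) ->
  exists k Q0 Q1, mono (mu B k) * c = toL (xa a) * toL Q0 + toL (yb b) * toL Q1.
Proof.
move=> hc hJ; have [k [[Q eQ] [Q' [JQ' eQ']]]] := evt_ex (evt_and (inOs_aff_up hc) (Jloc_up Ji hJ)).
exists k; have [Q0 [Q1 e]] := eval_split Q a b; set x := Q.[_].[_] in e.
have JsQ : J (s * Q).
  suff -> : s * Q = Q' by []. apply: (@toL_inj K); rewrite toLM eQ eQ' mulrCA //.
have Jx : J (x%:P%:P * s).
  have -> : x%:P%:P * s = s * Q - (Q0 * (xa a * s) + Q1 * (yb b * s)).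
    by rewrite e; move: (x%:P%:P) (xa a) (yb b) => x1 x2 x3; ring.
  by apply: ideal_B => //; apply: ideal_D => //; apply: ideal_M.
have x0 : x = 0.
  apply/eqP; apply/negPn/negP => x0; apply: sJ.
  have := ideal_M Ji (x^-1)%:P%:P Jx; rewrite mulrA -!polyCM mulVf //.
  by rewrite mul1r.
exists Q0, Q1; rewrite -eQ e x0 !polyC0 add0r toLD !toLM //.
Qed.

Lemma Mp_surj I (c : L) : EP J s (- d%:Z) I c -> exists c0 c1,
  [/\ EO (- d%:Z - 1) I c0, EO (- d%:Z - 1) I c1 & toL (xa a) * c0 + toL (yb b) * c1 = c].
Proof.
case=> hc hJ; have hc0 := inOa_0U hc.
have [k [Q0 [Q1 e]]] := Mp_split hc0 hJ; set B := sval I in e hc hJ hc0.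
have ec : c = mono (- mu B k) * (toL (xa a) * toL Q0 + toL (yb b) * toL Q1).
  by rewrite -e mulrA monoK mul1r.
have I0 : B != set0 := chart_neq0 I.
case/boolP: (o0 \in B) => h0.
  exists (mono (- mu B k) * toL Q0), (mono (- mu B k) * toL Q1).
  have hm : inOs B (mono (- mu B k) : L).
    by apply: inOs_mono; have := muN_reg B k; rewrite setUC (setUidPl _) ?sub1set.
  split; try by apply: inOa_aff => //; apply: inOsM => //; apply: inOs_toL.
  rewrite ec; move: (toL _) (toL (yb b)) (mono _) (toL Q0) (toL Q1) => x1 x2 x3 x4 x5; ring.
set z := zinf B.
(* Near L_oo one of the two generators times z is 1 - al z. The partial geometric series [T] inverts
   it up to t^k', whose zero along L_oo absorbs the poles of [Q0] and [Q1]. *)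
pose al := if o1 \in B then a else b.
pose f := if o1 \in B then toL (xa a) else toL (yb b).
have fE : f * mono z = 1 - al *: mono z.
  rewrite /f /al /z /zinf; case: ifP => _; rewrite ?toL_xa ?toL_yb mulrBl -scalerAl mul1r -monoD;
  by congr (_ - _); rewrite -mono0; congr mono.
have mO (Q : A) : inOs (o0 |: B) (mono (- mu B k) * toL Q).
  by apply: inOsM; [apply/inOs_mono/muN_reg|apply: inOs_toL; rewrite !inE].
have [k' [h1 h2]] := evt_ex (evt_and (z_up_a (- d%:Z - 1) I0 h0 (mO Q0)) (z_up_a (- d%:Z - 1) I0 h0 (mO Q1))).
pose t := al *: mono z; pose T := \sum_(i < k') 1 ^+ (k'.-1 - i) * t ^+ i.
have zO : inOs B (mono z : L) by apply: inOs_mono; apply: zinf_reg.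
have TO : inOs B T.
  by apply: inOs_sum => i _; apply: inOsM; apply: inOsX; [apply: inOs1|apply: inOsZ].
have TE : f * mono z * T = 1 - t ^+ k' by rewrite fE -[in RHS](expr1n _ k') subrXX.
have hT : inOa (- d%:Z - 1) B (mono z * (T * c)) by apply: inOa_z => //; apply: inOaM.
have GO := good_EO (- d%:Z - 1).
exists ((if o1 \in B then mono z * (T * c) else 0) + al ^+ k' *: (mono (z *+ k') * (mono (- mu B k) * toL Q0))),
  ((if o1 \in B then 0 else mono z * (T * c)) + al ^+ k' *: (mono (z *+ k') * (mono (- mu B k) * toL Q1))).
split.
- apply: (gD GO); last by apply: (gZ GO).
  by case: ifP => _ //; apply: (g0 GO).
- apply: (gD GO); last by apply: (gZ GO).
  by case: ifP => _ //; apply: (g0 GO).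
have e1 : c = f * (mono z * (T * c)) + t ^+ k' * c.
  by rewrite !mulrA TE mulrBl mul1r subrK.
have e2 : t ^+ k' * c = toL (xa a) * (al ^+ k' *: (mono (z *+ k') * (mono (- mu B k) * toL Q0))) +
    toL (yb b) * (al ^+ k' *: (mono (z *+ k') * (mono (- mu B k) * toL Q1))).
  rewrite /t exprZn monoX [in LHS]ec -!scalerAr -scalerAl -scalerDr; congr (_ *: _).
  move: (toL (xa a)) (toL (yb b)) (mono (z *+ k')) (mono (- _)) (toL Q0) (toL Q1) => x1 x2 x3 x4 x5 x6; ring.
rewrite [RHS]e1 e2 !mulrDr /f; case: ifP => _; rewrite mulr0 ?add0r -?addrA //.
by rewrite addrCA.
Qed.

(** Koszul resolution 0 -> O(-d-2) -> O(-d-1)^2 -> M -> 0, so the class is (1 - (d+1) h)^2 / (1 -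
    (d+2) h) modulo h^3. *)
Lemma chern_Mp S (io : forall I, sec S I -> 'I_1 -> L) :
  is_subsheaf (prodD (E1 (EP J s (- d%:Z)))) io -> total_chern S (1 + (- d%:Z) *: 'X + 'X^2).
Proof.
move=> H; have [S2 [io2 H2] t2] := chern_sum2 (- d%:Z - 1).
apply: (chern_quo (S1 := shO (- d%:Z - 1 - 1)) _ (chern_shO _) t2).
  apply: (short_exact_of
    (T := fun c => mk2 (toL (yb b) * c ord0) (- (toL (xa a) * c ord0)))
    (U := fun c _ => toL (xa a) * c k0 + toL (yb b) * c k1) (subsheaf_is _) H2 H).
  - apply: (@Llin_scal _ _ _ (fun k _ => if k == k0 then toL (yb b) else - toL (xa a))) => c k.
    by rewrite big_ord1 /mk2; case: eqP => _; rewrite ?mulNr.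
  - apply: (@Llin_scal _ _ _ (fun _ k => if k == k0 then toL (xa a) else toL (yb b))) => c k.
    by rewrite sum2.
  - move=> I c hc; have := hc ord0; set e := c ord0; rewrite /E1 /EO => he.
    have hX (v : ZZ) (x : K) : nonneg v -> v.1 + v.2 = 1 ->
        inOa (- d%:Z - 1) (sval I) ((mono v - x%:A) * e).
      move=> v0 v1; rewrite mulrBl -scalerAl mul1r; apply: (gD (good_inOa K (- d%:Z - 1))).
        move: he => /inOaP he; apply/inOaP => m; rewrite lcoef_mono => /he.
        move: v0 v1; rewrite /nonneg; case: (o0 \in _); case: (o1 \in _); case: (o2 \in _) => //=; lia.
      rewrite -scaleNr; apply: (gZ (good_inOa K (- d%:Z - 1))).
      move: he => /inOaP he; apply/inOaP => m /he.
      case: (o0 \in _); case: (o1 \in _); case: (o2 \in _) => //=; lia.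
    apply: prodD2; rewrite /EO ?toL_xa ?toL_yb; first exact: hX.
    by rewrite -scaleN1r; apply: (gZ (good_inOa K (- d%:Z - 1))); apply: hX.
  - move=> I c hc k; have h0 := hc k0; have h1 := hc k1; rewrite /E2 /EO /= in h0 h1.
    set c0 := c k0 in h0 *; set c1 := c k1 in h1 *.
    have hX (v : ZZ) (x : K) (e : L) : nonneg v -> v.1 + v.2 = 1 -> inOa (- d%:Z - 1) (sval I) e ->
        inOa (- d%:Z) (sval I) ((mono v - x%:A) * e).
      move=> v0 v1 he; rewrite mulrBl -scalerAl mul1r; apply: (gD (good_inOa K (- d%:Z))).
        move: he => /inOaP he; apply/inOaP => m; rewrite lcoef_mono => /he.
        move: v0 v1; rewrite /nonneg; case: (o0 \in _); case: (o1 \in _); case: (o2 \in _) => //=; lia.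
      rewrite -scaleNr; apply: (gZ (good_inOa K (- d%:Z))).
      move: he => /inOaP he; apply/inOaP => m /he.
      case: (o0 \in _); case: (o1 \in _); case: (o2 \in _) => //=; lia.
    split.
      by apply: (gD (good_inOa K (- d%:Z))); rewrite ?toL_xa ?toL_yb; apply: hX.
    have -> : toL s * (toL (xa a) * c0 + toL (yb b) * c1) =
        c0 * toL (xa a * s) + c1 * toL (yb b * s).
      by rewrite !toLM; move: (toL (xa a)) (toL (yb b)) (toL s) => x1 x2 x3; ring.
    by apply: JlocD => //; (apply: JlocM => //; [exact: inOa_0U h0 || exact: inOa_0U h1|exact: Jloc_toL]).
  - move=> I c _ e k; rewrite (ord1 k); have := e k0; rewrite /mk2 /= => /laur_domain[] // e2.
    by case: (toL_neq0 (yb_neq0 b) e2).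
  - move=> I c hc; have [c0 [c1 [h0 h1 e]]] := Mp_surj (hc ord0).
    exists (mk2 c0 c1); first exact: prodD2.
    by apply: funext => k; rewrite (ord1 k) -e.
  - move=> I c _ k; rewrite /mk2 /=; move: (toL (xa a)) (toL (yb b)) (c ord0) => x1 x2 x3; ring.
  - move=> I c hc e; have [||w hw [e1 e2]] := @koszul_ker K (sval I) a b (- d%:Z - 1 - 1) (c k0) (c k1) _ _ (e ord0).
    + by rewrite subrK; apply: (hc k0).
    + by rewrite subrK; apply: (hc k1).
    exists (fun=> w); first by move=> k.
    by rewrite -[RHS]mk2_eta e1 e2.
set D := d%:Z.
have -> : (1 + (- D - 1) *: 'X) * (1 + (- D - 1) *: 'X) =
  (1 + (- D - 1 - 1) *: 'X) * (1 + (- D) *: 'X + 'X^2) + (D + 2)%:P * 'X^3 :> {poly int}.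
  rewrite -!mul_polyC !(polyCD, polyCN, polyCMn, polyC1).
  by move: (D%:P) => y; ring.
by rewrite take_polyD take_polyMXn_0 addr0.
Qed.
End Socle.
End Chern.

(** * Socle elements and the Chern class of an ideal of finite colength *)

Section Colength.
Variable K : closedFieldType.
Notation A := {poly {poly K}}.
Notation L := (laurent K).
Implicit Types (B : {set 'I_3}) (J : A -> Prop).

Lemma EP1 J I (c : L) : EP J 1 0 I c <-> in_O I c /\ Jloc J (sval I) c.
Proof. by rewrite /EP toL1 mul1r inOa0. Qed.

Lemma Jloc_sub J J' B (c : L) : (forall Q, J Q -> J' Q) -> Jloc J B c -> Jloc J' B c.
Proof. by move=> h [k [Q [JQ e]]]; exists k, Q; split=> //; apply: h. Qed.

Definition field_basis J n (b : 'I_n -> A) :=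
  (forall P, exists c : 'I_n -> K, J (P - \sum_i (c i)%:P%:P * b i)) /\
  (forall c : 'I_n -> K, J (\sum_i (c i)%:P%:P * b i) -> forall i, c i = 0).

Lemma field_basis_lf J n (b : 'I_n -> A) : is_ideal J -> field_basis J b -> lf_ideal J n.
Proof.
move=> Ji [h1 h2]; exists 1%N, (fun=> 1), (fun=> 1), (fun=> b).
rewrite big_ord1 mulr1; split=> // _; split.
  by move=> P; have [c hc] := h1 P; exists 0%N, c; rewrite expr0 mul1r.
by move=> c /h2 h; exists 0%N => i; rewrite h mulr0.
Qed.

Lemma lf_field_basis J n : is_ideal J -> lf_ideal J n -> exists b : 'I_n -> A, field_basis J b.
Proof.
move=> Ji [l [d [w [b [wd lb]]]]].
have [j dj] : exists j, d j != 0.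
  case: (pselect (exists j, d j != 0)) => // h; exfalso.
  have hd j : d j = 0 by apply/eqP/negPn/negP => hj; apply: h; exists j.
  have := oner_neq0 K; rewrite -wd big1 ?eqxx // => j _.
  by rewrite hd mulr0.
have [sp ind] := lb j; exists (b j); split.
  move=> P; have [N [c hc]] := sp P; have dN : d j ^+ N != 0 by rewrite expf_neq0.
  exists (fun i => (d j ^+ N)^-1 * c i).
  have e : ((d j ^+ N)^-1)%:P%:P * (d j ^+ N)%:P%:P = 1 :> A by rewrite -!polyCM mulVf.
  have := ideal_M Ji ((d j ^+ N)^-1)%:P%:P hc; rewrite mulrBr mulrA e mul1r.
  by rewrite mulr_sumr; congr J; congr (_ - _); apply: eq_bigr => i _; rewrite mulrA !polyCM.
move=> c /ind[N h] i; have := h i => /eqP; rewrite mulf_eq0 expf_eq0 (negPf dj) andbF /=.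
by move/eqP.
Qed.

(** The factors are applied to s one after another; the last product outside [J] is sent into [J] by
    the next factor. *)
Lemma linear_factor J (s : A) (f : K -> A) rs : is_ideal J -> ~ J s ->
  J ((\prod_(r <- rs) f r) * s) -> exists r Q, ~ J (Q * s) /\ J (f r * (Q * s)).
Proof.
move=> Ji; elim: rs s => [|r rs IH] s sJ; first by rewrite big_nil mul1r.
rewrite big_cons; case: (pselect (J (f r * s))) => h.
  by exists r, 1; rewrite mul1r.
move=> h'; have [|r' [Q [h1 h2]]] := IH (f r * s) h.
  by rewrite mulrA [_ * f r]mulrC.
by exists r', (Q * f r); rewrite -mulrA.
Qed.

Lemma monic_split (xi : A) (f : {poly K}) : f \is monic ->
  exists rs : seq K, evA xi f = \prod_(r <- rs) (xi - r%:P%:P).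
Proof.
move=> /monicP mf; have [rs e] := closed_field_poly_normal f; exists rs.
rewrite e mf scale1r rmorph_prod; apply: eq_bigr => r _.
by rewrite rmorphB /= evAXx evAC.
Qed.

(** A common eigenvector of x and y on the nonzero quotient by [J]: over an algebraically closed
    field the monic relations for x and y split into linear factors. *)
Lemma socle J n : is_ideal J -> lf_ideal J n -> ~ J 1 ->
  exists s a b, [/\ ~ J s, J (xa a * s) & J (yb b * s)].
Proof.
move=> Ji lf J1; have [f mf Jf] := lf_integral Ji 'X%:P lf; have [g mg Jg] := lf_integral Ji 'X lf.
have [rs ers] := monic_split 'X%:P mf; have [qs eqs] := monic_split 'X mg.
have [|a [Q [h1 h2]]] := linear_factor (rs := rs) (f := fun r => 'X%:P - r%:P%:P) Ji J1.
  by rewrite mulr1 -ers.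
have [|b [Q' [h3 h4]]] := linear_factor (rs := qs) (f := fun r => 'X - r%:P%:P) Ji h1.
  by rewrite -eqs; apply: ideal_Mr.
exists (Q' * (Q * 1)), a, b; split=> //.
by rewrite mulrCA; apply: ideal_M.
Qed.

Lemma socle_ext J n s a b : is_ideal J -> lf_ideal J n.+1 -> ~ J s -> J (xa a * s) -> J (yb b * s) ->
  let J' := fun Q => exists x : K, J (Q - x%:P%:P * s) in is_ideal J' /\ lf_ideal J' n.
Proof.
move=> Ji lf sJ ha hb J'.
have J'i : is_ideal J'.
  split; first by exists 0; rewrite !polyC0 mul0r subr0; apply: ideal_0.
    move=> P Q [x hx] [y hy]; exists (x + y).
    by rewrite !polyCD mulrDl opprD addrACA; apply: ideal_D.
  move=> P Q [x hx]; have [P0 [P1 e]] := eval_split P a b; set p := P.[_].[_] in e.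
  exists (p * x).
  have -> : P * Q - (p * x)%:P%:P * s = P * (Q - x%:P%:P * s) +
      x%:P%:P * (P0 * (xa a * s) + P1 * (yb b * s)).
    rewrite mulrBr -addrA; congr (_ + _); rewrite e !polyCM.
    move: (p%:P%:P) (xa a) (yb b) (x%:P%:P) => x1 x2 x3 x4; ring.
  by apply: ideal_D; [|apply: ideal_M|apply: ideal_M => //; apply: ideal_D => //; apply: ideal_M].
split=> //.
have [e [sp ind]] := lf_field_basis Ji lf.
have [sg hsg] := sp s.
have [i0 si0] : exists i, sg i != 0.
  case: (pselect (exists i, sg i != 0)) => // h; exfalso.
  have hd i : sg i = 0 by apply/eqP/negPn/negP => hj; apply: h; exists i.
  by apply: sJ; move: hsg; rewrite big1 ?subr0 // => i _; rewrite hd !polyC0 mul0r.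
(* A basis vector whose coefficient in s is nonzero becomes redundant modulo s and is dropped. *)
apply: (@field_basis_lf _ _ (e \o lift i0)) => //; split.
  move=> P; have [c hc] := sp P.
  have [y ey] : exists y, y * sg i0 = c i0 by exists (c i0 / sg i0); rewrite divfK.
  exists (fun i => c (lift i0 i) - y * sg (lift i0 i)), y.
  have -> : P - \sum_i (c (lift i0 i) - y * sg (lift i0 i))%:P%:P * (e \o lift i0) i -
      y%:P%:P * s = (P - \sum_i (c i)%:P%:P * e i) - y%:P%:P * (s - \sum_i (sg i)%:P%:P * e i).
    rewrite [\sum_(i < n.+1) (c i)%:P%:P * _](bigD1_ord i0) //=.
    rewrite [\sum_(i < n.+1) (sg i)%:P%:P * _](bigD1_ord i0) //=.
    under eq_bigr do rewrite !polyCB mulrBl !polyCM -mulrA.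
    rewrite sumrB -mulr_sumr -ey !polyCM.
    move: (\sum_i _) (\sum_i _) (y%:P%:P) ((sg i0)%:P%:P) (e i0) => x1 x2 x3 x4 x5; ring.
  by apply: ideal_B => //; apply: ideal_M.
move=> c [x hx].
pose c' i := (if unlift i0 i is Some j then c j else 0) - x * sg i.
have h : forall i, c' i = 0.
  apply: ind; rewrite (bigD1_ord i0) //= /c' unlift_none.
  under eq_bigr do rewrite liftK !polyCB mulrBl.
  rewrite sumrB.
  have := ideal_M Ji x%:P%:P hsg; rewrite mulrBr => h.
  have := ideal_D Ji hx h; rewrite addrA subrK (bigD1_ord i0) //= mulrDr opprD addrA.
  rewrite sub0r; congr J; rewrite addrAC !polyCN mulNr -addrA [LHS]addrC -addrA addrCA.
  rewrite mulrA -!polyCM; congr (_ + _); rewrite addrC; congr (_ + - _).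
  by rewrite mulr_sumr; apply: eq_bigr => i _; rewrite mulrA -!polyCM.
have x0 : x = 0.
  have /eqP := h i0; rewrite /c' unlift_none sub0r oppr_eq0 mulf_eq0 (negPf si0) orbF => /eqP //.
by move=> i; have := h (lift i0 i); rewrite /c' liftK x0 mul0r subr0.
Qed.

Lemma degree_bound (s : A) : exists d : nat, forall B (c : L), inOa (- d%:Z) B c -> inOs B (toL s * c).
Proof.
have [N hN] := supp_bound (toL s); exists (2 * N)%N => B c /inOaP hc m /lcoefM_neq0[m1 [m2 [-> h1 /hc]]].
have := hN _ h1; have := toL_polyL h1; rewrite /nonneg regularE.
case: (o0 \in B); case: (o1 \in B); case: (o2 \in B) => //=; lia.
Qed.

(* Induction on n: a socle element s of the quotient by J gives J' = J + K s of colength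
   n - 1 and 0 -> M -> O(-d) (+) J~ -> J'~ -> 0, where M = {c | s c in J} is the ideal of a
   point twisted by -d, resolved by a Koszul complex; no sheaf with finite support occurs. *)
Lemma chern_colength n J S (io : forall I, sec S I -> 'I_1 -> L) : is_ideal J -> lf_ideal J n ->
  is_subsheaf (prodD (E1 (EP J 1 0))) io -> total_chern S (1 + n%:R *: 'X^2).
Proof.
elim: n J S io => [|n IH] J S io Ji lf H.
  (* In colength 0 the ideal is everything and the sheaf is O. *)
  rewrite scale0r addr0 -[1]addr0 -(scale0r 'X); apply: chern_O.
  apply: (@is_O_EO _ _ _ io); apply: is_subsheaf_eq H => I c; split=> h k.
    by have [] := h k.
  split; first exact: h.
  rewrite toL1 mul1r; have [k' /(_ _ (leqnn _))[P e]] := inOs_aff_up (inOa_0U (h k)).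
  by exists k', P; split; [exact: lf_zero lf _|exact: e].
have J1 : ~ J 1.
  move=> J1; have [e [_ ind]] := lf_field_basis Ji lf.
  have /eqP : (1 : K) = 0.
    apply: (ind (fun=> 1) _ ord0); apply: ideal_sum => // i _.
    by rewrite -[_ * _]mulr1; apply: ideal_M.
  by rewrite oner_eq0.
have [s [a [b [sJ sa sb]]]] := socle Ji lf J1.
have [J'i lf'] := socle_ext Ji lf sJ sa sb; set J' := fun Q => _ in J'i lf'.
have [d hd] := degree_bound s.
have J'E Q : J' Q <-> exists x : K, J (Q - x%:P%:P * s) by [].
have JJ' Q : J Q -> J' Q by move=> h; exists 0; rewrite !polyC0 mul0r subr0.
have sJ' : J' s by exists 1; rewrite mul1r subrr; apply: ideal_0.
pose h1 := good_cond (good_E1 (good_EP s (- d%:Z) Ji)).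
pose h3 := good_cond (good_E1 (good_EP 1 0 J'i)).
pose h2 := good_cond (good_E2 (good_EO K (- d%:Z)) (good_EP 1 0 Ji)).
have t1 := chern_Mp Ji sJ sa sb (subsheaf_is h1).
have t3 := IH J' _ _ J'i lf' (subsheaf_is h3).
have T2 : total_chern (subsheaf h2) ((1 + (- d%:Z) *: 'X + 'X^2) * (1 + n%:R *: 'X^2)).
  apply: chern_mid t1 t3.
  apply: (short_exact_of (T := fun c => mk2 (c ord0) (- (toL s * c ord0)))
     (U := fun c _ => toL s * c k0 + c k1) (subsheaf_is h1) (subsheaf_is h2) (subsheaf_is h3)).
  - apply: (@Llin_scal _ _ _ _ (fun k _ => if k == k0 then 1 else - toL s)) => c k.
    by rewrite big_ord1 /mk2; case: eqP => _; rewrite ?mul1r ?mulNr.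
  - apply: (@Llin_scal _ _ _ _ (fun _ k => if k == k0 then toL s else 1)) => c k.
    by rewrite sum2 /= mul1r.
  - move=> I c hc; have [ha hb] := hc ord0; apply: prodD2 => //; apply/EP1; split.
      by apply: inOsN; apply: hd.
    exact: JlocN.
  - move=> I c hc k; have ha := hc k0; have hb := hc k1; rewrite /E2 /= in ha hb.
    move/EP1: hb => [hb1 hb2]; apply/EP1; split; first by apply: inOsD => //; apply: hd.
    apply: JlocD => //; last exact: Jloc_sub hb2.
    rewrite mulrC; apply: JlocM => //; [exact: inOa_0U ha|exact: Jloc_toL].
  - by move=> I c _ e k; rewrite (ord1 k); apply: (e k0).
  - move=> I c hc; have /EP1[ha hb] := hc ord0; set c0 := c ord0 in ha hb *.
    (* Surjectivity: modulo [J], c0 is a scalar times s divided by a monomial. If o0 is in B, that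
       scalar over the monomial serves as e; otherwise it is multiplied by t^k', which is congruent
       to 1 modulo the ideal and moves it into O(-d). *)
    suff [e [he hJ]] : exists e, inOa (- d%:Z) (sval I) e /\ Jloc J (sval I) (c0 - toL s * e).
      exists (mk2 e (c0 - toL s * e)).
        apply: prodD2 => //; apply/EP1; split=> //.
        by apply: inOsB => //; apply: hd.
      by apply: funext => k; rewrite /mk2 /= subrKC /c0 (ord1 k).
    have [k [Q [[x hx] eQ]]] := hb; set B := sval I in ha hb eQ *.
    have c0E : c0 = mono (- mu B k) * toL Q by rewrite eQ mulrA monoK mul1r.
    have QE : toL Q = x *: toL s + toL (Q - x%:P%:P * s) by rewrite toLB toLZ subrKC.
    have hj : Jloc J B (mono (- mu B k) * toL (Q - x%:P%:P * s)).
      by apply: JlocM => //; [apply/inOs_mono/muN_reg|apply: Jloc_toL].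
    case/boolP: (o0 \in B) => h0.
      exists (x *: mono (- mu B k)); split.
        apply: inOa_aff => //; apply: inOsZ; apply: inOs_mono.
        by have := muN_reg B k; rewrite setUC (setUidPl _) ?sub1set.
      suff -> : c0 - toL s * (x *: mono (- mu B k)) = mono (- mu B k) * toL (Q - x%:P%:P * s) by [].
      rewrite c0E QE mulrDr -!scalerAr [toL s * _]mulrC addrC addKr //.
    have I0 : B != set0 := chart_neq0 I.
    have [w hw Jw] := near_inf Ji lf I0 h0; set z := zinf B in Jw *.
    have [k' hk'] := evt_ex (z_up_a (- d%:Z) I0 h0 (@inOs_mono K _ _ (muN_reg B k))).
    pose t := mono z * - w; pose T := \sum_(i < k') 1 ^+ (k'.-1 - i) * t ^+ i.
    have tE : (1 + mono z * w) * T = 1 - t ^+ k'.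
      by rewrite -[in RHS](expr1n _ k') subrXX /T /t mulrN opprK.
    have wO := inOsN hw.
    have tO : inOs B t by apply: inOsM => //; apply: inOs_mono; apply: zinf_reg.
    have TO : inOs B T by apply: inOs_sum => i _; apply: inOsM; apply: inOsX => //; apply: inOs1.
    exists (x *: ((- w) ^+ k' * (mono (z *+ k') * mono (- mu B k)))); split.
      by apply: (gZ (good_inOa K (- d%:Z))); apply: inOaM => //; apply: inOsX.
    have -> : c0 - toL s * (x *: ((- w) ^+ k' * (mono (z *+ k') * mono (- mu B k)))) =
       T * c0 * (1 + mono z * w) + t ^+ k' * (mono (- mu B k) * toL (Q - x%:P%:P * s)).
      rewrite mulrAC [T * _]mulrC tE mulrBl mul1r -addrA; congr (_ + _).
      rewrite c0E QE mulrDr mulrDr opprD addrNK /t exprMn monoX -!scalerAr; congr (- (_ *: _)).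
      move: ((- w) ^+ k') (mono (z *+ k')) (mono (- _)) (toL s) => x1 x2 x3 x4; ring.
    apply: JlocD => //; apply: JlocM => //; apply: inOs0U; [exact: inOsM|exact: inOsX].
  - by move=> I c _ k; rewrite /mk2 /= subrr.
  - move=> I c hc e; have ha := hc k0; have hb := hc k1; rewrite /E2 /= in ha hb.
    have e1 : c k1 = - (toL s * c k0) by apply/eqP; rewrite -addr_eq0 addrC (e ord0).
    exists (fun=> c k0); last by rewrite -[RHS]mk2_eta e1.
    move=> k; split=> //; have /EP1[_] := hb; rewrite e1 => /(JlocN Ji).
    by rewrite opprK.
(* The split extension of O(-d) by the ideal sheaf: dividing by the class of O(-d) leaves the class
   of the ideal sheaf. *)
apply: (chern_sub (S2 := subsheaf h2) (S3 := shO K (- d%:Z)) _ T2 (chern_shO _ _)).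
  apply: (short_exact_of (T := fun c => mk2 0 (c ord0)) (U := fun c _ => c k0)
     H (subsheaf_is h2) (subsheaf_is _)).
  - apply: (@Llin_scal _ _ _ _ (fun k _ => (k == k1)%:R)) => c k.
    by rewrite big_ord1 /mk2; case: (ord2 k) => -> /=; rewrite ?mul1r ?mul0r.
  - apply: (@Llin_scal _ _ _ _ (fun _ k => (k == k0)%:R)) => c k.
    by rewrite sum2 /= mul1r mul0r addr0.
  - by move=> I c hc; apply: prodD2; [apply: (g0 (good_EO K _))|apply: hc].
  - by move=> I c hc k; apply: (hc k0).
  - by move=> I c _ e k; rewrite (ord1 k); apply: (e k1).
  - move=> I c hc; exists (mk2 (c ord0) 0).
      by apply: prodD2; [apply: hc|apply: (g0 (good_EP 1 0 Ji))].
    by apply: funext => k; rewrite (ord1 k).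
  - by [].
  - move=> I c hc e; exists (fun=> c k1); first by move=> k; apply: (hc k1).
    by rewrite -[RHS]mk2_eta (e ord0).
set D := d%:Z; set N := (n%:R : int).
have <- : (1 + (- D) *: 'X + 'X^2) * (1 + N *: 'X^2) + (- (D * (N + 1) - D * N))%:P * 'X^3 + (- N%:P * 'X) * 'X^3 =
  (1 + n.+1%:R *: 'X^2) * (1 + (- D) *: 'X) :> {poly int}.
  rewrite -!mul_polyC -natr1 !(polyCD, polyCN, polyCM, polyC1) -/N.
  by move: (D%:P) (N%:P) => y x; ring.
by rewrite !take_polyD !(take_polyMXn_0 3) !addr0.
Qed.
End Colength.

(** * Fibres over closed points *)

Section FieldExplicit.
Variable K : closedFieldType.
Notation A := {poly {poly K}}.
Notation L := (laurent K).
Variables (P : A) (J : A -> Prop) (n : nat).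
Hypotheses (Ji : is_ideal J) (lf : lf_ideal J n).
Variables (S : qcoh K) (io : forall I, sec S I -> 'I_2 -> L).
Hypothesis H : is_subsheaf (Dexp P J) io.

Lemma emb_torsion_free : torsion_free S.
Proof.
move=> I s s0 c hc e m; suff -> : c = 0 by rewrite lcoef0.
case: (pselect (c = 0)) => // c0; case: s0; apply: (io_inj H) => k.
have := congr1 (fun s => io s k) e; rewrite (io_act H) // !(io_0 H).
by case/laur_domain.
Qed.

Lemma inO_torus (c : L) : in_O torus_chart c.
Proof. by move=> m _; rewrite regularE !inE. Qed.

Lemma emb_rank : has_rank S 2.
Proof.
have [f mf Jf] := lf_integral Ji 'X%:P lf; set F := evA _ f in Jf.
have F0 : toL F <> 0.
  apply: toL_neq0; rewrite /F evA_X polyC_eq0; exact: monic_neq0.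
have D1 : Dexp P J torus_chart (mk2 (toL F) (toL P * toL F)).
  by split; try exact: inO_torus; rewrite /mk2 /= subrr; apply: Jloc0.
have D2 : Dexp P J torus_chart (mk2 0 (toL F)).
  by split; try exact: inO_torus; rewrite /mk2 /= mulr0 subr0; apply: Jloc_toL.
have [s1 e1] := io_ex H D1; have [s2 e2] := io_ex H D2.
split.
  exists (fun k => if k == k0 then s1 else s2) => c hc.
  rewrite sum2 /= => e.
  have E k : c k0 * io s1 k + c k1 * io s2 k = 0.
    by rewrite -!(io_act H) // -(io_add H) e (io_0 H).
  have c0 : c k0 = 0.
    by have := E k0; rewrite e1 e2 /mk2 /= mulr0 addr0 => /laur_domain[].
  have c1 : c k1 = 0.
    by have := E k1; rewrite e1 e2 /mk2 /= c0 mul0r add0r => /laur_domain[].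
  by move=> k m; case: (ord2 k) => ->; rewrite ?c0 ?c1 lcoef0.
(* For three vectors of length 2 the minors are the coefficients of a relation, so independence
   makes the minors vanish. Then pairs of first components, and of second components, are
   coefficients of relations and vanish as well, which leaves a zero vector. *)
move=> s ind.
pose i0 : 'I_3 := ord0; pose a j := io (s j) k0; pose b j := io (s j) k1.
have key (c : 'I_3 -> L) : c o0 * a o0 + c o1 * a o1 + c o2 * a o2 = 0 ->
    c o0 * b o0 + c o1 * b o1 + c o2 * b o2 = 0 -> forall j, c j = 0.
  move=> ea eb j; apply: laurP => m; rewrite lcoef0; apply: (ind c).
    by move=> ?; apply: inO_torus.
  apply: (io_inj H) => k; rewrite (io_0 H) (io_sum H) !big_ord_recl big_ord0 addr0.
  rewrite !(io_act H); try exact: inO_torus.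
  have -> : lift ord0 ord0 = o1 by apply: val_inj.
  have -> : lift ord0 (lift ord0 ord0) = o2 by apply: val_inj.
  by rewrite addrA; case: (ord2 k) => ->; [exact: ea|exact: eb].
pose mk3 (x y z : L) (j : 'I_3) := if j == o0 then x else if j == o1 then y else z.
have key3 x y z : x * a o0 + y * a o1 + z * a o2 = 0 -> x * b o0 + y * b o1 + z * b o2 = 0 ->
    [/\ x = 0, y = 0 & z = 0].
  move=> ea eb; have h := key (mk3 x y z) ea eb.
  by split; [exact: (h o0)|exact: (h o1)|exact: (h o2)].
have [c0 c1 c2] : [/\ a o1 * b o2 - a o2 * b o1 = 0, a o2 * b o0 - a o0 * b o2 = 0 &
    a o0 * b o1 - a o1 * b o0 = 0].
  by apply: key3; move: (a o0) (a o1) (a o2) (b o0) (b o1) (b o2) => x1 x2 x3 x4 x5 x6; ring.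
have [a1 a0 _] : [/\ a o1 = 0, - a o0 = 0 & (0 : L) = 0].
  apply: key3; first by move: (a o0) (a o1) (a o2) => x1 x2 x3; ring.
  by rewrite mul0r addr0 mulNr -opprB c2 oppr0.
have [b1 b0 _] : [/\ b o1 = 0, - b o0 = 0 & (0 : L) = 0].
  apply: key3; last by move: (b o0) (b o1) (b o2) => x1 x2 x3; ring.
  by rewrite mul0r addr0 mulNr mulrC [b o0 * _]mulrC c2.
have [||/eqP + _ _] := key3 1 0 0.
- by move/eqP: a0; rewrite oppr_eq0 => /eqP->; rewrite mulr0 !mul0r !addr0.
- by move/eqP: b0; rewrite oppr_eq0 => /eqP->; rewrite mulr0 !mul0r !addr0.
by rewrite oner_eq0.
Qed.

(** The first component gives an exact sequence from the ideal sheaf to S to O; it is onto by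
    [Dexp_lift]. *)
Lemma emb_c2 : has_c2 S n.
Proof.
pose h1 := good_cond (good_E1 (good_EP 1 0 Ji)).
have t1 := chern_colength Ji lf (subsheaf_is h1).
exists ((1 + n%:R *: 'X^2) * (1 + 0 *: 'X)); split.
  apply: chern_mid t1 (chern_shO K 0).
  apply: (short_exact_of (T := fun c => mk2 0 (c ord0)) (U := fun c _ => c k0)
     (subsheaf_is h1) H (subsheaf_is _)).
  - apply: (@Llin_scal _ _ _ _ (fun k _ => (k == k1)%:R)) => c k.
    by rewrite big_ord1 /mk2; case: (ord2 k) => -> /=; rewrite ?mul1r ?mul0r.
  - apply: (@Llin_scal _ _ _ _ (fun _ k => (k == k0)%:R)) => c k.
    by rewrite sum2 /= mul1r mul0r addr0.
  - by move=> I c hc; have /EP1[h h'] := hc ord0; apply: Dexp0.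
  - by move=> I c [h _ _] k; apply/inOa0.
  - by move=> I c _ e k; rewrite (ord1 k); apply: (e k1).
  - move=> I c hc; have [u [hu _]] := Dexp_lift P Ji lf I.
    exists (fun k => c ord0 * mk2 1 u k).
      by apply: Dexp_O => //; apply/inOa0; exact: (hc ord0).
    by apply: funext => k; rewrite (ord1 k) /mk2 /= mulr1.
  - by [].
  - move=> I c [h h' hJ] e; exists (fun=> c k1).
      move=> k; apply/EP1; split=> //.
      by move: hJ; rewrite (e ord0) mulr0 subr0.
    by rewrite -[RHS]mk2_eta (e ord0).
by rewrite scale0r addr0 mulr1 coefD coefZ coefXn coef1 /= add0r mulr1 natz.
Qed.
End FieldExplicit.

(** * Uniqueness of base change up to isomorphism *)

Section Iso.
Variable R : comNzRingType.
Implicit Types (S : qcoh R).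
Definition sheaf_iso S S' (F : forall I, sec S I -> sec S' I) :=
  [/\ sheaf_morph F, forall I, injective (F I) & forall I t, exists s, F I s = t].

Lemma iso_subsheaf r S S' D (io : forall I, sec S' I -> 'I_r -> laurent R) F :
  sheaf_iso (S := S) (S' := S') F -> is_subsheaf D io -> is_subsheaf D (fun I s => io I (F I s)).
Proof.
case=> [[Fl Fm Fr] Fi Fs] [h1 h2 h3 h4 h5]; split.
- by move=> I x s t k m; rewrite Fl h1.
- by move=> I m hm s k m'; rewrite Fm // h2.
- by move=> I J hI s; rewrite Fr // h3.
- by move=> I s t /h4/Fi.
- move=> I c; split=> [/h5[t <-]|[s <-]]; last by apply/h5; exists (F I s).
  by have [s <-] := Fs I t; exists s.
Qed.
End Iso.

Section TensorUnique.
Variables (R R' : comNzRingType) (g : {rmorphism R -> R'}).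

Lemma tensor_uniq (M : lmodType R) (M' N : lmodType R') (F : M -> M') (u v : M' -> N) :
  (forall (r : R) s t, F (r *: s + t) = g r *: F s + F t) -> is_tensor g F ->
  (forall (r : R') s t, u (r *: s + t) = r *: u s + u t) ->
  (forall (r : R') s t, v (r *: s + t) = r *: v s + v t) ->
  (forall s, u (F s) = v (F s)) -> u =1 v.
Proof.
move=> Fl ten ul vl e.
have hl (r : R) s t : u (F (r *: s + t)) = g r *: u (F s) + u (F t) by rewrite Fl ul.
have [h' [_ _ h3]] := ten N (u \o F) hl.
move=> s; rewrite (h3 u) //; symmetry; apply: h3 => // x.
by rewrite /= e.
Qed.

Lemma gm_powD (x : Gm R') (a b : int) : gm_pow x (a + b) = gm_pow x a * gm_pow x b.
Proof.
have xK := gm_valK x.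
have P (i j : nat) : gm_val x ^+ i * gm_inv x ^+ (i + j) = gm_inv x ^+ j.
  by rewrite exprD mulrA -exprMn xK expr1n mul1r.
have Q (i j : nat) : gm_val x ^+ (i + j) * gm_inv x ^+ i = gm_val x ^+ j.
  by rewrite addnC exprD -mulrA -exprMn xK expr1n mulr1.
have B (i j : nat) : gm_pow x (i%:Z - j%:Z) = gm_val x ^+ i * gm_inv x ^+ j.
  case: (leqP j i) => h.
    by rewrite subzn // -{2}(subnKC h) Q.
  have -> : i%:Z - j%:Z = Negz (j - i).-1 by lia.
  rewrite -{2}(subnKC (ltnW h)) P /= prednK ?subn_gt0 //.
have E (c : int) : exists i j : nat, c = i%:Z - j%:Z.
  by case: c => i; [exists i, 0%N|exists 0%N, i.+1]; lia.
have [i [j ->]] := E a; have [k [l ->]] := E b.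
rewrite addrACA -opprD -!PoszD !B !exprD; ring.
Qed.
Lemma bweightD (t : torus R') m m' : bweight t (m + m') = bweight t m * bweight t m'.
Proof. by rewrite /bweight /= !gm_powD mulrACA. Qed.
Lemma bweight0 (t : torus R') : bweight t 0 = 1.
Proof. by rewrite /bweight /= !expr0 mulr1. Qed.
Lemma bweightK (t : torus R') m : bweight t (- m) * bweight t m = 1.
Proof. by rewrite -bweightD addNr bweight0. Qed.

Lemma pull_factor (t : torus R') (S : qcoh R) (S1 S2 : qcoh R') F1 F2 :
  is_pullback (S := S) (S' := S1) g t F1 -> is_pullback (S := S) (S' := S2) g t F2 ->
  exists H, sheaf_morph (S := S1) (S' := S2) H /\ forall I s, H I (F1 I s) = F2 I s.
Proof.
case=> l1 m1 r1 t1 [l2 m2 r2 t2].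
have ex : forall I, exists h' : sec S1 I -> sec S2 I,
    (forall (r : R') s t, h' (r *: s + t) = r *: h' s + h' t) /\ forall s, h' (F1 I s) = F2 I s.
  by move=> I; have [h' [a b _]] := t1 I _ (F2 I) (l2 I); exists h'.
pose H I := sval (cid (ex I)).
have hH I : (forall (r : R') s t, H I (r *: s + t) = r *: H I s + H I t) /\
    (forall s, H I (F1 I s) = F2 I s) := svalP (cid (ex I)).
have Hl I := proj1 (hH I); have HF I := proj2 (hH I).
exists H; split=> //; split=> //.
  move=> I m hm s.
  apply: (tensor_uniq (u := fun s => H I (mon S1 m s)) (v := fun s => mon S2 m (H I s)) (l1 I) (t1 I)).
  - by move=> r x y; rewrite mon_linear // Hl.
  - by move=> r x y; rewrite Hl mon_linear.
  move=> x; rewrite HF.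
  have e1 : mon S1 m (F1 I x) = bweight t m *: F1 I (mon S m x).
    by rewrite m1 // scalerA mulrC bweightK scale1r.
  have e2 : mon S2 m (F2 I x) = bweight t m *: F2 I (mon S m x).
    by rewrite m2 // scalerA mulrC bweightK scale1r.
  by rewrite e1 e2 (semilinZ (g := idfun) (Hl I)) HF.
move=> I J hI s.
apply: (tensor_uniq (u := fun s => H J (res S1 J s)) (v := fun s => res S2 J (H I s)) (l1 I) (t1 I)).
- by move=> r x y; rewrite res_linear // Hl.
- by move=> r x y; rewrite Hl res_linear.
by move=> x; rewrite -r1 // !HF r2.
Qed.

Lemma pull_unique (t : torus R') (S : qcoh R) (S1 S2 : qcoh R') F1 F2 :
  is_pullback (S := S) (S' := S1) g t F1 -> is_pullback (S := S) (S' := S2) g t F2 ->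
  exists H, sheaf_iso (S := S1) (S' := S2) H /\ forall I s, H I (F1 I s) = F2 I s.
Proof.
move=> p1 p2; have [H [Hm HF]] := pull_factor p1 p2; have [G [Gm GF]] := pull_factor p2 p1.
exists H; split=> //; case: p1 => l1 m1 r1 t1; case: p2 => l2 m2 r2 t2.
case: (Hm) => Hl _ _; case: (Gm) => Gl _ _.
have GH I s : G I (H I s) = s.
  apply: (tensor_uniq (u := fun s => G I (H I s)) (v := id) (l1 I) (t1 I)) => //.
    by move=> r x y; rewrite Hl Gl.
  by move=> x; rewrite HF GF.
have HG I s : H I (G I s) = s.
  apply: (tensor_uniq (u := fun s => H I (G I s)) (v := id) (l2 I) (t2 I)) => //.
    by move=> r x y; rewrite Gl Hl.
  by move=> x; rewrite GF HF.
split=> // I; first by move=> s s' e; rewrite -[s]GH e GH.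
by move=> s; exists (G I s).
Qed.
End TensorUnique.

(** * Base change and torus action *)

Section Framed.
Variables (K : closedFieldType) (n : nat).
Implicit Types (R : comAlgType K).

Lemma hilb_is_ideal R (J : hilb n R) : is_ideal J.
Proof. by case: J => J h0 hD hM hf /=; split. Qed.
Lemma hilb_lf R (J : hilb n R) : lf_ideal J n.
Proof. by case: J. Qed.

(** An explicit presentation of a given framed sheaf. It is kept as data on S, rather than as an
    equality, because points of M(n,2) are framed sheaves up to isomorphism. *)
Definition Emb R (P : {poly {poly R}}) (J : hilb n R) (S : framed n R) :=
  exists2 io : forall I, sec S I -> 'I_2 -> laurent R,
    is_subsheaf (Dexp P J) io & std_frame io (frame S).

(** By uniqueness of pullbacks the fibre is isomorphic to the explicit sheaf of the fibre of [J],
    whose invariants have been computed over the field. *)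
Lemma explicit_fibre R (P : {poly {poly R}}) (J : hilb n R) (S : qcoh R)
    (io : forall I, sec S I -> 'I_2 -> laurent R) : is_subsheaf (Dexp P J) io ->
  forall (p : {lrmorphism R -> K^o}) (S0 : qcoh K) F,
    is_pullback (S := S) (S' := S0) p (torus1 K) F ->
    [/\ torsion_free S0, has_rank S0 2 & has_c2 S0 n].
Proof.
move=> H p S0 F hF.
pose g : {rmorphism R -> K} := (p : {rmorphism R -> K^o}).
have Ji := hilb_is_ideal J; have lf := hilb_lf J.
have Ji' : is_ideal (Jmap g J) := Jmap_ideal g J; have lf' := lf_map g Ji lf.
pose S1 := subsheaf (Dexp_cond (map2 g P) Ji').
have H1 := subsheaf_is (Dexp_cond (map2 g P) Ji').
have [|F1 [hF1 _]] := pull_explicit Ji lf H (fun Q => iff_refl (Jmap g J Q)) _ H1.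
  by rewrite subrr; apply: ideal_0.
have [G [Gi _]] := pull_unique hF hF1.
have H0 := iso_subsheaf Gi H1.
split; [exact: emb_torsion_free H0|exact: (emb_rank Ji' lf' H0)|exact: (emb_c2 Ji' lf' H0)].
Qed.

Lemma explicit_ex R (P : {poly {poly R}}) (J : hilb n R) : exists S : framed n R, Emb P J S.
Proof.
have Ji := hilb_is_ideal J; have lf := hilb_lf J.
have H := subsheaf_is (Dexp_cond P Ji).
have [fr sf] := std_frame_ex Ji lf H.
pose S := Framed (emb_fin_gen Ji lf H) (emb_flat Ji lf H) (explicit_fibre H) (emb_framing Ji H sf).
by exists S, (@sio _ _ _ (Dexp_cond P Ji)).
Qed.

Lemma hilb_map R R' (g : {lrmorphism R -> R'}) (J : hilb n R) : exists J' : hilb n R', hilb_pulls g J J'.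
Proof.
have Ji := hilb_is_ideal J; have lf := hilb_lf J.
have [h0 hD hM] := Jmap_ideal g J.
by exists (Hilb h0 hD hM (lf_map g Ji lf)).
Qed.

Lemma Emb_pulls R R' (g : {lrmorphism R -> R'}) (J : hilb n R) (J' : hilb n R') P P' S S' :
  hilb_pulls g J J' -> J' (P' - map_xy g P) -> Emb P J S -> Emb P' J' S' -> pulls g S S'.
Proof.
move=> hJ hP [io H sf] [io' H' sf'].
have [F [hF FE]] := pull_explicit (hilb_is_ideal J) (hilb_lf J) H hJ hP H'.
exists F => // I k hI; apply/(emb_vanish (hilb_is_ideal J') H') => // k' m hm.
rewrite scale1r (io_sub H') lcoefB FE LmapE sf // sf' // rmorph_nat subrr //.
Qed.

Lemma emb_frame_iso R (P : {poly {poly R}}) (J : hilb n R) (S1 S2 : framed n R) F :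
  sheaf_iso (S := S1) (S' := S2) F ->
  (forall I k, chart_inf I -> vanish_inf (F I (frame S1 I k) - frame S2 I k)) ->
  Emb P J S2 -> Emb P J S1.
Proof.
move=> Fi Ff [io H sf]; exists (fun I s => io I (F I s)); first exact: iso_subsheaf Fi H.
move=> I k hI k' m hm; have /(emb_vanish (hilb_is_ideal J) H _ hI) h := Ff I k hI.
by have := h k' m hm; rewrite (io_sub H) lcoefB sf // => /eqP; rewrite subr_eq0 => /eqP.
Qed.

Lemma vanishD R (S : qcoh R) I (s t : sec S I) : chart_inf I -> vanish_inf s -> vanish_inf t ->
  vanish_inf (s + t).
Proof.
move=> hI /vanish_z[// | s' ->] /vanish_z[// | t' ->].
have hz : regular (sval I) (zinf (sval I)) by apply: zinf_reg => //; apply: chart_neq0.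
exists (zinf (sval I)), (s' + t'); split; [exact: hz|by rewrite zinf_expo|].
have := mon_linear hz 1 s' t'; rewrite !scale1r => -> //.
Qed.
Lemma vanishZ R (S : qcoh R) I (r : R) (s : sec S I) : vanish_inf s -> vanish_inf (r *: s).
Proof.
case=> m [s' [h1 h2 ->]]; exists m, (r *: s'); split=> //.
by rewrite (semilinZ (g := idfun) (mon_linear h1)).
Qed.
Lemma vanishN R (S : qcoh R) I (s : sec S I) : vanish_inf s -> vanish_inf (- s).
Proof. by rewrite -scaleN1r; apply: vanishZ. Qed.
Lemma vanish_morph R (S S' : qcoh R) (F : forall I, sec S I -> sec S' I) I s : sheaf_morph F ->
  vanish_inf s -> vanish_inf (F I s).
Proof. by case=> _ Fm _ [m [s' [h1 h2 ->]]]; exists m, (F I s'); split=> //; rewrite Fm. Qed.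

Lemma moves_unique R R' (g : {lrmorphism R -> R'}) t (S : framed n R) (S1 S2 : framed n R') :
  moves g t S S1 -> moves g t S S2 -> exists F, sheaf_iso (S := S1) (S' := S2) F /\
  (forall I k, chart_inf I -> vanish_inf (F I (frame S1 I k) - frame S2 I k)).
Proof.
move=> [F1 p1 f1] [F2 p2 f2]; have [F [Fi FE]] := pull_unique p1 p2; exists F; split=> // I k hI.
have [Fm _ _] := Fi; have [Fl _ _] := Fm.
have h1 := vanish_morph Fm (f1 I k hI).
have e : F I (gm_val (torusA t k) *: F1 I (frame S I k) - frame S1 I k) =
    gm_val (torusA t k) *: F2 I (frame S I k) - F I (frame S1 I k).
  by rewrite (semilinB (g := idfun) (Fl I)) (semilinZ (g := idfun) (Fl I)) FE.
rewrite e in h1; have := vanishD hI (vanishN h1) (f2 I k hI).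
by rewrite opprB addrA subrK.
Qed.

(** An arbitrary base change of S is compared with the explicit one, and the embedding is carried
    over by the framed isomorphism between them. *)
Lemma pulls_Emb R R' (g : {lrmorphism R -> R'}) (J : hilb n R) (J' : hilb n R') P S S' :
  hilb_pulls g J J' -> Emb P J S -> pulls g S S' -> Emb (map_xy g P) J' S'.
Proof.
move=> hJ ES pS; have [S2 E2] := explicit_ex (map_xy g P) J'.
have p2 : pulls g S S2.
  by apply: Emb_pulls hJ _ ES E2; rewrite subrr; exact: (ideal_0 (hilb_is_ideal J')).
have [F [Fi Ff]] := moves_unique pS p2.
exact: emb_frame_iso Fi Ff E2.
Qed.
End Framed.

(** * The torus action on explicit sheaves *)

Section TorusAction.
Variables (K : closedFieldType) (R : comAlgType K) (t : torus R).
Implicit Types (c d : laurent R).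

(** Composition of a function with the inverse of b; monomials are eigenvectors. *)
Definition Ltw c : laurent R := Lext (fun m => bweight t (- m) *: mono m) c.
Lemma LtwE c m : Ltw c m = bweight t (- m) * c m.
Proof.
rewrite /Ltw /Lext lcoef_sum.
transitivity (\sum_(i <- finsupp c) (c i *: mono i : laurent R) m * bweight t (- m)).
  apply: eq_bigr => i _; rewrite !lcoefZ monoE; case: eqP => [->|_].
    by rewrite !mulr1.
  by rewrite !mulr0 mul0r.
by rewrite -mulr_suml -lcoef_sum -laur_expand mulrC.
Qed.
Lemma LtwD c d : Ltw (c + d) = Ltw c + Ltw d.
Proof. by apply: laurP => m; rewrite lcoefD !LtwE lcoefD mulrDr. Qed.
Lemma LtwZ r c : Ltw (r *: c) = r *: Ltw c.
Proof. by apply: laurP => m; rewrite lcoefZ !LtwE lcoefZ mulrCA. Qed.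
Lemma Ltw0 : Ltw 0 = 0.
Proof. by apply: laurP => m; rewrite LtwE lcoef0 mulr0. Qed.
Lemma LtwB c d : Ltw (c - d) = Ltw c - Ltw d.
Proof. by apply: laurP => m; rewrite lcoefB !LtwE lcoefB mulrBr. Qed.
Lemma Ltw_monoM m c : Ltw (mono m * c) = bweight t (- m) *: (mono m * Ltw c).
Proof.
apply: laurP => m'; rewrite LtwE lcoefZ !lcoef_mono LtwE mulrA -bweightD; congr (bweight _ _ * _).
by rewrite opprB addrA [- m + m]addrC subrr add0r.
Qed.
Lemma LtwM c d : Ltw (c * d) = Ltw c * Ltw d.
Proof.
rewrite mulL_sum [Ltw c]/Ltw /Lext mulr_suml.
have S (T : Type) (s : seq T) (f : T -> laurent R) : Ltw (\sum_(i <- s) f i) = \sum_(i <- s) Ltw (f i).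
  by elim: s => [|i s IH]; rewrite ?big_nil ?big_cons ?Ltw0 // LtwD IH.
rewrite S; apply: eq_bigr => m _.
by rewrite LtwZ Ltw_monoM -!scalerAl.
Qed.
Lemma inOs_Ltw B c : inOs B (Ltw c) <-> inOs B c.
Proof.
split=> h m hm; apply: h; rewrite ?LtwE; last first.
  by apply: contraNneq hm; rewrite LtwE => ->; rewrite mulr0.
apply: contraNneq hm => e; have := congr1 ( *%R (bweight t m)) e.
by rewrite mulrA [bweight t m * _]mulrC bweightK mul1r mulr0 => ->.
Qed.

Lemma coef_comp_scaleX (S : comNzRingType) (p : {poly S}) (c : S) i : (p \Po (c *: 'X))`_i = p`_i * c ^+ i.
Proof.
rewrite coef_comp_poly; case: (ltnP i (size p)) => h.
  rewrite (bigD1 (Ordinal h)) //= exprZn coefZ coefXn eqxx mulr1 big1 ?addr0 // => j.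
  by rewrite -val_eqE eq_sym /= exprZn coefZ coefXn => /negPf->; rewrite !mulr0.
rewrite [p`_i]nth_default // mul0r big1 // => j _.
rewrite exprZn coefZ coefXn; case: eqP => [e|_]; last by rewrite !mulr0.
by move: h; rewrite e leqNgt ltn_ord.
Qed.

Lemma toL_act P : toL (act_xy t P) = Ltw (toL P).
Proof.
apply: laurP => m; rewrite LtwE !toLE /bweight.
case: m => [[p|p] [q|q]] /=; rewrite ?mulr0 //.
rewrite /act_xy coef_comp_scaleX coef_map_id0; last by rewrite comp_poly0.
rewrite -rmorphXn /= coefMC coef_comp_scaleX.
have P' (x : Gm R) (i : nat) : gm_pow x (- i%:Z) = gm_inv x ^+ i by case: i.
by rewrite !P' -[LHS]mulrA [LHS]mulrC.
Qed.
End TorusAction.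

Section TorusMoves.
Variables (K : closedFieldType) (R : comAlgType K) (t : torus R) (n : nat).
Implicit Types (c d : laurent R).

Definition LtwV c : laurent R := mkL (finsupp c) (fun m => bweight t m * c m).
Lemma LtwVE c m : LtwV c m = bweight t m * c m.
Proof. by rewrite mkLE; case: finsuppP; rewrite ?mulr0. Qed.
Lemma LtwVK c : Ltw t (LtwV c) = c.
Proof. by apply: laurP => m; rewrite LtwE LtwVE mulrA bweightK mul1r. Qed.
Lemma LtwK c : LtwV (Ltw t c) = c.
Proof. by apply: laurP => m; rewrite LtwVE LtwE mulrA [bweight t m * _]mulrC bweightK mul1r. Qed.
Lemma act_surj (Q : {poly {poly R}}) : exists P, act_xy t P = Q.
Proof.
exists (fromL (LtwV (toL Q))); apply: toL_inj; rewrite toL_act fromLK ?LtwVK //.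
by apply/inOs_aff; apply: (proj1 (inOs_Ltw t _ _)); rewrite LtwVK; apply/inOs_aff/toL_polyL.
Qed.
Lemma act_inj : injective (act_xy t).
Proof. by move=> P Q /(congr1 (@toL R)); rewrite !toL_act => /(congr1 LtwV); rewrite !LtwK => /toL_inj. Qed.
Lemma act_D P Q : act_xy t (P + Q) = act_xy t P + act_xy t Q.
Proof. by apply: toL_inj; rewrite toLD !toL_act toLD LtwD. Qed.
Lemma act_M P Q : act_xy t (P * Q) = act_xy t P * act_xy t Q.
Proof. by apply: toL_inj; rewrite toLM !toL_act toLM LtwM. Qed.
Lemma act_Z r P : act_xy t (r%:P%:P * P) = r%:P%:P * act_xy t P.
Proof. by apply: toL_inj; rewrite toLZ !toL_act toLZ LtwZ. Qed.
Lemma act_0 : act_xy t (0 : {poly {poly R}}) = 0.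
Proof. by apply: toL_inj; rewrite toL_act toL0 Ltw0. Qed.
Lemma act_B P Q : act_xy t (P - Q) = act_xy t P - act_xy t Q.
Proof. by apply: toL_inj; rewrite toLB !toL_act toLB LtwB. Qed.
Lemma act_sum (T : Type) (l : seq T) (F : T -> {poly {poly R}}) :
  act_xy t (\sum_(i <- l) F i) = \sum_(i <- l) act_xy t (F i).
Proof. by elim: l => [|i l IH]; rewrite ?big_nil ?big_cons ?act_0 // act_D IH. Qed.

Lemma hilb_act (J : hilb n R) : exists J' : hilb n R, hilb_moves t J J'.
Proof.
have Ji := hilb_is_ideal J; have [l [d [w [e [wd lb]]]]] := hilb_lf J.
pose J' Q := exists2 P, J P & act_xy t P = Q.
have h0 : J' 0 by exists 0; [apply: ideal_0|apply: act_0].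
have hD P Q : J' P -> J' Q -> J' (P + Q).
  by move=> [P1 h1 <-] [Q1 h2 <-]; exists (P1 + Q1); [apply: ideal_D|apply: act_D].
have hM P Q : J' Q -> J' (P * Q).
  move=> [Q1 h2 <-]; have [P1 <-] := act_surj P; exists (P1 * Q1); [exact: ideal_M|exact: act_M].
have lf : quotient_locally_free J' n.
  exists l, d, w, (fun j i => act_xy t (e j i)); split=> // j; have [sp ind] := lb j.
  split.
    move=> Q; have [P <-] := act_surj Q; have [N [c hc]] := sp P; exists N, c.
    exists ((d j ^+ N)%:P%:P * P - \sum_i (c i)%:P%:P * e j i) => //.
    rewrite act_B act_Z act_sum; congr (_ - _); apply: eq_bigr => i _; exact: act_Z.
  move=> c [P JP eP]; apply: ind; suff <- : P = \sum_i (c i)%:P%:P * e j i by [].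
  apply: act_inj; rewrite eP act_sum; apply: eq_bigr => i _; by rewrite act_Z.
exists (Hilb h0 hD hM lf) => P /=; split=> [h|[Q h /act_inj <-] //]; by exists P.
Qed.

Variables (J J' : hilb n R) (JJ' : hilb_moves t J J').

Lemma Jloc_Ltw B c : Jloc J' B (Ltw t c) <-> Jloc J B c.
Proof.
have Ji := hilb_is_ideal J; have Ji' := hilb_is_ideal J'.
split=> -[k [Q [JQ e]]].
  have [P eP] := act_surj Q; have JP : J P by apply/JJ'; rewrite eP.
  have eL : toL P = bweight t (mu B k) *: (mono (mu B k) * c).
    rewrite -[LHS]LtwK -toL_act eP e -[RHS]LtwK; congr LtwV.
    by rewrite LtwZ Ltw_monoM scalerA [bweight t _ * _]mulrC bweightK scale1r.
  exists k, ((bweight t (- mu B k))%:P%:P * P); split; first exact: ideal_M.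
  by rewrite toLZ eL scalerA bweightK scale1r.
exists k, ((bweight t (mu B k))%:P%:P * act_xy t Q); split.
  by apply: ideal_M => //; apply/JJ'.
by rewrite toLZ toL_act e Ltw_monoM scalerA [bweight t _ * _]mulrC bweightK scale1r.
Qed.

Variables (P P' : {poly {poly R}}).
Hypothesis hP : J' (P' - (char_u t)%:P%:P * act_xy t P).

(** Since [moves] multiplies the k-th framing vector by a_k, the k-th coordinate is divided by a_k.
    In the equation b = P a this replaces P by (a_0 / a_1) P, which is the origin of the character
    u. *)
Lemma Dexp_moves I (c : 'I_2 -> laurent R) :
  Dexp P J I c <-> Dexp P' J' I (fun k => gm_inv (torusA t k) *: Ltw t (c k)).
Proof.
have Ji := hilb_is_ideal J; have Ji' := hilb_is_ideal J'.
have hP' : J' ((char_u t)%:P%:P * act_xy t P - P') by rewrite -opprB; apply: ideal_N.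
pose c' k := gm_inv (torusA t k) *: Ltw t (c k).
have inO k : in_O I (c' k) <-> in_O I (c k).
  rewrite /c'; split=> [h|h]; last exact: inOsZ (proj2 (inOs_Ltw t _ _) h).
  apply: (proj1 (inOs_Ltw t _ _)); rewrite -[Ltw t _]scale1r -(gm_valK (torusA t k)) -scalerA.
  exact: inOsZ.
have e : c' k1 - toL ((char_u t)%:P%:P * act_xy t P) * c' k0 =
    gm_inv (torusA t k1) *: Ltw t (c k1 - toL P * c k0).
  rewrite toLZ toL_act LtwB LtwM scalerBr /c' -scalerAl -scalerAr scalerA; congr (_ - _ *: _).
  by rewrite /char_u mulrAC gm_valK mul1r.
have eJ : Jloc J' (sval I) (c' k1 - toL ((char_u t)%:P%:P * act_xy t P) * c' k0) <->
    Jloc J (sval I) (c k1 - toL P * c k0).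
  rewrite e -Jloc_Ltw; split=> h; last exact: JlocZ.
  rewrite -[Ltw t _]scale1r -(gm_valK (torusA t k1)) -scalerA; exact: JlocZ.
split=> [[h1 h2 h3]|h].
  apply: (Dexp_eqP Ji' hP'); split; [exact/inO|exact/inO|exact/eJ].
by have [h1 h2 h3] := Dexp_eqP Ji' hP h; split; [exact/inO|exact/inO|exact/eJ].
Qed.

Lemma Emb_moves S S' : Emb P J S -> Emb P' J' S' -> moves idfun t S S'.
Proof.
move=> [io H sf] [io' H' sf'].
pose F I s := sval (cid (io_ex H' (proj1 (Dexp_moves _ _) (io_D H (s : sec S I))))).
have FE I s k : io' I (F I s) k = gm_inv (torusA t k) *: Ltw t (io I s k).
  by rewrite /F; case: cid => x /= ->.
have Fl I (r : R) s s' : F I (r *: s + s') = r *: F I s + F I s'.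
  apply: (io_inj H') => k; rewrite FE (io_lin H) LtwD LtwZ (io_lin H') !FE scalerDr !scalerA.
  by rewrite mulrC.
have Fs I s' : exists s, F I s = s'.
  pose c k := gm_val (torusA t k) *: LtwV (io' I s' k).
  have e k : gm_inv (torusA t k) *: Ltw t (c k) = io' I s' k.
    by rewrite /c LtwZ scalerA LtwVK mulrC gm_valK scale1r.
  have hc : Dexp P J I c.
    apply/Dexp_moves; rewrite (_ : (fun k => _) = io' I s'); first exact: (io_D H').
    by apply: funext => k; apply: e.
  by have [s es] := io_ex H hc; exists s; apply: (io_inj H') => k; rewrite FE es e.
have Fi I s s' : F I s = F I s' -> s = s'.
  move=> e; apply: (io_inj H) => k; have := congr1 (fun x => io' I x k) e; rewrite !FE.
  move/(congr1 ( *:%R (gm_val (torusA t k)))); rewrite !scalerA gm_valK !scale1r.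
  by move/(congr1 LtwV); rewrite !LtwK.
exists F.
  split=> //.
  - move=> I m hm s; apply: (io_inj H') => k; rewrite FE (io_mon H) // Ltw_monoM.
    by rewrite (io_scale H') (io_mon H') // FE -scalerAr !scalerA mulrC.
  - by move=> I J2 hI s; apply: (io_inj H') => k; rewrite FE (io_res H) // (io_res H') // FE.
  move=> I N h hl; have /choice[G GE] := Fs I.
  have GF s : G (F I s) = s by apply: (Fi I); rewrite GE.
  exists (h \o G); split=> [r s s'|s|h'' _ e s] /=.
  - by rewrite -hl; congr h; apply: (Fi I); rewrite Fl !GE.
  - by rewrite GF.
  - by rewrite -e GE.
move=> I k hI; apply/(emb_vanish (hilb_is_ideal J') H') => // k' m hm.
rewrite (io_sub H') (io_scale H') lcoefB lcoefZ FE lcoefZ LtwE sf // sf' //.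
case: eqP => [<-|_]; last by rewrite !mulr0 subrr.
case: eqP => [->|_]; last by rewrite !mulr0 subrr.
by rewrite oppr0 bweight0 !mulr1 gm_valK subrr.
Qed.
End TorusMoves.

Lemma moves_Emb (K : closedFieldType) (R : comAlgType K) (t : torus R) n (J J' : hilb n R) P S S' :
  hilb_moves t J J' -> Emb P J S -> moves idfun t S S' ->
  Emb ((char_u t)%:P%:P * act_xy t P) J' S'.
Proof.
move=> hJ ES mS; have [S2 E2] := explicit_ex ((char_u t)%:P%:P * act_xy t P) J'.
have m2 : moves idfun t S S2.
  by apply: (Emb_moves hJ _ ES E2); rewrite subrr; exact: (ideal_0 (hilb_is_ideal J')).
have [F [Fi Ff]] := moves_unique mS m2.
exact: emb_frame_iso Fi Ff E2.
Qed.

(** * Semilinear morphisms to O and framed morphisms to O^2 *)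

Section Lmor.
Variables (K : closedFieldType) (n : nat).
Implicit Types (R : comAlgType K).

Definition lmor R R' (g : R -> R') (S : qcoh R) (dl : forall I, sec S I -> laurent R') :=
  [/\ forall I r s t, dl I (r *: s + t) = g r *: dl I s + dl I t,
      forall I m, regular (sval I) m -> forall s, dl I (mon S m s) = mono m * dl I s,
      forall I J, csub I J -> forall s, dl J (res S J s) = dl I s &
      forall I s, in_O I (dl I s)].

(** A morphism to O^2 over [g] that is the identity along L_oo. In contrast to an embedding it can
    be composed with base changes on either side, and rigidity makes it unique on tangent
    vectors. *)
Definition fmor R R' (g : R -> R') (S : framed n R) (Phi : forall I, sec S I -> 'I_2 -> laurent R') :=
  (forall k, lmor g (fun I s => Phi I s k)) /\
  (forall I k, chart_inf I -> forall k' m, expo m ord0 = 0 ->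
    Phi I (frame S I k) k' m = ((k == k') && (m == 0))%:R).

Lemma lmor_vanish R R' (g : R -> R') (S : qcoh R) dl I (s : sec S I) : lmor (R' := R') g dl ->
  chart_inf I -> vanish_inf s -> atinf0 (dl I s).
Proof.
case=> _ hm _ hO hI [m [s' [h1 h2 ->]]]; rewrite hm //.
exact: z_atinf0 hI h2 (hO I s').
Qed.

Lemma Emb_fmor R P (J : hilb n R) S : Emb P J S ->
  exists2 io : forall I, sec S I -> 'I_2 -> laurent R, is_subsheaf (Dexp P J) io & fmor id io.
Proof.
case=> io H sf; exists io => //; split=> // k; split.
- by move=> I r s t; apply: (io_lin H).
- by move=> I m hm s; apply: (io_mon H).
- by move=> I J' hI s; rewrite (io_res H).
- by move=> I s; apply: (Dexp_inO (io_D H s)).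
Qed.

(** An ideal of colength 0 is the unit ideal, so a point of Z is the sum of O and the ideal sheaf:
    the explicit sheaf with P = 0. *)
Lemma in_Z_Emb R (J : hilb n R) (S : framed n R) : in_Z J S <-> Emb 0 J S.
Proof.
have Ji := hilb_is_ideal J.
have iiP m (J' : hilb m R) I c : in_ideal_sheaf J' I c <-> in_O I c /\ Jloc J' (sval I) c.
  have Ji' := hilb_is_ideal J'; split=> -[h1 h2]; split=> //.
    have [m' [P [a b JP e]]] := h2; apply/(Jloc_iff Ji'); exists m', P; split=> //.
    by apply: laurP => m2; rewrite toLE e lcoef_mono.
  have /(Jloc_iff Ji')[m' [P [a b JP e]]] := h2; exists m', P; split=> // m2.
  by rewrite -toLE e lcoef_mono.
have J0all (J0 : hilb 0 R) I c : in_ideal_sheaf J0 I c <-> in_O I c.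
  rewrite iiP; split=> [[]//|h]; split=> //.
  have [k /(_ _ (leqnn _))[Q e]] := inOs_aff_up (inOs0U h).
  exists k, Q; split=> //; exact: (lf_zero (hilb_is_ideal J0) (hilb_lf J0)).
have E (J0 : hilb 0 R) I c : (in_ideal_sheaf J0 I (c k0) /\ in_ideal_sheaf J I (c k1)) <-> Dexp 0 J I c.
  rewrite J0all iiP; split=> [[h1 [h2 h3]]|[h1 h2 h3]]; last first.
    by split=> //; split=> //; rewrite toL0 mul0r subr0 in h3.
  by split=> //; rewrite toL0 mul0r subr0.
split=> [[J0 [io H sf]]|[io H sf]].
  by exists io => //; apply: is_subsheaf_eq H => I c; apply: E.
have J0lf : quotient_locally_free (fun _ : {poly {poly R}} => True) 0.
  exists 1%N, (fun=> 1), (fun=> 1), (fun=> fun=> 0); rewrite big_ord1 mulr1; split=> // _; split.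
    by move=> P; exists 0%N, (fun=> 0).
  by move=> c _; exists 0%N => -[].
pose J0 := @Hilb K 0 R (fun=> True) I (fun _ _ _ _ => I) (fun _ _ _ => I) J0lf.
by exists J0, io => //; apply: is_subsheaf_eq H => I' c; rewrite E.
Qed.
End Lmor.

(** * Surjective base change and rigidity *)

(* The quotient of V by D as a module over R' = R / ker g, realized by the elements
   that are the chosen representatives of their classes. *)
Definition quot (R R' : comNzRingType) (g : {rmorphism R -> R'}) (gs : forall r', exists r, g r = r')
  (V : lmodType R) (D : V -> Prop) (h : sub_closed D) (hk : forall k x, g k = 0 -> D (k *: x)) : Type :=
  {x : V | (if pselect (exists y, D (x - y)) is left e then sval (cid e) else 0) = x}.

Section Quot.
Variables (R R' : comNzRingType) (g : {rmorphism R -> R'}) (gs : forall r', exists r, g r = r').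
Variables (V : lmodType R) (D : V -> Prop) (h : sub_closed D) (hk : forall k x, g k = 0 -> D (k *: x)).
Local Notation N := (quot gs h hk).

Let D0 : D 0. Proof. by case: h. Qed.
Let DD x y : D x -> D y -> D (x + y).
Proof. by move=> a b; rewrite -[x]scale1r; apply: (proj2 h). Qed.
Let DZ r x : D x -> D (r *: x).
Proof. by move=> a; rewrite -[_ *: _]addr0; apply: (proj2 h). Qed.
Let DN x : D x -> D (- x). Proof. by rewrite -scaleN1r; apply: DZ. Qed.
Let DC x y : D (x - y) -> D (y - x). Proof. by move/DN; rewrite opprB. Qed.
Let DT y x z : D (x - y) -> D (y - z) -> D (x - z).
Proof. by move=> a /(DD a); rewrite addrA subrK. Qed.

Definition qrep (x : V) : V := if pselect (exists y, D (x - y)) is left e then sval (cid e) else 0.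
Lemma qrepP x : D (x - qrep x).
Proof.
rewrite /qrep; case: pselect => [e|]; first by case: cid.
by case; exists x; rewrite subrr.
Qed.
Lemma qrep_eq x y : D (x - y) -> qrep x = qrep y.
Proof.
move=> e; rewrite /qrep.
have -> : (fun z => D (x - z)) = (fun z => D (y - z)); last by [].
apply: funext => z; apply: propext; split; apply: DT => //; exact: DC.
Qed.
Definition qproj (x : V) : N := exist _ (qrep x) (qrep_eq (DC (qrepP x))).
Lemma qprojP x y : qproj x = qproj y <-> D (x - y).
Proof.
split=> [e|e].
  have e' : qrep x = qrep y := congr1 sval e.
  by apply: DT (qrepP x) _; rewrite e'; apply: DC; apply: qrepP.
have e' := qrep_eq e; rewrite /qproj; move: (qrep_eq _) (qrep_eq _); rewrite e' => p q.
by congr exist; apply: Prop_irrelevance.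
Qed.
Lemma qvalK (x : N) : qproj (sval x) = x.
Proof.
case: x => x px /=; rewrite /qproj; move: (qrep_eq _) => p.
have e : qrep x = x := px; move: p; rewrite e => p; congr exist; apply: Prop_irrelevance.
Qed.
Lemma qvalP x : D (sval (qproj x) - x).
Proof. by apply: DC; apply: qrepP. Qed.

HB.instance Definition _ := gen_eqMixin N.
HB.instance Definition _ := gen_choiceMixin N.
Definition qadd (x y : N) : N := qproj (sval x + sval y).
Definition qopp (x : N) : N := qproj (- sval x).
Definition qscale (r : R') (x : N) : N := qproj (sval (cid (gs r)) *: sval x).
Lemma qaddE x y : qadd (qproj x) (qproj y) = qproj (x + y).
Proof. by apply/qprojP; rewrite opprD addrACA; apply: DD; apply: qvalP. Qed.
Lemma qoppE x : qopp (qproj x) = qproj (- x).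
Proof. by apply/qprojP; rewrite -opprD; apply: DN; apply: qvalP. Qed.
Lemma qscaleE r x : qscale (g r) (qproj x) = qproj (r *: x).
Proof.
apply/qprojP; case: cid => s /= es; rewrite -(subrK (s *: x) (s *: _)) -scalerBr -addrA.
apply: DD; first by apply: DZ; apply: qvalP.
by rewrite -scalerBl; apply: hk; rewrite rmorphB es subrr.
Qed.
Lemma qind (P : N -> Prop) : (forall x, P (qproj x)) -> forall x, P x.
Proof. by move=> H x; rewrite -[x]qvalK. Qed.
Fact qaddA : associative qadd.
Proof. by elim/qind=> x; elim/qind=> y; elim/qind=> z; rewrite !qaddE addrA. Qed.
Fact qaddC : commutative qadd.
Proof. by elim/qind=> x; elim/qind=> y; rewrite !qaddE addrC. Qed.
Fact qadd0 : left_id (qproj 0) qadd.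
Proof. by elim/qind=> x; rewrite !qaddE add0r. Qed.
Fact qaddN : left_inverse (qproj 0) qopp qadd.
Proof. by elim/qind=> x; rewrite qoppE !qaddE addNr. Qed.
HB.instance Definition _ := GRing.isZmodule.Build N qaddA qaddC qadd0 qaddN.
Fact qscaleA a b (s : N) : qscale a (qscale b s) = qscale (a * b) s.
Proof.
have [r <-] := gs a; have [r' <-] := gs b; elim/qind: s => x.
by rewrite -rmorphM !qscaleE scalerA.
Qed.
Fact qscale1 : left_id 1 qscale.
Proof. by elim/qind=> x; rewrite -(rmorph1 g) qscaleE scale1r. Qed.
Fact qscaleDr : right_distributive qscale +%R.
Proof.
move=> a; have [r <-] := gs a; elim/qind=> x; elim/qind=> y.
have -> : qproj x + qproj y = qproj (x + y) by exact: qaddE.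
by rewrite !qscaleE scalerDr -qaddE.
Qed.
Fact qscaleDl (s : N) : {morph qscale^~ s : a b / a + b}.
Proof.
move=> a b; have [r <-] := gs a; have [r' <-] := gs b; elim/qind: s => x.
by rewrite -rmorphD !qscaleE scalerDl -qaddE.
Qed.
HB.instance Definition _ := GRing.Zmodule_isLmodule.Build R' N qscaleA qscale1 qscaleDr qscaleDl.
Lemma qproj_lin (r : R) x y : qproj (r *: x + y) = g r *: qproj x + qproj y.
Proof. by rewrite -[RHS]/(qadd (qscale _ _) _) qscaleE qaddE. Qed.
Lemma qproj0 x : qproj x = 0 <-> D x.
Proof. by rewrite -[0 in X in X <-> _]/(qproj 0) qprojP subr0. Qed.
End Quot.

Section TensorSurj.
Variables (R R' : comNzRingType) (g : {rmorphism R -> R'}) (gs : forall r', exists r, g r = r').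
Variables (M : lmodType R) (M' : lmodType R') (F : M -> M').
Hypothesis Fl : forall (r : R) s t, F (r *: s + t) = g r *: F s + F t.

(** The image of F is an R'-submodule because g is onto. The projection of M' onto its quotient by
    the image and the zero map agree on the image, hence everywhere. *)
Lemma tensor_surj : is_tensor g F -> forall t, exists s, F s = t.
Proof.
move=> ten t; pose D (t : M') := exists s, F s = t.
have hD : sub_closed D.
  split; first by exists 0; rewrite (semilin0 Fl).
  move=> r' _ _ [x <-] [y <-]; have [r <-] := gs r'; exists (r *: x + y); exact: Fl.
have ids : forall r' : R', exists r, (idfun : {rmorphism R' -> R'}) r = r' by move=> r; exists r.
have hk k x : (idfun : {rmorphism R' -> R'}) k = 0 -> D (k *: x).
  by move=> /= ->; rewrite scale0r; case: hD.
apply/(qproj0 ids hD hk).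
apply: (tensor_uniq (u := @qproj _ _ _ ids _ _ hD hk) (v := fun=> 0) Fl ten).
- by move=> r x y; rewrite qproj_lin.
- by move=> r x y; rewrite scaler0 addr0.
- by move=> s; apply/qproj0; exists s.
Qed.

(** The quotient of M by [D] is a module over R' = R / ker g, so the projection onto it factors
    through F. *)
Lemma tensor_ker (D : M -> Prop) : is_tensor g F -> sub_closed D ->
  (forall k x, g k = 0 -> D (k *: x)) -> forall s, F s = 0 -> D s.
Proof.
move=> ten hD hk s e; apply/(qproj0 gs hD hk).
have [h' [h1 h2 _]] := ten _ (@qproj _ _ _ gs _ _ hD hk) (qproj_lin gs hD hk).
by rewrite -h2 e (semilin0 (g := idfun) h1).
Qed.

End TensorSurj.

(** The polynomials f and g involve different variables. Comparing leading coefficients in y, that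
    of P is a multiple of f, so its degree in x is at least that of f unless P = 0. *)
Lemma coprime_regular (R : comNzRingType) (f g : {poly R}) (P Q : {poly {poly R}}) :
  f \is monic -> g \is monic -> map_poly polyC g * P = f%:P * Q ->
  (forall q : nat, (size (P`_q)%R < size f)%N) -> P = 0.
Proof.
move=> mf mg e sP; apply/eqP; apply: contraTT isT => P0.
have mG : map_poly polyC g \is monic by apply: monic_map.
have := lead_coef_monicM P mG; rewrite e /lead_coef coefCM -/(lead_coef P) => eL.
have := sP (size P).-1; rewrite -/(lead_coef P) -eL.
set h := Q`_ _; have [h0|h0] := eqVneq h 0.
  by move: eL; rewrite -/h h0 mulr0 => /esym/eqP; rewrite lead_coef_eq0 (negPf P0).
rewrite size_monicM // ltnNge; have : (0 < size h)%N by rewrite lt0n size_poly_eq0.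
case: (size h) => // k _; rewrite addnS /=; by rewrite leq_addr.
Qed.

Lemma expo_edge (p q N : nat) : (p%:Z - N%:Z + q%:Z <= 0) -> 0 <= q%:Z -> (N <= p)%N ->
  expo (p%:Z - N%:Z, q%:Z) ord0 = 0.
Proof. rewrite /expo /=; lia. Qed.

(** * Rigidity of morphisms that vanish at infinity *)

Section Rigid.
Variables (K : closedFieldType) (n : nat).
Implicit Types (R : comAlgType K).

Lemma lmor_act R R' (g : {rmorphism R -> R'}) (S : qcoh R) (dl : forall I, sec S I -> laurent R')
    I c (s : sec S I) : lmor g dl -> in_O I c -> dl I (act c s) = Lmap g c * dl I s.
Proof.
case=> dl1 dl2 _ _ hc; rewrite /act (semilin_sum (dl1 I)) [in RHS](laur_expand c) (raddf_sum (Lmap g)).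
rewrite mulr_suml big_seq [RHS]big_seq; apply: eq_bigr => m; rewrite mem_finsupp => /hc hm.
by rewrite (semilinZ (dl1 I)) dl2 // /= LmapZ Lmap_mono scalerAl.
Qed.

Fact c1_neq0 : [set o1] != set0 :> {set 'I_3}. Proof. by apply/set0Pn; exists o1; rewrite inE. Qed.
Fact c2_neq0 : [set o2] != set0 :> {set 'I_3}. Proof. by apply/set0Pn; exists o2; rewrite inE. Qed.
Fact aff_neq0 : aff_chart != set0. Proof. by apply/set0Pn; exists o0; rewrite inE. Qed.
Definition ch0 : chart := exist _ aff_chart aff_neq0.
Definition ch1 : chart := exist _ [set o1] c1_neq0.
Definition ch2 : chart := exist _ [set o2] c2_neq0.
Lemma csub_torus I : csub I torus_chart. Proof. exact: subsetT. Qed.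
Lemma ch1_inf : chart_inf ch1. Proof. by rewrite /chart_inf inE. Qed.

Variables (R : comAlgType K) (J : hilb n R) (S : framed n R).
Hypothesis ES : Emb 0 J S.
Variable dl : forall I, sec S I -> laurent R.
Hypothesis dlm : lmor id dl.
Hypothesis dlf : forall I k, chart_inf I -> atinf0 (dl (frame S I k)).

(* J contains monic polynomials f(x) and g(y).  The value of dl at (0, f) has x-degree
   less than that of f by the vanishing at infinity, and g dl(0, f) = f dl(0, g), so it is 0. *)
Lemma rigid0 I (s : sec S I) : dl s = 0.
Proof.
have Ji := hilb_is_ideal J; have lf := hilb_lf J.
have [io H sf] := ES; have [d1 d2 d3 d4] := dlm.
have dl_eq I1 I2 (x : sec S I1) (y : sec S I2) m : (forall k, io I1 x k = mono m * io I2 y k) ->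
    dl x = mono m * dl y.
  move=> e; rewrite -(d3 I1 torus_chart (csub_torus _)) -(d3 I2 torus_chart (csub_torus _)).
  rewrite -d2; last by rewrite regularE !inE.
  congr (dl _); apply: (io_inj H) => k; rewrite (io_mon H); last by rewrite regularE !inE.
  by rewrite !(io_res H) ?csub_torus // e.
have D0E I' c : Dexp 0 J I' c <-> [/\ in_O I' (c k0), in_O I' (c k1) & Jloc J (sval I') (c k1)].
  have e : c k1 - toL 0 * c k0 = c k1 by rewrite toL0 mul0r subr0.
  by split=> -[a b]; rewrite ?e => h; split; rewrite ?e.
have hatinf I' (hI' : chart_inf I') (x : sec S I') k :
    (forall k' m, expo m ord0 = 0 -> io I' x k' m = ((k == k') && (m == 0))%:R) -> atinf0 (dl x).
  move=> e; have hv : vanish_inf (x - frame S I' k).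
    apply/(emb_vanish Ji H) => // k' m hm.
    by rewrite (io_sub H) lcoefB e // sf // subrr.
  have := lmor_vanish dlm hI' hv; have -> : dl (x - frame S I' k) = dl x - dl (frame S I' k).
    by rewrite -scaleN1r addrC d1 scaleN1r addrC.
  by move=> h1 m hm; have := h1 m hm; rewrite lcoefB dlf // subr0.
have [e0 he0] : exists x : sec S ch0, io _ x = mk2 1 0.
  by apply: (io_ex H); apply/D0E; split; rewrite /mk2 /=; [exact: inOs1|exact: inOs0|exact: Jloc0].
have [e1 he1] : exists x : sec S ch1, io _ x = mk2 1 0.
  by apply: (io_ex H); apply/D0E; split; rewrite /mk2 /=; [exact: inOs1|exact: inOs0|exact: Jloc0].
(* The value at (1, 0) is regular on C^2 and on U_1, so it is a constant, and the condition at
   infinity makes it 0. *)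
have E0 : dl e0 = 0.
  have ee : dl e0 = dl e1.
    by have := dl_eq ch0 ch1 e0 e1 0; rewrite mono0 mul1r; apply => k; rewrite mul1r he0 he1.
  have h1 : atinf0 (dl e0).
    rewrite ee; apply: (hatinf ch1 ch1_inf e1 k0) => k' m hm; rewrite he1 /mk2.
    by case: (ord2 k') => -> /=; rewrite ?lcoef1 ?lcoef0.
  apply: laurP => m; rewrite lcoef0; apply/eqP; apply: contraTT isT => hm.
  have := d4 _ e0 m hm; rewrite regular_aff /nonneg.
  rewrite ee in hm; have := d4 _ e1 m hm; rewrite regularE !inE /= => /andP[h2 _].
  move=> /andP[h3 h4]; rewrite -ee in hm; move: hm; rewrite h1 ?eqxx // /expo /=; lia.
have [f mf Jf] := lf_integral Ji 'X%:P lf; have [g mg Jg] := lf_integral Ji 'X lf.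
rewrite evA_X in Jf; rewrite evA_Y in Jg.
have secJ Q : J Q -> exists x : sec S ch0, io _ x = mk2 0 (toL Q).
  move=> JQ; apply: (io_ex H); apply/D0E; split; rewrite /mk2 /=; [exact: inOs0| |exact: Jloc_toL].
  by apply: inOs_toL; rewrite inE.
have [sF hF] := secJ _ Jf; have [sG hG] := secJ _ Jg.
pose N := (size f).-1.
have sfN : size f = N.+1 by rewrite prednK // lt0n size_poly_eq0 monic_neq0.
(* As f is monic of degree N, x^(-N) f is regular on U_1 and restricts to 1 on L_oo, so (0, x^(-N)
   f) agrees there with the second framing vector. *)
pose fh : laurent R := mono (- N%:Z, 0) * toL f%:P.
have fhE m : fh m = coefxy f%:P (m.1 + N%:Z, m.2).
  rewrite /fh lcoef_mono toLE; congr (coefxy _ (_, _)); rewrite /= ?opprK //; lia.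
have fc m : coefxy f%:P m = if m.2 == 0 then (if m.1 is Posz p then f`_p else 0) else 0.
  case: m => [[p|p] [[|q]|q]] //=; rewrite coefC //= coef0 //.
have fhO : inOs [set o1] fh.
  move=> m; rewrite fhE fc regularE !inE /=; have [e2|_] := eqVneq m.2 0; last by rewrite eqxx.
  case E : (m.1 + N%:Z) => [p|p]; last by rewrite eqxx.
  move=> hp; have : (p <= N)%N by rewrite leqNgt; apply: contraNN hp => hp; rewrite nth_default // sfN.
  by lia.
have [sF1 hF1] : exists x : sec S ch1, io _ x = mk2 0 fh.
  apply: (io_ex H); apply/D0E; split; rewrite /mk2 /=; [exact: inOs0|exact: fhO|].
  apply: JlocM => //; last exact: Jloc_toL.
  by apply: inOs_mono; rewrite regularE !inE.
have eF1 : dl sF1 = mono (- N%:Z, 0) * dl sF.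
  apply: dl_eq => k; rewrite hF1 hF /mk2; case: (ord2 k) => -> //=; by rewrite mulr0.
have aF1 : atinf0 (dl sF1).
  apply: (hatinf ch1 ch1_inf sF1 k1) => k' m hm; rewrite hF1 /mk2.
  case: (ord2 k') => -> /=; first by rewrite lcoef0.
  rewrite fhE fc /=; move: hm; rewrite /expo /= => hm.
  case: m hm => m1 m2 /= hm; case: eqP => [e|ne].
    have -> : m1 = 0 by lia.
    rewrite e add0r eqxx; have /monicP := mf; by rewrite /lead_coef.
  by case: eqP => // -[_ e]; case: ne.
have phiP : polyL (dl sF) by apply/inOs_aff; exact: (d4 ch0 sF).
have psiP : polyL (dl sG) by apply/inOs_aff; exact: (d4 ch0 sG).
have actE c (x : sec S ch0) : in_O ch0 c -> dl (act c x) = c * dl x.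
  move=> hc; rewrite (@lmor_act _ _ idfun _ _ _ _ _ dlm hc).
  by rewrite Lmap_id.
have tO P : in_O ch0 (toL P : laurent R) by apply: inOs_toL; rewrite inE.
have eFG : toL (map_poly polyC g) * dl sF = toL f%:P * dl sG.
  rewrite -!actE //; congr (dl _); apply: (io_inj H) => k; rewrite !(io_act H) // hF hG /mk2.
  by case: (ord2 k) => -> /=; rewrite ?mulr0 // mulrC.
have phi0 : dl sF = 0.
  rewrite -(fromLK phiP); suff -> : fromL (dl sF) = 0 by rewrite toL0.
  apply: (@coprime_regular R f g _ (fromL (dl sG))) => //.
    by apply: (@toL_inj R); rewrite !toLM !fromLK.
  move=> q; rewrite sfN ltnS; apply/leq_sizeP => p hp.
  have -> : (fromL (dl sF))`_q`_p = dl sF (p%:Z, q%:Z).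
    by rewrite -{2}(fromLK phiP) toLE.
  apply/eqP; apply: contraTT isT => hne.
  have e1' : dl sF1 (p%:Z - N%:Z, q%:Z) = dl sF (p%:Z, q%:Z).
    by rewrite eF1 lcoef_mono; congr (fun_of_fsfun _ _); congr pair; rewrite /=; lia.
  have hne1 : dl sF1 (p%:Z - N%:Z, q%:Z) != 0 by rewrite e1'.
  have := d4 _ sF1 _ hne1; rewrite regularE !inE /= => h.
  have /andP[h1' h2'] := h.
  have hz : expo (p%:Z - N%:Z, q%:Z) ord0 = 0 by apply: expo_edge.
  by rewrite aF1 ?eqxx in hne1.
(* Linearity gives f dl(0, Q) = Q dl(0, f) = 0, and the monic f is not a zero divisor. *)
have dlJ Q (x : sec S ch0) : io _ x = mk2 0 (toL Q) -> dl x = 0.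
  move=> ex; have xP : polyL (dl x) by apply/inOs_aff; exact: (d4 ch0 x).
  have e : toL f%:P * dl x = 0.
    have -> : toL f%:P * dl x = toL Q * dl sF.
      rewrite -!actE //; congr (dl _); apply: (io_inj H) => k; rewrite !(io_act H) // hF ex /mk2.
      by case: (ord2 k) => -> /=; rewrite ?mulr0 // mulrC.
    by rewrite phi0 mulr0.
  rewrite -(fromLK xP); suff -> : fromL (dl x) = 0 by rewrite toL0.
  have e2 : f%:P * fromL (dl x) = 0.
    by apply: (@toL_inj R); rewrite toLM fromLK // e toL0.
  apply/polyP => q; rewrite coef0; apply/eqP; apply: contraTT isT => h0.
  have := congr1 (fun P : {poly {poly R}} => P`_q) e2; rewrite coefCM coef0 => e3.
  have h1 : (0 < size ((fromL (dl x))`_q)%R)%N by rewrite lt0n size_poly_eq0.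
  have := size_monicM mf h0; rewrite e3 size_poly0 sfN.
  by case: (size _) h1 => // k _; rewrite addSn addnS.
have dl0 (x : sec S ch0) : dl x = 0.
  have /D0E[ha hb /Jloc_aff[Q JQ eQ]] := io_D H x.
  have [sQ hQ] := secJ Q JQ.
  have -> : x = act (io _ x k0) e0 + sQ.
    apply: (io_inj H) => k; rewrite (io_add H) (io_act H) // he0 hQ /mk2.
    by case: (ord2 k) => -> /=; rewrite ?mulr1 ?addr0 ?mulr0 ?add0r.
  by rewrite -[act _ _]scale1r d1 actE // E0 (dlJ Q) // mulr0 scaler0 addr0.
have /D0E[ha hb hJ] := io_D H s.
have [k [[Q eQ] [Q' [JQ' eQ']]]] := evt_ex (evt_and (inOs_aff_up (inOs0U ha)) (Jloc_up Ji hJ)).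
have [x hx] : exists x : sec S ch0, io _ x = mk2 (toL Q) (toL Q').
  by apply: (io_ex H); apply/D0E; split; rewrite /mk2 /=; [exact: tO|exact: tO|exact: Jloc_toL].
have : dl x = mono (mu (sval I) k) * dl s.
  by apply: dl_eq => j; rewrite hx /mk2; case: (ord2 j) => -> /=; rewrite ?eQ ?eQ'.
by rewrite dl0 => e; apply: (@mono_inj R (mu (sval I) k)); rewrite mulr0.
Qed.
End Rigid.

(** Restriction of scalars along h, as a separate type that carries the R-module structure. *)
Definition rs (R R' : comNzRingType) (h : {rmorphism R -> R'}) (N : lmodType R') : Type := N.
Section Restrict.
Variables (R R' : comNzRingType) (h : {rmorphism R -> R'}) (N : lmodType R').
HB.instance Definition _ := GRing.Zmodule.on (rs h N).
Definition rs_scale (r : R) (x : rs h N) : rs h N := (h r *: (x : N)).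
Fact rs_A a b x : rs_scale a (rs_scale b x) = rs_scale (a * b) x.
Proof. by rewrite /rs_scale scalerA rmorphM. Qed.
Fact rs_1 : left_id 1 rs_scale. Proof. by move=> x; rewrite /rs_scale rmorph1 scale1r. Qed.
Fact rs_Dr : right_distributive rs_scale +%R.
Proof. by move=> r x y; rewrite /rs_scale scalerDr. Qed.
Fact rs_Dl x : {morph rs_scale^~ x : a b / a + b}.
Proof. by move=> a b; rewrite /rs_scale rmorphD scalerDl. Qed.
HB.instance Definition _ := GRing.Zmodule_isLmodule.Build R (rs h N) rs_A rs_1 rs_Dr rs_Dl.
End Restrict.

(** * Composition and cancellation of base changes *)

Section TensorComp.
Variables (R R' R'' : comNzRingType) (g : {rmorphism R -> R'}) (h : {rmorphism R' -> R''}) (f : {rmorphism R -> R''}).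
Hypothesis fE : forall r, f r = h (g r).

Lemma tensor_uniq_rs (M : lmodType R) (M' : lmodType R') (N : lmodType R'') (F : M -> M') (u v : M' -> N) :
  (forall (r : R) s t, F (r *: s + t) = g r *: F s + F t) -> is_tensor g F ->
  (forall (r : R') s t, u (r *: s + t) = h r *: u s + u t) ->
  (forall (r : R') s t, v (r *: s + t) = h r *: v s + v t) ->
  (forall s, u (F s) = v (F s)) -> u =1 v.
Proof. move=> Fl ten ul vl e; exact: (@tensor_uniq _ _ g M M' (rs h N) F u v Fl ten ul vl e). Qed.

Lemma tensor_comp (M : lmodType R) (M' : lmodType R') (M'' : lmodType R'') (F : M -> M') (G : M' -> M'') :
  (forall (r : R) s t, F (r *: s + t) = g r *: F s + F t) ->
  (forall (r : R') s t, G (r *: s + t) = h r *: G s + G t) ->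
  is_tensor g F -> is_tensor h G -> is_tensor f (fun s => G (F s)).
Proof.
move=> Fl Gl tF tG N k kl.
have kl' (r : R) s t : k (r *: s + t) = g r *: (k s : rs h N) + k t by rewrite kl fE.
have [k1 [k1l k1F k1u]] := tF (rs h N) k kl'.
have [k2 [k2l k2G k2u]] := tG N k1 k1l.
exists k2; split=> // [s|k3 k3l k3e]; first by rewrite k2G k1F.
apply: k2u => // s; apply: (k1u (fun s => k3 (G s))) => // r x y; by rewrite Gl k3l.
Qed.

Lemma tensor_descend (M : lmodType R) (M' : lmodType R') (M'' : lmodType R'') (F : M -> M') (H : M -> M'') :
  (forall (r : R) s t, F (r *: s + t) = g r *: F s + F t) ->
  (forall (r : R) s t, H (r *: s + t) = f r *: H s + H t) ->
  is_tensor g F -> is_tensor f H -> exists G : M' -> M'',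
    [/\ forall (r : R') s t, G (r *: s + t) = h r *: G s + G t, forall s, G (F s) = H s & is_tensor h G].
Proof.
move=> Fl Hl tF tH.
have Hl' (r : R) s t : H (r *: s + t) = g r *: (H s : rs h M'') + H t by rewrite Hl fE.
have [G [Gl GF Gu]] := tF (rs h M'') H Hl'.
exists G; split=> // N k kl.
have kl' (r : R) s t : k (F (r *: s + t)) = f r *: k (F s) + k (F t) by rewrite Fl kl fE.
have [k' [k'l k'H k'u]] := tH N (fun s => k (F s)) kl'.
have k'G : (fun t => k' (G t)) =1 k.
  apply: (tensor_uniq_rs Fl tF) => // [r s t|s]; first by rewrite Gl k'l.
  by rewrite GF k'H.
exists k'; split=> // k'' k''l e; apply: k'u => // s; by rewrite -GF e.
Qed.
End TensorComp.

Section Pull.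
Variables (K : closedFieldType) (n : nat).
Implicit Types (R : comAlgType K).

Definition pb R R' (g : {lrmorphism R -> R'}) (S : qcoh R) (S' : qcoh R') (F : forall I, sec S I -> sec S' I) :=
  [/\ forall I (r : R) s s', F I (r *: s + s') = g r *: F I s + F I s',
      forall I m, regular (sval I) m -> forall s, F I (mon S m s) = mon S' m (F I s),
      forall I J, csub I J -> forall s, F J (res S J s) = res S' J (F I s) &
      forall I, is_tensor g (F I)].

Lemma bweight1 R m : bweight (torus1 R) m = 1.
Proof.
have e z : gm_pow (gm1 R) z = 1 by case: z => j /=; rewrite expr1n.
by rewrite /bweight !e mulr1.
Qed.

Lemma pbE R R' (g : {lrmorphism R -> R'}) (S : qcoh R) (S' : qcoh R') F :
  is_pullback (S := S) (S' := S') g (torus1 R') F <-> pb g F.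
Proof.
split=> -[h1 h2 h3 h4]; split=> // I m hm s; first by rewrite h2 // bweight1 scale1r.
by rewrite bweight1 scale1r h2.
Qed.

Lemma pullsE R R' (g : {lrmorphism R -> R'}) (S : framed n R) (S' : framed n R') : pulls g S S' <->
  exists2 F, pb (S := S) (S' := S') g F &
    forall I k, chart_inf I -> vanish_inf (F I (frame S I k) - frame S' I k).
Proof.
by split=> -[F pF fF]; exists F => [|I k hI]; try (by apply/pbE); have := fF I k hI; rewrite /= scale1r.
Qed.

Lemma pb_vanish R R' (g : {lrmorphism R -> R'}) (S : qcoh R) (S' : qcoh R') F I s :
  pb (S := S) (S' := S') g F -> vanish_inf s -> vanish_inf (F I s).
Proof. by case=> _ hm _ _ [m [s' [h1 h2 ->]]]; exists m, (F I s'); rewrite hm. Qed.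

Lemma pulls_comp R R' R'' (g : {lrmorphism R -> R'}) (h : {lrmorphism R' -> R''}) (f : {lrmorphism R -> R''})
    (S : framed n R) (S1 : framed n R') (S2 : framed n R'') :
  (forall r, f r = h (g r)) -> pulls g S S1 -> pulls h S1 S2 -> pulls f S S2.
Proof.
move=> fE /pullsE[F pF fF] /pullsE[G pG fG]; have [f1 f2 f3 f4] := pF; have [g1 g2 g3 g4] := pG.
apply/pullsE; exists (fun I s => G I (F I s)).
  split=> [I r s t|I m hm s|I J hI s|I].
  - by rewrite f1 g1 fE.
  - by rewrite f2 // g2.
  - by rewrite f3 // g3.
  - exact: (tensor_comp fE (f1 I) (g1 I) (f4 I) (g4 I)).
move=> I k hI.
have -> : G I (F I (frame S I k)) - frame S2 I k =
    G I (F I (frame S I k) - frame S1 I k) + (G I (frame S1 I k) - frame S2 I k).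
  by rewrite (semilinB (g1 I)) addrA subrK.
apply: vanishD => //; last exact: fG.
exact: pb_vanish pG (fF I k hI).
Qed.

(** The universal property of S1 gives the map to S2, and that of S2 over S makes it a base change;
    compatibilities are checked on the image of S, which determines them. *)
Lemma pulls_descend R R' R'' (g : {lrmorphism R -> R'}) (h : {lrmorphism R' -> R''}) (f : {lrmorphism R -> R''})
    (S : framed n R) (S1 : framed n R') (S2 : framed n R'') :
  (forall r, f r = h (g r)) -> pulls g S S1 -> pulls f S S2 -> pulls h S1 S2.
Proof.
move=> fE /pullsE[F pF fF] /pullsE[H pH fH]; have [f1 f2 f3 f4] := pF; have [h1 h2 h3 h4] := pH.
pose G I := sval (cid (tensor_descend fE (f1 I) (h1 I) (f4 I) (h4 I))).
have GP I : [/\ forall (r : R') s t, G I (r *: s + t) = h r *: G I s + G I t,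
    forall s, G I (F I s) = H I s & is_tensor h (G I)] by rewrite /G; case: cid.
have pG : pb (S := S1) (S' := S2) h G.
  split=> [I|I m hm|I J hI|I]; have [q1 q2 q3] := GP I => //.
  - apply: (tensor_uniq_rs (h := h) (f1 I) (f4 I)) => [r s t|r s t|s].
    + by rewrite (mon_linear hm) q1.
    + by rewrite q1 (mon_linear hm).
    + by rewrite -f2 // !q2 h2.
  - have [q1' q2' q3'] := GP J; apply: (tensor_uniq_rs (h := h) (f1 I) (f4 I)) => [r s t|r s t|s].
    + by rewrite (res_linear hI) q1'.
    + by rewrite q1 (res_linear hI).
    + by rewrite -f3 // q2 q2' h3.
apply/pullsE; exists G => // I k hI; have [q1 q2 q3] := GP I.
have -> : G I (frame S1 I k) - frame S2 I k =
    (H I (frame S I k) - frame S2 I k) - G I (F I (frame S I k) - frame S1 I k).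
  by rewrite (semilinB q1) q2 opprB [RHS]addrC addrA subrK.
apply: vanishD => //; [exact: fH|apply: vanishN]; exact: pb_vanish pG (fF I k hI).
Qed.

Lemma vanish0 R (S : qcoh R) I : chart_inf I -> vanish_inf (0 : sec S I).
Proof.
move=> hI; have hz : regular (sval I) (zinf (sval I)) by apply: zinf_reg => //; apply: chart_neq0.
exists (zinf (sval I)), 0; split=> //; first by rewrite zinf_expo.
by rewrite (semilin0 (g := idfun) (mon_linear hz)).
Qed.

Lemma pulls_id R (f : {lrmorphism R -> R}) (S : framed n R) : (forall r, f r = r) -> pulls f S S.
Proof.
move=> fE; apply/pullsE; exists (fun I s => s) => [|I k hI]; last by rewrite subrr; exact: vanish0.
have tI I : is_tensor f (fun s : sec S I => s); last by split=> // I r s t; rewrite fE.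
move=> N h hl; by exists h; split=> // r s t; rewrite hl (_ : _ r = r) //; exact: fE.
Qed.

Lemma lmor_pull R R' (R'' : comAlgType K) (g : {lrmorphism R -> R'}) (h : R' -> R'') (S : qcoh R) (S' : qcoh R')
    F dl : pb (S := S) (S' := S') g F -> lmor h dl -> lmor (fun r => h (g r)) (fun I s => dl I (F I s)).
Proof.
move=> [f1 f2 f3 f4] [d1 d2 d3 d4]; split=> // [I r s t|I m hm s|I J hI s].
- by rewrite f1 d1.
- by rewrite f2 // d2.
- by rewrite f3 // d3.
Qed.

Lemma fmor_pull R R' (R'' : comAlgType K) (g : {lrmorphism R -> R'}) (h : {rmorphism R' -> R''}) (S : framed n R) (S' : framed n R')
    F Phi : pb (S := S) (S' := S') g F ->
  (forall I k, chart_inf I -> vanish_inf (F I (frame S I k) - frame S' I k)) ->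
  fmor h Phi -> fmor (fun r => h (g r)) (fun I s => Phi I (F I s)).
Proof.
move=> pF fF [h1 h2]; split=> [k|I k hI k' m hm]; first exact: (lmor_pull pF (h1 k)).
rewrite -(h2 I k hI k' m hm); have [l1 _ _ _] := h1 k'.
have := lmor_vanish (h1 k') hI (fF I k hI) hm.
by rewrite (semilinB (l1 I)) lcoefB => /eqP; rewrite subr_eq0 => /eqP.
Qed.

(** For surjective g, [tensor_ker] bounds the kernel of F by any submodule containing (ker g) S; the
    kernel of dl is one. *)
Lemma lmor_descend R R' (R'' : comAlgType K) (g : {lrmorphism R -> R'}) (h : {rmorphism R' -> R''}) (S : qcoh R)
    (S' : qcoh R') F dl : (forall r', exists r, g r = r') -> pb (S := S) (S' := S') g F ->
  lmor (fun r => h (g r)) dl -> exists dl', lmor h (S := S') dl' /\ forall I s, dl' I (F I s) = dl I s.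
Proof.
move=> gs [f1 f2 f3 f4] [d1 d2 d3 d4].
have dl1 I := semilinB (g := h \o g) (d1 I).
have ker I s : F I s = 0 -> dl I s = 0.
  move: s; refine (tensor_ker gs (D := fun s => dl I s = 0) (f4 I) _ _).
    by split=> [|r x y hx hy]; rewrite ?(semilin0 (g := h \o g) (d1 I)) // d1 hx hy scaler0 addr0.
  by move=> k x gk; rewrite (semilinZ (g := h \o g) (d1 I)) /= gk rmorph0 scale0r.
have eqF I s t : F I s = F I t -> dl I s = dl I t.
  move=> e; apply/eqP; rewrite -subr_eq0 -dl1; apply/eqP/ker.
  by rewrite (semilinB (f1 I)) e subrr.
have Fs I := tensor_surj gs (f1 I) (f4 I).
pose G I t := sval (cid (Fs I t)).
have FG I t : F I (G I t) = t by rewrite /G; case: cid.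
have dlG I s : dl I (G I (F I s)) = dl I s by apply: eqF; rewrite FG.
exists (fun I t => dl I (G I t)); split=> //; split=> // [I r s t|I m hm s|I J hI s].
- by have [r' <-] := gs r; rewrite -d1; apply: eqF; rewrite f1 !FG.
- by rewrite -d2 //; apply: eqF; rewrite f2 // !FG.
- by rewrite -(d3 I J hI); apply: eqF; rewrite f3 // !FG.
Qed.

Lemma fmor_descend R R' (R'' : comAlgType K) (g : {lrmorphism R -> R'}) (h : {rmorphism R' -> R''}) (S : framed n R)
    (S' : framed n R') F Phi : (forall r', exists r, g r = r') -> pb (S := S) (S' := S') g F ->
  (forall I k, chart_inf I -> vanish_inf (F I (frame S I k) - frame S' I k)) ->
  fmor (fun r => h (g r)) Phi ->
  exists Phi', fmor h (S := S') Phi' /\ forall I s k, Phi' I (F I s) k = Phi I s k.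
Proof.
move=> gs pF fF [h1 h2]; have /choice[dl dlP] := fun k => lmor_descend gs pF (h1 k).
exists (fun I s k => dl k I s); split=> [|I s k]; last by case: (dlP k).
split=> [k|I k hI k' m hm]; first by case: (dlP k).
have [lk ek] := dlP k'; have [l1 _ _ _] := lk.
have := lmor_vanish lk hI (fF I k hI) hm.
by rewrite (semilinB (l1 I)) ek lcoefB => /eqP; rewrite subr_eq0 => /eqP <-; rewrite h2.
Qed.

Lemma rigid_pull R R' (g : {lrmorphism R -> R'}) (J : hilb n R') (S : framed n R) (S0 : framed n R') dl :
  (forall r', exists r, g r = r') -> pulls g S S0 -> Emb 0 J S0 -> lmor g (S := S) dl ->
  (forall I k, chart_inf I -> atinf0 (dl I (frame S I k))) -> forall I s, dl I s = 0.
Proof.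
move=> gs /pullsE[F pF fF] E0 dlm dlf I s.
have [dl' [lm' e]] := lmor_descend (h := idfun) gs pF dlm.
rewrite -e; apply: (rigid0 E0 lm') => I' k hI m hm; have [l1 _ _ _] := lm'.
have := lmor_vanish lm' hI (fF I' k hI) hm.
rewrite (semilinB (g := idfun) (l1 I')) e lcoefB => /eqP; rewrite subr_eq0 => /eqP <-; exact: dlf.
Qed.
End Pull.

(** * Dual numbers *)

Section Map2.
Variables (R R' : comNzRingType) (g : {rmorphism R -> R'}).
Implicit Types P Q : {poly {poly R}}.
Lemma map2D P Q : map2 g (P + Q) = map2 g P + map2 g Q. Proof. exact: raddfD. Qed.
Lemma map2B P Q : map2 g (P - Q) = map2 g P - map2 g Q. Proof. exact: raddfB. Qed.
Lemma map2M P Q : map2 g (P * Q) = map2 g P * map2 g Q. Proof. exact: rmorphM. Qed.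
Lemma map2_0 : map2 g 0 = 0. Proof. exact: raddf0. Qed.
Lemma map2_sum (I : Type) (s : seq I) F : map2 g (\sum_(i <- s) F i) = \sum_(i <- s) map2 g (F i).
Proof. exact: raddf_sum. Qed.
Lemma toLN P : toL (- P) = - toL P. Proof. exact: raddfN. Qed.
Lemma LmapD c d : Lmap g (c + d) = Lmap g c + Lmap g d. Proof. exact: raddfD. Qed.
Lemma LmapB c d : Lmap g (c - d) = Lmap g c - Lmap g d. Proof. exact: raddfB. Qed.
Lemma LmapN c : Lmap g (- c) = - Lmap g c. Proof. exact: raddfN. Qed.
Lemma LmapM c d : Lmap g (c * d) = Lmap g c * Lmap g d. Proof. exact: rmorphM. Qed.
Lemma Lmap0 : Lmap g 0 = 0. Proof. exact: raddf0. Qed.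
End Map2.

Section Dual.
Variables (K : closedFieldType) (R : comAlgType K) (k : nat).
Local Notation D := (dualnum R k).
Local Notation aug := (@dual_aug K R k).
Local Notation cst := (@dual_const K R k).
Local Notation A := {poly {poly R}}.
Local Notation AD := {poly {poly D}}.

Definition eps (l : 'I_k) : D := (0, delta_mx 0 l).

Lemma dualP (x y : D) : x.1 = y.1 -> (forall l, x.2 0 l = y.2 0 l) -> x = y.
Proof. by case: x y => [a v] [b w] /= -> e; congr pair; apply/rowP. Qed.
Lemma dual_add2 (x y : D) l : (x + y).2 0 l = x.2 0 l + y.2 0 l.
Proof. by rewrite mxE. Qed.
Lemma dual_mul2 (x y : D) l : (x * y).2 0 l = x.1 * y.2 0 l + y.1 * x.2 0 l.
Proof. by rewrite !mxE. Qed.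
Lemma dual_sum1 (I : Type) (s : seq I) (F : I -> D) : (\sum_(i <- s) F i).1 = \sum_(i <- s) (F i).1.
Proof. by elim: s => [|i s IH]; rewrite ?big_nil // !big_cons -IH. Qed.
Lemma dual_sum2 (I : Type) (s : seq I) (F : I -> D) l :
  (\sum_(i <- s) F i).2 0 l = \sum_(i <- s) (F i).2 0 l.
Proof. by elim: s => [|i s IH]; rewrite ?big_nil ?mxE // !big_cons -IH mxE. Qed.
Lemma epsM1 l (x : D) : (eps l * x).1 = 0. Proof. exact: mul0r. Qed.
Lemma epsM2 l (x : D) l' : (eps l * x).2 0 l' = x.1 * (l' == l)%:R.
Proof. by rewrite dual_mul2 /= mul0r add0r mxE eqxx. Qed.
Lemma eps_eps l l' : eps l * eps l' = 0.
Proof. by apply: dualP => [|i]; rewrite ?epsM1 // epsM2 mul0r mxE. Qed.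
Lemma dual_split (x : D) : x = cst x.1 + \sum_l eps l * cst (x.2 0 l).
Proof.
apply: dualP => [|i].
  rewrite /= -[X in _ = _ + X]/((\sum_l eps l * cst (x.2 0 l)).1) dual_sum1 big1 ?addr0 // => l _.
  exact: epsM1.
rewrite dual_add2 dual_sum2 [X in X + _]mxE add0r (bigD1 i) // epsM2 eqxx mulr1 big1 => [|l /negPf h].
  by rewrite /= addr0.
by rewrite epsM2 eq_sym h mulr0.
Qed.
Lemma aug_surj r : exists x : D, aug x = r. Proof. by exists (cst r). Qed.

Definition Lcomp (l : 'I_k) (c : laurent D) : laurent R := mkL (finsupp c) (fun m => (c m).2 0 l).
Lemma LcompE l c m : Lcomp l c m = (c m).2 0 l.
Proof. by rewrite /Lcomp mkLE; case: finsuppP => //; rewrite mxE. Qed.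
Lemma LcompD l c d : Lcomp l (c + d) = Lcomp l c + Lcomp l d.
Proof. by apply: laurP => m; rewrite lcoefD !LcompE lcoefD dual_add2. Qed.
Lemma LcompZ l (x : D) c : Lcomp l (x *: c) = x.1 *: Lcomp l c + x.2 0 l *: Lmap aug c.
Proof.
by apply: laurP => m; rewrite lcoefD !lcoefZ !LcompE LmapE lcoefZ dual_mul2; congr (_ + _); rewrite mulrC.
Qed.
Lemma Lcomp_mono l m c : Lcomp l (mono m * c) = mono m * Lcomp l c.
Proof. by apply: laurP => m'; rewrite lcoef_mono !LcompE lcoef_mono. Qed.
Lemma inOs_Lcomp B l c : inOs B c -> inOs B (Lcomp l c).
Proof. by move=> h m hm; apply: h; apply: contraNneq hm => e; rewrite LcompE e mxE. Qed.
Lemma Lcomp_cst l c : Lcomp l (Lmap cst c) = 0.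
Proof. by apply: laurP => m; rewrite LcompE LmapE mxE lcoef0. Qed.
Lemma Lmap_aug_cst c : Lmap aug (Lmap cst c) = c.
Proof. by apply: laurP => m; rewrite !LmapE. Qed.
Lemma Lsplit c : c = Lmap cst (Lmap aug c) + \sum_l eps l *: Lmap cst (Lcomp l c).
Proof.
apply: laurP => m; rewrite lcoefD !LmapE lcoef_sum {1}[c m]dual_split; congr (_ + _).
by apply: eq_bigr => l _; rewrite lcoefZ LmapE LcompE.
Qed.
Lemma LdualP c d : Lmap aug c = Lmap aug d -> (forall l, Lcomp l c = Lcomp l d) -> c = d.
Proof. by move=> e h; rewrite (Lsplit c) e [RHS]Lsplit; congr (_ + _); apply: eq_bigr => l _; rewrite h. Qed.
Lemma inOs_Lmap (R1 R2 : comNzRingType) (g : {rmorphism R1 -> R2}) B c : inOs B c -> inOs B (Lmap g c).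
Proof. by move=> h m hm; apply: h; apply: contraNneq hm => e; rewrite LmapE e rmorph0. Qed.

Definition pcomp (l : 'I_k) (P : AD) : A := fromL (Lcomp l (toL P)).
Definition pdual (l : 'I_k) (P : A) : AD := (eps l)%:P%:P * map2 cst P.
Lemma toL_pcomp l P : toL (pcomp l P) = Lcomp l (toL P).
Proof.
by apply: fromLK => m hm; apply: (@toL_polyL _ P); apply: contraNneq hm => e; rewrite LcompE e mxE.
Qed.
Lemma toL_pdual l P : @toL D (pdual l P) = eps l *: Lmap cst (toL P).
Proof. by rewrite toLZ toL_map. Qed.
Lemma pdual_map l P : map_xy aug (pdual l P) = 0.
Proof.
apply: (@toL_inj R); rewrite toL_map toL_pdual LmapZ toL0.
by apply: laurP => m; rewrite lcoefZ mul0r lcoef0.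
Qed.
Lemma psplit P : P = map2 cst (map_xy aug P) + \sum_l pdual l (pcomp l P).
Proof.
apply: (@toL_inj D); rewrite toLD toL_map toL_map (raddf_sum (@toL D)) /= {1}[toL P]Lsplit; congr (_ + _).
by apply: eq_bigr => l _; rewrite -toL_pcomp; exact: esym (toL_pdual _ _).
Qed.
Lemma pdualD l P Q : pdual l (P + Q) = pdual l P + pdual l Q.
Proof. by apply: (@toL_inj D); rewrite toLD !toL_pdual toLD LmapD scalerDr. Qed.
Lemma pdualN l P : pdual l (- P) = - pdual l P.
Proof.
by apply: (@toL_inj D); rewrite toLN !toL_pdual toLN LmapN scalerN.
Qed.
Lemma pdualM l P Q : pdual l (map_xy aug P * Q) = P * pdual l Q.
Proof.
apply: (@toL_inj D); rewrite toL_pdual [RHS]toLM toL_pdual toLM toL_map; move: (toL P) (toL Q) => c d.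
rewrite LmapM {2}[c]Lsplit mulrDl mulr_suml big1 ?addr0 -?scalerAr // => l' _.
by rewrite -scalerAl -scalerAr scalerA eps_eps scale0r.
Qed.
End Dual.
Arguments eps {K R k} l.

Lemma split_id (S : comNzRingType) (x1 x2 x3 x4 x5 : S) :
  x1 * (x2 + x3 + x4) - (x1 * x4 + x5) = x1 * x3 + (x1 * x2 - x5).
Proof. ring. Qed.

Section DualIdealLf.
Variables (R D : comNzRingType) (k n : nat) (aug : {rmorphism D -> R}) (cst : {rmorphism R -> D}).
Variable e : 'I_k -> D.
Local Notation A := {poly {poly R}}.
Local Notation AD := {poly {poly D}}.
Let pd l (Q : A) : AD := (e l)%:P%:P * map2 cst Q.
Hypothesis augK : forall r, aug (cst r) = r.
Hypothesis dsplit : forall x, exists y : 'I_k -> R, x = cst (aug x) + \sum_l e l * cst (y l).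
Hypothesis psplit : forall P, exists Q : 'I_k -> A, P = map2 cst (map2 aug P) + \sum_l pd l (Q l).
Variables (J : A -> Prop) (H : AD -> Prop).
Hypotheses (Ji : is_ideal J) (lfJ : lf_ideal J n) (Hi : is_ideal H) (HJ : forall P, H P -> J (map2 aug P))
  (JH : forall Q, J Q -> exists P, H P /\ map2 aug P = Q)
  (He : forall Q : 'I_k -> A, H (\sum_l pd l (Q l)) <-> forall l, J (Q l)).

(** A criterion for flat deformations: H maps onto [J], and its part inside the span of the e_l
    consists of copies of [J]. Lifts of a local basis for [J] then form one for H: coordinates are
    found modulo the e_l, and the error, a combination of the e_l, is expanded in the same basis. *)
Lemma dual_ideal_lf_abs : lf_ideal H n.
Proof.
have [l0 [d [w [b [wd lb]]]]] := lfJ.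
have mcst Q : map2 aug (map2 cst Q) = Q.
  apply: (@toL_inj R); rewrite !toL_map; by apply: laurP => m; rewrite !LmapE augK.
have cX r m : cst r ^+ m = cst (r ^+ m) by rewrite rmorphXn.
exists l0, (cst \o d), (cst \o w), (fun j i => map2 cst (b j i)); split.
  by rewrite /= -(rmorph1 cst) -wd rmorph_sum; apply: eq_bigr => j _; rewrite rmorphM.
move=> j; have [sp ind] := lb j; split.
  move=> P; have [N [c hc]] := sp (map2 aug P).
  have [h [Hh eh]] := JH hc.
  pose T := (cst (d j) ^+ N)%:P%:P * P - \sum_i (cst (c i))%:P%:P * map2 cst (b j i) - h.
  have T0 : map2 aug T = 0.
    rewrite /T !map2B eh map2M map2C rmorphXn /= augK map2_sum; apply/eqP; rewrite subr_eq0; apply/eqP; congr (_ - _).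
    by apply: eq_bigr => i _; rewrite map2M map2C mcst ?augK.
  have [Tc eTc] := psplit T; rewrite T0 map2_0 add0r in eTc.
  have spl (l : 'I_k) : evt (fun N' => exists c' : 'I_n -> R,
      J ((d j ^+ N')%:P%:P * Tc l - \sum_i (c' i)%:P%:P * b j i)).
    have [N' [c' h']] := sp (Tc l); exists N' => N2 hN.
    exists (fun i => d j ^+ (N2 - N') * c' i).
    suff -> : (d j ^+ N2)%:P%:P * Tc l - \sum_i (d j ^+ (N2 - N') * c' i)%:P%:P * b j i =
      (d j ^+ (N2 - N'))%:P%:P * ((d j ^+ N')%:P%:P * Tc l - \sum_i (c' i)%:P%:P * b j i).
      by apply: ideal_M.
    rewrite mulrBr mulrA -!polyCM -exprD subnK //; congr (_ - _).
    by rewrite mulr_sumr; apply: eq_bigr => i _; rewrite mulrA -!polyCM.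
  have [N' hN'] := evt_ex (evt_fin spl); have /choice[c' hc'] := hN'.
  (* N clears the denominators modulo the e_l, and N' those of the error term [T]. *)
  exists (N' + N)%N, (fun i => cst (d j ^+ N' * c i) + \sum_l e l * cst (c' l i)).
  have -> : ((cst \o d) j ^+ (N' + N))%:P%:P * P -
      \sum_i (cst (d j ^+ N' * c i) + \sum_l e l * cst (c' l i))%:P%:P * map2 cst (b j i) =
      (cst (d j ^+ N'))%:P%:P * h +
      \sum_l pd l ((d j ^+ N')%:P%:P * Tc l - \sum_i (c' l i)%:P%:P * b j i).
    have eT : (cst (d j ^+ N'))%:P%:P * T = \sum_l pd l ((d j ^+ N')%:P%:P * Tc l).
      rewrite [in LHS]eTc mulr_sumr; apply: eq_bigr => l _.
      by rewrite /pd map2M map2C mulrCA.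
    have eP : (cst (d j) ^+ N)%:P%:P * P = T + h + \sum_i (cst (c i))%:P%:P * map2 cst (b j i).
      by rewrite /T !subrK.
    set X := (cst (d j ^+ N'))%:P%:P in eT *.
    set S1 := \sum_i _ in eP.
    pose E := \sum_l pd l (\sum_i (c' l i)%:P%:P * b j i).
    have e1 : \sum_i (cst (d j ^+ N' * c i) + \sum_l e l * cst (c' l i))%:P%:P * map2 cst (b j i) = X * S1 + E.
      rewrite /S1 /E mulr_sumr; under [X in _ = _ + X]eq_bigr do rewrite /pd /= map2_sum mulr_sumr.
      rewrite exchange_big -big_split; apply: eq_bigr => i _; rewrite !polyCD mulrDl /=; congr (_ + _).
        by rewrite rmorphM !polyCM mulrA.
      rewrite !raddf_sum /= mulr_suml; apply: eq_bigr => l _.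
      by rewrite map2M map2C !polyCM mulrA.
    have e2 : \sum_l pd l ((d j ^+ N')%:P%:P * Tc l - \sum_i (c' l i)%:P%:P * b j i) = X * T - E.
      by under eq_bigr do rewrite /pd map2B mulrBr; rewrite sumrB -eT.
    rewrite e1 e2 /= exprD cX !polyCM -mulrA eP -/X.
    exact: split_id.
  apply: ideal_D => //; first exact: ideal_M.
  by apply/He => l; apply: hc'.
move=> c hc; have /choice[y hy] := fun i => dsplit (c i).
have h1 : J (\sum_i (aug (c i))%:P%:P * b j i).
  have := HJ hc; rewrite map2_sum; congr (J _); apply: eq_bigr => i _.
  by rewrite map2M map2C mcst ?augK.
have [N hN] := ind _ h1.
have h2 (l : 'I_k) : J (\sum_i (d j ^+ N * y i l)%:P%:P * b j i).
  move: l; apply/He.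
  suff -> : \sum_l pd l (\sum_i (d j ^+ N * y i l)%:P%:P * b j i) =
    (cst (d j ^+ N))%:P%:P * \sum_i (c i)%:P%:P * map2 cst (b j i) by apply: ideal_M.
  under eq_bigr do rewrite /pd map2_sum mulr_sumr.
  rewrite exchange_big mulr_sumr; apply: eq_bigr => i _.
  under eq_bigr do rewrite /= map2M map2C mulrA -!polyCM.
  rewrite -mulr_suml -!raddf_sum /= mulrA -!polyCM; congr (_%:P%:P * _).
  rewrite [in RHS](hy i) mulrDr -rmorphM hN rmorph0 add0r mulr_sumr.
  by apply: eq_bigr => l _; rewrite rmorphM mulrCA.
have fin (l : 'I_k) : evt (fun N' => forall i, d j ^+ N' * (d j ^+ N * y i l) = 0).
  have [N' hN'] := ind _ (h2 l); exists N' => N2 hh i.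
  by rewrite -(subnK hh) exprD -mulrA hN' mulr0.
have [N' hN'] := evt_ex (evt_fin fin).
exists (N' + N)%N => i; rewrite /= cX (hy i) exprD !mulrDr rmorphM -mulrA -rmorphM.
rewrite hN rmorph0 mulr0 add0r mulr_sumr big1 // => l _.
by rewrite mulrCA -!rmorphM -mulrA hN' rmorph0 mulr0.
Qed.

End DualIdealLf.

Section DualIdeal.
Variables (K : closedFieldType) (R : comAlgType K) (k n : nat).
Local Notation D := (dualnum R k).
Local Notation aug := (@dual_aug K R k).
Local Notation cst := (@dual_const K R k).
Local Notation A := {poly {poly R}}.
Local Notation AD := {poly {poly D}}.
Variables (J : hilb n R) (H : AD -> Prop).
Hypotheses (Hi : is_ideal H) (HJ : forall P, H P -> J (map_xy aug P))
  (JH : forall Q, J Q -> exists P, H P /\ map_xy aug P = Q)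
  (He : forall Q : 'I_k -> A, H (\sum_l pdual l (Q l)) <-> forall l, J (Q l)).

Lemma dual_ideal_lf : lf_ideal H n.
Proof.
apply: (@dual_ideal_lf_abs R D k n aug cst eps _ _ _ J H (hilb_is_ideal J) (hilb_lf J) Hi HJ JH He) => //.
  by move=> x; exists (fun l => x.2 0 l); exact: dual_split.
by move=> P; exists (fun l => pcomp l P); exact: psplit.
Qed.

Lemma dual_hilb : exists J1 : hilb n D, (forall P, J1 P <-> H P) /\ hilb_pulls aug J1 J.
Proof.
have [h0 hD hM] := Hi; exists (Hilb h0 hD hM dual_ideal_lf); split=> // Q; split=> [JQ|].
  have [P [HP <-]] := JH JQ; exists 1%N, (fun=> P), (fun=> 1); split=> //.
  by rewrite big_ord1 mul1r.
case=> l [P [c [hP ->]]]; apply: (ideal_sum (hilb_is_ideal J)) => i _.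
by apply: (ideal_M (hilb_is_ideal J)); apply: HJ; apply: hP.
Qed.
End DualIdeal.

(** * Extracting an explicit deformation *)

Lemma lmorB (K : closedFieldType) (R R' : comAlgType K) (g : {rmorphism R -> R'}) (S : qcoh R) (d1 d2 : forall I, sec S I -> laurent R') :
  lmor g d1 -> lmor g d2 -> lmor g (fun I s => d1 I s - d2 I s).
Proof.
move=> [a1 a2 a3 a4] [b1 b2 b3 b4]; split=> [I r s t|I m hm s|I J hI s|I s].
- by rewrite a1 b1 scalerBr opprD addrACA.
- by rewrite a2 // b2 // mulrBr.
- by rewrite a3 // b3.
- exact: inOsB (a4 I s) (b4 I s).
Qed.

Lemma lmor_Lmap (K : closedFieldType) (R R' R'' : comAlgType K) (g : R -> R') (h : {rmorphism R' -> R''}) (S : qcoh R)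
    (d : forall I, sec S I -> laurent R') : lmor g d -> lmor (fun r => h (g r)) (fun I s => Lmap h (d I s)).
Proof.
move=> [a1 a2 a3 a4]; split=> [I r s t|I m hm s|I J hI s|I s].
- by rewrite a1 LmapD LmapZ.
- by rewrite a2 // LmapM Lmap_mono.
- by rewrite a3.
- exact: inOs_Lmap (a4 I s).
Qed.

Lemma fmor_Lmap (K : closedFieldType) n (R R' R'' : comAlgType K) (g : R -> R') (h : {rmorphism R' -> R''})
    (S : framed n R) Phi : fmor g (S := S) Phi -> fmor (fun r => h (g r)) (S := S) (fun I s k => Lmap h (Phi I s k)).
Proof.
case=> p1 p2; split=> [k|I k hI k' m hm]; first exact: (lmor_Lmap h (p1 k)).
by rewrite LmapE p2 // rmorph_nat.
Qed.

Lemma fmor_sub (K : closedFieldType) n (R R' : comAlgType K) (g : R -> R') (S : framed n R) P1 P2 :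
  fmor g (S := S) P1 -> fmor g (S := S) P2 -> forall I k k', chart_inf I ->
  atinf0 (P1 I (frame S I k) k' - P2 I (frame S I k) k' : laurent R').
Proof. by move=> [_ a] [_ b] I k k' hI m hm; rewrite lcoefB a // b // subrr. Qed.

Section Tangent.
Variables (K : closedFieldType) (R : comAlgType K) (n : nat) (J : hilb n R).
Local Notation D := (dualnum R 1).
Local Notation aug := (@dual_aug K R 1).
Local Notation cst := (@dual_const K R 1).
Local Notation e := (@eps K R 1 ord0).
Variable v : framed n D.
Hypothesis tv : tangent J v.

Lemma dual1P (x : D) : x = cst x.1 + e * cst (x.2 0 0).
Proof. by rewrite {1}(dual_split x) big_ord1. Qed.
Lemma dual1_aug0 (x : D) : aug x = 0 -> x = e * cst (x.2 0 0).
Proof. by move=> h; rewrite {1}(dual1P x) -[x.1]/(aug x) h raddf0 add0r. Qed.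
Lemma eps_mul0 (x : D) : e * x = 0 -> aug x = 0.
Proof.
move=> h; have := epsM2 ord0 x ord0; rewrite h eqxx mulr1 => /esym; by rewrite mxE.
Qed.

Lemma tangent_rigid dl : lmor aug (S := v) dl -> (forall I k, chart_inf I -> atinf0 (dl I (frame v I k))) ->
  forall I s, dl I s = 0.
Proof.
by have [S0 /in_Z_Emb E0 p0] := tv; apply: rigid_pull (@aug_surj _ _ _) p0 E0.
Qed.

Lemma tangent_fmor_uniq q1 q2 : fmor aug (S := v) q1 -> fmor aug (S := v) q2 -> forall I s k, q1 I s k = q2 I s k.
Proof.
move=> h1 h2 I s k; apply/eqP; rewrite -subr_eq0; apply/eqP.
by apply: (tangent_rigid (lmorB (proj1 h1 k) (proj1 h2 k))) => I' k' hI; apply: fmor_sub h1 h2 _ _ _ hI.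
Qed.

(** Here q is reduction modulo e followed by the inclusion of the special fibre in O^2. The last two
    clauses say that its kernel is e v and contains everything killed by e; the latter is flatness
    over R[e]. *)
Lemma tangent_red : exists q : forall I, sec v I -> 'I_2 -> laurent R,
  [/\ fmor aug q, forall I s, Dexp 0 J I (q I s),
      forall I c, Dexp 0 J I c -> exists s, forall k, q I s k = c k,
      forall I s, (forall k, q I s k = 0) -> exists s', s = e *: s' &
      forall I s, e *: s = 0 -> forall k, q I s k = 0].
Proof.
have [S0 /in_Z_Emb E0 /pullsE[F pF fF]] := tv.
have [io H fio] := Emb_fmor E0; have [f1 f2 f3 f4] := pF.
have Fs I := tensor_surj (@aug_surj _ _ _) (f1 I) (f4 I).
have fq : fmor aug (S := v) (fun I s k => io I (F I s) k) := fmor_pull (h := idfun) pF fF fio.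
exists (fun I s k => io I (F I s) k); split=> //.
- by move=> I s; apply: (io_D H).
- by move=> I c hc; have [t et] := io_ex H hc; have [s es] := Fs I t; exists s => k; rewrite es et.
- move=> I s h.
  have : F I s = 0 by apply: (io_inj H) => k; rewrite h (io_0 H).
  move: s {h}; refine (tensor_ker (@aug_surj _ _ _) (D := fun s => exists s', s = e *: s') (f4 I) _ _).
    split=> [|r _ _ [x ->] [y ->]]; first by exists 0; rewrite scaler0.
    by exists (r *: x + y); rewrite scalerDr !scalerA mulrC.
  by move=> x s hx; exists (cst (x.2 0 0) *: s); rewrite scalerA -dual1_aug0.
move=> I s h k.
(* The equational criterion is applied to the relation e s = 0: the entries of the resulting matrix
   are killed by e, so they reduce to 0. *)
have h' : \sum_i (\row_(j < 1) e) 0 i *: (fun=> s) i = 0 by rewrite big_ord1 mxE.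
have [l [a [z [ra xs]]]] := framed_flat h'; rewrite (xs ord0).
have [l1 _ _ _] := proj1 fq k.
have lsum (T : Type) (r : seq T) (G : T -> sec v I) : io I (F I (\sum_(i <- r) G i)) k = \sum_(i <- r) io I (F I (G i)) k.
  by apply: (semilin_sum (g := aug) (h := fun x => io I (F I x) k)) => r' x y; apply: l1.
rewrite lsum big1 // => j _.
rewrite (semilinZ (g := aug) (h := fun x => io I (F I x) k)) //.
have := congr1 (fun M : 'M_(1, l) => M 0 j) ra; rewrite !mxE big_ord1 mxE => /eps_mul0 h0.
by rewrite [X in X *: _](_ : _ = 0) ?scale0r.
Qed.

Lemma Dexp00 I c : Dexp 0 J I c <-> [/\ in_O I (c k0), in_O I (c k1) & Jloc J (sval I) (c k1)].
Proof.
have h : c k1 - toL 0 * c k0 = c k1 by rewrite toL0 mul0r subr0.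
by split=> -[a b]; rewrite ?h => c3; split; rewrite ?h.
Qed.

Lemma eps_aug (c : laurent D) : e *: c = e *: Lmap cst (Lmap aug c).
Proof.
apply: laurP => m; rewrite !lcoefZ !LmapE; apply: dualP => [|l]; first by rewrite !epsM1.
by rewrite !epsM2.
Qed.
Lemma Lsplit1 (c : laurent D) : c = Lmap cst (Lmap aug c) + e *: Lmap cst (Lcomp ord0 c).
Proof. by rewrite {1}[c]Lsplit big_ord1. Qed.
Lemma eps_inj (c d : laurent R) : e *: Lmap cst c = e *: Lmap cst d -> c = d.
Proof.
move/(congr1 (Lcomp ord0)); rewrite !LcompZ !Lcomp_cst !Lmap_aug_cst !scaler0 !add0r.
by rewrite mxE !eqxx !scale1r.
Qed.

Fact full0_neq0 (I : chart) : o0 |: sval I != set0. Proof. by apply/set0Pn; exists o0; rewrite !inE. Qed.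
Definition ch0U (I : chart) : chart := exist (fun I : {set 'I_3} => I != set0) (o0 |: sval I) (full0_neq0 I).
Lemma csub_ch0U I : csub I (ch0U I). Proof. exact: subsetUr. Qed.
Lemma csub0_ch0U I : csub ch0 (ch0U I). Proof. exact: subsetUl. Qed.

Section Extract.
Variable Phi : forall I, sec v I -> 'I_2 -> laurent D.
Hypothesis hPhi : fmor id Phi.
Variable q : forall I, sec v I -> 'I_2 -> laurent R.
Hypotheses (fq : fmor aug q) (qD : forall I (s : sec v I), Dexp 0 J I (q s))
  (qs : forall I c, Dexp 0 J I c -> exists s : sec v I, forall k, q s k = c k)
  (qk : forall I (s : sec v I), (forall k, q s k = 0) -> exists s', s = e *: s').

Lemma Phi_aug I (s : sec v I) k : Lmap aug (Phi s k) = q s k.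
Proof. exact: (tangent_fmor_uniq (fmor_Lmap aug hPhi) fq). Qed.
Let Pl I k (r : D) (s t : sec v I) : Phi (r *: s + t) k = r *: Phi s k + Phi t k.
Proof. by case: (proj1 hPhi k) => h _ _ _; apply: h. Qed.
Let PlD I k (s t : sec v I) : Phi (s + t) k = Phi s k + Phi t k.
Proof. by rewrite -[s]scale1r Pl !scale1r. Qed.
Let Pl0 I k : Phi (0 : sec v I) k = 0.
Proof. by apply: (@addrI _ (Phi (0 : sec v I) k)); rewrite -PlD !addr0. Qed.
Let PlZ I k (r : D) (s : sec v I) : Phi (r *: s) k = r *: Phi s k.
Proof. by rewrite -[r *: s]addr0 Pl Pl0 addr0. Qed.
Let PlB I k (s t : sec v I) : Phi (s - t) k = Phi s k - Phi t k.
Proof. by rewrite addrC -scaleN1r Pl scaleN1r addrC. Qed.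
Let Pm I k m (s : sec v I) : regular (sval I) m -> Phi (mon v m s) k = mono m * Phi s k.
Proof. by case: (proj1 hPhi k) => _ h _ _ hm; apply: h. Qed.
Let Pr I I' k (s : sec v I) : csub I I' -> Phi (res v I' s) k = Phi s k.
Proof. by case: (proj1 hPhi k) => _ _ h _ hI; apply: h. Qed.
Let PO I k (s : sec v I) : in_O I (Phi s k).
Proof. by case: (proj1 hPhi k) => _ _ _ h; apply: h. Qed.
Let Pact I k c (s : sec v I) : in_O I c -> Phi (act c s) k = c * Phi s k.
Proof. by move=> hc; rewrite (lmor_act (g := idfun) s (proj1 hPhi k) hc) Lmap_id. Qed.
Let Pe I k (s : sec v I) : Phi (e *: s) k = e *: Lmap cst (q s k).
Proof. by rewrite PlZ eps_aug Phi_aug. Qed.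

(** If Phi s = 0 then s = e s', and e q(s') = 0 gives s' = e s''; so s = e^2 s'' = 0. *)
Lemma Phi_inj I (s t : sec v I) : (forall k, Phi s k = Phi t k) -> s = t.
Proof.
move=> h; apply/eqP; rewrite -subr_eq0; apply/eqP.
have h0 k : Phi (s - t) k = 0 by rewrite PlB h subrr.
have [s' es] : exists s', s - t = e *: s' by apply: qk => k; rewrite -Phi_aug h0 Lmap0.
have [s2 es2] : exists s2, s' = e *: s2.
  apply: qk => k; apply: eps_inj; rewrite -Pe -es h0 Lmap0 scaler0 //.
by rewrite es es2 scalerA eps_eps scale0r.
Qed.

(** Sections satisfy no condition along L_oo besides regularity. This is clear on the special fibre,
    whose condition lives on C^2, and is lifted in two steps: modulo e, and for the coefficient of
    e. *)
Lemma Phi_ext I (t : sec v (ch0U I)) : (forall k, in_O I (Phi t k)) -> exists s : sec v I, forall k, Phi s k = Phi t k.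
Proof.
move=> tO.
have Dd c : Dexp 0 J (ch0U I) c -> (forall k, in_O I (c k)) -> Dexp 0 J I c.
  by move=> /Dexp00[_ _ h] hO; apply/Dexp00; split; [exact: hO|exact: hO|apply/Jloc0U].
have [s1 e1] : exists s1 : sec v I, forall k, q s1 k = q t k.
  by apply: qs; apply: Dd => // k; rewrite -Phi_aug; apply: inOs_Lmap (tO k).
have [t' et] : exists t', t - res v (ch0U I) s1 = e *: t'.
  by apply: qk => k; rewrite -Phi_aug PlB LmapB Pr ?csub_ch0U // !Phi_aug e1 subrr.
have ePt k : Phi t k = Phi s1 k + e *: Lmap cst (q t' k).
  by rewrite -Pe -et PlB Pr ?csub_ch0U // addrC subrK.
have [s2 e2] : exists s2 : sec v I, forall k, q s2 k = q t' k.
  apply: qs; apply: Dd => // k.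
  have -> : q t' k = Lcomp ord0 (Phi t k - Phi s1 k).
    apply: eps_inj; rewrite ePt addrAC subrr add0r; congr (e *: Lmap cst _).
    rewrite LcompZ Lcomp_cst scaler0 add0r Lmap_aug_cst mxE !eqxx scale1r //.
  apply: (inOs_Lcomp (B := sval I)); apply: inOsB; [exact: tO|exact: PO].
by exists (s1 + e *: s2) => k; rewrite PlD Pe ePt e2.
Qed.

(* The first-order deformation of J cut out by the image of Phi. *)
Definition extH (Q : {poly {poly D}}) := exists s : sec v ch0, Phi s k0 = 0 /\ Phi s k1 = toL Q.

Let chO (R' : comNzRingType) (P : {poly {poly R'}}) : in_O ch0 (toL P : laurent R').
Proof. by apply: inOs_toL; rewrite inE. Qed.
Let chL (R' : comNzRingType) (c : laurent R') : in_O ch0 c -> toL (fromL c) = c.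
Proof. by move=> /inOs_aff; apply: fromLK. Qed.

Lemma ext_clean (s : sec v ch0) : exists s' : sec v ch0, Phi s' k0 = Lmap cst (q s k0) /\ Phi s' k1 = Phi s k1.
Proof.
have [t et] : exists t : sec v ch0, forall k, q t k = mk2 (Lcomp ord0 (Phi s k0)) 0 k.
  apply: qs; apply/Dexp00; rewrite /mk2 /=; split; [|exact: inOs0|exact: (Jloc0 (hilb_is_ideal J))].
  by apply: inOs_Lcomp; apply: PO.
exists (s - e *: t); rewrite !PlB !Pe !et /mk2 /= Lmap0 scaler0 subr0; split=> //.
by rewrite {1}[Phi s k0]Lsplit1 Phi_aug addrK.
Qed.

Lemma extH_ideal : is_ideal extH.
Proof.
split=> [|P Q [s [s0 s1]] [t [t0 t1]]|P Q [s [s0 s1]]].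
- by exists 0; rewrite !Pl0 toL0.
- by exists (s + t); rewrite !PlD s0 t0 s1 t1 addr0 toLD.
- by exists (act (toL P) s); rewrite !Pact // s0 s1 mulr0 toLM.
Qed.

Lemma extH_hilb : exists J1 : hilb n D, (forall P, J1 P <-> extH P) /\ hilb_pulls aug J1 J.
Proof.
apply: dual_hilb extH_ideal _ _ _.
- move=> Q [s [s0 s1]]; have /Dexp00[_ _] := qD s; rewrite -Phi_aug s1 -toL_map => /Jloc_aff[Q' JQ' eQ'].
  by have -> : map_xy aug Q = Q' by apply: (@toL_inj R).
- move=> Q JQ; have [s es] : exists s : sec v ch0, forall k, q s k = mk2 0 (toL Q) k.
    by apply: qs; apply/Dexp00; rewrite /mk2 /=; split; [exact: inOs0|exact: chO|exact: Jloc_toL].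
  have [s' [h0 h1]] := ext_clean s; exists (fromL (Phi s k1)); split.
    by exists s'; rewrite h0 h1 es /mk2 /= Lmap0 chL //; apply: PO.
  by apply: (@toL_inj R); rewrite toL_map chL ?Phi_aug ?es //; apply: PO.
- move=> Q; rewrite big_ord1; split=> [[s [s0 s1]] l|JQ].
    rewrite (ord1 l); have [s' es] : exists s', s = e *: s'.
      apply: qk => k; rewrite -Phi_aug; case: (ord2 k) => ->; first by rewrite s0 Lmap0.
      by rewrite s1 -toL_map -[X in toL X]/(map_xy aug _) pdual_map toL0.
    have /Dexp00[_ _] := qD s'; have -> : q s' k1 = toL (Q ord0).
      by apply: eps_inj; rewrite -Pe -es s1 toL_pdual.
    by move/Jloc_aff => [Q' JQ' /(@toL_inj R) <-].
  have [s es] : exists s : sec v ch0, forall k, q s k = mk2 0 (toL (Q ord0)) k.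
    by apply: qs; apply/Dexp00; rewrite /mk2 /=; split; [exact: inOs0|exact: chO|exact: Jloc_toL].
  by exists (e *: s); rewrite !Pe !es /mk2 /= Lmap0 scaler0 toL_pdual.
Qed.

Variables (sg : sec v ch0) (P : {poly {poly R}}).
Hypotheses (sg0 : q sg k0 = 1) (sg1 : q sg k1 = 0) (eP : toL P = Lcomp ord0 (Phi sg k1)).

(** A framed map to O[e]^2 forces the explicit form: some section has image (1, e P), and
    subtracting multiples of it from the others over C^2 leaves vectors (0, Q), whose second
    components form J1. *)
Lemma fmor_explicit : exists J1 : hilb n D, hilb_pulls aug J1 J /\ is_subsheaf (Dexp (pdual ord0 P) J1) Phi.
Proof.
have [J1 [J1P J1J]] := extH_hilb; have Ji1 := hilb_is_ideal J1; exists J1; split=> //.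
have [sg' [s0 s1]] := ext_clean sg.
rewrite sg0 in s0; have {}s0 : Phi sg' k0 = 1 by rewrite s0; apply: (rmorph1 (Lmap cst)).
have {}s1 : Phi sg' k1 = toL (pdual ord0 P).
  by rewrite s1 toL_pdual eP {1}[Phi sg k1]Lsplit1 Phi_aug sg1 Lmap0 add0r.
have ch0P (s : sec v ch0) : exists2 Q, J1 Q & toL Q = Phi s k1 - toL (pdual ord0 P) * Phi s k0.
  exists (fromL (Phi (s - act (Phi s k0) sg') k1)).
    apply/J1P; exists (s - act (Phi s k0) sg'); rewrite PlB Pact ?PO // s0 mulr1 subrr chL //; exact: PO.
  by rewrite chL ?PO // PlB Pact ?PO // s1 mulrC.
split.
- by move=> I x s t k m; rewrite Pl lcoefD lcoefZ.
- by move=> I m hm s k m'; rewrite Pm // lcoef_mono.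
- by move=> I I' hI s; apply: funext => k; rewrite Pr.
- by move=> I s t h; apply: Phi_inj => k; rewrite h.
move=> I c; split=> [[ha hb hJ]|[s <-]]; last first.
  split; [exact: PO|exact: PO|].
  have [m [s' [h1 h2 h3]]] := res_frac (csub0_ch0U I) (res v (ch0U I) s).
  have [Q JQ eQ] := ch0P s'; apply/(Jloc_iff Ji1); exists m, Q; split=> //.
  have E k : Phi s' k = mono m * Phi s k.
    rewrite -(Pr k s' (csub0_ch0U I)) -h3 Pm; last by apply: regularS (csub0_ch0U I) h1.
    by rewrite Pr // csub_ch0U.
  by rewrite eQ !E mulrBr mulrCA.
have [kk [[A eA] [Q [JQ eQ]]]] := evt_ex (evt_and (inOs_aff_up (inOs0U ha)) (Jloc_up Ji1 hJ)).
have /J1P[t [t0 t1]] := JQ.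
pose s' := t + act (toL A) sg'.
have s'0 : Phi s' k0 = mono (mu (sval I) kk) * c k0 by rewrite PlD (Pact _ _ (@chO _ A)) t0 s0 mulr1 add0r.
have s'1 : Phi s' k1 = mono (mu (sval I) kk) * c k1.
  rewrite PlD (Pact _ _ (@chO _ A)) t1 s1 eQ eA; move: (mono _) (c k0) (c k1) (toL _) => x1 x2 x3 x4; ring.
pose t' : sec v (ch0U I) := mon v (- mu (sval I) kk) (res v (ch0U I) s').
have tE k : Phi t' k = c k.
  rewrite Pm; last exact: muN_reg.
  rewrite Pr ?csub0_ch0U //; case: (ord2 k) => ->; rewrite ?s'0 ?s'1 mulrA monoK mul1r //.
have [k|s es] := @Phi_ext I t'; first by rewrite tE; case: (ord2 k) => ->.
by exists s; apply: funext => k; rewrite es tE.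
Qed.
End Extract.
End Tangent.

Lemma pdual0 (K : closedFieldType) (R : comAlgType K) k (l : 'I_k) : pdual l (0 : {poly {poly R}}) = 0.
Proof. by apply: (addrI (pdual l 0)); rewrite -pdualD !addr0. Qed.
Lemma pdual_sum (K : closedFieldType) (R : comAlgType K) k (l : 'I_k) (I : Type) (s : seq I) (F : I -> {poly {poly R}}) :
  pdual l (\sum_(i <- s) F i) = \sum_(i <- s) pdual l (F i).
Proof. by elim: s => [|i s IH]; rewrite ?big_nil ?pdual0 // !big_cons pdualD IH. Qed.

(** * The class P of an explicit tangent vector *)

Section Ex.
Variables (K : closedFieldType) (R : comAlgType K) (n : nat) (J : hilb n R).
Local Notation D := (dualnum R 1).
Local Notation aug := (@dual_aug K R 1).
Local Notation cst := (@dual_const K R 1).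
Local Notation e := (@eps K R 1 ord0).
Local Notation A := {poly {poly R}}.
Implicit Types (v : framed n D) (P Q : A).

(* v is the deformation {(a, b) in O[e]^2 : b - e P a in J1} for some deformation J1 of J. *)
Definition Ex v P := exists J1 : hilb n D, hilb_pulls aug J1 J /\ Emb (pdual ord0 P) J1 v.

Lemma Ex_tangent v P : Ex v P -> tangent J v.
Proof.
case=> J1 [hJ E]; have [S0 E0] := explicit_ex 0 J; exists S0; first exact/in_Z_Emb.
by apply: (Emb_pulls hJ _ E E0); rewrite pdual_map subrr; apply: (ideal_0 (hilb_is_ideal J)).
Qed.

(** Rigidity is used twice: for the reduction modulo e, and then for the coefficient of e, which is
    semilinear over [aug] once the reduction vanishes. *)
Lemma tangent_rigid_id v dl : tangent J v -> lmor id (S := v) dl ->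
  (forall I k, chart_inf I -> atinf0 (dl I (frame v I k))) -> forall I s, dl I s = 0.
Proof.
move=> tv dlm dlf.
have a0 I s : Lmap aug (dl I s) = 0.
  apply: (tangent_rigid tv (lmor_Lmap aug dlm)) => I' k hI m hm.
  by rewrite LmapE dlf // rmorph0.
have [d1 d2 d3 d4] := dlm.
have l0 : lmor aug (S := v) (fun I s => Lcomp ord0 (dl I s)).
  split=> [I r s t|I m hm s|I I' hI s|I s].
  - by rewrite d1 LcompD LcompZ a0 scaler0 addr0.
  - by rewrite d2 // Lcomp_mono.
  - by rewrite d3.
  - exact: (inOs_Lcomp (B := sval I) (d4 I s)).
move=> I s; rewrite [dl I s]Lsplit1 a0 Lmap0 add0r (tangent_rigid tv l0) ?Lmap0 ?scaler0 //.
by move=> I' k hI m hm; rewrite LcompE dlf // mxE.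
Qed.

(** Flatness of J1 over R[e], read off from its explicit sheaf with P = 0: the section (0, e Q)
    reduces to 0, so it is e s', and s' reduces to (0, Q). *)
Lemma hilb_pdual (J1 : hilb n D) Q : hilb_pulls aug J1 J -> J1 (pdual ord0 Q) <-> J Q.
Proof.
move=> hJ; have Ji1 := hilb_is_ideal J1; split=> [JQ|/hJ[l [F [c [hF ->]]]]].
  have [v E] := explicit_ex 0 J1.
  have [S0 E0] := explicit_ex 0 J.
  have tv : tangent J v.
    exists S0; first exact/in_Z_Emb.
    apply: (Emb_pulls hJ _ E E0); rewrite /map_xy !map_poly0 subrr; exact: (ideal_0 (hilb_is_ideal J)).
  have [io H fio] := Emb_fmor E.
  have [q [q1 q2 q3 q4 q5]] := tangent_red tv.
  have tO : in_O ch0 (toL (pdual ord0 Q) : laurent D) by apply: inOs_toL; rewrite inE.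
  have [s es] := io_ex H (Dexp0 0 tO (Jloc_toL (sval ch0) JQ)).
  have eio k : Lmap aug (io _ s k) = q _ s k := Phi_aug tv fio q1 s k.
  have [s' es'] : exists s', s = e *: s'.
    apply: q4 => k; rewrite -eio es /mk2; case: (ord2 k) => -> /=; first by rewrite Lmap0.
    by rewrite -toL_map -[X in toL X]/(map_xy aug _) pdual_map toL0.
  have /Dexp00[_ _] := q2 _ s'; have -> : q _ s' k1 = toL Q.
    by apply: eps_inj; rewrite -toL_pdual -(Phi_aug tv fio q1) -eps_aug -(io_scale H) -es' es.
  by move/Jloc_aff => [Q2 JQ2 /toL_inj <-].
rewrite pdual_sum; under eq_bigr do rewrite mulrC pdualM mulrC.
by apply: ideal_sum => // i _; apply: ideal_M.
Qed.

Lemma fmor_Ex v (Phi : forall I, sec v I -> 'I_2 -> laurent D) (sg : sec v ch0) P : tangent J v -> fmor id Phi ->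
  Lmap aug (Phi _ sg k0) = 1 -> Lmap aug (Phi _ sg k1) = 0 -> toL P = Lcomp ord0 (Phi _ sg k1) -> Ex v P.
Proof.
move=> tv hP s0 s1 eP; have [q [q1 q2 q3 q4 q5]] := tangent_red tv.
have e0 := Phi_aug tv hP q1 sg k0; have e1 := Phi_aug tv hP q1 sg k1.
rewrite s0 in e0; rewrite s1 in e1.
have [J1 [hJ H]] := fmor_explicit tv hP q1 q2 q3 q4 (esym e0) (esym e1) eP.
by exists J1; split=> //; exists Phi => //; case: hP.
Qed.

Lemma tangent_sg v (Phi : forall I, sec v I -> 'I_2 -> laurent D) : tangent J v -> fmor id Phi ->
  exists sg : sec v ch0, Lmap aug (Phi _ sg k0) = 1 /\ Lmap aug (Phi _ sg k1) = 0.
Proof.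
move=> tv hP; have [q [q1 q2 q3 q4 q5]] := tangent_red tv.
have [sg es] : exists s : sec v ch0, forall k, q _ s k = mk2 1 0 k.
  apply: q3; apply/Dexp00; rewrite /mk2 /=; split; [exact: inOs1|exact: inOs0|exact: (Jloc0 (hilb_is_ideal J))].
by exists sg; rewrite !(Phi_aug tv hP q1) !es.
Qed.

(** P modulo [J] is visible on any section that reduces to (1, 0), so it depends only on the framed
    map and not on the chosen presentation. *)
Lemma Ex_fmor v P : Ex v P -> exists2 Phi : forall I, sec v I -> 'I_2 -> laurent D, fmor id Phi &
  forall sg : sec v ch0, Lmap aug (Phi _ sg k0) = 1 -> Lmap aug (Phi _ sg k1) = 0 ->
  exists Q, toL Q = Lcomp ord0 (Phi _ sg k1) /\ J (Q - P).
Proof.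
move=> EP; have tv := Ex_tangent EP; have [J1 [hJ E]] := EP.
have [io H fio] := Emb_fmor E; exists io => // sg s0 s1.
have Ji1 := hilb_is_ideal J1; have [a b c] := io_D H sg.
have [Q eQ] : exists Q : A, toL Q = Lcomp ord0 (io _ sg k1).
  exists (fromL (Lcomp ord0 (io _ sg k1))); apply: fromLK; apply/inOs_aff.
  exact: (inOs_Lcomp (B := aff_chart) b).
exists Q; split=> //.
have e1 : io _ sg k1 - toL (pdual ord0 P) * io _ sg k0 = toL (pdual ord0 (Q - P)).
  rewrite !toL_pdual toLB eQ LmapB scalerBr {1}[io _ sg k1]Lsplit1 s1 Lmap0 add0r; congr (_ - _).
  rewrite -scalerAl eps_aug LmapM s0 Lmap_aug_cst mulr1 //.
rewrite e1 in c; have [Q' JQ' /toL_inj eQ'] := Jloc_aff c; rewrite eQ' in JQ'.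
exact: (proj1 (hilb_pdual _ hJ) JQ').
Qed.

Lemma Ex_eq v P Q : Ex v P -> J (P - Q) -> Ex v Q.
Proof.
case=> J1 [hJ [io H sf]] hPQ; exists J1; split=> //; exists io => //.
have Ji1 := hilb_is_ideal J1.
have h : J1 (pdual ord0 P - pdual ord0 Q).
  by rewrite -pdualN -pdualD; apply/(hilb_pdual _ hJ).
have h' : J1 (pdual ord0 Q - pdual ord0 P) by rewrite -opprB; apply: ideal_N.
by apply: is_subsheaf_eq H => I c; split; apply: Dexp_eqP.
Qed.

Lemma Ex_uniq v P Q : Ex v P -> Ex v Q -> J (P - Q).
Proof.
move=> EP EQ; have tv := Ex_tangent EP; have Ji := hilb_is_ideal J.
have [F1 f1 h1] := Ex_fmor EP; have [F2 f2 h2] := Ex_fmor EQ.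
have eF I s k : F1 I s k = F2 I s k.
  apply/eqP; rewrite -subr_eq0; apply/eqP.
  apply: (tangent_rigid_id tv (lmorB (g := idfun) (proj1 f1 k) (proj1 f2 k))) => I' k' hI.
  exact: (fmor_sub f1 f2).
have [sg [s0 s1]] := tangent_sg tv f1.
have [Q1 [e1 j1]] := h1 _ s0 s1; rewrite !eF in s0 s1 e1; have [Q2 [e2 j2]] := h2 _ s0 s1.
have eQ : Q1 = Q2 by apply: (@toL_inj R); rewrite e1 e2.
have -> : P - Q = (Q2 - Q) - (Q1 - P) by rewrite eQ; ring.
exact: ideal_B.
Qed.

End Ex.

(** * Linear relations between tangent vectors *)

Section Transfer.
Variables (K : closedFieldType) (R : comAlgType K) (n k : nat) (J : hilb n R).
Local Notation D := (dualnum R 1).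
Local Notation Dk := (dualnum R k).
Local Notation aug := (@dual_aug K R 1).
Local Notation augk := (@dual_aug K R k).
Local Notation cst := (@dual_const K R 1).
Local Notation e := (@eps K R 1 ord0).
Local Notation dm A := (@dual_map K R R k 1 idfun A).

Lemma dm_surj (A : 'M[R]_(k, 1)) : (exists B : 'M_(1, k), B *m A = 1%:M) -> forall x, exists y, dm A y = x.
Proof.
case=> B hB [r w]; exists (r, w *m B); congr pair.
by rewrite /= map_mx_id // -mulmxA hB mulmx1.
Qed.

Lemma tangent_along (A B : 'M[R]_(k, 1)) (d : framed n Dk) v w :
  pulls (dm A) d v -> pulls (dm B) d w -> tangent J v -> tangent J w.
Proof.
move=> pv pw [S0 Z0 p0]; exists S0 => //.
apply: (pulls_descend (f := augk) _ pw) => //.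
by apply: (pulls_comp _ pv p0).
Qed.

Variables (A B C : 'M[R]_(k, 1)) (x y : R) (d : framed n Dk) (v w s : framed n D).
Variables P Q : {poly {poly R}}.
Hypotheses (pv : pulls (dm A) d v) (pw : pulls (dm B) d w) (ps : pulls (dm C) d s).
Hypotheses (eC : C = x *: A + y *: B) (C1 : exists C' : 'M_(1, k), C' *m C = 1%:M).
Hypotheses (Ev : Ex J v P) (Ew : Ex J w Q).

(* Along e_i -> A_i e the lift of the inclusion q is q + e psi_A with psi_A linear in A. *)
Lemma transfer : Ex J s (x%:P%:P * P + y%:P%:P * Q).
Proof.
have tv := Ex_tangent Ev; have ts := tangent_along pv ps tv.
have [S0 /in_Z_Emb E0 p0] := tv.
have pd0 : pulls augk d S0 by apply: (pulls_comp _ pv p0).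
have [Phv fv hv] := Ex_fmor Ev; have [Phw fw hw] := Ex_fmor Ew.
have /pullsE[Fv pFv fFv] := pv; have /pullsE[Fw pFw fFw] := pw; have /pullsE[Fs pFs fFs] := ps.
have gv := fmor_pull (h := idfun) pFv fFv fv; have gw := fmor_pull (h := idfun) pFw fFw fw.
pose PA I z j := Phv I (Fv I z) j; pose PB I z j := Phw I (Fw I z) j.
have {}gv : fmor (dm A) (S := d) PA := gv; have {}gw : fmor (dm B) (S := d) PB := gw.
have av : fmor augk (S := d) (fun I z j => Lmap aug (PA I z j)) := fmor_Lmap aug gv.
have aw : fmor augk (S := d) (fun I z j => Lmap aug (PB I z j)) := fmor_Lmap aug gw.
have eq I z j : Lmap aug (PA I z j) = Lmap aug (PB I z j).
  apply/eqP; rewrite -subr_eq0; apply/eqP.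
  apply: (rigid_pull (@aug_surj _ _ _) pd0 E0 (lmorB (proj1 av j) (proj1 aw j))) => I' i hI.
  exact: (fmor_sub av aw).
(* The common reduction plus e times the combination of the two coefficients of e; C = x A + y B is
   what makes it semilinear over [dm C]. *)
have [PC PCE] : exists PC : forall I, sec d I -> 'I_2 -> laurent D, forall I z j,
    PC I z j = Lmap cst (Lmap aug (PA I z j)) +
      e *: Lmap cst (x *: Lcomp ord0 (PA I z j) + y *: Lcomp ord0 (PB I z j)) by eexists.
have augC I z j : Lmap aug (PC I z j) = Lmap aug (PA I z j).
  by rewrite PCE LmapD LmapZ !Lmap_aug_cst [X in X *: _](_ : _ = 0) // scale0r addr0.
have compC I z j : Lcomp ord0 (PC I z j) = x *: Lcomp ord0 (PA I z j) + y *: Lcomp ord0 (PB I z j).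
  rewrite PCE LcompD Lcomp_cst add0r LcompZ Lcomp_cst scaler0 add0r Lmap_aug_cst.
  by rewrite mxE !eqxx scale1r.
have fC : fmor (dm C) (S := d) PC.
  split=> [j|I i hI j m hm].
    have [a1 a2 a3 a4] := proj1 gv j; have [b1 b2 b3 b4] := proj1 gw j.
    split=> [I r z t|I m hm z|I I' hI z|I z].
    - have eA : PA I (r *: z + t) j = dm A r *: PA I z j + PA I t j := a1 I r z t.
      have eB : PB I (r *: z + t) j = dm B r *: PB I z j + PB I t j := b1 I r z t.
      apply: LdualP => [|l]; first by rewrite augC eA !LmapD !LmapZ !augC; congr (_ *: _ + _).
      rewrite (ord1 l) compC eA eB !LcompD !LcompZ !compC -eq augC.
      have cE (M : 'M[R]_(k, 1)) : (dm M r).2 0 0 = (r.2 *m M) 0 0 by rewrite /= map_mx_id.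
      rewrite !cE eC mulmxDr -!scalemxAr !mxE.
      move: (Lcomp _ _) (Lcomp _ _) (Lcomp _ _) (Lcomp _ _) (Lmap _ _) => c1 c2 c3 c4 c5.
      move: ((r.2 *m A) 0 0) ((r.2 *m B) 0 0) => u1 u2; rewrite /=.
      rewrite !scalerDr !scalerDl !scalerA; rewrite [r.1 * x]mulrC [r.1 * y]mulrC.
      move: (_ *: c1) (_ *: c2) (_ *: c3) (_ *: c4) (_ *: c5) (_ *: c5) => d1 d2 d3 d4 d5 d6; ring.
    - have eA : PA I (mon d m z) j = mono m * PA I z j := a2 I m hm z.
      have eB : PB I (mon d m z) j = mono m * PB I z j := b2 I m hm z.
      apply: LdualP => [|l]; first by rewrite augC eA !LmapM Lmap_mono augC.
      by rewrite (ord1 l) compC eA eB !Lcomp_mono compC mulrDr !scalerAr.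
    - have eA : PA I' (res d I' z) j = PA I z j := a3 I I' hI z.
      have eB : PB I' (res d I' z) j = PB I z j := b3 I I' hI z.
      by rewrite !PCE eA eB.
    - rewrite PCE; apply: inOsD; first by do 2![apply: inOs_Lmap]; apply: a4.
      apply: inOsZ; apply: inOs_Lmap; apply: inOsD; apply: inOsZ.
        exact: (inOs_Lcomp (B := sval I) (a4 I z)).
      exact: (inOs_Lcomp (B := sval I) (b4 I z)).
  have eA : PA I (frame d I i) j m = ((i == j) && (m == 0))%:R := proj2 gv I i hI j m hm.
  have eB : PB I (frame d I i) j m = ((i == j) && (m == 0))%:R := proj2 gw I i hI j m hm.
  have z2 (b : bool) : (b%:R : D).2 0 0 = 0 by case: b; rewrite mxE.
  rewrite PCE lcoefD !LmapE lcoefZ LmapE lcoefD !lcoefZ !LcompE eA eB z2 !mulr0 addr0 raddf0 mulr0 addr0.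
  by case: (_ && _).
(* As [dm C] is onto, the framed map on d factors through its restriction s. *)
have [Phs [fs es]] := fmor_descend (h := idfun) (dm_surj C1) pFs fFs fC.
have [sg [s0 s1]] := tangent_sg ts fs.
have [f1 _ _ f4] := pFs; have [dl edl] := tensor_surj (dm_surj C1) (f1 ch0) (f4 ch0) sg.
rewrite -edl !es !augC in s0 s1.
have [Q1 [e1 j1]] := hv _ s0 s1.
rewrite !eq in s0 s1; have [Q2 [e2 j2]] := hw _ s0 s1.
have E : Ex J s (x%:P%:P * Q1 + y%:P%:P * Q2).
  apply: (fmor_Ex (sg := sg) ts fs).
  - by rewrite -edl es augC eq.
  - by rewrite -edl es augC eq.
  - by rewrite -edl es compC toLD !toLZ e1 e2.
apply: Ex_eq E _; have Ji := hilb_is_ideal J.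
have -> : x%:P%:P * Q1 + y%:P%:P * Q2 - (x%:P%:P * P + y%:P%:P * Q) =
  x%:P%:P * (Q1 - P) + y%:P%:P * (Q2 - Q) by ring.
by apply: ideal_D => //; apply: ideal_M.
Qed.
End Transfer.

(** * Fibre sums *)

Section Combo.
Variables (K : closedFieldType).
Implicit Types (R : comAlgType K).

Definition pcombo R k (Q : {poly {poly R}}) (F : 'I_k -> {poly {poly R}}) : {poly {poly (dualnum R k)}} :=
  map2 (@dual_const K R k) Q + \sum_l pdual l (F l).

Lemma toL_pcombo R k Q (F : 'I_k -> {poly {poly R}}) m :
  toL (pcombo Q F) m = (toL Q m, \row_l toL (F l) m) :> dualnum R k.
Proof.
rewrite [RHS]dual_split /pcombo toLD lcoefD toL_map LmapE; congr (_ + _).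
rewrite (raddf_sum (@toL _)) lcoef_sum; apply: eq_bigr => l _.
by rewrite -[X in fun_of_fsfun X _]/(toL (pdual l (F l))) toL_pdual lcoefZ LmapE mxE.
Qed.

Lemma dual_map_combo R R' k (g : {lrmorphism R -> R'}) (A : 'M[R']_(k, 1)) Q (F : 'I_k -> {poly {poly R}}) :
  map_xy (dual_map g A) (pcombo Q F) =
  pcombo (map_xy g Q) (fun _ : 'I_1 => \sum_l (A l 0)%:P%:P * map_xy g (F l)).
Proof.
apply: toL_inj; apply: laurP => m; rewrite toL_map LmapE !toL_pcombo toL_map LmapE.
congr pair; apply/rowP => j; rewrite !mxE (ord1 j) (raddf_sum (@toL R')) lcoef_sum.
by apply: eq_bigr => l _; rewrite !mxE /= toLZ lcoefZ toL_map LmapE mulrC.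
Qed.

Lemma pcombo_pdual R k (l : 'I_k) P : pdual l P = pcombo 0 (fun l' => if l' == l then P else 0 : {poly {poly R}}).
Proof.
rewrite /pcombo map2_0 add0r (bigD1 l) //= eqxx big1 ?addr0 // => i /negPf ->; exact: pdual0.
Qed.
Lemma pcombo1 R P : pcombo 0 (fun _ : 'I_1 => P : {poly {poly R}}) = pdual ord0 P.
Proof. by rewrite /pcombo map2_0 add0r big_ord1. Qed.

Lemma dual_map_pdual R R' k (g : {lrmorphism R -> R'}) (A : 'M[R']_(k, 1)) l (P : {poly {poly R}}) :
  map_xy (dual_map g A) (pdual l P) = pdual ord0 ((A l 0)%:P%:P * map_xy g P).
Proof.
rewrite pcombo_pdual dual_map_combo; have -> : map_xy g 0 = 0 by rewrite /map_xy map_poly0.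
rewrite -pcombo1; congr pcombo; apply: funext => _; rewrite (bigD1 l) //= eqxx big1 ?addr0 // => i /negPf ->.
by rewrite /map_xy map_poly0 mulr0.
Qed.

Lemma pcomboE R k (P : {poly {poly (dualnum R k)}}) : P = pcombo (map_xy (@dual_aug K R k) P) (fun l => pcomp l P).
Proof. exact: psplit. Qed.

Lemma aug_pcombo R k Q (F : 'I_k -> {poly {poly R}}) : map_xy (@dual_aug K R k) (pcombo Q F) = Q.
Proof. by apply: toL_inj; apply: laurP => m; rewrite toL_map LmapE toL_pcombo. Qed.
End Combo.

Section HilbPulls.
Variables (K : closedFieldType) (n : nat).
Implicit Types (R : comAlgType K).

Lemma map_xy_comp R R' R'' (g : {lrmorphism R -> R'}) (h : {lrmorphism R' -> R''}) (f : {lrmorphism R -> R''}) P :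
  (forall r, f r = h (g r)) -> map_xy f P = map_xy h (map_xy g P).
Proof. by move=> fE; apply: toL_inj; apply: laurP => m; rewrite !toL_map !LmapE; exact: fE. Qed.

Lemma hilb_pulls_comp R R' R'' (g : {lrmorphism R -> R'}) (h : {lrmorphism R' -> R''}) (f : {lrmorphism R -> R''})
    (J : hilb n R) (J' : hilb n R') (J'' : hilb n R'') : (forall r, f r = h (g r)) ->
  hilb_pulls g J J' -> hilb_pulls h J' J'' -> hilb_pulls f J J''.
Proof.
move=> fE hg hh Q; split=> [/hh[l [P [c [hP ->]]]]|[l [P [c [hP ->]]]]].
  have /choice[F hF] : forall i, exists s : seq ({poly {poly R}} * {poly {poly R'}}),
      (forall t, t \in s -> J t.1) /\ P i = \sum_(t <- s) t.2 * map_xy g t.1.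
    move=> i; have /hg[l' [P' [c' [hP' ->]]]] := hP i; exists [seq (P' j, c' j) | j <- index_enum 'I_l']; split.
      by move=> t /mapP[j _ ->]; apply: hP'.
    by rewrite big_map.
  pose s := flatten [seq [seq (t.1, c i * map_xy h t.2) | t <- F i] | i <- index_enum 'I_l].
  exists (size s), (fun i => (nth (0, 0) s i).1), (fun i => (nth (0, 0) s i).2); split.
    move=> i; have : nth (0, 0) s i \in s by apply: mem_nth.
    by case/flattenP => _ /mapP[j _ ->] /mapP[t ht ->] /=; apply: (proj1 (hF j)).
  rewrite -(big_mkord xpredT (fun i => (nth (0, 0) s i).2 * map_xy f (nth (0, 0) s i).1)).
  rewrite -(big_nth _ xpredT (fun t => t.2 * map_xy f t.1)) /s big_flatten big_map; apply: eq_bigr => i _.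
  rewrite big_map {1}(proj2 (hF i)) -[map_xy h]/(map2 h) map2_sum mulr_sumr; apply: eq_bigr => t _ /=.
  by rewrite map2M mulrA (map_xy_comp _ fE).
apply/hh; exists l, (fun i => map_xy g (P i)), c; split.
  by move=> i; apply/hg; exists 1%N, (fun=> P i), (fun=> 1); rewrite big_ord1 mul1r.
by apply: eq_bigr => i _; rewrite (map_xy_comp _ fE).
Qed.

Lemma hilb_pulls_uniq R R' (g : {lrmorphism R -> R'}) (J : hilb n R) (J1 J2 : hilb n R') :
  hilb_pulls g J J1 -> hilb_pulls g J J2 -> forall Q, J1 Q <-> J2 Q.
Proof. by move=> h1 h2 Q; rewrite h1 h2. Qed.

Lemma hilb_pulls_descend R R' R'' (g : {lrmorphism R -> R'}) (h : {lrmorphism R' -> R''}) (f : {lrmorphism R -> R''})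
    (J : hilb n R) (J' : hilb n R') (J'' : hilb n R'') : (forall r, f r = h (g r)) ->
  hilb_pulls g J J' -> hilb_pulls f J J'' -> hilb_pulls h J' J''.
Proof.
move=> fE hg hf; have [J2 h2] := hilb_map h J'.
have e := hilb_pulls_uniq hf (hilb_pulls_comp fE hg h2).
by move=> Q; rewrite e h2.
Qed.

Lemma hilb_pulls_aug R k (J1 : hilb n (dualnum R k)) (J : hilb n R) : hilb_pulls (@dual_aug K R k) J1 J <->
  (forall P, J1 P -> J (map_xy (@dual_aug K R k) P)) /\ (forall Q, J Q -> exists P, J1 P /\ map_xy (@dual_aug K R k) P = Q).
Proof.
split=> [h|[h1 h2] Q]; split.
- by move=> P JP; apply/h; exists 1%N, (fun=> P), (fun=> 1); rewrite big_ord1 mul1r.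
- move=> Q /h[l [P [c [hP ->]]]]; exists (\sum_i map2 (@dual_const K R k) (c i) * P i); split.
    by apply: (ideal_sum (hilb_is_ideal J1)) => i _; apply: (ideal_M (hilb_is_ideal J1)).
  rewrite -[map_xy _]/(map2 (@dual_aug K R k)) map2_sum; apply: eq_bigr => i _; rewrite map2M; congr (_ * _).
  by apply: toL_inj; rewrite !toL_map Lmap_aug_cst.
- by move=> /h2[P [JP <-]]; exists 1%N, (fun=> P), (fun=> 1); rewrite big_ord1 mul1r.
- case=> l [P [c [hP ->]]]; apply: (ideal_sum (hilb_is_ideal J)) => i _.
  by apply: (ideal_M (hilb_is_ideal J)); apply: h1.
Qed.

(* The fibre sum of two deformations of J, glued along the directions e_1 -> e, e_2 -> 0
   and e_1 -> be e, e_2 -> e. *)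
Lemma hilb_glue R (J : hilb n R) (J1 J2 : hilb n (dualnum R 1)) (be : R) (B : 'M[R]_(2, 1)) :
  B ord0 0 = be -> B ord_max 0 = 1 ->
  hilb_pulls (@dual_aug K R 1) J1 J -> hilb_pulls (@dual_aug K R 1) J2 J ->
  exists Jd : hilb n (dualnum R 2), [/\ hilb_pulls (@dual_aug K R 2) Jd J,
    hilb_pulls (dual_map idfun (delta_mx ord0 0 : 'M[R]_(2, 1))) Jd J1 & hilb_pulls (dual_map idfun B) Jd J2].
Proof.
move=> B0 B1 h1 h2; pose A : 'M[R]_(2, 1) := delta_mx ord0 0.
pose gA := dual_map (idfun : {lrmorphism R -> R}) A; pose gB := dual_map (idfun : {lrmorphism R -> R}) B.
have Ji := hilb_is_ideal J; have Ji1 := hilb_is_ideal J1; have Ji2 := hilb_is_ideal J2.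
have id_xy (P : {poly {poly R}}) : map_xy idfun P = P.
  by apply: toL_inj; apply: laurP => m; rewrite toL_map LmapE.
have EA Q (F : 'I_2 -> {poly {poly R}}) : map_xy gA (pcombo Q F) = pcombo Q (fun=> F k0).
  rewrite dual_map_combo id_xy; congr pcombo; apply: funext => _.
  by rewrite sum2 !mxE /= !id_xy mul1r mul0r addr0.
have EB Q (F : 'I_2 -> {poly {poly R}}) : map_xy gB (pcombo Q F) = pcombo Q (fun=> be%:P%:P * F k0 + F k1).
  by rewrite dual_map_combo id_xy; congr pcombo; apply: funext => _; rewrite sum2 !id_xy B0 B1 mul1r.
pose H P := J1 (map_xy gA P) /\ J2 (map_xy gB P).
have [a1 b1] := proj1 (hilb_pulls_aug J1 J) h1; have [a2 b2] := proj1 (hilb_pulls_aug J2 J) h2.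
(* The coefficients of e_1 and e_2 are solved from those of P1 and P2; the system is triangular
   because the second entry of [B] is 1. *)
have lift P1 P2 : J1 P1 -> J2 P2 -> map_xy (@dual_aug K R 1) P1 = map_xy (@dual_aug K R 1) P2 ->
    exists P, [/\ H P, map_xy gA P = P1, map_xy gB P = P2 & map_xy (@dual_aug K R 2) P = map_xy (@dual_aug K R 1) P1].
  move=> j1 j2 eP; pose Q0 := map_xy (@dual_aug K R 1) P1.
  pose P := pcombo Q0 (fun l => if l == k0 then pcomp ord0 P1 else pcomp ord0 P2 - be%:P%:P * pcomp ord0 P1).
  have e1 : map_xy gA P = P1.
    by rewrite EA /= [RHS]pcomboE; congr pcombo; apply: funext => l; rewrite (ord1 l).
  have e2 : map_xy gB P = P2.
    rewrite EB /= [RHS]pcomboE -eP; congr pcombo; apply: funext => l; rewrite (ord1 l).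
    by rewrite addrC subrK.
  by exists P; rewrite /H e1 e2 aug_pcombo.
have [Jd [JdP hJd]] : exists Jd : hilb n (dualnum R 2), (forall P, Jd P <-> H P) /\ hilb_pulls (@dual_aug K R 2) Jd J.
  apply: dual_hilb.
  - split.
    + by rewrite /H /map_xy !map_poly0; split; [exact: (ideal_0 Ji1)|exact: (ideal_0 Ji2)].
    + move=> P Q [p1 p2] [q1 q2]; split; first by rewrite -[map_xy _]/(map2 gA) map2D; apply: ideal_D.
      by rewrite -[map_xy _]/(map2 gB) map2D; apply: ideal_D.
    + move=> P Q [q1 q2]; split; first by rewrite -[map_xy _]/(map2 gA) map2M; apply: ideal_M.
      by rewrite -[map_xy _]/(map2 gB) map2M; apply: ideal_M.
  - move=> P [p1 _]; have := a1 _ p1; rewrite -(map_xy_comp (f := @dual_aug K R 2)) //.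
  - move=> Q JQ; have [P1 [j1 e1]] := b1 _ JQ; have [P2 [j2 e2]] := b2 _ JQ.
    have [P [HP _ _ e]] := lift _ _ j1 j2 (etrans e1 (esym e2)); exists P; split=> //.
    by rewrite e e1.
  - move=> F; have -> : \sum_l pdual l (F l) = pcombo 0 F by rewrite /pcombo map2_0 add0r.
    rewrite /H EA EB !pcombo1 (hilb_pdual _ h1) (hilb_pdual _ h2); split=> [[q1 q2] l|q].
      have q1' : J (be%:P%:P * F k0) by apply: ideal_M.
      have q3 : J (F k1) by have := ideal_B Ji q2 q1'; rewrite addrC addKr.
      by case: (ord2 l) => ->.
    by split=> //; apply: ideal_D => //; apply: ideal_M.
exists Jd; split=> //.
- move=> Q; split=> [j1|[l [P [c [hP ->]]]]].
    have [P2 [j2 e2]] := b2 _ (a1 _ j1).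
    have [P [HP e _ _]] := lift _ _ j1 j2 (esym e2).
    by exists 1%N, (fun=> P), (fun=> 1); rewrite big_ord1 mul1r e; split=> // _; apply/JdP.
  by apply: ideal_sum => // i _; apply: ideal_M => //; case: (proj1 (JdP _) (hP i)).
- move=> Q; split=> [j2|[l [P [c [hP ->]]]]].
    have [P1 [j1 e1]] := b1 _ (a2 _ j2).
    have [P [HP _ e _]] := lift _ _ j1 j2 e1.
    by exists 1%N, (fun=> P), (fun=> 1); rewrite big_ord1 mul1r e; split=> // _; apply/JdP.
  by apply: ideal_sum => // i _; apply: ideal_M => //; case: (proj1 (JdP _) (hP i)).
Qed.
End HilbPulls.

Section DualConst.
Variables (K : closedFieldType) (R : comAlgType K) (k : nat).
Fact dual_const_scalable : scalable (@dual_const K R k).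
Proof. by move=> c x; congr pair; rewrite /= scaler0. Qed.
HB.instance Definition _ := GRing.isScalable.Build K R (dualnum R k) *:%R (@dual_const K R k) dual_const_scalable.
End DualConst.

Lemma rmorph_mulCA (S S' : comNzRingType) (g : {rmorphism S -> S'}) u b c d :
  g u * (g b * (d * g c)) = d * g (u * (b * c)).
Proof. by rewrite !rmorphM; ring. Qed.

(** * Operations on explicit tangent vectors *)

Section Calculus.
Variables (K : closedFieldType) (R : comAlgType K) (n : nat) (J : hilb n R).
Local Notation D := (dualnum R 1).
Local Notation aug := (@dual_aug K R 1).
Local Notation dm A := (@dual_map K R R _ 1 idfun A).
Local Notation m1 := (delta_mx ord0 0 : 'M[R]_(2, 1)).
Local Notation m2 := (delta_mx ord_max 0 : 'M[R]_(2, 1)).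
Local Notation m3 := (const_mx 1 : 'M[R]_(2, 1)).
Implicit Types (v w s : framed n D) (P Q : {poly {poly R}}).

Lemma m1_surj : exists B : 'M_(1, 2), B *m m1 = 1%:M.
Proof.
exists (delta_mx 0 ord0); rewrite mul_delta_mx; apply/matrixP => i j.
by rewrite !mxE !ord1 !eqxx.
Qed.
Lemma m3_surj : exists B : 'M_(1, 2), B *m m3 = 1%:M.
Proof.
exists (delta_mx 0 ord0); apply/matrixP => i j; rewrite !mxE !ord1 sum2 !mxE !eqxx /=.
by rewrite mul1r mul0r addr0.
Qed.
Lemma m3E : m3 = 1 *: m1 + 1 *: m2.
Proof.
apply/matrixP => i j; rewrite !mxE ord1; case: (ord2 i) => -> /=; by rewrite ?mulr0 ?mulr1 ?addr0 ?add0r.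
Qed.
(** The first summand is the sum minus the second, so [transfer] also cancels; this gives the
    converse direction in [normal_eq_Ex]. *)
Lemma m1E : m1 = 1 *: m3 + (-1) *: m2.
Proof.
apply/matrixP => i j; rewrite !mxE ord1; case: (ord2 i) => -> /=; by rewrite ?mulr0 ?addr0 ?mulr1 ?mul1r ?subrr.
Qed.

Lemma id_xy P : map_xy idfun P = P.
Proof. by apply: toL_inj; apply: laurP => m; rewrite toL_map LmapE. Qed.

Lemma add_Ex v w s P Q : tangent_add v w s -> Ex J v P -> Ex J w Q -> Ex J s (P + Q).
Proof.
case=> d [pv pw ps] Ev Ew; have := transfer pv pw ps m3E m3_surj Ev Ew.
by rewrite !mul1r.
Qed.

Lemma Ex_in_Z J1 z : hilb_pulls aug J1 J -> in_Z J1 z -> Ex J z 0.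
Proof. by move=> h /in_Z_Emb E; exists J1; rewrite pdual0. Qed.

Lemma normal_eq_Ex v w P : normal_eq J v w -> Ex J v P <-> Ex J w P.
Proof.
case=> J1 [z [h Z A]]; have Ez := Ex_in_Z h Z; split=> E; last by have := add_Ex A E Ez; rewrite addr0.
have [d [pw pz pv]] := A; have := transfer pv pz pw m1E m1_surj E Ez.
by rewrite mulr0 addr0 mul1r.
Qed.

Lemma Ex_exists P : exists v, Ex J v P.
Proof.
have Ji := hilb_is_ideal J.
have [J1 h1] := hilb_map (@dual_const K R 1) J.
have h0 : hilb_pulls idfun J J.
  move=> Q; split=> [JQ|[l [F [c [hF ->]]]]]; first by exists 1%N, (fun=> Q), (fun=> 1); rewrite big_ord1 id_xy mul1r.
  by apply: ideal_sum => // i _; rewrite id_xy; apply: ideal_M.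
have h : hilb_pulls aug J1 J by apply: (hilb_pulls_descend _ h1 h0).
have [v E] := explicit_ex (pdual ord0 P) J1; by exists v, J1.
Qed.

(** The two deformations of [J] are glued along the coordinate directions (be = 0); with e_1 P + e_2
    Q on top, the diagonal restriction is the sum. *)
Lemma Ex_add v w P Q : Ex J v P -> Ex J w Q -> exists2 s, tangent_add v w s & Ex J s (P + Q).
Proof.
case=> J1 [h1 E1] [J2 [h2 E2]].
have b0 : m2 ord0 0 = 0 by rewrite mxE.
have b1 : m2 ord_max 0 = 1 by rewrite mxE.
have [Jd [hd d1 d2]] := hilb_glue b0 b1 h1 h2.
have [J3 d3] := hilb_map (dm m3) Jd.
have h3 : hilb_pulls aug J3 J by apply: (hilb_pulls_descend _ d3 hd).
have [d Ed] := explicit_ex (pdual ord0 P + pdual ord_max Q) Jd.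
have [s Es] := explicit_ex (pdual ord0 (P + Q)) J3.
have me (A : 'M[R]_(2, 1)) : map_xy (dm A) (pdual ord0 P + pdual ord_max Q) =
    pdual ord0 ((A ord0 0)%:P%:P * P + (A ord_max 0)%:P%:P * Q).
  by rewrite -[map_xy _]/(map2 (dm A)) map2D pdualD; congr (_ + _);
    by rewrite -[map2 _ _]/(map_xy (dm A) _) dual_map_pdual id_xy.
exists s; last by exists J3.
exists d; split.
- apply: (Emb_pulls d1 _ Ed E1); rewrite me !mxE /= mul1r mul0r addr0 subrr.
  exact: (ideal_0 (hilb_is_ideal J1)).
- apply: (Emb_pulls d2 _ Ed E2); rewrite me !mxE /= mul1r mul0r add0r subrr.
  exact: (ideal_0 (hilb_is_ideal J2)).
- apply: (Emb_pulls d3 _ Ed Es); rewrite me !mxE /= !mul1r subrr.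
  exact: (ideal_0 (hilb_is_ideal J3)).
Qed.

(** Here be = 1: the ideals of w and v are placed along e_1 and along the diagonal, with common
    class P e_1. The restriction to e_2 has class 0 and is the vector along Z by which v and w
    differ. *)
Lemma Ex_normal_eq v w P : Ex J v P -> Ex J w P -> normal_eq J v w.
Proof.
case=> J1 [h1 E1] [J2 [h2 E2]].
have b0 : m3 ord0 0 = 1 by rewrite mxE.
have b1 : m3 ord_max 0 = 1 by rewrite mxE.
have [Jd [hd d1 d3]] := hilb_glue b0 b1 h2 h1.
have [J3 d2] := hilb_map (dm m2) Jd.
have h3 : hilb_pulls aug J3 J by apply: (hilb_pulls_descend _ d2 hd).
have [d Ed] := explicit_ex (pdual ord0 P) Jd.
have [z Ez] := explicit_ex 0 J3.
exists J3, z; split=> //; first exact/in_Z_Emb.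
exists d; split.
- apply: (Emb_pulls d1 _ Ed E2); rewrite dual_map_pdual id_xy !mxE /= mul1r subrr.
  exact: (ideal_0 (hilb_is_ideal J2)).
- apply: (Emb_pulls d2 _ Ed Ez); rewrite dual_map_pdual id_xy !mxE /= mul0r pdual0 subrr.
  exact: (ideal_0 (hilb_is_ideal J3)).
- apply: (Emb_pulls d3 _ Ed E1); rewrite dual_map_pdual id_xy !mxE /= mul1r subrr.
  exact: (ideal_0 (hilb_is_ideal J1)).
Qed.

(** The explicit sheaf with rescaled P is one base change, and every other is isomorphic to it. *)
Lemma Ex_pull (R' : comAlgType K) (g : {lrmorphism R -> R'}) (J' : hilb n R') (r : R') (M : 'M[R']_1) v P :
  hilb_pulls g J J' -> M 0 0 = r -> Ex J v P ->
  (exists w : framed n (dualnum R' 1), pulls (dual_map g M) v w) /\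
  (forall w : framed n (dualnum R' 1), pulls (dual_map g M) v w -> Ex J' w (r%:P%:P * map_xy g P)).
Proof.
move=> hJ Mr [J1 [h1 E1]].
have [J2 h2] := hilb_map (dual_map g M) J1.
pose f : {lrmorphism D -> R'} := (g \o aug)%FUN.
have hf : hilb_pulls f J1 J' by apply: (hilb_pulls_comp _ h1 hJ).
have h3 : hilb_pulls (@dual_aug K R' 1) J2 J' by apply: (hilb_pulls_descend _ h2 hf).
have e : map_xy (dual_map g M) (pdual ord0 P) = pdual ord0 (r%:P%:P * map_xy g P).
  by rewrite dual_map_pdual Mr.
split=> [|w pw]; last by exists J2; split=> //; rewrite -e; apply: pulls_Emb h2 E1 pw.
have [w Ew] := explicit_ex (map_xy (dual_map g M) (pdual ord0 P)) J2; exists w.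
apply: (Emb_pulls h2 _ E1 Ew); rewrite subrr; exact: (ideal_0 (hilb_is_ideal J2)).
Qed.

Lemma Ex_moves (t : torus R) (J' : hilb n R) v P : hilb_moves t J J' -> Ex J v P ->
  (exists w, moves idfun (torus_map (@dual_const K R 1) t) v w) /\
  (forall w, moves idfun (torus_map (@dual_const K R 1) t) v w -> Ex J' w ((char_u t)%:P%:P * act_xy t P)).
Proof.
move=> hJ [J1 [h1 E1]]; set T := torus_map _ t.
have [J2 h2] := hilb_act T J1.
have powE (x : Gm R) z : gm_pow (gm_map (@dual_const K R 1) x) z = dual_const 1 (gm_pow x z).
  by case: z => j /=; rewrite (rmorphXn (@dual_const K R 1)).
have bE m : bweight T m = dual_const 1 (bweight t m) by rewrite /bweight !powE (rmorphM (@dual_const K R 1)).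
have uE : char_u T = dual_const 1 (char_u t) by rewrite /char_u (rmorphM (@dual_const K R 1)).
have aE (P1 : {poly {poly D}}) : map_xy aug (act_xy T P1) = act_xy t (map_xy aug P1).
  apply: toL_inj; rewrite toL_map !toL_act toL_map; apply: laurP => m.
  by rewrite LmapE !LtwE LmapE bE.
have h3 : hilb_pulls aug J2 J'.
  have [a b] := proj1 (hilb_pulls_aug J1 J) h1; apply/hilb_pulls_aug; split=> [Q JQ|Q JQ].
    have [P1 e1] := act_surj T Q; rewrite -e1 aE; apply/hJ; apply: a; apply/h2; rewrite e1; exact: JQ.
  have [Q1 e1] := act_surj t Q; rewrite -e1 in JQ; have /hJ/b[P1 [JP1 eP]] := JQ.
  by exists (act_xy T P1); split; [apply/h2|rewrite aE eP].
have e : (char_u T)%:P%:P * act_xy T (pdual ord0 P) = pdual ord0 ((char_u t)%:P%:P * act_xy t P).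
  apply: toL_inj; rewrite toLZ toL_act !toL_pdual toLZ toL_act uE; apply: laurP => m.
  by rewrite !(lcoefZ, LtwE, LmapE) bE; apply: rmorph_mulCA.
split=> [|w mw]; last by exists J2; split=> //; rewrite -e; apply: moves_Emb h2 E1 mw.
have [w Ew] := explicit_ex (pdual ord0 ((char_u t)%:P%:P * act_xy t P)) J2; exists w.
apply: (Emb_moves h2 _ E1 Ew); rewrite e subrr; exact: (ideal_0 (hilb_is_ideal J2)).
Qed.
End Calculus.

(** * The isomorphism of bundles, given explicit presentations of weight vectors *)

Section Final.
Variables (K : closedFieldType) (n : nat).
Implicit Types (R : comAlgType K).

Lemma hilb_pulls_id R (J : hilb n R) : hilb_pulls idfun J J.
Proof.
move=> Q; split=> [JQ|[l [F [c [hF ->]]]]].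
  by exists 1%N, (fun=> Q), (fun=> 1); rewrite big_ord1 id_xy mul1r.
by apply: (ideal_sum (hilb_is_ideal J)) => // i _; rewrite id_xy; apply: (ideal_M (hilb_is_ideal J)).
Qed.

Lemma act_projA R (t : torus R) P : act_xy (projA t) P = P.
Proof.
apply: toL_inj; rewrite toL_act; apply: laurP => m; rewrite LtwE.
by rewrite -[bweight _ _]/(bweight (torus1 R) (- m)) bweight1 mul1r.
Qed.

(** Rescaling by u and the action of A both multiply P by u, and P determines the vector modulo
    Z. *)
Lemma Ex_weight R (J : hilb n R) (x : fib (normal_bundle K n) J) P :
  Ex J (sval x) P -> has_weight (@char_u) x.
Proof.
move=> Ex0 R' g t J' x' y fg hJ [w pw nw] [w' pw' nw'].
have o11 : (1%:M : 'M[R']_1) 0 0 = 1 by rewrite mxE.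
have u11 : ((char_u t)%:M : 'M[R']_1) 0 0 = char_u t by rewrite mxE.
have [_ h1] := Ex_pull hJ o11 Ex0; have E1 := h1 _ pw; rewrite mul1r in E1.
have E2 := proj1 (normal_eq_Ex _ nw) E1.
have [_ h3] := Ex_pull (hilb_pulls_id J') u11 E2; have E3 := h3 _ pw'; rewrite id_xy in E3.
have E4 := proj1 (normal_eq_Ex _ nw') E3.
have mJ : hilb_moves (projA t) J' J' by move=> Q; rewrite act_projA.
have [[z mz] h5] := Ex_moves mJ E2; have E5 := h5 _ mz; rewrite act_projA in E5.
exists z => //; exact: Ex_normal_eq E5 E4.
Qed.

Hypothesis weight_Ex : forall R (J : hilb n R) (x : fib (normal_bundle K n) J), fin_gen_alg R ->
  has_weight (@char_u) x -> exists P, Ex J (sval x) P.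

Theorem bundle_iso_of_weight : bundle_iso (N_minus K n) (twist (tautological K n) (@char_u)).
Proof.
pose phi R (hR : fin_gen_alg R) (J : hilb n R) (x : fib (N_minus K n) J) : {poly {poly R}} :=
  sval (cid (weight_Ex hR (proj2_sig x))).
have phiP R (hR : fin_gen_alg R) J (x : fib (N_minus K n) J) : Ex J (sval (sval x)) (phi R hR J x).
  by rewrite /phi; case: cid.
(* All compatibilities reduce to this: for explicit vectors, equality in the normal bundle is
   equality of P modulo [J]. *)
have key R (J : hilb n R) v w P Q : Ex J v P -> Ex J w Q -> normal_eq J v w <-> J (P - Q).
  move=> Ev Ew; split=> [h|h]; first exact: Ex_uniq (proj1 (normal_eq_Ex _ h) Ev) Ew.
  by apply: Ex_normal_eq (Ex_eq Ev h) Ew.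
exists phi; split.
- by move=> R hR J x y; apply: key; apply: phiP.
- move=> R hR J P; have [v Ev] := Ex_exists J P.
  pose x0 : fib (normal_bundle K n) J := exist _ v (Ex_tangent Ev).
  have hx : has_weight (@char_u) x0 by apply: (@Ex_weight R J x0 P).
  pose x : fib (N_minus K n) J := exist _ x0 hx; exists x.
  have E : Ex J v (phi R hR J x) := phiP R hR J x.
  by have := Ex_uniq E Ev.
- move=> R hR J; split=> [x y z|r x y].
    split=> [[s A N]|h].
      by apply/(key _ _ _ _ _ _ (add_Ex A (phiP R hR J x) (phiP R hR J y)) (phiP R hR J z)).
    have [s A E] := Ex_add (phiP R hR J x) (phiP R hR J y); exists s => //.
    by apply/(key _ _ _ _ _ _ E (phiP R hR J z)).
  have r11 : (r%:M : 'M[R]_1) 0 0 = r by rewrite mxE.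
  have [[w pw] h2] := Ex_pull (hilb_pulls_id J) r11 (phiP R hR J x); rewrite id_xy in h2.
  split=> [[w' pw' N]|h]; first exact: (proj1 (key _ _ _ _ _ _ (h2 _ pw') (phiP R hR J y)) N).
  by exists w => //; apply/(key _ _ _ _ _ _ (h2 _ pw) (phiP R hR J y)).
- move=> R R' hR hR' g J J' hJ x x'.
  have o11 : (1%:M : 'M[R']_1) 0 0 = 1 by rewrite mxE.
  have [[w pw] h2] := Ex_pull hJ o11 (phiP R hR J x); rewrite mul1r in h2.
  split=> [[w' pw' N]|h]; first exact: (proj1 (key _ _ _ _ _ _ (h2 _ pw') (phiP R' hR' J' x')) N).
  by exists w => //; apply/(key _ _ _ _ _ _ (h2 _ pw) (phiP R' hR' J' x')).
- move=> R hR t J J' hJ x x'; have Ji' := hilb_is_ideal J'.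
  have [[w mw] h2] := Ex_moves hJ (phiP R hR J x).
  split=> [[w' mw' N]|[y h3 h4]].
    exists (act_xy t (phi R hR J x)); first by rewrite /= subrr; apply: ideal_0.
    exact: (proj1 (key _ _ _ _ _ _ (h2 _ mw') (phiP R hR J' x')) N).
  exists w => //; apply/(key _ _ _ _ _ _ (h2 _ mw) (phiP R hR J' x')).
  have -> : (char_u t)%:P%:P * act_xy t (phi R hR J x) - phi R hR J' x' =
    (char_u t)%:P%:P * (act_xy t (phi R hR J x) - y) + ((char_u t)%:P%:P * y - phi R hR J' x').
    by rewrite mulrBr addrA subrK.
  by apply: ideal_D => //; apply: ideal_M.
Qed.
End Final.

(** * Constructions of framed sheaves *)

Section Act.
Variables (K : closedFieldType) (R : comAlgType K) (S : qcoh R) (I : chart).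
Implicit Types (c d : laurent R) (s : sec S I).
Lemma actE c s : act c s = Lext (fun m => mon S m s) c. Proof. by []. Qed.
Lemma actDl c d s : act (c + d) s = act c s + act d s. Proof. by rewrite !actE raddfD. Qed.
Lemma actZl r c s : act (r *: c) s = r *: act c s.
Proof. by rewrite !actE (linearZ_LR (Lext (fun m => mon S m s))). Qed.
Lemma act0l s : act 0 s = 0. Proof. by rewrite actE raddf0. Qed.
Lemma actDr c s t : in_O I c -> act c (s + t) = act c s + act c t.
Proof.
move=> hc; rewrite /act -big_split big_seq [RHS]big_seq; apply: eq_bigr => m.
rewrite mem_finsupp => /hc hm; by rewrite (semilinD (g := idfun) (mon_linear hm)) scalerDr.
Qed.
Lemma Lmap_fsub (R' : comNzRingType) (g : {rmorphism R -> R'}) c : (finsupp (Lmap g c) `<=` finsupp c)%fset.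
Proof.
apply/fsubsetP => m; rewrite !mem_finsupp; apply: contraNneq => e.
by rewrite LmapE e rmorph0.
Qed.
Lemma act_vanish c s : chart_inf I -> in_O I c -> vanish_inf s -> vanish_inf (act c s).
Proof.
move=> hI hc hs; rewrite /act big_seq; elim/big_ind: _ => [|x y hx hy|m]; first exact: vanish0.
  exact: vanishD.
rewrite mem_finsupp => /hc hm; apply: vanishZ; case: hs => m' [s' [h1 h2 ->]].
by exists m', (mon S m s'); rewrite -!mon_D // addrC.
Qed.
End Act.

(** * Base change along an automorphism of the base ring *)

Section Twist.
Variables (K : closedFieldType) (n : nat) (R : comAlgType K) (a b : {lrmorphism R -> R}).
Hypotheses (ab : forall x, a (b x) = x) (ba : forall x, b (a x) = x).
Variable v : framed n R.

(** Base change along b is restriction of scalars along its inverse a, on the same underlying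
    sections. *)
Let sec' I : lmodType R := rs a (sec v I).
Let mon' I (m : ZZ) (s : sec' I) : sec' I := mon v m (s : sec v I).
Let res' I J (s : sec' I) : sec' J := res v J (s : sec v I).

Fact tw_mon_linear I m : regular (sval I) m -> forall (r : R) s t, @mon' I m (r *: s + t) = r *: mon' m s + mon' m t.
Proof. by move=> hm r s t; apply: (mon_linear hm). Qed.
Fact tw_mon_0 I (s : sec' I) : mon' 0 s = s. Proof. exact: mon_0. Qed.
Fact tw_mon_D I m m' (s : sec' I) : regular (sval I) m -> regular (sval I) m' -> mon' (m + m') s = mon' m (mon' m' s).
Proof. exact: mon_D. Qed.
Fact tw_res_linear I J : csub I J -> forall (r : R) (s t : sec' I), res' J (r *: s + t) = r *: res' J s + res' J t.
Proof. by move=> hI r s t; apply: (res_linear hI). Qed.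
Fact tw_res_id I (s : sec' I) : res' I s = s. Proof. exact: res_id. Qed.
Fact tw_res_comp I J H : csub I J -> csub J H -> forall s : sec' I, res' H (res' J s) = res' H s.
Proof. by move=> h1 h2 s; apply: (res_comp h1 h2). Qed.
Fact tw_res_mon I J : csub I J -> forall m, regular (sval I) m -> forall s : sec' I, res' J (mon' m s) = mon' m (res' J s).
Proof. by move=> h1 m h2 s; apply: (res_mon h1 h2). Qed.
Fact tw_res_ker I J : csub I J -> forall s : sec' I, res' J s = 0 ->
  exists m, [/\ regular (sval I) m, regular (sval J) (- m) & mon' m s = 0].
Proof. by move=> h1 s; apply: (res_ker h1). Qed.
Fact tw_res_frac I J : csub I J -> forall t : sec' J, exists m (s : sec' I),
  [/\ regular (sval I) m, regular (sval J) (- m) & mon' m t = res' J s].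
Proof. by move=> h1 s; apply: (res_frac h1). Qed.
Let tw : qcoh R := Qcoh tw_mon_linear tw_mon_0 tw_mon_D tw_res_linear tw_res_id tw_res_comp tw_res_mon tw_res_ker tw_res_frac.

Lemma tw_act I c (s : sec v I) : act c (s : sec tw I) = act (Lmap a c) s.
Proof. by rewrite [RHS]actE (LextE _ (Lmap_fsub a c)) /act; apply: eq_bigr => m _; rewrite LmapE. Qed.
Lemma LmapK c : Lmap a (Lmap b c) = c.
Proof. by apply: laurP => m; rewrite !LmapE; exact: ab. Qed.

Lemma tw_pb : pb (S := v) (S' := tw) b (fun I s => s).
Proof.
split=> // [I r s t|I N h hl]; first by rewrite -[RHS]/(a (b r) *: s + t) ab.
exists h; split=> // r s t; rewrite -[r *: s in LHS]/(a r *: (s : sec v I)) hl.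
by rewrite [X in X *: _ + _](_ : _ = r) //; exact: ba.
Qed.

Lemma framed_twist : exists v' : framed n R, pulls b v v'.
Proof.
have fg : fin_gen tw.
  move=> I; have [l [gen hg]] := framed_fin_gen v I; exists l, gen => s; have [c [hc e]] := hg s.
  exists (fun j => Lmap b (c j)); split=> [j|]; first exact: inOs_Lmap (hc j).
  rewrite {1}e; apply: eq_bigr => j _; by rewrite tw_act LmapK.
have fl : flat tw.
  move=> I k r x hx.
  have h : \sum_i (map_mx a r) 0 i *: (x i : sec v I) = 0.
    by rewrite -[RHS]hx; apply: eq_bigr => i _; rewrite mxE.
  have [l [A [z [rA xz]]]] := framed_flat h; exists l, (map_mx b A), z; split.
    have -> : r = map_mx b (map_mx a r) by apply/matrixP => i j; rewrite !mxE; exact: esym (ba _).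
    by rewrite -map_mxM rA map_mx0.
  move=> i; rewrite xz; apply: eq_bigr => j _.
  have e : a ((map_mx b A) i j) = A i j by rewrite mxE; exact: ab.
  by rewrite -[in LHS]e.
(* The fibre of the twisted sheaf at p is the fibre of v at the composite of p and b. *)
have fib (p : {lrmorphism R -> K^o}) (S0 : qcoh K) F :
    is_pullback (S := tw) (S' := S0) p (torus1 K) F ->
    [/\ torsion_free S0, has_rank S0 2 & has_c2 S0 n].
  move=> /(@pbE K R K^o) [f1 f2 f3 f4]; pose q : {lrmorphism R -> K^o} := (p \o b)%FUN.
  apply: (framed_fibre (p := q) (F := F)); apply/(@pbE K R K^o).
  have [g1 g2 g3 g4] := tw_pb.
  split=> [I r s t|||I] //; first by rewrite -f1 -g1.
  exact: (tensor_comp (g := b) (h := p) _ (g1 I) (f1 I) (g4 I) (f4 I)).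
have fram : is_framing (S := tw) (frame v).
  have [a1 a2 a3] := framed_frame v; split=> //.
    move=> I hI s; have [c [hc e]] := a2 I hI s; exists (fun j => Lmap b (c j)).
    split=> [j|]; first exact: inOs_Lmap (hc j).
    by under eq_bigr do rewrite tw_act LmapK.
  move=> I c hI hc hv k m hm.
  have h0 := a3 I (fun k => Lmap a (c k)) hI (fun k => @inOs_Lmap _ _ a _ _ (hc k)).
  have h1 : Lmap a (c k) m = 0.
    apply: h0 => //; move: hv; by under eq_bigr do rewrite tw_act.
  have -> : c k m = b (Lmap a (c k) m) by rewrite LmapE; exact: esym (ba _).
  by rewrite h1 rmorph0.
exists (Framed fg fl fib fram); apply/pullsE; exists (fun I s => s); first exact: tw_pb.
by move=> I k hI; rewrite subrr; apply: vanish0.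
Qed.
End Twist.

(* For E = D (+) R e_2 and an (E, D)-pair of modules M -> M0, the E-module M (+) M0 e_2. *)
Section ExtMod.
Variables (E D R : comNzRingType) (pi : {rmorphism E -> D}) (au : {rmorphism D -> R}) (ep : E -> R).
Hypotheses (epD : forall x y, ep (x + y) = ep x + ep y)
  (epM : forall x y, ep (x * y) = au (pi x) * ep y + ep x * au (pi y)).
Variables (M : lmodType D) (M0 : lmodType R) (F : M -> M0).
Hypothesis Fl : forall (r : D) s t, F (r *: s + t) = au r *: F s + F t.

Definition emod of (forall x y, ep (x + y) = ep x + ep y) &
  (forall x y, ep (x * y) = au (pi x) * ep y + ep x * au (pi y)) &
  (forall (r : D) s t, F (r *: s + t) = au r *: F s + F t) : Type := (M * M0)%type.
Local Notation W := (emod epD epM Fl).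
HB.instance Definition _ := GRing.Zmodule.on W.
Definition escale (x : E) (p : W) : W := (pi x *: p.1, au (pi x) *: p.2 + ep x *: F p.1).
Fact emod_ep1 : ep 1 = 0.
Proof. by apply: (addrI (ep 1)); rewrite addr0 -{3}[1]mulr1 epM !rmorph1 mul1r mulr1. Qed.
Fact escaleA x y p : escale x (escale y p) = escale (x * y) p.
Proof.
congr pair; rewrite /=; first by rewrite rmorphM scalerA.
by rewrite (semilinZ Fl) epM !rmorphM scalerDr !scalerA scalerDl addrA.
Qed.
Fact escale1 : left_id 1 escale.
Proof. by case=> s f; rewrite /escale /= emod_ep1 !rmorph1 !scale1r scale0r addr0. Qed.
Fact escaleDr : right_distributive escale +%R.
Proof. by move=> x p q; congr pair; rewrite /= ?(semilinD Fl) !scalerDr // addrACA. Qed.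
Fact escaleDl p : {morph escale^~ p : x y / x + y}.
Proof. by move=> x y; congr pair; rewrite /= ?epD !rmorphD !scalerDl // addrACA. Qed.
HB.instance Definition _ := GRing.Zmodule_isLmodule.Build E W escaleA escale1 escaleDr escaleDl.
Lemma emodP (p q : W) : p.1 = q.1 -> p.2 = q.2 -> p = q.
Proof. by case: p q => [a b] [c d] /= -> ->. Qed.
Lemma emod_sum1 (T : Type) (r : seq T) (f : T -> W) : (\sum_(i <- r) f i).1 = \sum_(i <- r) (f i).1.
Proof. by elim: r => [|i r IH]; rewrite ?big_nil // !big_cons -IH. Qed.
Lemma emod_sum2 (T : Type) (r : seq T) (f : T -> W) : (\sum_(i <- r) f i).2 = \sum_(i <- r) (f i).2.
Proof. by elim: r => [|i r IH]; rewrite ?big_nil // !big_cons -IH. Qed.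
End ExtMod.

Section ExtFlat.
Variables (E D R : comNzRingType) (pi : {rmorphism E -> D}) (au : {rmorphism D -> R}) (ep : E -> R).
Variables (th : {rmorphism D -> E}) (cs : {rmorphism R -> D}) (e2 : E) (eta : D).
Hypotheses (epD : forall x y, ep (x + y) = ep x + ep y)
  (epM : forall x y, ep (x * y) = au (pi x) * ep y + ep x * au (pi y))
  (pith : forall x, pi (th x) = x) (epth : forall x, ep (th x) = 0) (pie2 : pi e2 = 0) (epe2 : ep e2 = 1)
  (aucs : forall r, au (cs r) = r) (Edet : forall x y, pi x = pi y -> ep x = ep y -> x = y)
  (aueta : au eta = 0).
Variables (M : lmodType D) (M0 : lmodType R) (F : M -> M0).
Hypothesis Fl : forall (r : D) s t, F (r *: s + t) = au r *: F s + F t.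
Hypothesis Fs : forall f, exists s, F s = f.
Hypothesis Fk : forall s, F s = 0 -> exists s', s = eta *: s'.
Local Notation W := (emod epD epM Fl).

Lemma epS (T : Type) (r : seq T) (f : T -> E) : ep (\sum_(i <- r) f i) = \sum_(i <- r) ep (f i).
Proof.
have ep0 : ep 0 = 0 by apply: (addrI (ep 0)); rewrite -epD !addr0.
by elim: r => [|i r IH]; rewrite ?big_nil // !big_cons epD IH.
Qed.
Lemma ext_split x : x = th (pi x) + e2 * th (cs (ep x)).
Proof.
apply: Edet; first by rewrite rmorphD rmorphM pie2 mul0r addr0 pith.
by rewrite epD epth add0r epM pie2 rmorph0 mul0r add0r epe2 mul1r pith aucs.
Qed.
Lemma eta_e2 : e2 * th eta = 0.
Proof.
apply: Edet; first by rewrite rmorphM pie2 mul0r rmorph0.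
rewrite epM epth mulr0 add0r pith aueta mulr0.
by apply: (addrI (ep 0)); rewrite -epD !addr0.
Qed.

Lemma e2_comm x : x * e2 = e2 * th (pi x).
Proof.
apply: Edet; first by rewrite !rmorphM pie2 mul0r mulr0.
by rewrite !epM epth pie2 rmorph0 epe2 mulr0 mulr1 mul0r addr0 add0r mul1r pith.
Qed.

Definition eio (s : M) : W := (s, 0).
Lemma eio_lin (r : D) s t : eio (r *: s + t) = th r *: eio s + eio t.
Proof. by apply: emodP; rewrite /= ?pith // epth scale0r scaler0 !addr0. Qed.
Lemma emod_dec (p : W) : exists s', p = eio p.1 + e2 *: eio s' /\ F s' = p.2.
Proof.
have [s' e] := Fs p.2; exists s'; split=> //; apply: emodP; rewrite /= ?pie2 ?scale0r ?addr0 //.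
by rewrite add0r rmorph0 scale0r add0r epe2 scale1r e.
Qed.

(** A map h extends by (s, f) -> h s + e_2 h(s') for any lift s' of f: two lifts differ by a
    multiple of eta, and e_2 eta = 0. *)
Lemma ext_tensor : is_tensor th eio.
Proof.
move=> N h hl; have /choice[G GE] := Fs.
have hZ : forall r s, h (r *: s) = th r *: h s := semilinZ hl.
have hB : forall s t, h (s - t) = h s - h t := semilinB hl.
have k0 s t : F s = F t -> e2 *: h s = e2 *: h t.
  move=> e; have [s' es] : exists s', s - t = eta *: s' by apply: Fk; rewrite (semilinB Fl) e subrr.
  by apply/eqP; rewrite -subr_eq0 -scalerBr -hB es hZ scalerA eta_e2 scale0r.
exists (fun p : W => h p.1 + e2 *: h (G p.2)); split=> [x p q|s|h'' h''l e p] /=.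
- have -> : e2 *: h (G (au (pi x) *: p.2 + ep x *: F p.1 + q.2)) =
      e2 *: h (pi x *: G p.2 + (cs (ep x) *: p.1 + G q.2)).
    by apply: k0; rewrite !Fl !GE aucs addrA.
  have xa : x *: h p.1 = th (pi x) *: h p.1 + (e2 * th (cs (ep x))) *: h p.1 by rewrite -scalerDl -ext_split.
  rewrite !hl !scalerDr xa !scalerA e2_comm.
  move: (_ *: h p.1) (h q.1) (_ *: h (G p.2)) (_ *: h p.1) (_ *: h (G q.2)) => x1 x2 x3 x4 x5.
  by rewrite [x3 + (x1 + x5)]addrCA [x4 + x2 + _]addrACA [x2 + (x3 + x5)]addrCA -!addrA.
- by rewrite (k0 _ 0) ?hZ; [rewrite -[0](scale0r (0 : M)) hZ rmorph0 scale0r scaler0 addr0|rewrite GE (semilin0 Fl)].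
- have [s' [ep' es']] := emod_dec p; rewrite [in LHS]ep' addrC h''l e e addrC; congr (_ + _).
  by apply: k0; rewrite GE.
Qed.

(** The equational criterion in two rounds. The first components are resolved over D by [A] and [z].
    The second components together with the F(z_l) then satisfy a relation over R, resolved by [B]
    and [w]. Lifting the latter to D leaves errors divisible by eta, which give the additional
    generators [z']. *)
Lemma ext_flat : flat_module M -> flat_module M0 -> flat_module W.
Proof.
move=> fM fM0 k r x h0.
have h1 : \sum_i (map_mx pi r) 0 i *: (x i).1 = 0.
  by rewrite -[RHS]/((0 : W).1) -h0 emod_sum1; apply: eq_bigr => i _; rewrite mxE.
have h2 : \sum_i (au (pi (r 0 i)) *: (x i).2 + ep (r 0 i) *: F (x i).1) = 0.
  by rewrite -[RHS]/((0 : W).2) -h0 emod_sum2.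
have [L [A [z [rA xz]]]] := fM _ _ _ h1.
pose y (i : 'I_(k + L)) := match split i with inl i => (x i).2 | inr l => F (z l) end.
pose cf : 'rV_(k + L) := row_mx (\row_i au (pi (r 0 i))) (\row_l \sum_i ep (r 0 i) * au (A i l)).
have h3 : \sum_i cf 0 i *: y i = 0.
  rewrite big_split_ord /= -[RHS]h2 big_split /=; congr (_ + _).
    by apply: eq_bigr => i _; rewrite row_mxEl mxE /y (unsplitK (inl _)).
  under [RHS]eq_bigr do rewrite xz (semilin_sum Fl) scaler_sumr.
  rewrite exchange_big; apply: eq_bigr => l _ /=; rewrite row_mxEr mxE /y (unsplitK (inr _)) scaler_suml.
  by apply: eq_bigr => i _; rewrite (semilinZ Fl) scalerA.
have [m [B [w [cB yw]]]] := fM0 _ _ _ h3.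
have /choice[w' w'E] : forall j, exists s, F s = w j by move=> j; apply: Fs.
have /choice[z' z'E] : forall l, exists s', z l - \sum_j cs (B (rshift k l) j) *: w' j = eta *: s'.
  move=> l; apply: Fk; rewrite (semilinB Fl) (semilin_sum Fl).
  have := yw (rshift k l); rewrite /y (unsplitK (inr _)) => ->; rewrite -sumrB big1 // => j _.
  by rewrite (semilinZ Fl) aucs w'E subrr.
pose a1 : 'M_(k, m) := \matrix_(i, j) (\sum_l th (A i l) * th (cs (B (rshift k l) j)) + e2 * th (cs (B (lshift L i) j))).
pose a2 : 'M_(k, L) := \matrix_(i, l) (th (A i l) * th eta).
pose g (j : 'I_(m + L)) : W := match split j with inl j => eio (w' j) | inr l => eio (z' l) end.
exists (m + L)%N, (row_mx a1 a2), g; split.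
  have rA0 l : \sum_i pi (r 0 i) * A i l = 0.
    have h := congr1 (fun X : 'rV_L => X 0 l) rA; rewrite !mxE in h; rewrite -[RHS]h.
    by apply: eq_bigr => i _; rewrite mxE.
  have ep0 : ep 0 = 0 by apply: (addrI (ep 0)); rewrite -epD !addr0.
  rewrite mul_mx_row; apply/rowP => j; rewrite -[j]splitK; case: (split j) => {}j /=.
    rewrite row_mxEl !mxE; apply: Edet; rewrite ?rmorph0 ?ep0.
      rewrite rmorph_sum /=.
      transitivity (\sum_l (\sum_i pi (r 0 i) * A i l) * cs (B (rshift k l) j)).
        under [RHS]eq_bigr do rewrite mulr_suml.
        rewrite exchange_big; apply: eq_bigr => i _ /=; rewrite mxE rmorphM rmorphD rmorphM pie2 mul0r addr0.
        by rewrite rmorph_sum mulr_sumr; apply: eq_bigr => l _; rewrite rmorphM /= !pith mulrA.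
      by rewrite big1 // => l _; rewrite rA0 mul0r.
    rewrite epS; have h := congr1 (fun X : 'rV_m => X 0 j) cB; rewrite !mxE big_split_ord /= in h; rewrite -[RHS]h.
    transitivity (\sum_i (au (pi (r 0 i)) * B (lshift L i) j + \sum_l ep (r 0 i) * au (A i l) * B (rshift k l) j)).
      apply: eq_bigr => i _; rewrite mxE epM epD epS rmorphD rmorph_sum rmorphD rmorph_sum /=.
      rewrite big1 ?add0r; last by move=> l _; rewrite epM !epth mulr0 mul0r addr0.
      rewrite epM pie2 rmorph0 mul0r add0r epe2 mul1r pith aucs rmorphM pie2 mul0r rmorph0 addr0.
      congr (_ + _); rewrite mulr_sumr; apply: eq_bigr => l _.
      by rewrite !rmorphM /= !pith aucs mulrA.
    rewrite big_split /= exchange_big /=; congr (_ + _); apply: eq_bigr => i _.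
      by rewrite row_mxEl mxE.
    by rewrite row_mxEr mxE mulr_suml.
  rewrite row_mxEr !mxE; apply: Edet; rewrite ?rmorph0 ?ep0.
    transitivity ((\sum_i pi (r 0 i) * A i j) * eta); last by rewrite rA0 mul0r.
    rewrite rmorph_sum mulr_suml; apply: eq_bigr => i _.
    by rewrite mxE !rmorphM /= !pith mulrA.
  rewrite epS big1 // => i _; rewrite mxE epM epM !epth mulr0 mul0r addr0 mulr0 add0r.
  by rewrite !rmorphM /= !pith aueta !mulr0.
move=> i; rewrite big_split_ord /=; apply: emodP; rewrite /= !(emod_sum1, emod_sum2).
  under eq_bigr => j _ do rewrite row_mxEl mxE /g (unsplitK (inl _)) /= rmorphD rmorphM pie2 mul0r addr0 rmorph_sum scaler_suml.
  under [X in _ + X]eq_bigr => l _ do rewrite row_mxEr mxE /g (unsplitK (inr _)) /= rmorphM !pith.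
  rewrite exchange_big -big_split xz; apply: eq_bigr => l _ /=.
  rewrite -scalerA -z'E scalerBr scaler_sumr.
  under eq_bigr do rewrite rmorphM /= !pith -scalerA.
  by rewrite addrC subrK.
under eq_bigr => j _ do rewrite row_mxEl mxE /g (unsplitK (inl _)) /= scaler0 add0r epD epS.
rewrite [X in _ + X]big1 ?addr0; last first.
  by move=> l _; rewrite row_mxEr mxE /g (unsplitK (inr _)) /= scaler0 add0r epM !epth mulr0 mul0r addr0 scale0r.
have := yw (lshift L i); rewrite /y (unsplitK (inl _)) => ->; apply: eq_bigr => j _.
rewrite big1 ?add0r; last by move=> l _; rewrite epM !epth mulr0 mul0r addr0.
by rewrite epM pie2 rmorph0 mul0r add0r epe2 mul1r pith aucs w'E.
Qed.
End ExtFlat.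

Lemma pb_act (K : closedFieldType) (R R' : comAlgType K) (g : {lrmorphism R -> R'}) (S : qcoh R) (S' : qcoh R')
    F I c (s : sec S I) : pb (S := S) (S' := S') g F -> in_O I c -> F I (act c s) = act (Lmap g c) (F I s).
Proof.
move=> [f1 f2 _ _] hc; rewrite [RHS]actE (LextE _ (Lmap_fsub g c)) /act (semilin_sum (f1 I)).
rewrite big_seq [RHS]big_seq; apply: eq_bigr => m; rewrite mem_finsupp => /hc hm.
by rewrite (semilinZ (f1 I)) f2 // LmapE.
Qed.

Section ExtSheaf.
Variables (K : closedFieldType) (n : nat) (E D R : comAlgType K).
Variables (pi : {lrmorphism E -> D}) (au : {lrmorphism D -> R}) (ep : E -> R).
Variables (th : {lrmorphism D -> E}) (cs : {lrmorphism R -> D}) (e2 : E) (eta : D).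
Hypotheses (epD : forall x y, ep (x + y) = ep x + ep y)
  (epM : forall x y, ep (x * y) = au (pi x) * ep y + ep x * au (pi y))
  (pith : forall x, pi (th x) = x) (epth : forall x, ep (th x) = 0) (pie2 : pi e2 = 0) (epe2 : ep e2 = 1)
  (aucs : forall r, au (cs r) = r) (Edet : forall x y, pi x = pi y -> ep x = ep y -> x = y)
  (aueta : au eta = 0) (auker : forall x, au x = 0 -> exists y, x = eta * y).
Variables (v : framed n D) (S0 : framed n R) (F : forall I, sec v I -> sec S0 I).
Hypotheses (pF : pb (S := v) (S' := S0) au F)
  (fF : forall I k, chart_inf I -> vanish_inf (F (frame v I k) - frame S0 I k)).

Let Fl I (r : D) (s t : sec v I) : F (r *: s + t) = au r *: F s + F t.
Proof. by case: pF => h _ _ _; apply: h. Qed.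
Let Fm I m (s : sec v I) : regular (sval I) m -> F (mon v m s) = mon S0 m (F s).
Proof. by case: pF => _ h _ _ hm; apply: h. Qed.
Let Fr I I' (s : sec v I) : csub I I' -> F (res v I' s) = res S0 I' (F s).
Proof. by case: pF => _ _ h _ hI; apply: h. Qed.
Let aus r : exists x, au x = r. Proof. by exists (cs r). Qed.
Let Fs I (f : sec S0 I) : exists s : sec v I, F s = f.
Proof. by case: pF => h _ _ t; exact: (tensor_surj aus (h I) (t I)). Qed.
Let Fk I (s : sec v I) : F s = 0 -> exists s', s = eta *: s'.
Proof.
case: pF => _ _ _ t; move: s; refine (tensor_ker aus (D := fun s => exists s', s = eta *: s') (t I) _ _).
  split=> [|r _ _ [x ->] [y ->]]; first by exists 0; rewrite scaler0.
  by exists (r *: x + y); rewrite scalerDr !scalerA mulrC.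
by move=> x s /auker[y ->]; exists (y *: s); rewrite scalerA.
Qed.

Let W I : lmodType E := emod epD epM (@Fl I).
Let wmon I (m : ZZ) (p : W I) : W I := (mon v m p.1, mon S0 m p.2).
Let wres I J (p : W I) : W J := (res v J p.1, res S0 J p.2).

Fact ext_mon_linear I m : regular (sval I) m -> forall (r : E) s t, @wmon I m (r *: s + t) = r *: wmon m s + wmon m t.
Proof.
move=> hm r s t; congr pair; first exact: (mon_linear hm).
rewrite -[LHS]/(mon S0 m ((au (pi r) *: s.2 + ep r *: F s.1) + t.2)) /= Fm //.
by rewrite !(semilinD (g := idfun) (mon_linear hm)) !(semilinZ (g := idfun) (mon_linear hm)).
Qed.
Fact ext_mon_0 I (s : W I) : wmon 0 s = s. Proof. by case: s => a b; rewrite /wmon !mon_0. Qed.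
Fact ext_mon_D I m m' (s : W I) : regular (sval I) m -> regular (sval I) m' -> wmon (m + m') s = wmon m (wmon m' s).
Proof. by move=> h1 h2; rewrite /wmon !mon_D. Qed.
Fact ext_res_linear I J : csub I J -> forall (r : E) (s t : W I), wres J (r *: s + t) = r *: wres J s + wres J t.
Proof.
move=> hI r s t; congr pair; first exact: (res_linear hI).
rewrite -[LHS]/(res S0 J ((au (pi r) *: s.2 + ep r *: F s.1) + t.2)) /= Fr //.
by rewrite !(semilinD (g := idfun) (res_linear hI)) !(semilinZ (g := idfun) (res_linear hI)).
Qed.
Fact ext_res_id I (s : W I) : wres I s = s. Proof. by case: s => a b; rewrite /wres !res_id. Qed.
Fact ext_res_comp I J H : csub I J -> csub J H -> forall s : W I, wres H (wres J s) = wres H s.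
Proof. by move=> h1 h2 s; rewrite /wres !res_comp. Qed.
Fact ext_res_mon I J : csub I J -> forall m, regular (sval I) m -> forall s : W I, wres J (wmon m s) = wmon m (wres J s).
Proof. by move=> h1 m h2 s; rewrite /wres /wmon !res_mon. Qed.
Fact ext_res_ker I J : csub I J -> forall s : W I, wres J s = 0 ->
  exists m, [/\ regular (sval I) m, regular (sval J) (- m) & wmon m s = 0].
Proof.
move=> hI [s f] h; have h1 : res v J s = 0 := congr1 fst h; have h2 : res S0 J f = 0 := congr1 snd h.
have [a [a1 a2 a3]] := res_ker hI h1; have [b [b1 b2 b3]] := res_ker hI h2.
exists (a + b); split; [exact: regularD|by rewrite opprD; apply: regularD|].
congr pair; rewrite /=; first by rewrite addrC mon_D // a3 (semilin0 (g := idfun) (mon_linear b1)).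
by rewrite mon_D // b3 (semilin0 (g := idfun) (mon_linear a1)).
Qed.
Fact ext_res_frac I J : csub I J -> forall t : W J, exists m (s : W I),
  [/\ regular (sval I) m, regular (sval J) (- m) & wmon m t = wres J s].
Proof.
move=> hI [s f]; have [a [s' [a1 a2 a3]]] := res_frac hI s; have [b [f' [b1 b2 b3]]] := res_frac hI f.
exists (a + b), (mon v b s', mon S0 a f'); split; [exact: regularD|by rewrite opprD; apply: regularD|].
have a4 := regularS hI a1; have b4 := regularS hI b1.
congr pair; rewrite /=; first by rewrite addrC mon_D // a3 res_mon.
by rewrite mon_D // b3 res_mon.
Qed.
Let ext : qcoh E := Qcoh ext_mon_linear ext_mon_0 ext_mon_D ext_res_linear ext_res_id ext_res_comp ext_res_mon ext_res_ker ext_res_frac.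
Let io I (s : sec v I) : sec ext I := eio epD epM (@Fl I) s.

Lemma ext_pb : pb (S := v) (S' := ext) th io.
Proof.
split=> [I r s t|I m hm s|I J hI s|I].
- exact: (eio_lin epD epM pith epth (@Fl I)).
- by congr pair; rewrite /= (semilin0 (g := idfun) (mon_linear hm)).
- by congr pair; rewrite /= (semilin0 (g := idfun) (res_linear hI)).
- exact: (ext_tensor epD epM pith epth pie2 epe2 aucs Edet aueta (@Fl I) (@Fs I) (@Fk I)).
Qed.

Let io0 I : io (0 : sec v I) = 0. Proof. by []. Qed.
Let dec I (p : sec ext I) : exists s s' : sec v I, p = io s + e2 *: io s'.
Proof. by have [s' [h _]] := emod_dec pie2 epe2 (@Fs I) p; exists p.1, s'. Qed.

Lemma ext_act I c c' (s : sec v I) : in_O I c -> in_O I c' ->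
  act (Lmap th c + e2 *: Lmap th c') (io s) = io (act c s) + e2 *: io (act c' s).
Proof. by move=> h1 h2; rewrite actDl actZl -!(pb_act _ ext_pb). Qed.

Lemma ext_sum I (T : Type) (r : seq T) (f f' : T -> sec v I) :
  \sum_(i <- r) (io (f i) + e2 *: io (f' i)) = io (\sum_(i <- r) f i) + e2 *: io (\sum_(i <- r) f' i).
Proof.
case: ext_pb => l _ _ _.
by rewrite big_split /= -scaler_sumr -!(semilin_sum (l I)).
Qed.

Lemma ext_vanish I (s s' : sec v I) : chart_inf I -> vanish_inf s -> vanish_inf s' -> vanish_inf (io s + e2 *: io s').
Proof.
move=> hI h1 h2; apply: vanishD => //; last apply: vanishZ; exact: (pb_vanish ext_pb).
Qed.

Lemma framed_ext : exists d : framed n E, pulls th v d.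
Proof.
have [l1 l2 l3 l4] := ext_pb.
have fg : fin_gen ext.
  move=> I; have [l [gen hg]] := framed_fin_gen v I; exists l, (fun j => io (gen j)) => p.
  have [s [s' ->]] := dec p; have [c [hc ->]] := hg s; have [c' [hc' ->]] := hg s'.
  exists (fun j => Lmap th (c j) + e2 *: Lmap th (c' j)); split=> [j|].
    by apply: inOsD; [|apply: inOsZ]; apply: inOs_Lmap; [exact: hc|exact: hc'].
  by rewrite -ext_sum; apply: eq_bigr => j _; rewrite ext_act.
have fl : flat ext.
  move=> I; apply: (ext_flat pith epth pie2 epe2 aucs Edet aueta (@Fs I) (@Fk I)).
    exact: framed_flat.
  exact: framed_flat.
have fib (p : {lrmorphism E -> K^o}) (S1 : qcoh K) G :
    is_pullback (S := ext) (S' := S1) p (torus1 K) G ->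
    [/\ torsion_free S1, has_rank S1 2 & has_c2 S1 n].
  (* The sheaf is the base change of v along [th], so its fibre at p is the fibre of v at the
     composite of p and [th]. *)
  move=> /(@pbE K E K^o) [f1 f2 f3 f4]; pose q : {lrmorphism D -> K^o} := (p \o th)%FUN.
  apply: (framed_fibre (p := q) (F := fun I s => G I (io s))); apply/(@pbE K D K^o).
  split=> [I r s t|I m hm s|I J hI s|I].
  - by rewrite l1 f1.
  - by rewrite l2 // f2.
  - by rewrite l3 // f3.
  - exact: (tensor_comp (g := th) (h := p) _ (l1 I) (f1 I) (l4 I) (f4 I)).
have fram : is_framing (S := ext) (fun I k => io (frame v I k)).
  have [a1 a2 a3] := framed_frame v; split=> [I J k hJ hI|I hI p|I C hI hC hv k m hm].
  - have -> : res ext J (io (frame v I k)) - io (frame v J k) = io (res v J (frame v I k) - frame v J k).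
      by rewrite (semilinB (l1 J)) -l3.
    exact: pb_vanish ext_pb (a1 I J k hJ hI).
  - have [s [s' ->]] := dec p; have [c [hc e]] := a2 I hI s; have [c' [hc' e']] := a2 I hI s'.
    exists (fun j => Lmap th (c j) + e2 *: Lmap th (c' j)); split=> [j|].
      by apply: inOsD; [|apply: inOsZ]; apply: inOs_Lmap; [exact: hc|exact: hc'].
    under eq_bigr do rewrite ext_act //.
    rewrite ext_sum opprD addrACA -scalerBr -!(semilinB (l1 I)).
    exact: ext_vanish.
  (* The coefficients split as th c + e_2 th(c'). The two parts of a vanishing combination vanish
     separately, the second one in S0, so the framings of v and of S0 apply. *)
  - pose c j := Lmap pi (C j); pose c' j : laurent R := mkL (finsupp (C j)) (fun m => ep (C j m)).
    have ep0 : ep 0 = 0 by apply: (addrI (ep 0)); rewrite -epD !addr0.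
    have c'E j m' : c' j m' = ep (C j m') by rewrite mkLE; case: finsuppP => // _; rewrite ep0.
    have hc j : in_O I (c j) by apply: inOs_Lmap (hC j).
    have hc' j : in_O I (c' j).
      by move=> m' h; apply: (hC j); apply: contraNneq h => e; rewrite c'E e ep0.
    have hcs j : in_O I (Lmap cs (c' j)) by apply: inOs_Lmap (hc' j).
    have CE j m' : C j m' = th (c j m') + e2 * th (cs (c' j m')).
      by rewrite LmapE c'E; exact: (ext_split epD epM pith epth pie2 epe2 aucs Edet).
    have eC j : C j = Lmap th (c j) + e2 *: Lmap th (Lmap cs (c' j)).
      by apply: laurP => m'; rewrite lcoefD lcoefZ !LmapE -!(LmapE pi) CE.
    have hv2 : vanish_inf (io (\sum_j act (c j) (frame v I j)) + e2 *: io (\sum_j act (Lmap cs (c' j)) (frame v I j))).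
      rewrite -ext_sum; congr vanish_inf: hv; apply: eq_bigr => j _; by rewrite [in LHS]eC ext_act.
    case: hv2 => m0 [p [h1 h2 h3]].
    have v1 : vanish_inf (\sum_j act (c j) (frame v I j)).
      exists m0, p.1; split=> //; rewrite -[RHS]/((mon ext m0 p).1) -h3 /= pie2 scale0r addr0 //.
    have v2 : vanish_inf (F (\sum_j act (Lmap cs (c' j)) (frame v I j))).
      exists m0, p.2; split=> //; rewrite -[RHS]/((mon ext m0 p).2) -h3 /= epe2 scale1r.
      by rewrite scaler0 !add0r.
    have v3 : vanish_inf (\sum_j act (c' j) (frame S0 I j)).
      have -> : \sum_j act (c' j) (frame S0 I j) = F (\sum_j act (Lmap cs (c' j)) (frame v I j)) -
          \sum_j act (c' j) (F (frame v I j) - frame S0 I j).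
        rewrite (semilin_sum (@Fl I)) -sumrB; apply: eq_bigr => j _.
        rewrite (pb_act _ pF) //; have -> : Lmap au (Lmap cs (c' j)) = c' j.
          by apply: laurP => m'; rewrite !LmapE; exact: aucs.
        have h : act (c' j) (F (frame v I j)) = act (c' j) (F (frame v I j) - frame S0 I j) + act (c' j) (frame S0 I j).
          by rewrite -actDr // subrK.
        by rewrite h [X in X - _]addrC addrK.
      apply: vanishD => //; apply: vanishN; elim/big_ind: _ => [|x y|j _]; [exact: vanish0|exact: vanishD|].
      by apply: act_vanish => //; apply: fF.
    have [_ _ b3] := framed_frame S0.
    by rewrite CE (a3 I c hI hc v1 k m hm) (b3 I c' hI hc' v3 k m hm) !rmorph0 mulr0 addr0.
exists (Framed fg fl fib fram); apply/pullsE; exists io; first exact: ext_pb.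
by move=> I k hI; rewrite subrr; apply: vanish0.
Qed.
End ExtSheaf.

(** * Reflexivity in the normal bundle and the weight test *)

Section Refl.
Variables (K : closedFieldType) (R : comAlgType K) (n : nat) (J : hilb n R).
Local Notation D := (dualnum R 1).
Local Notation D2 := (dualnum R 2).
Local Notation aug := (@dual_aug K R 1).
Local Notation m1 := (delta_mx ord0 0 : 'M[R]_(2, 1)).
Local Notation m2 := (delta_mx ord_max 0 : 'M[R]_(2, 1)).
Local Notation m3 := (const_mx 1 : 'M[R]_(2, 1)).
Local Notation th := (dual_map (idfun : {lrmorphism R -> R}) (delta_mx 0 ord0 : 'M[R]_(1, 2))).
Local Notation dm A := (dual_map (idfun : {lrmorphism R -> R}) A).

Lemma dm2 k l (A : 'M[R]_(k, l)) (x : dualnum R k) j : (dm A x).2 0 j = \sum_i x.2 0 i * A i j.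
Proof. by rewrite mxE; apply: eq_bigr => i _; rewrite mxE. Qed.

Lemma th2 (x : D) j : (th x).2 0 j = if j == ord0 then x.2 0 0 else 0.
Proof.
rewrite dm2 big_ord1 mxE eqxx /=; case: eqP => _; by rewrite ?mulr1 ?mulr0.
Qed.

(** The base change of v along e -> e_1. Since e_1 e_2 = 0, the new direction e_2 contributes only a
    copy of the special fibre, as in [framed_ext]. *)
Lemma ext_exists (v : framed n D) (S0 : framed n R) : pulls aug v S0 -> exists d : framed n D2, pulls th v d.
Proof.
case/pullsE => F pF fF.
pose ep (x : D2) := x.2 0 ord_max.
have m1E (x : D2) : (dm m1 x).2 0 0 = x.2 0 ord0.
  by rewrite dm2 sum2 !mxE /= mulr1 mulr0 addr0.
apply: (@framed_ext K n D2 D R (dm m1) aug ep th (@dual_const K R 1) (eps ord_max) (eps ord0) _ _ _ _ _ _ _ _ _ _ v S0 F pF fF).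
- by move=> x y; rewrite /ep dual_add2.
- by move=> x y; rewrite /ep dual_mul2; congr (_ + _); rewrite mulrC.
- by move=> x; apply: dualP => // j; rewrite (ord1 j) m1E th2.
- by move=> x; rewrite /ep th2.
- by apply: dualP => // j; rewrite (ord1 j) m1E !mxE.
- by rewrite /ep mxE !eqxx.
- by [].
- move=> x y h1 h2; apply: dualP => [|j]; first exact: (congr1 fst h1).
  by case: (ord2 j) => ->; [rewrite -!m1E h1|exact: h2].
- by [].
- by move=> x /dual1_aug0 ->; exists (@dual_const K R 1 (x.2 0 0)).
Qed.

Lemma hilb_cst : exists J1 : hilb n D, hilb_pulls (@dual_const K R 1) J J1 /\ hilb_pulls aug J1 J.
Proof.
have [J1 h1] := hilb_map (@dual_const K R 1) J; exists J1; split=> //.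
by apply: (hilb_pulls_descend _ h1 (hilb_pulls_id J)).
Qed.

(** A framed sheaf over R[e_1,e_2] is needed that restricts to v, to a vector along Z and to v. The
    base change of v along e -> e_1 does so, the vector along Z being the constant deformation. *)
Lemma normal_eq_refl (v : framed n D) : tangent J v -> normal_eq J v v.
Proof.
case=> S0 Z0 p0; have [d pd] := ext_exists p0; have [J1 [h1 h2]] := hilb_cst.
have E0 := proj1 (in_Z_Emb J S0) Z0.
have [z Ez] := explicit_ex 0 J1; exists J1, z; split=> //; first exact/in_Z_Emb.
have pz : pulls ((@dual_const K R 1) \o aug)%FUN v z.
  apply: (pulls_comp _ p0 (Emb_pulls h1 _ E0 Ez)) => //.
  by rewrite /map_xy map_poly0 subrr; apply: (ideal_0 (hilb_is_ideal J1)).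
have pv := pulls_id (f := idfun) v (fun r => erefl).
exists d; split.
- apply: (pulls_descend _ pd pv) => x; apply: dualP => // j.
  by rewrite (ord1 j) dm2 sum2 !th2 !mxE /= mulr1 mulr0 addr0.
- apply: (pulls_descend _ pd pz) => x; apply: dualP => // j.
  by rewrite (ord1 j) dm2 sum2 !th2 !mxE /= mulr0 mul0r addr0.
- apply: (pulls_descend _ pd pv) => x; apply: dualP => // j.
  by rewrite (ord1 j) dm2 sum2 !th2 !mxE /= mulr1 mul0r addr0.
Qed.

(** For invertible r the substitution e -> r e is an automorphism of R[e], so even a vector without
    presentation can be rescaled. *)
Lemma scale_twist (r r' : R) (v : framed n D) : r * r' = 1 -> tangent J v ->
  exists w, pulls (dm (r%:M : 'M[R]_1)) v w /\ tangent J w.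
Proof.
move=> rr tv.
have E (a b : R) : a * b = 1 -> forall x : D, dm (a%:M : 'M[R]_1) (dm (b%:M : 'M[R]_1) x) = x.
  move=> ab x; apply: dualP => // j; rewrite (ord1 j) !dm2 !big_ord1 dm2 big_ord1 !mxE eqxx /= !mulr1n.
  by rewrite -mulrA [b * a]mulrC ab mulr1.
have [w pw] := framed_twist (a := dm (r'%:M : 'M[R]_1)) (b := dm (r%:M : 'M[R]_1)) (E r' r (etrans (mulrC _ _) rr)) (E r r' rr) v.
exists w; split=> //.
have p1 : pulls (dm (1%:M : 'M[R]_1)) v v.
  apply: pulls_id => x; apply: dualP => // j; by rewrite (ord1 j) dm2 big_ord1 mxE eqxx mulr1.
exact: tangent_along p1 pw tv.
Qed.

(* The weight condition tested on the constant torus point with u = r. *)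
Lemma weight_test (r r' : R) (x : fib (normal_bundle K n) J) : fin_gen_alg R -> r * r' = 1 ->
  has_weight (@char_u) x ->
  exists (t : torus R) (y w z : framed n D) (J1 : hilb n D),
  [/\ (gm_val (torusA t ord0) = r /\ gm_val (torusA t ord_max) = 1) /\ torusB t = (fun=> gm1 R),
      pulls (dm (r%:M : 'M[R]_1)) (sval x) y,
      moves idfun (torus_map (@dual_const K R 1) t) (sval x) w,
      hilb_pulls aug J1 J /\ in_Z J1 z & tangent_add y z w].
Proof.
case: x => v tv fg rr hx.
(* The point with a = (r, 1) and trivial B-part has u = r. *)
pose t0 := Torus (fun i : 'I_2 => if i == ord0 then GmPoint rr else gm1 R) (fun=> gm1 R).
have [y [py ty]] := scale_twist rr tv.
pose x0 : fib (normal_bundle K n) J := exist _ v tv.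
pose y0 : fib (normal_bundle K n) J := exist _ y ty.
have pr : pull_rel (normal_bundle K n) (idfun : {lrmorphism R -> R}) x0 x0.
  exists v; last exact: normal_eq_refl.
  apply: pulls_id => x; apply: dualP => // j; by rewrite (ord1 j) dm2 big_ord1 mxE eqxx mulr1.
have u0 : char_u t0 = r by rewrite /char_u /= mulr1.
have sr : scale_rel (normal_bundle K n) (char_u t0) x0 y0.
  exists y; first by rewrite u0.
  exact: normal_eq_refl.
have [w mw [J1 [z [h1 h2 h3]]]] := hx R idfun t0 J x0 y0 fg (hilb_pulls_id J) pr sr.
by exists (projA t0), y, w, z, J1; split.
Qed.
End Refl.

(** * Weight vectors *)

Lemma add_map0 (V W : zmodType) (f : V -> W) : (forall s t, f (s + t) = f s + f t) -> f 0 = 0.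
Proof. by move=> fD; apply: (addrI (f 0)); rewrite -fD !addr0. Qed.
Lemma add_mapB (V W : zmodType) (f : V -> W) : (forall s t, f (s + t) = f s + f t) ->
  forall s t, f (s - t) = f s - f t.
Proof. by move=> fD s t; apply: (addIr (f t)); rewrite -fD !subrK. Qed.

(* The maps p, p' : d -> v are the restrictions of d to the moved and to the rescaled v,
   so p = tt p' modulo e with tt = (2, 1); q + e z is the restriction of d to Z.  On
   the kernel v_J of q_0 the section s lifts to dl with p dl = p' dl = s, and s |-> z dl
   takes e s to (-3/2, -1) q s.  After rescaling it extends to a map psi on v with
   psi (e s) = q s, and q + e psi lifts q. *)
Section Core.
Variables (K : closedFieldType) (R : comAlgType K) (n : nat).
Local Notation D := (dualnum R 1).
Local Notation D2 := (dualnum R 2).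
Local Notation aug := (@dual_aug K R 1).
Local Notation cst := (@dual_const K R 1).
Local Notation cs2 := (@dual_const K R 2).
Local Notation e := (@eps K R 1 ord0).
Local Notation T := torus_chart.
Local Notation cL := (Lmap cst).

Variables (v : framed n D) (q : forall I, sec v I -> 'I_2 -> laurent R).
Hypothesis fq : fmor aug q.
Hypothesis q1 : forall I, exists s : sec v I, q s k0 = 1.
Hypothesis q4 : forall I (s : sec v I), (forall k, q s k = 0) -> exists s', s = e *: s'.
Hypothesis q5 : forall I (s : sec v I), e *: s = 0 -> forall k, q s k = 0.

Variables (d : qcoh D2) (E1 E2 : D2) (p p' : forall I, sec d I -> sec v I).
Variable z : forall I, sec d I -> 'I_2 -> laurent R.
Variables (h ka : R) (tt : 'I_2 -> R).
Hypotheses (tt0 : tt k0 = 2) (tt1 : tt k1 = 1) (h2 : h * 2 = 1) (ka1 : ka * (h - 2) = 1).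
Hypotheses (pl : forall I (r : R) (s t : sec d I), p (cs2 r *: s + t) = cst r *: p s + p t)
  (p'l : forall I (r : R) (s t : sec d I), p' (cs2 r *: s + t) = cst r *: p' s + p' t)
  (zl : forall I (r : R) (s t : sec d I) k, z (cs2 r *: s + t) k = r *: z s k + z t k)
  (pe1 : forall I (s : sec d I), p (E1 *: s) = e *: p s) (pe2 : forall I (s : sec d I), p (E2 *: s) = e *: p s)
  (p'e1 : forall I (s : sec d I), p' (E1 *: s) = e *: (cst h *: p' s))
  (p'e2 : forall I (s : sec d I), p' (E2 *: s) = 0)
  (ze1 : forall I (s : sec d I) k, z (E1 *: s) k = 0)
  (ze2 : forall I (s : sec d I) k, z (E2 *: s) k = q (p' s) k).
Hypotheses (pm : forall I m (s : sec d I), regular (sval I) m -> p (mon d m s) = mon v m (p s))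
  (p'm : forall I m (s : sec d I), regular (sval I) m -> p' (mon d m s) = mon v m (p' s))
  (zm : forall I m (s : sec d I) k, regular (sval I) m -> z (mon d m s) k = mono m * z s k)
  (pr : forall I I' (s : sec d I), csub I I' -> p (res d I' s) = res v I' (p s))
  (p'r : forall I I' (s : sec d I), csub I I' -> p' (res d I' s) = res v I' (p' s))
  (zr : forall I I' (s : sec d I) k, csub I I' -> z (res d I' s) k = z s k)
  (zO : forall I (s : sec d I) k, in_O I (z s k)).
Hypotheses (ps : forall I (t : sec v I), exists s : sec d I, p s = t)
  (p's : forall I (t : sec v I), exists s : sec d I, p' s = t)
  (p'k : forall I (s : sec d I), p' s = 0 -> exists s', s = E2 *: s')
  (qpp : forall I (s : sec d I) k, q (p s) k = tt k *: q (p' s) k).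

Let ql I k x (s t : sec v I) : q (x *: s + t) k = aug x *: q s k + q t k.
Proof. by case: (proj1 fq k) => a _ _ _; apply: a. Qed.
Let qD I k (s t : sec v I) : q (s + t) k = q s k + q t k.
Proof. by have := ql k 1 s t; rewrite !scale1r. Qed.
Let q0 I k : q (0 : sec v I) k = 0. Proof. exact: (add_map0 (@qD I k)). Qed.
Let qB I k (s t : sec v I) : q (s - t) k = q s k - q t k. Proof. exact: (add_mapB (@qD I k)). Qed.
Let qZ I k x (s : sec v I) : q (x *: s) k = aug x *: q s k.
Proof. by have := ql k x s 0; rewrite !addr0 q0 addr0. Qed.
Let qe I k (s : sec v I) : q (e *: s) k = 0. Proof. by rewrite qZ [X in X *: _](_ : _ = 0) ?scale0r. Qed.
Let qm I k m (s : sec v I) : regular (sval I) m -> q (mon v m s) k = mono m * q s k.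
Proof. by move=> hm; case: (proj1 fq k) => _ a _ _; apply: a. Qed.
Let qr I I' k (s : sec v I) : csub I I' -> q (res v I' s) k = q s k.
Proof. by move=> hm; case: (proj1 fq k) => _ _ a _; apply: a. Qed.
Let qO I k (s : sec v I) : in_O I (q s k).
Proof. by case: (proj1 fq k) => _ _ _ a; apply: a. Qed.

Let pD I (s t : sec d I) : p (s + t) = p s + p t.
Proof. by have := pl 1 s t; rewrite !rmorph1 !scale1r. Qed.
Let p'D I (s t : sec d I) : p' (s + t) = p' s + p' t.
Proof. by have := p'l 1 s t; rewrite !rmorph1 !scale1r. Qed.
Let zD I k (s t : sec d I) : z (s + t) k = z s k + z t k.
Proof. by have := zl 1 s t k; rewrite !rmorph1 !scale1r. Qed.
Let pB I := add_mapB (@pD I).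
Let p'B I := add_mapB (@p'D I).
Let zB I k := add_mapB (@zD I k).

Let dia I (s : sec v I) (dl : sec d I) := p dl = s /\ p' dl = s.

(** Take x with p' x = s. As p = tt p' modulo e, and tt differs from 1 only in the coordinate where
    q s vanishes, p x agrees with s modulo e. The difference is removed by a multiple of E2, which
    p' kills. *)
Lemma dia_ex I (s : sec v I) : q s k0 = 0 -> exists dl, dia s dl.
Proof.
move=> qs; have [x xs] := p's s.
have [ta eta] : exists ta, p x - s = e *: ta.
  apply: q4 => k; rewrite qB qpp xs; case: (ord2 k) => ->; first by rewrite qs scaler0 subrr.
  by rewrite tt1 scale1r subrr.
have [y yt] := ps ta; exists (x - E2 *: y); split; last by rewrite p'B p'e2 subr0.
by rewrite pB pe2 yt -eta opprB addrC subrK.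
Qed.

(** Such an x is E2 y with e p(y) = 0, so 0 = q(p y) = tt q(p' y). As 2 is invertible, z x = q(p' y)
    = 0, which makes z a function of s alone. *)
Lemma dia_z0 I (x : sec d I) k : dia 0 x -> z x k = 0.
Proof.
case=> h1 /p'k[y ey]; rewrite ey ze2.
have h0 : forall j, q (p y) j = 0 by apply: q5; rewrite -pe2 -ey.
have := h0 k; rewrite qpp; case: (ord2 k) => ->; last by rewrite tt1 scale1r.
rewrite tt0 => /(congr1 ( *:%R h)); by rewrite scalerA h2 scale1r scaler0.
Qed.

Definition zdia I (s : sec v I) : 'I_2 -> laurent R :=
  if pselect (exists dl, dia s dl) is left ex then z (sval (cid ex)) else fun=> 0.
Lemma zdiaE I (s : sec v I) dl k : dia s dl -> zdia s k = z dl k.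
Proof.
move=> hd; rewrite /zdia; case: pselect => [ex|]; last by case; exists dl.
case: cid => dl' /= hd'; apply/eqP; rewrite -subr_eq0 -zB; apply/eqP; apply: dia_z0.
by case: hd hd' => a b [a' b']; split; rewrite ?pB ?p'B ?a' ?b' ?a ?b subrr.
Qed.

Lemma zdia_lin I r (s t : sec v I) k : q s k0 = 0 -> q t k0 = 0 ->
  zdia (cst r *: s + t) k = r *: zdia s k + zdia t k.
Proof.
move=> /dia_ex[x hx] /dia_ex[y hy]; rewrite (zdiaE _ hx) (zdiaE _ hy).
have hxy : dia (cst r *: s + t) (cs2 r *: x + y).
  by case: hx hy => a b [a' b']; split; rewrite ?pl ?p'l ?a ?b ?a' ?b'.
by rewrite (zdiaE _ hxy) zl.
Qed.
Lemma zdia_mon I m (s : sec v I) k : regular (sval I) m -> q s k0 = 0 -> zdia (mon v m s) k = mono m * zdia s k.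
Proof.
move=> hm /dia_ex[x hx]; rewrite (zdiaE _ hx).
have hxm : dia (mon v m s) (mon d m x) by case: hx => a b; split; rewrite ?pm ?p'm ?a ?b.
by rewrite (zdiaE _ hxm) zm.
Qed.
Lemma zdia_res I I' (s : sec v I) k : csub I I' -> q s k0 = 0 -> zdia (res v I' s) k = zdia s k.
Proof.
move=> hI /dia_ex[x hx]; rewrite (zdiaE _ hx).
have hxm : dia (res v I' s) (res d I' x) by case: hx => a b; split; rewrite ?pr ?p'r ?a ?b.
by rewrite (zdiaE _ hxm) zr.
Qed.
Lemma zdia_O I (s : sec v I) k : q s k0 = 0 -> in_O I (zdia s k).
Proof. by move=> /dia_ex[x hx]; rewrite (zdiaE _ hx); apply: zO. Qed.

Let cc k := if k == k0 then h - 2 else -1.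
(** With p' x = 2 s and p y = s - p x, the element E1 x + E2 y lies over e s under both p and p'.
    Its image under z is q(p' y) = (1/tt - 2) q s, that is, h - 2 and -1 in the two coordinates. *)
Lemma zdia_eps I (s : sec v I) k : zdia (e *: s) k = cc k *: q s k.
Proof.
have [x xs] := p's (cst 2 *: s); have [y ys] := ps (s - p x).
have hd : dia (e *: s) (E1 *: x + E2 *: y).
  split; first by rewrite pD pe1 pe2 ys -scalerDr addrC subrK.
  have hh : cst h * cst 2 = 1 by rewrite -(rmorphM cst) h2 (rmorph1 cst).
  by rewrite p'D p'e1 p'e2 addr0 xs [cst h *: _]scalerA hh scale1r.
rewrite (zdiaE _ hd) zD ze1 ze2 add0r.
have e1 : q (p y) k = q s k - tt k *: (2 *: q s k).
  by rewrite ys qB qpp xs qZ.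
rewrite qpp in e1; rewrite /cc; case: (ord2 k) => ek; rewrite ek ?tt0 ?tt1 /= in e1 *.
  have := congr1 ( *:%R h) e1; rewrite scalerA h2 scale1r => ->.
  by rewrite scalerBr !scalerA h2 mul1r scalerBl.
by rewrite !scale1r in e1; rewrite e1 -{1}[q s k1]scale1r -scalerBl; congr (_ *: _); ring.
Qed.

Let kap k := if k == k0 then ka else -1.
(** The rescaling makes e s go to q s, as required of the coefficient of e in a lift of q. *)
Definition psJ I (s : sec v I) k := kap k *: zdia s k.
Lemma psJ_eps I (s : sec v I) k : psJ (e *: s) k = q s k.
Proof.
rewrite /psJ zdia_eps scalerA /kap /cc; case: ifP => _; first by rewrite ka1 scale1r.
by rewrite mulN1r opprK scale1r.
Qed.
Lemma psJ_lin I r (s t : sec v I) k : q s k0 = 0 -> q t k0 = 0 -> psJ (cst r *: s + t) k = r *: psJ s k + psJ t k.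
Proof. by move=> a b; rewrite /psJ zdia_lin // scalerDr !scalerA mulrC. Qed.
Lemma psJ_mon I m (s : sec v I) k : regular (sval I) m -> q s k0 = 0 -> psJ (mon v m s) k = mono m * psJ s k.
Proof. by move=> a b; rewrite /psJ zdia_mon // scalerAr. Qed.
Lemma psJ_res I I' (s : sec v I) k : csub I I' -> q s k0 = 0 -> psJ (res v I' s) k = psJ s k.
Proof. by move=> a b; rewrite /psJ zdia_res. Qed.
Lemma psJ_O I (s : sec v I) k : q s k0 = 0 -> in_O I (psJ s k).
Proof. by move=> a; apply: inOsZ; apply: zdia_O. Qed.

Lemma inO_T (R' : comNzRingType) (c : laurent R') : in_O T c.
Proof. by move=> m _; rewrite regularE !inE. Qed.
Lemma reg_T m : regular (sval T) m. Proof. by rewrite regularE !inE. Qed.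

Lemma act_monoM m c (s : sec v T) : act (mono m * c) s = mon v m (act c s).
Proof.
move: c; apply: (@lin_ext D (sec v T)) => [r x y|r x y|m'].
- by rewrite mulrDr -scalerAr actDl actZl.
- by rewrite actDl actZl (mon_linear (reg_T m)).
- by rewrite -monoD !actE !Lext_mono (mon_D _ (reg_T m) (reg_T m')).
Qed.

Section Tchart.
Variables (sg : sec v T) (sg1 : q sg k0 = 1) (b : 'I_2 -> laurent R).

Let q_act I c (s : sec v I) k : in_O I c -> q (act c s) k = Lmap aug c * q s k.
Proof. exact: (lmor_act s (proj1 fq k)). Qed.

Definition nu (s : sec v T) : sec v T := s - act (cL (q s k0)) sg.
Lemma nu_q s : q (nu s) k0 = 0.
Proof. by rewrite qB q_act ?sg1 ?mulr1 ?Lmap_aug_cst ?subrr //; apply: inO_T. Qed.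
Lemma nu_id s : q s k0 = 0 -> nu s = s.
Proof. by move=> h0; rewrite /nu h0 Lmap0 act0l subr0. Qed.
Lemma nu_lin r s t : nu (cst r *: s + t) = cst r *: nu s + nu t.
Proof. by rewrite /nu ql LmapD LmapZ actDl actZl scalerBr opprD addrACA. Qed.
Lemma nu_mon m s : nu (mon v m s) = mon v m (nu s).
Proof.
rewrite /nu qm ?reg_T // LmapM Lmap_mono act_monoM; have l := mon_linear (q := v) (reg_T m).
by rewrite (semilinB (g := idfun) l).
Qed.

(** Over the torus the section [sg] splits q_0, so psJ extends from the kernel of q_0 to all
    sections. The value [b] on [sg] is free and is adjusted later to obtain regularity on every
    chart. *)
Definition psT (s : sec v T) k := q s k0 * b k + psJ (nu s) k.
Lemma psT_lin r s t k : psT (cst r *: s + t) k = r *: psT s k + psT t k.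
Proof.
rewrite /psT nu_lin psJ_lin ?nu_q // ql [aug _](_ : _ = r) // scalerDr mulrDl -scalerAl.
by rewrite addrACA.
Qed.
Lemma psT_mon m s k : psT (mon v m s) k = mono m * psT s k.
Proof. by rewrite /psT nu_mon psJ_mon ?reg_T ?nu_q // qm ?reg_T // mulrDr mulrA. Qed.
Lemma psT_eps s k : psT (e *: s) k = q s k.
Proof. by rewrite /psT qe mul0r add0r nu_id ?qe // psJ_eps. Qed.
Lemma psTJ s k : q s k0 = 0 -> psT s k = psJ s k.
Proof. by move=> h0; rewrite /psT h0 mul0r add0r nu_id. Qed.
Lemma psT_D s t k : psT (s + t) k = psT s k + psT t k.
Proof. by have := psT_lin 1 s t k; rewrite rmorph1 !scale1r. Qed.
Lemma psT_act c s k : psT (act (cL c) s) k = c * psT s k.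
Proof.
move: c; apply: (@lin_ext R (laurent R)) => [r x y|r x y|m].
- by rewrite LmapD LmapZ actDl actZl psT_lin.
- by rewrite mulrDl -scalerAl.
- by rewrite Lmap_mono actE Lext_mono psT_mon.
Qed.

Definition ps0 I (s : sec v I) k := psT (res v T s) k.

(** A section with q_0 = 1 splits off the kernel of q_0, where psJ is regular; so regularity is
    decided by one such section over any larger open set. *)
Lemma ps0_O I j (sj : sec v j) s k : csub j I -> q sj k0 = 1 -> in_O j (ps0 sj k) -> in_O I (ps0 (s : sec v I) k).
Proof.
move=> hj e1 hO; pose a := q s k0; pose s' := s - act (cL a) (res v I sj).
have aO : in_O I (cL a).
  move=> m hm; have : a m != 0 by apply: contraNneq hm => e0; rewrite LmapE e0 rmorph0.
  exact: (@qO I k0 s).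
have qs' : q s' k0 = 0 by rewrite qB q_act // qr // e1 mulr1 Lmap_aug_cst subrr.
have -> : ps0 s k = a * ps0 sj k + psJ s' k.
  rewrite -(psJ_res k (csub_torus I) qs') -psTJ ?qr ?csub_torus //.
  rewrite /ps0 -psT_act -psT_D; congr (psT _ k).
  rewrite -(res_comp (q := v) hj (csub_torus I)).
  have -> : act (cL a) (res v T (res v I sj)) = res v T (act (cL a) (res v I sj)).
    rewrite {2}/act (semilin_sum (g := idfun) (res_linear (csub_torus I))) big_seq /act big_seq.
    apply: eq_bigr => m; rewrite mem_finsupp => /aO hm.
    by rewrite (semilinZ (g := idfun) (res_linear (csub_torus I))) res_mon // csub_torus.
  by rewrite /s' (semilinB (g := idfun) (res_linear (csub_torus I))) addrC subrK.
apply: inOsD; last exact: psJ_O.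
apply: inOsM; first exact: (@qO I k0 s).
by apply: inOsS hO.
Qed.
End Tchart.

Fact chU_neq0 (I J : chart) : sval I :|: sval J != set0.
Proof. by apply: contraNneq (chart_neq0 I) => /eqP; rewrite setU_eq0 => /andP[]. Qed.
Definition chU (I J : chart) : chart := exist (fun X : {set 'I_3} => X != set0) (sval I :|: sval J) (chU_neq0 I J).
Lemma csub_chUl (I J : chart) : csub I (chU I J). Proof. exact: subsetUl. Qed.
Lemma csub_chUr (I J : chart) : csub J (chU I J). Proof. exact: subsetUr. Qed.

Lemma chart_cover (I : chart) : [\/ csub ch0 I, csub ch1 I | csub ch2 I].
Proof.
have := nonempty3 (chart_neq0 I) => /or3P[hx|hx|hx]; [constructor 1|constructor 2|constructor 3];
  by rewrite /csub /= /aff_chart sub1set.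
Qed.

(* The Cech cocycle of the local lifts is a coboundary, since H^1(P^2, O) = 0. *)
Lemma cech : exists (sg : sec v T) (b : 'I_2 -> laurent R), q sg k0 = 1 /\
  forall I (s : sec v I) k, in_O I (ps0 sg b s k).
Proof.
have [s0 e0] := q1 ch0; have [s1 e1] := q1 ch1; have [s2 e2] := q1 ch2.
pose sg := res v T s0; have sg1 : q sg k0 = 1 by rewrite qr ?csub_torus.
pose hh I (s : sec v I) k := psJ (nu sg (res v T s)) k.
have hO I J' I' (si : sec v I) (sj : sec v J') k : csub I I' -> csub J' I' -> q si k0 = 1 -> q sj k0 = 1 ->
    in_O I' (hh I si k - hh J' sj k).
  move=> hI hJ ei ej; pose x := cst (-1) *: res v I' sj + res v I' si.
  have qx : q x k0 = 0 by rewrite ql !qr // ei ej scaleN1r addNr.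
  have -> : hh I si k - hh J' sj k = psJ x k; last exact: psJ_O.
  rewrite -(psJ_res k (csub_torus I') qx) -(nu_id sg (s := res v T x)) ?qr ?csub_torus //.
  rewrite /x (res_linear (csub_torus I')) !res_comp ?csub_torus // (nu_lin sg) psJ_lin ?nu_q //.
  by rewrite scaleN1r addrC.
(* The cochain [hh] has regular differences on overlaps. Monomials regular on C^2 are corrected by
   its value on U_1, all others by its value on U_0; the exponent inequalities on the three overlaps
   give regularity on each chart. *)
pose b k : laurent R := mkL (finsupp (hh _ s0 k) `|` finsupp (hh _ s1 k))%fset
  (fun m => if nonneg m then - hh _ s1 k m else - hh _ s0 k m).
have bE k m : b k m = if nonneg m then - hh _ s1 k m else - hh _ s0 k m.
  rewrite /b mkLE inE; case: ifP => // /negbT; rewrite negb_or !mem_finsupp !negbK => /andP[/eqP -> /eqP ->].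
  by rewrite oppr0 if_same.
have psE I (s : sec v I) k : q s k0 = 1 -> ps0 sg b s k = b k + hh _ s k.
  by move=> es; rewrite /ps0 /psT qr ?csub_torus // es mul1r.
have d01 k m : hh _ s0 k m - hh _ s1 k m != 0 -> 0 <= m.2.
  rewrite -lcoefB => hm; have := hO _ _ (chU ch0 ch1) s0 s1 k (csub_chUl _ _) (csub_chUr _ _) e0 e1 _ hm.
  by rewrite regularE !inE /=.
have d02 k m : hh _ s0 k m - hh _ s2 k m != 0 -> 0 <= m.1.
  rewrite -lcoefB => hm; have := hO _ _ (chU ch0 ch2) s0 s2 k (csub_chUl _ _) (csub_chUr _ _) e0 e2 _ hm.
  by rewrite regularE !inE /= => /andP[].
have d12 k m : hh _ s1 k m - hh _ s2 k m != 0 -> m.1 + m.2 <= 0.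
  rewrite -lcoefB => hm; have := hO _ _ (chU ch1 ch2) s1 s2 k (csub_chUl _ _) (csub_chUr _ _) e1 e2 _ hm.
  by rewrite regularE !inE /= andbT.
have O0 k : in_O ch0 (ps0 sg b s0 k).
  move=> m; rewrite psE // lcoefD bE regular_aff; case: ifP => // _; by rewrite addNr eqxx.
have O1 k : in_O ch1 (ps0 sg b s1 k).
  move=> m; rewrite psE // lcoefD bE regularE !inE /=; case: ifP => [_|hn]; first by rewrite addNr eqxx.
  rewrite addrC => hm; have h01 : hh _ s0 k m - hh _ s1 k m != 0 by rewrite -oppr_eq0 opprB.
  have m2 := d01 _ _ h01; rewrite m2 andbT.
  have [e12|/d12 //] := eqVneq (hh _ s1 k m - hh _ s2 k m) 0.
  have h02 : hh _ s0 k m - hh _ s2 k m != 0 by rewrite -(subrK (hh _ s1 k m) (hh _ s0 k m)) -addrA e12 addr0.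
  by move: hn; rewrite /nonneg m2 (d02 _ _ h02).
have O2 k : in_O ch2 (ps0 sg b s2 k).
  move=> m; rewrite psE // lcoefD bE regularE !inE /= !andbT; case: ifP => [hn|hn].
    rewrite addrC => hm; have h12 : hh _ s1 k m - hh _ s2 k m != 0 by rewrite -oppr_eq0 opprB.
    by case/andP: hn => -> _; rewrite (d12 _ _ h12).
  rewrite addrC => hm; have h02 : hh _ s0 k m - hh _ s2 k m != 0 by rewrite -oppr_eq0 opprB.
  have m1 := d02 _ _ h02; rewrite m1 andbT.
  have [e12|/d12 //] := eqVneq (hh _ s1 k m - hh _ s2 k m) 0.
  have h01 : hh _ s0 k m - hh _ s1 k m != 0.
    apply: contraNneq h02 => e3; by rewrite -(subrK (hh _ s1 k m) (hh _ s0 k m)) -addrA e12 e3 addr0.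
  by move: hn; rewrite /nonneg m1 (d01 _ _ h01).
exists sg, b; split=> // I s k; case: (chart_cover I) => hI.
- by apply: (@ps0_O sg sg1 b _ _ _ s k hI e0).
- by apply: (@ps0_O sg sg1 b _ _ _ s k hI e1).
- by apply: (@ps0_O sg sg1 b _ _ _ s k hI e2).
Qed.

Theorem core_fmor : exists Phi : forall I, sec v I -> 'I_2 -> laurent D, fmor id Phi.
Proof.
have [sg [b [sg1 psO]]] := cech.
have psl I r (s t : sec v I) k : ps0 sg b (cst r *: s + t) k = r *: ps0 sg b s k + ps0 sg b t k.
  by rewrite /ps0 (res_linear (csub_torus I)) psT_lin.
have pse I (s : sec v I) k : ps0 sg b (e *: s) k = q s k.
  by rewrite /ps0 (semilinZ (g := idfun) (res_linear (csub_torus I))) psT_eps // qr // csub_torus.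
have psm I m (s : sec v I) k : regular (sval I) m -> ps0 sg b (mon v m s) k = mono m * ps0 sg b s k.
  by move=> hm; rewrite /ps0 res_mon ?csub_torus // psT_mon.
have psr I I' (s : sec v I) k : csub I I' -> ps0 sg b (res v I' s) k = ps0 sg b s k.
  by move=> hI; rewrite /ps0 res_comp // csub_torus.
have psD I (s t : sec v I) k : ps0 sg b (s + t) k = ps0 sg b s k + ps0 sg b t k.
  by have := psl I 1 s t k; rewrite rmorph1 !scale1r.
have psB I k := add_mapB (fun s t => psD I s t k).
have inf_eq I I' j k m : chart_inf I' -> csub I I' -> expo m ord0 = 0 ->
    ps0 sg b (frame v I j) k m = ps0 sg b (frame v I' j) k m.
  move=> hI' hI hm; have [a1 _ _] := framed_frame v.
  have [m' [s' [h1 h3 h4]]] := a1 I I' j hI' hI.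
  have := congr1 (fun s => ps0 sg b s k) h4; rewrite psB psr // psm // => h5.
  have := z_atinf0 hI' h3 (psO I' s' k) hm; rewrite -h5 lcoefB => /eqP; by rewrite subr_eq0 => /eqP.
(* Along L_oo the values at the framing vectors are regular functions on a projective line, hence
   constants. Subtracting C q makes the lift framed and does not affect the values on e v. *)
pose C j k := ps0 sg b (frame v ch1 j) k 0.
pose ch12 := chU ch1 ch2.
have hi12 : chart_inf ch12 by rewrite /chart_inf !inE.
have e12 j k m : expo m ord0 = 0 -> ps0 sg b (frame v ch1 j) k m = ps0 sg b (frame v ch2 j) k m.
  by move=> hm; rewrite (inf_eq _ ch12) ?csub_chUl // [RHS](inf_eq _ ch12) ?csub_chUr.
have C1 j k m : expo m ord0 = 0 -> ps0 sg b (frame v ch1 j) k m = if m == 0 then C j k else 0.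
  move=> hm; case: eqVneq => [->//|m0]; apply/eqP; apply: contraNT m0 => hne.
  have := psO _ _ _ _ hne; rewrite regularE !inE /= => /andP[_ h22].
  rewrite e12 // in hne; have := psO _ _ _ _ hne; rewrite regularE !inE /= andbT => /andP[_ h11].
  move: hm; rewrite /expo /=; case: m {hne} h11 h22 => x y /= h11 h22 hm; apply/eqP; congr pair; lia.
have CI I j k m : chart_inf I -> expo m ord0 = 0 -> ps0 sg b (frame v I j) k m = if m == 0 then C j k else 0.
  move=> hI hm; case: (chart_cover I) => hx.
  - by move: hI; rewrite /chart_inf; move: hx; rewrite /csub /= sub1set => ->.
  - by rewrite -(inf_eq ch1) // C1.
  - by rewrite -(inf_eq ch2) // -e12 // C1.
pose Psi I (s : sec v I) k := ps0 sg b s k - \sum_j C j k *: q s j.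
have [Phi PE] : exists Phi : forall I, sec v I -> 'I_2 -> laurent D, forall I s k,
    Phi I s k = cL (q s k) + e *: cL (Psi I s k) by eexists.
have Pa I s k : Lmap aug (Phi I s k) = q s k.
  by rewrite PE LmapD LmapZ !Lmap_aug_cst [X in X *: _](_ : _ = 0) // scale0r addr0.
have Pc I s k : Lcomp ord0 (Phi I s k) = Psi I s k.
  by rewrite PE LcompD Lcomp_cst add0r LcompZ Lcomp_cst scaler0 add0r Lmap_aug_cst mxE !eqxx scale1r.
have Psl I (x : D) (s t : sec v I) k : Psi I (x *: s + t) k = x.1 *: Psi I s k + x.2 0 0 *: q s k + Psi I t k.
  rewrite /Psi; have -> : ps0 sg b (x *: s + t) k = x.1 *: ps0 sg b s k + x.2 0 0 *: q s k + ps0 sg b t k.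
    rewrite {1}(dual1P x) scalerDl mulrC -scalerA -addrA !psl pse addrA //.
  have -> : \sum_j C j k *: q (x *: s + t) j = x.1 *: (\sum_j C j k *: q s j) + \sum_j C j k *: q t j.
    rewrite scaler_sumr -big_split; apply: eq_bigr => j _.
    by rewrite ql [aug x](_ : _ = x.1) // scalerDr !scalerA mulrC.
  rewrite opprD addrACA [X in X + _ = _]addrAC -scalerBr; congr (_ + _).
exists Phi; split=> [k|I j hI k m hm].
  split=> [I x s t|I m hm s|I I' hI s|I s].
  - apply: LdualP => [|l]; first by rewrite LmapD LmapZ !Pa ql.
    by rewrite (ord1 l) LcompD LcompZ !Pc Pa Psl.
  - apply: LdualP => [|l]; first by rewrite LmapM Lmap_mono !Pa qm.
    rewrite (ord1 l) Lcomp_mono !Pc /Psi psm // mulrBr mulr_sumr; congr (_ - _).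
    by apply: eq_bigr => j _; rewrite qm // scalerAr.
  - apply: LdualP => [|l]; first by rewrite !Pa qr.
    by rewrite (ord1 l) !Pc /Psi psr //; congr (_ - _); apply: eq_bigr => j _; rewrite qr.
  - rewrite PE; apply: inOsD; first by apply: inOs_Lmap; apply: qO.
    apply: inOsZ; apply: inOs_Lmap; apply: inOsB; first exact: psO.
    by apply: inOs_sum => j _; apply: inOsZ; apply: qO.
have hq j' : q (frame v I j) j' m = ((j == j') && (m == 0))%:R := proj2 fq I j hI j' m hm.
apply: dualP => [|l].
  by rewrite -[LHS](LmapE aug) Pa hq; case: (_ && _).
rewrite (ord1 l) -LcompE Pc /Psi lcoefB CI // lcoef_sum.
under eq_bigr do rewrite lcoefZ hq.
have -> : (((j == k) && (m == 0))%:R : D).2 0 0 = 0 by case: (_ && _); rewrite mxE.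
case: eqVneq => [_|_]; last by rewrite big1 ?subr0 // => i _; rewrite andbF mulr0.
rewrite (bigD1 j) //= eqxx mulr1 big1 ?addr0 ?subrr // => i /negPf hne.
by rewrite eq_sym hne mulr0.
Qed.
End Core.

(** For bijective g the map F is onto by [tensor_surj] and injective by [tensor_ker] applied to
    0. *)
Lemma tensor_inv (R R' : comNzRingType) (g : {rmorphism R -> R'}) (M : lmodType R) (M' : lmodType R') (F : M -> M') :
  (forall r', exists r, g r = r') -> (forall r, g r = 0 -> r = 0) ->
  (forall (r : R) s t, F (r *: s + t) = g r *: F s + F t) -> is_tensor g F ->
  exists G : M' -> M, (forall s, G (F s) = s) /\ (forall t, F (G t) = t).
Proof.
move=> gs gi Fl ten; have /choice[G GE] := tensor_surj gs Fl ten.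
exists G; split=> // s; apply/eqP; rewrite -subr_eq0; apply/eqP.
have : F (G (F s) - s) = 0 by rewrite (semilinB Fl) GE subrr.
move: (G (F s) - s); refine (tensor_ker gs (D := fun s => s = 0) ten _ _).
  by split=> // r x y -> ->; rewrite scaler0 addr0.
by move=> k x /gi ->; rewrite scale0r.
Qed.

(** * Weight vectors are explicit *)

Section WeightEx.
Variables (K : closedFieldType) (R : comAlgType K) (n : nat) (J : hilb n R).
Local Notation D := (dualnum R 1).
Local Notation D2 := (dualnum R 2).
Local Notation aug := (@dual_aug K R 1).
Local Notation aug2 := (@dual_aug K R 2).
Local Notation cst := (@dual_const K R 1).
Local Notation cs2 := (@dual_const K R 2).
Local Notation e := (@eps K R 1 ord0).
Local Notation m1 := (delta_mx ord0 0 : 'M[R]_(2, 1)).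
Local Notation m2 := (delta_mx ord_max 0 : 'M[R]_(2, 1)).
Local Notation m3 := (const_mx 1 : 'M[R]_(2, 1)).
Local Notation dm A := (dual_map (idfun : {lrmorphism R -> R}) A).
Variables (h ka : R).
Hypotheses (h2 : h * 2 = 1) (ka1 : ka * (h - 2) = 1).

Theorem weight_Ex (x : fib (normal_bundle K n) J) : fin_gen_alg R -> has_weight (@char_u) x ->
  exists P, Ex J (sval x) P.
Proof.
move=> fg hx; have h2' : 2 * h = 1 by rewrite mulrC.
have [t [y [w [zf [J1 [[[t0 t1] tB] py mw [hJ1 Z1] [d [p1 p2 p3]]]]]]]] := weight_test fg h2' hx.
have tv : tangent J (sval x) by case: x {hx py mw}.
move: (sval x) tv py mw => v tv py mw {hx}.
have [q [fq q2 q3 q4 q5]] := tangent_red tv.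
have q1 I : exists s : sec v I, q I s k0 = 1.
  have [s es] : exists s : sec v I, forall k, q I s k = mk2 1 0 k.
    apply: q3; apply/Dexp00; rewrite /mk2 /=; split; [exact: inOs1|exact: inOs0|exact: (Jloc0 (hilb_is_ideal J))].
  by exists s; rewrite es.
have [S0 Z0 p0] := tv; have E0 := proj1 (in_Z_Emb J S0) Z0.
have py0 : pulls aug y S0 by apply: (pulls_descend _ py p0).
have pd0 : pulls aug2 d S0 by apply: (pulls_comp _ p1 py0).
have [Fy [y1 y2 y3 y4] fy] := proj1 (pullsE _ _ _) py.
have [G1 [a1 a2 a3 a4] f1] := proj1 (pullsE _ _ _) p1.
have [G2 pG2 f2] := proj1 (pullsE _ _ _) p2.
have [G3 [c1 c2 c3 c4] f3] := proj1 (pullsE _ _ _) p3.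
have [Fw [w1 w2' w3 w4] fw] := mw.
have bw m : bweight (torus_map cst t) m = 1.
  have pw i z : gm_pow (torusB (torus_map cst t) i) z = 1.
    by rewrite /= tB; case: z => j /=; rewrite (rmorph1 cst) expr1n.
  by rewrite /bweight !pw mulr1.
have w2 I m : regular (sval I) m -> forall s, Fw I (mon v m s) = mon w m (Fw I s).
  by move=> hm s; rewrite w2' // bw scale1r.
have dmK (a b : R) : a * b = 1 -> forall u : D, dm (a%:M : 'M[R]_1) (dm (b%:M : 'M[R]_1) u) = u.
  move=> ab u; apply: dualP => // j; rewrite (ord1 j) !dm2 !big_ord1 dm2 big_ord1 !mxE eqxx /= !mulr1n.
  by rewrite -mulrA [b * a]mulrC ab mulr1.
have gs2 u : exists u', dm (2%:M : 'M[R]_1) u' = u by exists (dm (h%:M : 'M[R]_1) u); apply: dmK.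
have gi2 u : dm (2%:M : 'M[R]_1) u = 0 -> u = 0 by move=> h0; rewrite -(dmK _ _ h2 u) h0 raddf0.
have /all_sig[Gy /all_and2[GyF FGy]] I : {G : sec y I -> sec v I | (forall s, G (Fy I s) = s) /\ (forall s, Fy I (G s) = s)}.
  by apply: cid; apply: (tensor_inv gs2 gi2 (y1 I) (y4 I)).
have /all_sig[Gw /all_and2[GwF FGw]] I : {G : sec w I -> sec v I | (forall s, G (Fw I s) = s) /\ (forall s, Fw I (G s) = s)}.
  by apply: cid; apply: (tensor_inv (g := idfun) _ _ (w1 I) (w4 I)) => // r; exists r.
have Fyi I (s s' : sec v I) : Fy I s = Fy I s' -> s = s' by move=> e1; rewrite -(GyF I s) e1 GyF.
have Fwi I (s s' : sec v I) : Fw I s = Fw I s' -> s = s' by move=> e1; rewrite -(GwF I s) e1 GwF.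
(* Moving and rescaling are bijective on sections, so the restrictions of d to w and y are read as
   sections of v itself. Inverting the rescaling by 2 sends e_1 to h e under p'. *)
pose p I (s : sec d I) := Gw I (G3 I s); pose p' I (s : sec d I) := Gy I (G1 I s).
pose g1 (u : D2) : D := dm (h%:M : 'M[R]_1) (dm m1 u).
have plin I (u : D2) s s' : p I (u *: s + s') = dm m3 u *: p I s + p I s'.
  by apply: Fwi; rewrite /p FGw c1 w1 !FGw.
have p'lin I (u : D2) s s' : p' I (u *: s + s') = g1 u *: p' I s + p' I s'.
  by apply: Fyi; rewrite /p' FGy a1 y1 !FGy; congr (_ *: _ + _); exact: esym (dmK _ _ h2' _).
have pm I m (s : sec d I) : regular (sval I) m -> p I (mon d m s) = mon v m (p I s).
  by move=> hm; apply: Fwi; rewrite /p FGw c2 // w2 // FGw.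
have p'm I m (s : sec d I) : regular (sval I) m -> p' I (mon d m s) = mon v m (p' I s).
  by move=> hm; apply: Fyi; rewrite /p' FGy a2 // y2 // FGy.
have pr I I' (s : sec d I) : csub I I' -> p I' (res d I' s) = res v I' (p I s).
  by move=> hI; apply: Fwi; rewrite /p FGw c3 // w3 // FGw.
have p'r I I' (s : sec d I) : csub I I' -> p' I' (res d I' s) = res v I' (p' I s).
  by move=> hI; apply: Fyi; rewrite /p' FGy a3 // y3 // FGy.
have m1E (u : D2) : (dm m1 u).2 0 0 = u.2 0 ord0 by rewrite dm2 sum2 !mxE /= mulr1 mulr0 addr0.
have m2E (u : D2) : (dm m2 u).2 0 0 = u.2 0 ord_max by rewrite dm2 sum2 !mxE /= mulr1 mulr0 add0r.
have m3E' (u : D2) : (dm m3 u).2 0 0 = u.2 0 ord0 + u.2 0 ord_max by rewrite dm2 sum2 !mxE !mulr1.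
have g1E (u : D2) : (g1 u).2 0 0 = u.2 0 ord0 * h by rewrite /g1 dm2 big_ord1 m1E mxE eqxx mulr1n.
pose gc : {rmorphism D2 -> D} := (dm (h%:M : 'M[R]_1) \o dm m1)%FUN.
have pZ I u s : p I (u *: s) = dm m3 u *: p I s := semilinZ (g := dm m3) (plin I) u s.
have p'Z I u s : p' I (u *: s) = g1 u *: p' I s := semilinZ (g := gc) (p'lin I) u s.
pose tt (k : 'I_2) : R := if k == k0 then 2 else 1.
have augq u : aug u = u.1 by [].
have qlin I k (u : D) s s' : q I (u *: s + s') k = u.1 *: q I s k + q I s' k.
  by case: (proj1 fq k) => l _ _ _; apply: l.
have qB I k s s' : q I (s - s') k = q I s k - q I s' k.
  by rewrite addrC -scaleN1r qlin addrC /= scaleN1r.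
have lp k : lmor aug2 (S := d) (fun I s => q I (p I s) k).
  have [l1 l2 l3 l4] := proj1 fq k; split=> [I r s s'|I m hm s|I I' hI s|I s].
  - by rewrite plin qlin.
  - by rewrite pm // l2.
  - by rewrite pr // l3.
  - exact: l4.
have lp' k : lmor aug2 (S := d) (fun I s => q I (p' I s) k).
  have [l1 l2 l3 l4] := proj1 fq k; split=> [I r s s'|I m hm s|I I' hI s|I s].
  - by rewrite p'lin qlin.
  - by rewrite p'm // l2.
  - by rewrite p'r // l3.
  - exact: l4.
have qv I k s : chart_inf I -> vanish_inf s -> atinf0 (q I s k) by move=> hI; apply: lmor_vanish (proj1 fq k) hI.
have Gyv I (s : sec y I) : vanish_inf s -> vanish_inf (Gy I s).
  case=> m [s' [b1 b2 ->]]; exists m, (Gy I s'); split=> //; apply: Fyi; by rewrite y2 // !FGy.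
have Gwv I (s : sec w I) : vanish_inf s -> vanish_inf (Gw I s).
  case=> m [s' [b1 b2 ->]]; exists m, (Gw I s'); split=> //; apply: Fwi; by rewrite w2 // !FGw.
have fq' I j k m : chart_inf I -> expo m ord0 = 0 -> q I (frame v I j) k m = ((j == k) && (m == 0))%:R.
  by move=> hI hm; apply: (proj2 fq).
have frp' I j k m : chart_inf I -> expo m ord0 = 0 -> q I (p' I (frame d I j)) k m = ((j == k) && (m == 0))%:R.
  move=> hI hm; rewrite -(fq' I) //.
  have hv : vanish_inf (p' I (frame d I j) - frame v I j).
    have -> : p' I (frame d I j) - frame v I j = Gy I ((G1 I (frame d I j) - frame y I j) - (Fy I (frame v I j) - frame y I j)).
      apply: Fyi; rewrite (semilinB (y1 I)) !FGy opprB addrA subrK //.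
    by apply: Gyv; apply: vanishD => //; [exact: f1|apply: vanishN; exact: fy].
  by have := qv I k _ hI hv m hm; rewrite qB lcoefB => /eqP; rewrite subr_eq0 => /eqP.
have ttE j : gm_val (torusA (torus_map cst t) j) = cst (tt j).
  by rewrite /tt; case: (ord2 j) => -> /=; rewrite ?t0 ?t1.
have frp I j k m : chart_inf I -> expo m ord0 = 0 ->
    q I (p I (frame d I j)) k m = tt j * ((j == k) && (m == 0))%:R.
  move=> hI hm; rewrite -(fq' I) //.
  have hv : vanish_inf (p I (frame d I j) - cst (tt j) *: frame v I j).
    have -> : p I (frame d I j) - cst (tt j) *: frame v I j =
        Gw I ((G3 I (frame d I j) - frame w I j) - (cst (tt j) *: Fw I (frame v I j) - frame w I j)).
      apply: Fwi; rewrite (semilinB (w1 I)) (semilinZ (w1 I)) !FGw opprB addrA subrK //.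
    apply: Gwv; apply: vanishD => //; first exact: f3.
    by apply: vanishN; rewrite -ttE; apply: fw.
  have := qv I k _ hI hv m hm; rewrite qB lcoefB => /eqP; rewrite subr_eq0 => /eqP ->.
  have := qlin I k (cst (tt j)) (frame v I j) 0; rewrite !addr0 => ->.
  have q00 : q I 0 k = 0 by have := qB I k 0 0; rewrite !subrr.
  by rewrite q00 addr0 lcoefZ.
(* By rigidity: both sides are morphisms over the reduction of R[e_1,e_2], and along L_oo both
   multiply the j-th framing vector by tt_j, the torus having scaled the first one by 2. *)
have qpp I s k : q I (p I s) k = tt k *: q I (p' I s) k.
  apply/eqP; rewrite -subr_eq0; apply/eqP.
  have lmZ : lmor aug2 (S := d) (fun I s => tt k *: q I (p' I s) k).
    have [l1 l2 l3 l4] := lp' k; split=> [I' r s1 s2|I' m hm s1|I' I2 hI s1|I' s1].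
    - by rewrite l1 scalerDr !scalerA mulrC.
    - by rewrite l2 // scalerAr.
    - by rewrite l3.
    - by apply: inOsZ; apply: l4.
  apply: (rigid_pull (@aug_surj _ _ _) pd0 E0 (lmorB (lp k) lmZ)) => I' j hI m hm.
  rewrite lcoefB lcoefZ frp // frp' //; case: eqVneq => [->|_]; by rewrite ?subrr // !mulr0 subrr.
(* The vector along Z embeds in O[e]^2, so d maps there. By rigidity the reduction of this map is q
   p', and its coefficient of e is the map z of [core_fmor]. *)
have [ioz Hz fz] := Emb_fmor (proj1 (in_Z_Emb J1 zf) Z1).
pose ze I (s : sec d I) k := ioz I (G2 I s) k.
have fze : fmor (dm m2) (S := d) ze := fmor_pull (h := idfun) pG2 f2 fz.
have aze : fmor aug2 (S := d) (fun I s k => Lmap aug (ze I s k)) := fmor_Lmap aug fze.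
have zq I s k : Lmap aug (ze I s k) = q I (p' I s) k.
  apply/eqP; rewrite -subr_eq0; apply/eqP.
  apply: (rigid_pull (@aug_surj _ _ _) pd0 E0 (lmorB (proj1 aze k) (lp' k))) => I' j hI m hm.
  by rewrite lcoefB frp' // (proj2 aze) // subrr.
have zelin I (u : D2) s s' k : ze I (u *: s + s') k = dm m2 u *: ze I s k + ze I s' k.
  by case: (proj1 fze k) => l _ _ _; apply: l.
have zeZ I (u : D2) s k : ze I (u *: s) k = dm m2 u *: ze I s k.
  exact: (semilinZ (g := dm m2) (fun u s s' => zelin I u s s' k)).
have E1 (r : R) : dm m3 (cs2 r) = cst r.
  by apply: dualP => // j; rewrite (ord1 j) m3E' !mxE addr0.
have [Phi hPhi] : exists Phi : forall I, sec v I -> 'I_2 -> laurent D, fmor id Phi.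
  apply: (@core_fmor K R n v q fq q1 q4 q5 d (eps ord0) (eps ord_max) p p' (fun I s k => Lcomp ord0 (ze I s k)) h ka tt).
  - by [].
  - by [].
  - exact: h2.
  - exact: ka1.
  - by move=> I r s s'; rewrite plin E1.
  - move=> I r s s'; rewrite p'lin; congr (_ *: _ + _).
    by apply: dualP => // j; rewrite (ord1 j) g1E !mxE mul0r.
  - by move=> I r s s' k; rewrite zelin LcompD LcompZ m2E mxE scale0r addr0.
  - move=> I s; rewrite pZ; congr (_ *: _).
    by apply: dualP => // j; rewrite (ord1 j) m3E' !mxE !eqxx addr0.
  - move=> I s; rewrite pZ; congr (_ *: _).
    by apply: dualP => // j; rewrite (ord1 j) m3E' !mxE !eqxx add0r.
  - move=> I s; rewrite p'Z scalerA; congr (_ *: _).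
    by apply: dualP => [|j]; rewrite ?epsM1 // (ord1 j) g1E epsM2 eqxx mulr1 mxE !eqxx mul1r.
  - move=> I s; rewrite p'Z [g1 _](_ : _ = 0) ?scale0r //.
    by apply: dualP => // j; rewrite (ord1 j) g1E !mxE mul0r.
  - move=> I s k; rewrite zeZ LcompZ m2E mxE /= !scale0r addr0 //.
  - by move=> I s k; rewrite zeZ LcompZ m2E mxE !eqxx /= scale0r add0r scale1r zq.
  - exact: pm.
  - exact: p'm.
  - move=> I m s k hm; case: (proj1 fze k) => _ l _ _; rewrite -Lcomp_mono; congr Lcomp; exact: l.
  - exact: pr.
  - exact: p'r.
  - by move=> I I' s k hI; case: (proj1 fze k) => _ _ l _; congr Lcomp; apply: l.
  - move=> I s k; case: (proj1 fze k) => _ _ _ l; exact: (inOs_Lcomp (B := sval I) (l I s)).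
  - move=> I s; have [s' es] := tensor_surj (dm_surj (m3_surj R)) (c1 I) (c4 I) (Fw I s).
    by exists s'; rewrite /p es GwF.
  - move=> I s; have [s' es] := tensor_surj (dm_surj (m1_surj R)) (a1 I) (a4 I) (Fy I s).
    by exists s'; rewrite /p' es GyF.
  - move=> I s ps; have : G1 I s = 0.
      by rewrite -(FGy I (G1 I s)) -/(p' I s) ps (semilin0 (y1 I)).
    move: s {ps}; refine (tensor_ker (dm_surj (m1_surj R)) (D := fun s => exists s', s = eps ord_max *: s') (a4 I) _ _).
      split=> [|r _ _ [s ->] [s' ->]]; first by exists 0; rewrite scaler0.
      by exists (r *: s + s'); rewrite scalerDr !scalerA mulrC.
    move=> u s hu; exists (cs2 (u.2 0 ord_max) *: s); rewrite scalerA; congr (_ *: _).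
    have hu1 : u.1 = 0 := congr1 fst hu.
    have hu2 : u.2 0 ord0 = 0 by rewrite -m1E hu mxE.
    apply: dualP => [|j]; first by rewrite epsM1 hu1.
    by rewrite epsM2; case: (ord2 j) => ->; rewrite ?hu2 ?mulr0 ?mulr1.
  - exact: qpp.
have [sg [s0 s1]] := tangent_sg tv hPhi.
have [P eP] : exists P : {poly {poly R}}, toL P = Lcomp ord0 (Phi _ sg k1).
  exists (fromL (Lcomp ord0 (Phi _ sg k1))); apply: fromLK; apply/inOs_aff.
  have [_ _ _ l] := proj1 hPhi k1; exact: (inOs_Lcomp (B := aff_chart) (l ch0 sg)).
by exists P; apply: fmor_Ex tv hPhi s0 s1 eP.
Qed.
End WeightEx.

Theorem mainTheorem1 (R : realType) (n : nat) :
  bundle_iso (N_minus R[i] n) (twist (tautological R[i] n) (@char_u)).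
Proof.
apply: bundle_iso_of_weight => S J x.
pose f : {rmorphism R[i] -> S} := in_alg S.
have h2 : f 2^-1 * 2 = 1.
  by rewrite -(rmorph_nat f 2) -rmorphM mulVf ?rmorph1 // pnatr_eq0.
(* The inverse of 1/u - u = 1/2 - 2 at u = 2. *)
have ka1 : f (- (2 / 3)) * (f 2^-1 - 2) = 1.
  rewrite -(rmorph_nat f 2) -rmorphB -rmorphM -[RHS](rmorph1 f); congr (f _); by field.
exact: (weight_Ex h2 ka1).
Qed.
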